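(* Let assumptions (a) and (b) of the context hold and let $\mu$, $(P_t)_{t>0}$ and $\mathbb{M}$ be as in the context. Assume that there exists a finite invariant measure $\nu$ for $\mathbb{M}$. Then the following hold: (i) $\mathbb{M}$ is non-explosive; hence $P_t(x,dy)$ is a probability measure on $(\mathbb{R}^d,\mathcal{B}(\mathbb{R}^d))$ for any $(x,t)\in\mathbb{R}^d\times(0,\infty)$ and equivalent to the Lebesgue measure. (ii) Any sub-invariant measure for $\mathbb{M}$ is finite and $\mu$ is a finite invariant measure for $\mathbb{M}$. (iii) $\nu$ is unique up to a multiplicative constant. More precisely, if there exists another invariant measure $\pi$ for $\mathbb{M}$, then $\pi$ is finite and $$\nu(E)=\frac{\nu(\mathbb{R}^d)}{\pi(\mathbb{R}^d)}\,\pi(E)\quad\text{for all }E\in\mathcal{B}(\mathbb{R}^d).$$ (iv) For any $s\in[1,\infty)$ and $f\in L^s(\mathbb{R}^d,\mu)$, $$\lim_{t\to\infty}P_tf=\frac1{\mu(\mathbb{R}^d)}\int_{\mathbb{R}^d}f\,d\mu\quad\text{in }L^s(\mathbb{R}^d,\mu),$$ and for all $x\in\mathbb{R}^d$, $E\in\mathcal{B}(\mathbb{R}^d)$, $$\lim_{t\to\infty}P_t(x,E)=\lim_{t\to\infty}\mathbb{P}_x(X_t\in E)=\frac{\mu(E)}{\mu(\mathbb{R}^d)}.$$ (v) Let $E\in\mathcal{B}(\mathbb{R}^d)$ with $\mu(E)>0$ and let $(t_n)_{n\ge1}\subset(0,\infty)$ be any sequence with $\lim_{n\to\infty}t_n=\infty$.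 Then $$\mathbb{P}_x(X_{t_n}\in E\text{ for infinitely many }n\in\mathbb{N})=1\quad\text{for all }x\in\mathbb{R}^d.$$ In particular, $\mathbb{P}_x(L_E=\infty)=1$ for all $x\in\mathbb{R}^d$ and $\mathbb{M}$ is recurrent in the probabilistic sense.
   Context: Let $d\ge2$, $p\in(d,\infty)$, $q=\frac{pd}{p+d}$. All measures are non-zero, positive Borel measures. For a matrix $B=(b_{ij})$ of functions, $\nabla B$ is the vector field with $i$-th component $\sum_j\partial_jb_{ij}$. Assumption (a): $A=(a_{ij})$ with $a_{ji}=a_{ij}\in H^{1,2}_{loc}(\mathbb{R}^d)\cap C(\mathbb{R}^d)$, such that for every relatively compact $V$ there is $\nu_V>0$ with $\nu_V^{-1}\|\xi\|^2\le\langle A(x)\xi,\xi\rangle\le\nu_V\|\xi\|^2$ for all $\xi\in\mathbb{R}^d$, $x\in V$; $C=(c_{ij})$ with $-c_{ji}=c_{ij}\in H^{1,2}_{loc}(\mathbb{R}^d)\cap C(\mathbb{R}^d)$; $\mathbf{H}\in L^p_{loc}(\mathbb{R}^d,\mathbb{R}^d)$. Put $\mathbf{G}=(g_1,\dots,g_d)=\tfrac12\nabla(A+C^T)+\mathbf{H}$ and $Lf=\tfrac12\sum_{i,j}a_{ij}\partial_{ij}f+\sum_ig_i\partial_if$, $f\in C^2(\mathbb{R}^d)$. Assumption (b): $\mathbf{G}\in L^q_{loc}(\mathbb{R}^d,\mathbb{R}^d)$. Measure: $\mu=\rho\,dx$, where $\rho\in H^{1,p}_{loc}(\mathbb{R}^d)\cap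 C(\mathbb{R}^d)$, $\rho>0$ everywhere, and $\int Lf\,d\mu=0$ for all $f\in C_0^\infty(\mathbb{R}^d)$ (such $\rho$ exists under (a); one is fixed). Semigroup: put $\beta^{\rho,A}_i=\tfrac12\sum_j(\partial_ja_{ij}+a_{ij}\tfrac{\partial_j\rho}\rho)$, $\mathbf{B}=\mathbf{G}-\beta^{\rho,A}$. For relatively compact open $V$ let $(L^{0,V},D(L^{0,V}))$ be the self-adjoint generator on $L^2(V,\mu)$ of the closure of $\tfrac12\int_V\langle A\nabla u,\nabla v\rangle d\mu$, $u,v\in C_0^\infty(V)$. The operator $L^{0,V}u+\langle\mathbf{B},\nabla u\rangle$ on bounded $u\in D(L^{0,V})$ is closable in $L^1(V,\mu)$ and its closure generates a sub-Markovian $C_0$-semigroup of contractions, with resolvent $\overline{G}^V_\alpha$; put $\overline{G}^V_\alpha f:=\overline{G}^V_\alpha(f1_V)$ (zero outside $V$) for $f\in L^1(\mathbb{R}^d,\mu)$. For relatively compact open $V_n\uparrow\mathbb{R}^d$ the limits $\overline{G}_\alpha f=\lim_n\overline{G}^{V_n}_\alpha f$ exist in $L^1(\mathbb{R}^d,\mu)$, do not depend on $(V_n)$, and form the resolvent of a sub-Markovian $C_0$-semigroup of contractions $(\overline{T}_t)_{t>0}$ on $L^1(\mathbb{R}^d,\mu)$, whose generator extends $(L,C_0^\infty(\mathbb{R}^d))$. $(T_t)_{t>0}$ denotes the sub-Markovian semigroup on every $L^s(\mathbb{R}^d,\mu)$, $s\in[1,\infty]$, obtained by restricting $(\overline{T}_t)$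 to $L^1\cap L^\infty$ and extending. For $f\in\bigcup_{s\in[1,\infty]}L^s(\mathbb{R}^d,\mu)$ and $t>0$, $T_tf$ has a continuous $\mu$-version, denoted $P_tf$; $P_0=\mathrm{id}$; $P_t(x,E):=P_t1_E(x)$. Process: under (a) and (b), $\mathbb{M}=(\Omega,\mathcal{F},(\mathcal{F}_t)_{t\ge0},(X_t)_{t\ge0},(\mathbb{P}_x)_{x\in\mathbb{R}^d\cup\{\Delta\}})$ is the Hunt process with state space $\mathbb{R}^d$, with continuous sample paths on the one-point compactification $\mathbb{R}^d_\Delta$ (absorbed at $\Delta$ after the lifetime $\zeta=\inf\{t\ge0:X_t=\Delta\}$), such that $P_tf(x)=\mathbb{E}_x[f(X_t)]$ for all $t\ge0$, $x\in\mathbb{R}^d$, $f$ bounded Borel, with $f(\Delta):=0$. $\mathbb{M}$ is non-explosive if $\mathbb{P}_x(\zeta=\infty)=1$ for all $x\in\mathbb{R}^d$. Definitions. A $\sigma$-finite measure $\widetilde\mu$ on $\mathcal{B}(\mathbb{R}^d)$ is an invariant measure for $\mathbb{M}$ if $\int_{\mathbb{R}^d}\mathbb{P}_x(X_t\in E)\,\widetilde\mu(dx)=\widetilde\mu(E)$ for all $t\ge0$, $E\in\mathcal{B}(\mathbb{R}^d)$; sub-invariant if this holds with $\le$ in place of $=$. $L_E=\sup\{t\ge0:X_t\in E\}$ ($\sup\emptyset:=0$). $\mathbb{M}$ is recurrent in the probabilistic sense if $\mathbb{P}_x(L_U=\infty)=1$ for all $x\in\mathbb{R}^d$ and all non-empty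 open $U\subset\mathbb{R}^d$. *)

(* Defs.v *)
From HB Require Import structures.
From mathcomp Require Import all_boot all_order all_algebra.
From mathcomp Require Import all_classical all_reals all_analysis.
From mathcomp Require Import measurable_realfun.
Import Order.TTheory GRing.Theory Num.Def Num.Theory.
Import numFieldNormedType.Exports.
Set Implicit Arguments.
Unset Strict Implicit.
Unset Printing Implicit Defensive.
Local Open Scope classical_set_scope.
Local Open Scope ring_scope.

(* B(R^d) is generated by the open sets of 'rV[R]_d. *)
Section borel.
Context (R : realType) (m n : nat).
HB.instance Definition _ := @isMeasurable.Build
  (sigma_display (@open 'M[R]_(m, n))) 'M[R]_(m, n)
  <<s (@open 'M[R]_(m, n)) >> (@sigma_algebra0 _ setT _)
  (@sigma_algebraC _ _) (@sigma_algebra_bigcup _ setT _).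
End borel.

Lemma open_countable_cubes (R : realType) d (U : set 'rV[R]_d) : open U ->
  U = \bigcup_(qn in [set qn : 'rV[rat]_d * nat |
         ball (map_mx ratr qn.1 : 'rV[R]_d) qn.2.+1%:R^-1 `<=` U])
      ball (map_mx ratr qn.1 : 'rV[R]_d) qn.2.+1%:R^-1.
Proof.
move=> oU; apply/seteqP; split; last by move=> x [qn /= sub /sub].
move=> x Ux.
have /nbhs_ballP[e /= e0 eU] : nbhs x U by exact: open_nbhs_nbhs.
have [k ke] : exists k : nat, k.+1%:R^-1 < e / 2.
  have e20 : 0 < e / 2 by rewrite divr_gt0.
  near \oo => k; exists k; near: k; exact: near_infty_natSinv_lt (PosNum e20).
have hk : 0 < k.+1%:R^-1 :> R by rewrite invr_gt0.
have q_ i : exists q : rat, ball (x ord0 i) k.+1%:R^-1 (ratr q : R).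
  have := @dense_rat R (ball (x ord0 i) k.+1%:R^-1).
  case; [by exists (x ord0 i); exact: ballxx|exact: ball_open|].
  by move=> y [xy [q _ qy]]; exists q; rewrite qy.
pose q : 'rV[rat]_d := \row_i projT1 (cid (q_ i)).
have xq : ball (map_mx ratr q : 'rV[R]_d) k.+1%:R^-1 x.
  split=> // i j; rewrite !mxE (ord1 i); apply: ball_sym.
  exact: projT2 (cid (q_ j)).
exists (q, k) => //= y qy; apply: eU.
apply: (@le_ball _ _ x (k.+1%:R^-1 + k.+1%:R^-1)).
  by rewrite (splitr e) ltW// ltrD.
exact: ball_triangle (ball_sym xq) qy.
Unshelve. all: by end_near.
Qed.

Lemma measurable_fun_rV (R : realType) d d0 (T : measurableType d0)
    (f : T -> 'rV[R]_d) :
  (forall i, measurable_fun setT (fun t => f t ord0 i)) ->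
  measurable_fun setT f.
Proof.
move=> mf; apply: (@measurability _ _ _ _ setT f (@open _)) => // _ [U oU <-].
rewrite setTI (open_countable_cubes oU) preimage_bigcup bigcup_mkcond.
apply: countable_bigcupT_measurable => // -[q k]; case: ifPn => // _.
rewrite (_ : _ @^-1` _ =
  \bigcap_(i in [set: 'I_d])
    [set t | ball (ratr (q ord0 i) : R) k.+1%:R^-1 (f t ord0 i)]).
  apply: fin_bigcap_measurable => // i _.
  rewrite -[X in measurable X]setTI; apply: mf => //.
  rewrite ball_itv; exact: measurable_itv.
apply/seteqP; split=> t /=.
  by move=> [_ tb] i _; have := tb ord0 i; rewrite mxE.
move=> tb; split; first by rewrite invr_gt0.
by move=> i j; rewrite mxE (ord1 i); exact: tb.
Qed.


Lemma measurable_coord (R : realType) m n (i : 'I_m) (j : 'I_n) :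
  measurable_fun setT (fun M : 'M[R]_(m, n) => M i j).
Proof.
apply: (measurability _ (RGenOInfty.measurableE R)) => _ [_ [x ->] <-].
rewrite setTI; apply: sub_sigma_algebra.
apply: open_comp; last exact: interval_open.
by move=> M _; exact: coord_continuous.
Qed.

Section cons_rV.
Context {R : realType} {d : nat}.

Definition cons_rV (xv : R * 'rV[R]_d) : 'rV[R]_d.+1 :=
  \row_i oapp (fun j => xv.2 ord0 j) xv.1 (unlift ord0 i).

Definition uncons_rV (w : 'rV[R]_d.+1) : R * 'rV[R]_d :=
  (w ord0 ord0, \row_j w ord0 (lift ord0 j)).

Lemma cons_rVK : cancel cons_rV uncons_rV.
Proof.
move=> [x v]; rewrite /uncons_rV mxE unlift_none /=; congr pair.
by apply/rowP => j; rewrite !mxE liftK.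
Qed.

Lemma uncons_rVK : cancel uncons_rV cons_rV.
Proof.
move=> w; apply/rowP => i; rewrite mxE.
by case: unliftP => [j ->|->] //=; rewrite mxE.
Qed.

Lemma measurable_cons_rV : measurable_fun setT cons_rV.
Proof.
apply: measurable_fun_rV => i.
under eq_fun do rewrite mxE.
case: unliftP => [j _|_] /=; last exact: measurable_fst.
exact: (measurableT_comp (measurable_coord ord0 j) measurable_snd).
Qed.

Lemma measurable_uncons_rV : measurable_fun setT uncons_rV.
Proof.
apply: measurable_fun_pair; first exact: measurable_coord.
apply: measurable_fun_rV => i; under eq_fun do rewrite mxE.
exact: measurable_coord.
Qed.

End cons_rV.



Section lebesgue_step.
Context (R : realType) (d : nat).
Variable m : {sigma_finite_measure set 'rV[R]_d -> \bar R}.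

Definition lebesgue_step : set 'rV[R]_d.+1 -> \bar R :=
  pushforward (@lebesgue_measure R \x m)%E cons_rV.

Let cons_preimage (A : set 'rV[R]_d.+1) : measurable A ->
  measurable (cons_rV @^-1` A : set (measurableTypeR R * 'rV[R]_d)%type).
Proof.
by move=> mA; rewrite -[X in measurable X]setTI; exact: measurable_cons_rV.
Qed.

Let lebesgue_step0 : lebesgue_step set0 = 0%E.
Proof. by rewrite /lebesgue_step /pushforward preimage_set0 measure0. Qed.

Let lebesgue_step_ge0 A : (0 <= lebesgue_step A)%E.
Proof.
by rewrite /lebesgue_step; exact: (@measure_ge0 _ _ _ (@lebesgue_measure R \x m)%E).
Qed.

Let lebesgue_step_sigma_additive : semi_sigma_additive lebesgue_step.
Proof.
move=> F mF tF mUF; rewrite /lebesgue_step /pushforward preimage_bigcup.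
apply: measure_semi_sigma_additive.
- by move=> n; exact: cons_preimage.
- apply/trivIsetP => /= i j _ _ ij; rewrite -preimage_setI.
  by move/trivIsetP : tF => /(_ _ _ _ _ ij) ->//; rewrite preimage_set0.
- by rewrite -preimage_bigcup; exact: cons_preimage.
Qed.

HB.instance Definition _ := isMeasure.Build _ _ _ lebesgue_step
  lebesgue_step0 lebesgue_step_ge0 lebesgue_step_sigma_additive.

Let lebesgue_step_sigma_finite : sigma_finite setT lebesgue_step.
Proof.
have /sigma_finiteP[F [FT ndF Foo]] := sigma_finiteT (@lebesgue_measure R).
have /sigma_finiteP[G [GT ndG Goo]] := sigma_finiteT m.
exists (fun n => uncons_rV @^-1` (F n `*` G n)).
  apply/seteqP; split=> // w _.
  have [k _ Fk] : (\bigcup_n F n) (uncons_rV w).1 by rewrite -FT.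
  have [l _ Gl] : (\bigcup_n G n) (uncons_rV w).2 by rewrite -GT.
  exists (maxn k l) => //; split.
  - by move: Fk; exact/subsetPset/ndF/leq_maxl.
  - by move: Gl; exact/subsetPset/ndG/leq_maxr.
move=> n; have [mF ltF] := Foo n; have [mG ltG] := Goo n; split.
  rewrite -[X in measurable X]setTI; apply: measurable_uncons_rV => //.
  exact: measurableX.
rewrite /lebesgue_step /pushforward (_ : _ @^-1` _ = F n `*` G n).
  by rewrite product_measure1E// lte_mul_pinfty// ge0_fin_numE.
by rewrite -comp_preimage (funext cons_rVK : uncons_rV \o cons_rV = id).
Qed.

HB.instance Definition _ := Measure_isSigmaFinite.Build _ _ _
  lebesgue_step lebesgue_step_sigma_finite.

End lebesgue_step.

(* d-dimensional Lebesgue measure on 'rV[R]_d, as an iterated product. *)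
Fixpoint lebesgue_rV (R : realType) (d : nat) :
    {sigma_finite_measure set 'rV[R]_d -> \bar R} :=
  if d is d'.+1 then lebesgue_step (lebesgue_rV R d')
  else dirac (0 : 'rV[R]_0).

Lemma lebesgue_rV_cons (R : realType) (d : nat) (E : set R)
    (F : set 'rV[R]_d) : measurable E -> measurable F ->
  lebesgue_rV R d.+1
    [set w : 'rV[R]_d.+1 | E (w ord0 ord0) /\ F (uncons_rV w).2] =
  (lebesgue_measure E * lebesgue_rV R d F)%E.
Proof.
move=> mE mF; rewrite /= /lebesgue_step /pushforward.
rewrite -(@product_measure1E _ _ _ _ _ lebesgue_measure (lebesgue_rV R d) E F)//.
by congr (_ _); apply/seteqP; split=> -[x v] /=;
  have := @cons_rVK R d (x, v); rewrite /uncons_rV => -[-> ->].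
Qed.

Section function_spaces.
Context {R : realType} {d : nat}.
Local Notation Rd := 'rV[R]_d.
Local Notation leb := (lebesgue_rV R d).

Definition dot (u v : Rd) : R := \sum_i u ord0 i * v ord0 i.

Definition partial (i : 'I_d) (f : Rd -> R) : Rd -> R :=
  fun x => 'D_(delta_mx ord0 i) f x.

Definition grad (f : Rd -> R) (x : Rd) : Rd := \row_i partial i f x.

Fixpoint cont_diff (k : nat) (f : Rd -> R) : Prop :=
  continuous f /\
  if k is k'.+1 then
    forall i, (forall x, derivable f x (delta_mx ord0 i)) /\
              cont_diff k' (partial i f)
  else True.

Definition smooth (f : Rd -> R) : Prop := forall k, cont_diff k f.

(* C_0^oo(V) *)
Definition test_fun (V : set Rd) (phi : Rd -> R) : Prop :=
  smooth phi /\
  exists K, [/\ compact K, K `<=` V & forall x, ~ K x -> phi x = 0].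

(* Elements of L^s(V, mu) are represented by functions on R^d, only the values
   on V being relevant: f \_ V is f on V and 0 outside V. *)
Definition in_Lp (mu : {measure set Rd -> \bar R}) (V : set Rd) (s : \bar R)
  (f : Rd -> R) : Prop := f \_ V \in Lfun mu s.

(* || f - g || in L^s(V, mu) *)
Definition Lp_dist (mu : {measure set Rd -> \bar R}) (V : set Rd) (s : \bar R)
  (f g : Rd -> R) : \bar R := Lnorm mu s (EFin \o (f \- g) \_ V).

Definition in_Lp_loc (V : set Rd) (s : R) (f : Rd -> R) : Prop :=
  forall K, compact K -> K `<=` V -> in_Lp leb K s%:E f.

Definition weak_partial (V : set Rd) (i : 'I_d) (f g : Rd -> R) : Prop :=
  [/\ in_Lp_loc V 1 f, in_Lp_loc V 1 g &
    forall phi, test_fun V phi ->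
      \int[leb]_(x in V) (f x * partial i phi x) =
      - \int[leb]_(x in V) (g x * phi x)].

(* A version of the weak partial derivative on the open set V; it is
   a.e. unique, and 0 by convention if there is none. *)
Definition wpartial (V : set Rd) (i : 'I_d) (f : Rd -> R) : Rd -> R :=
  xget (fun=> 0) [set g | weak_partial V i f g].

Definition wgrad (V : set Rd) (f : Rd -> R) (x : Rd) : Rd :=
  \row_i wpartial V i f x.

(* H^{1,s}_loc(R^d) *)
Definition sobolev_loc (s : R) (f : Rd -> R) : Prop :=
  in_Lp_loc setT s f /\
  forall i, exists2 g, weak_partial setT i f g & in_Lp_loc setT s g.

Definition relatively_compact (V : set Rd) : Prop := compact (closure V).

Definition exhaustion (V : nat -> set Rd) : Prop :=
  [/\ forall n, open (V n) /\ relatively_compact (V n),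
      forall n, V n `<=` V n.+1 & \bigcup_n V n = setT].

End function_spaces.

Section coefficients.
Context {R : realType} {d : nat}.
Local Notation Rd := 'rV[R]_d.
Local Notation leb := (lebesgue_rV R d).
Implicit Types (A C B : Rd -> 'M[R]_d) (H : Rd -> Rd).

Record assumption_a (p : R) A C H : Prop := {
  a_sym : forall x, (A x)^T = A x;
  a_sobolev : forall i j, sobolev_loc 2 (fun x => A x i j);
  a_continuous : forall i j, continuous (fun x => A x i j);
  a_elliptic : forall V, relatively_compact V -> exists2 nu : R, 0 < nu &
    forall xi x, V x ->
      nu^-1 * dot xi xi <= dot (xi *m (A x)^T) xi <= nu * dot xi xi;
  c_antisym : forall x, (C x)^T = - C x;
  c_sobolev : forall i j, sobolev_loc 2 (fun x => C x i j);
  c_continuous : forall i j, continuous (fun x => C x i j);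
  h_Lp_loc : forall i, in_Lp_loc setT p (fun x => H x ord0 i) }.

Definition mx_div B (x : Rd) : Rd :=
  \row_i \sum_j wpartial setT j (fun y => B y i j) x.

(* G *)
Definition drift A C H (x : Rd) : Rd :=
  2^-1 *: mx_div (fun y => A y + (C y)^T) x + H x.

Definition assumption_b (p : R) A C H : Prop :=
  forall i, in_Lp_loc setT (p * d%:R / (p + d%:R))
    (fun x => drift A C H x ord0 i).

Definition gen_L A (G : Rd -> Rd) (f : Rd -> R) (x : Rd) : R :=
  2^-1 * (\sum_i \sum_j A x i j * partial i (partial j f) x) +
  \sum_i G x ord0 i * partial i f x.

(* mu = rho dx is an infinitesimally invariant measure for (L, C_0^oo) *)
Record inf_invariant_density (p : R) A (G : Rd -> Rd) (rho : Rd -> R)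
    (mu : {measure set Rd -> \bar R}) : Prop := {
  rho_sobolev : sobolev_loc p rho;
  rho_continuous : continuous rho;
  rho_gt0 : forall x, 0 < rho x;
  mu_density : forall E, measurable E ->
    mu E = (\int[leb]_(x in E) (rho x)%:E)%E;
  mu_inf_invariant : forall phi, test_fun setT phi ->
    \int[mu]_x gen_L A G phi x = 0 }.

(* beta^{rho, A} *)
Definition log_drift A (rho : Rd -> R) (x : Rd) : Rd :=
  \row_i (2^-1 * \sum_j (wpartial setT j (fun y => A y i j) x +
                         A x i j * (wpartial setT j rho x / rho x))).

End coefficients.

Section L1_semigroups.
Context {R : realType} {d : nat}.
Local Notation Rd := 'rV[R]_d.
Variables (mu : {measure set Rd -> \bar R}) (V : set Rd).
Variable S : R -> (Rd -> R) -> (Rd -> R).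

(* Sub-Markovian C_0-semigroup of contractions on L^1(V, mu), acting on
   representatives; equalities hold mu-a.e. on V. *)
Record submarkovian_C0_semigroup : Prop := {
  sg_L1 : forall t f, 0 < t -> in_Lp mu V 1 f -> in_Lp mu V 1 (S t f);
  sg_linear : forall t a f g, 0 < t -> in_Lp mu V 1 f -> in_Lp mu V 1 g ->
    ae_eq mu V (S t (fun x => a * f x + g x))
               (fun x => a * S t f x + S t g x);
  sg_contraction : forall t f, 0 < t -> in_Lp mu V 1 f ->
    (Lp_dist mu V 1 (S t f) (cst 0%R) <= Lp_dist mu V 1 f (cst 0%R))%E;
  sg_submarkov : forall t f, 0 < t -> in_Lp mu V 1 f ->
    (\forall x \ae mu, V x -> 0 <= f x <= 1) ->
    \forall x \ae mu, V x -> 0 <= S t f x <= 1;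
  sg_semigroup : forall s t f, 0 < s -> 0 < t -> in_Lp mu V 1 f ->
    ae_eq mu V (S (s + t) f) (S s (S t f));
  sg_strong_continuity : forall f, in_Lp mu V 1 f ->
    Lp_dist mu V 1 (S t f) f @[t --> 0^'+] --> 0%E }.

(* u is in the domain of the generator, which maps u to w. *)
Definition generator (u w : Rd -> R) : Prop :=
  [/\ in_Lp mu V 1 u, in_Lp mu V 1 w &
    Lp_dist mu V 1 (fun x => (S t u x - u x) / t) w @[t --> 0^'+] --> 0%E].

Definition resolvent (alpha : R) (f u : Rd -> R) : Prop :=
  exists2 w, generator u w & ae_eq mu V (fun x => alpha * u x - w x) f.

End L1_semigroups.

Section local_operator.
Context {R : realType} {d : nat}.
Local Notation Rd := 'rV[R]_d.
Variables (mu : {measure set Rd -> \bar R}) (A : Rd -> 'M[R]_d).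
Variables (B : Rd -> Rd) (V : set Rd).

Definition dirichlet_form (u v : Rd -> R) : R :=
  2^-1 * \int[mu]_(x in V) dot (grad u x *m (A x)^T) (grad v x).

(* Form-Cauchy sequence in C_0^oo(V) that converges to u in L^2(V, mu). *)
Definition form_approx (u : Rd -> R) (u_ : nat -> Rd -> R) : Prop :=
  [/\ forall n, test_fun V (u_ n),
      forall e : R, 0 < e -> exists N, forall m n, (N <= m)%N -> (N <= n)%N ->
        dirichlet_form (u_ m \- u_ n) (u_ m \- u_ n) < e &
      Lp_dist mu V 2%:E (u_ n) u @[n --> \oo] --> 0%E].

Definition closed_form_dom (u : Rd -> R) : Prop :=
  in_Lp mu V 2%:E u /\ exists u_, form_approx u u_.

Definition closed_form (u v : Rd -> R) (e : R) : Prop :=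
  exists u_ v_, [/\ form_approx u u_, form_approx v v_ &
    dirichlet_form (u_ n) (v_ n) @[n --> \oo] --> e].

(* u is in D(L^{0,V}) and L^{0,V} u = w, by the correspondence between closed
   symmetric forms and self-adjoint operators. *)
Definition form_generator (u w : Rd -> R) : Prop :=
  [/\ in_Lp mu V 2%:E w, closed_form_dom u &
    forall v, closed_form_dom v ->
      closed_form u v (- \int[mu]_(x in V) (w x * v x))].

Definition perturbed_generator (u w : Rd -> R) : Prop :=
  [/\ in_Lp mu V +oo u, in_Lp mu V 1 w & exists2 w0, form_generator u w0 &
    ae_eq mu V w (fun x => w0 x + dot (B x) (wgrad V u x))].

Definition closed_perturbed_generator (u w : Rd -> R) : Prop :=
  [/\ in_Lp mu V 1 u, in_Lp mu V 1 w & exists u_ w_, [/\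
    forall n, perturbed_generator (u_ n) (w_ n),
    Lp_dist mu V 1 (u_ n) u @[n --> \oo] --> 0%E &
    Lp_dist mu V 1 (w_ n) w @[n --> \oo] --> 0%E]].

(* g is the resolvent of the closed operator at alpha, applied to f 1_V and
   extended by zero outside V. *)
Definition local_resolvent (alpha : R) (f g : Rd -> R) : Prop :=
  (exists2 w, closed_perturbed_generator g w &
    ae_eq mu V (fun x => alpha * g x - w x) f) /\
  forall x, ~ V x -> g x = 0.

End local_operator.

Section global_semigroup.
Context {R : realType} {d : nat}.
Local Notation Rd := 'rV[R]_d.
Variables (mu : {measure set Rd -> \bar R}) (A : Rd -> 'M[R]_d).
Variables (G : Rd -> Rd) (rho : Rd -> R).
Variable T : R -> (Rd -> R) -> (Rd -> R).

Let B x := G x - log_drift A rho x.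

(* T is the semigroup on L^1(R^d, mu) whose resolvent is the limit of the
   resolvents on relatively compact open sets. *)
Record L1_semigroup_construction : Prop := {
  loc_generation : forall V, open V -> relatively_compact V ->
    exists2 S, submarkovian_C0_semigroup mu V S &
      forall u w, generator mu V S u w <->
                  closed_perturbed_generator mu A B V u w;
  glob_semigroup : submarkovian_C0_semigroup mu setT T;
  glob_resolvent : forall alpha f V, 0 < alpha -> in_Lp mu setT 1 f ->
    exhaustion V -> exists g_ u, [/\
      forall n, local_resolvent mu A B (V n) alpha f (g_ n),
      resolvent mu setT T alpha f u &
      Lp_dist mu setT 1 (g_ n) u @[n --> \oo] --> 0%E];
  glob_extends : forall phi, test_fun setT phi ->
    generator mu setT T phi (gen_L A G phi) }.

Definition in_L1_Loo (f : Rd -> R) : Prop :=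
  in_Lp mu setT 1 f /\ in_Lp mu setT +oo f.

(* Extension of T_t from L^1 and L^oo along nondecreasing sequences. *)
Definition monotone_extension (t : R) (h k : Rd -> R) : Prop :=
  exists h_ : nat -> Rd -> R, [/\ forall n, in_L1_Loo (h_ n),
    forall n x, 0 <= h_ n x <= h_ n.+1 x,
    forall x, h_ n x @[n --> \oo] --> h x &
    \forall x \ae mu, T t (h_ n) x @[n --> \oo] --> k x].

(* g is a version of T_t f, with T_t acting on L^s(R^d, mu): the extension of
   T_t from the intersection of L^1 and L^oo is by density if s is finite, and
   by monotone limits on positive and negative parts if s = +oo, where this
   intersection is not dense. *)
Definition Lp_semigroup (s : \bar R) (t : R) (f g : Rd -> R) : Prop :=
  [/\ in_Lp mu setT s f, in_Lp mu setT s g &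
  match s with
  | _%:E => exists f_ : nat -> Rd -> R, [/\ forall n, in_L1_Loo (f_ n),
      Lp_dist mu setT s (f_ n) f @[n --> \oo] --> 0%E &
      Lp_dist mu setT s (T t (f_ n)) g @[n --> \oo] --> 0%E]
  | +oo%E => exists gp gm, [/\
      monotone_extension t (fun x => Num.max (f x) 0) gp,
      monotone_extension t (fun x => Num.max (- f x) 0) gm &
      ae_eq mu setT g (gp \- gm)]
  | -oo%E => False
  end].

Definition continuous_versions (P : R -> (Rd -> R) -> (Rd -> R)) : Prop :=
  (forall f, P 0 f = f) /\
  forall (s : \bar R) t f, (1 <= s)%E -> 0 < t -> in_Lp mu setT s f ->
    continuous (P t f) /\ Lp_semigroup s t f (P t f).

End global_semigroup.

Section process.
Context {R : realType} {d : nat}.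
Local Notation Rd := 'rV[R]_d.
(* The cemetery Delta is None. *)
Local Notation RdD := (one_point_compactification Rd).

Definition stopping_time {T : Type} (F : R -> set (set T)) (tau : T -> \bar R) :=
  (forall w, (0 <= tau w)%E) /\
  forall t, 0 <= t -> F t [set w | (tau w <= t%:E)%E].

Record hunt_process {dO} (Omega : measurableType dO) := HuntProcess {
  state : R -> Omega -> RdD;
  filtration : R -> set (set Omega);
  law : RdD -> probability Omega R;
  filtration_sigma_algebra : forall t, 0 <= t ->
    sigma_algebra setT (filtration t) /\ filtration t `<=` measurable;
  filtration_nondecreasing : forall s t, 0 <= s -> s <= t ->
    filtration s `<=` filtration t;
  filtration_right_continuous : forall t, 0 <= t ->
    \bigcap_(s in `]t, +oo[) filtration s `<=` filtration t;
  state_adapted : forall t E, 0 <= t -> <<s (@open RdD) >> E ->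
    filtration t (state t @^-1` E);
  law_measurable : forall Gamma,
    <<s [set state t @^-1` E | t in `[0, +oo[ & E in <<s (@open RdD) >>] >> Gamma ->
    measurable_fun setT (fun x : Rd => law (Some x) Gamma);
  law_normal : forall x, law x (state 0 @^-1` [set x]) = 1%E;
  state_continuous : forall w,
    {within `[0, +oo[, continuous (fun t => state t w)};
  state_absorbed : forall s t w, 0 <= s -> s <= t ->
    state s w = None -> state t w = None;
  (* strong Markov property, the set Gamma ranging over F_tau *)
  law_strong_markov : forall (tau : Omega -> \bar R) Gamma s E x,
    stopping_time filtration tau -> measurable Gamma ->
    (forall t, 0 <= t ->
      filtration t (Gamma `&` [set w | (tau w <= t%:E)%E])) ->
    0 <= s -> <<s (@open RdD) >> E ->
    let Gamma' := Gamma `&` [set w | (tau w < +oo)%E] in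
    law x (Gamma' `&` [set w | E (state (fine (tau w) + s) w)]) =
    (\int[law x]_(w in Gamma') law (state (fine (tau w)) w) (state s @^-1` E))%E;
  law_quasi_left_continuous : forall (tau_ : nat -> Omega -> \bar R) tau x,
    (forall n, stopping_time filtration (tau_ n)) ->
    stopping_time filtration tau ->
    (forall n w, (tau_ n w <= tau_ n.+1 w)%E) ->
    (forall w, tau_ n w @[n --> \oo] --> tau w) ->
    \forall w \ae law x, (tau w < +oo)%E ->
      state (fine (tau_ n w)) w @[n --> \oo] --> state (fine (tau w)) w }.

Context {dO : measure_display} {Omega : measurableType dO}.
Variable M : hunt_process Omega.

(* { X_t in E } for E a set of R^d, so that X_t is alive *)
Definition state_in (t : R) (E : set Rd) : set Omega :=
  state M t @^-1` (Some @` E).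

(* P_t f(x) = E_x[f(X_t)], with f(Delta) = 0 *)
Definition has_transition (P : R -> (Rd -> R) -> (Rd -> R)) : Prop :=
  forall t (x : Rd) (f : Rd -> R), 0 <= t -> measurable_fun setT f ->
    (exists K : R, forall y, `|f y| <= K) ->
    (\int[law M (Some x)]_w (oapp f 0 (state M t w))%:E)%E = (P t f x)%:E.

Definition lifetime (w : Omega) : \bar R :=
  ereal_inf [set t%:E | t in [set t | 0 <= t /\ state M t w = None]].

Definition nonexplosive : Prop :=
  forall x : Rd, law M (Some x) [set w | lifetime w = +oo%E] = 1%E.

(* The maximum with 0 only matters for the empty set, whose supremum is -oo. *)
Definition last_exit (E : set Rd) (w : Omega) : \bar R :=
  maxe 0%E (ereal_sup [set t%:E | t in [set t | 0 <= t /\ state_in t E w]]).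

Definition recurrent : Prop :=
  forall (x : Rd) (U : set Rd), open U -> U !=set0 ->
    law M (Some x) [set w | last_exit U w = +oo%E] = 1%E.

Definition invariant_measure (m : {measure set Rd -> \bar R}) : Prop :=
  [/\ m setT != 0%E, sigma_finite setT m &
    forall t E, 0 <= t -> measurable E ->
      (\int[m]_x law M (Some x) (state_in t E))%E = m E].

Definition subinvariant_measure (m : {measure set Rd -> \bar R}) : Prop :=
  [/\ m setT != 0%E, sigma_finite setT m &
    forall t E, 0 <= t -> measurable E ->
      (\int[m]_x law M (Some x) (state_in t E) <= m E)%E].

End process.

(* Main.v *)
Require Import Defs.
From HB Require Import structures.
From mathcomp Require Import all_boot all_order all_algebra.
From mathcomp Require Import all_classical all_reals all_analysis.
From mathcomp Require Import measurable_realfun.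
From mathcomp Require Import ring lra.
Import Order.TTheory GRing.Theory Num.Def Num.Theory.
Import numFieldNormedType.Exports.
Set Implicit Arguments.
Unset Strict Implicit.
Unset Printing Implicit Defensive.
Local Open Scope classical_set_scope.
Local Open Scope ring_scope.

(** * Smooth functions *)

(** A finite invariant measure already forces conservativity. The L^1 contraction and the continuity
    of P_t 1_E give P_t 1_E = 0 as soon as mu(E) = 0 ([P_null]), so [nu] has a density h with
    respect to [mu]. For S = {h > c}, invariance says that P_t 1_S and 1_S have the same integral
    against h dmu, and contraction says that the integral of P_t 1_S against mu is at most mu(S).
    Since (1_S - P_t 1_S)(h - c) is nonnegative, it vanishes almost everywhere, and P_t 1_S = 1_S
    almost everywhere follows ([superlevel_invariant]). A continuous function with values 0 and 1 is
    constant, so P_t 1_S = 1 when S is not null. Hence S has full measure, [mu] is finite and no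
    mass is lost ([full_invariant_set]); contraction for E and for its complement makes [mu]
    invariant ([mu_invariant]).

    Irreducibility, P_t 1_E(x) > 0 whenever mu(E) > 0 ([transition_gt0]), rests on a logarithmic
    energy estimate. Let U_t = P_t f with f a nonnegative test function, and let F be a bounded
    smooth substitute for the logarithm at scale k. Testing the equation with F'(U_t) b^2, and using
    that the drift B is divergence free with respect to mu ([div_free]), bounds the square of the
    integral of F(U_t) d_i b dx by the time derivative of the integral of F(U_t) b^2 dmu, up to
    constants that do not depend on k ([generator_estimate]). After integration in time the right
    side grows like |ln k|. Dividing by |ln k|^2 and letting k tend to 0 turns -F/|ln k| into the
    indicator of {U_t = 0}, which therefore has zero weak gradient for almost every t
    ([evolution_zero_set_flux]). For small t this zero set misses a box, so it is null
    ([flux_free_null]), and one further application of the semigroup gives positivity everywhere.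

    The estimate is first obtained for the local operators of the construction. Elements of the form
    domain are described by test functions converging together with their gradients ([grad_cvg]),
    which yields the weak formulation [perturbed_generator_test] and then [core_estimate]. The
    passage to the generator of the global L^1 semigroup goes through the convergence of the local
    resolvents ([generator_approx]).

    For convergence to equilibrium, take f bounded of mean 0. The norms of P_n f in L^1 decrease,
    and each decrease equals twice the mass that cancels between P_1 of the positive and of the
    negative part of P_n f. This overlap tends to 0, so at some point x and along a subsequence one
    of the two parts is asymptotically invisible to P_1(x, .), whose density is positive; that part
    then tends to 0 in L^1, and so does the other, which has the same mass ([ergodic_L1]).
    Truncation extends this to L^s ([ergodic_Ls]), and the density of P_1(x, .) upgrades it to
    pointwise convergence ([ergodic_pointwise]).

    The remaining claims follow from P_t 1_E(x) tending to mu(E)/mu(R^d): Fatou makes sub-invariant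
    measures finite, dominated convergence identifies the invariant ones, and the Markov property
    shows that a trajectory returns to E along any sequence of times tending to infinity
    ([hit_infinitely_often]). *)

Section smooth1.
Context {R : realType}.
Implicit Types f g : R -> R.

(** One-variable counterpart of [cont_diff]. The derivative is an existential witness tied to [f] by
    [is_derive], so a closure property only has to name the new derivative and recurse. *)
Fixpoint cont_diff1 (k : nat) f : Prop :=
  if k is k'.+1 then
    exists2 g : R -> R, (forall x : R, is_derive x 1 f (g x)) & cont_diff1 k' g
  else continuous f.

Definition smooth1 f := forall k, cont_diff1 k f.

Lemma is_derive_continuous f g :
  (forall x : R, is_derive x 1 f (g x)) -> continuous f.
Proof.
by move=> df x; apply/differentiable_continuous/derivable1_diffP; have [] := df x.
Qed.

Lemma cont_diff1_continuous k f : cont_diff1 k f -> continuous f.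
Proof. by case: k => [//|k [g fg _]]; exact: is_derive_continuous fg. Qed.

Lemma cont_diff1W k f : cont_diff1 k.+1 f -> cont_diff1 k f.
Proof.
elim: k f => [f /cont_diff1_continuous//|k IH f [g fg /IH gk]].
by exists g.
Qed.

Lemma cont_diff1D k f g :
  cont_diff1 k f -> cont_diff1 k g -> cont_diff1 k (f \+ g).
Proof.
elim: k f g => [f g cf cg x|k IH f g [f' ff' f'k] [g' gg' g'k]].
  by apply: continuousD; [exact: cf|exact: cg].
exists (f' \+ g'); last exact: IH.
by move=> x; apply: is_deriveD.
Qed.

Lemma cont_diff1M k f g :
  cont_diff1 k f -> cont_diff1 k g -> cont_diff1 k (f \* g).
Proof.
elim: k f g => [f g cf cg x|k IH f g fk gk].
  by apply: continuousM; [exact: cf|exact: cg].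
have [f' ff' f'k] := fk; have [g' gg' g'k] := gk.
exists (f \* g' \+ g \* f').
  by move=> x; apply: is_deriveM.
by apply: cont_diff1D; apply: IH => //; exact: cont_diff1W.
Qed.

Lemma cont_diff1_cst k (c : R) : cont_diff1 k (cst c).
Proof.
elim: k c => [c|k IH c]; first exact: cst_continuous.
by exists (cst 0); [move=> x; exact: is_derive_cst|exact: IH].
Qed.

Lemma smooth1_id : smooth1 id.
Proof.
case=> [|k]; first by move=> x.
by exists (cst 1); [move=> x; exact: is_derive_id|exact: cont_diff1_cst].
Qed.

Lemma cont_diff1_comp k f g :
  cont_diff1 k f -> cont_diff1 k g -> cont_diff1 k (f \o g).
Proof.
elim: k f g => [f g cf cg x|k IH f g [f' ff' f'k] gk].
  by apply: continuous_comp; [exact: cg|exact: cf].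
have [g' gg' g'k] := gk.
exists ((f' \o g) \* g').
  by move=> x; apply: is_derive1_comp.
by apply: cont_diff1M => //; apply: IH => //; exact: cont_diff1W.
Qed.

Lemma cont_diff1V k f : (forall x, f x != 0) ->
  cont_diff1 k f -> cont_diff1 k (fun x => (f x)^-1).
Proof.
move=> f0; elim: k => [cf x|k IH fk].
  by apply: continuousV => //; exact: cf.
have [f' ff' f'k] := fk.
have Vk := IH (cont_diff1W fk).
exists (cst (- 1) \* ((fun x => (f x)^-1) \* (fun x => (f x)^-1)) \* f').
  move=> x; have := @is_deriveV _ f x (f' x) 1 (f0 x) (ff' x).
  move=> H; apply: (is_derive_eq H) => /=.
  by rewrite /GRing.scale/= -exprVn expr2 mulN1r.
by apply: cont_diff1M => //; apply: cont_diff1M; [exact: cont_diff1_cst|exact: cont_diff1M].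
Qed.

Lemma smooth1_cst (c : R) : smooth1 (cst c).
Proof. by move=> k; exact: cont_diff1_cst. Qed.

Lemma smooth1D f g : smooth1 f -> smooth1 g -> smooth1 (f \+ g).
Proof. by move=> sf sg k; exact: cont_diff1D. Qed.

Lemma smooth1M f g : smooth1 f -> smooth1 g -> smooth1 (f \* g).
Proof. by move=> sf sg k; exact: cont_diff1M. Qed.

Lemma smooth1_comp f g : smooth1 f -> smooth1 g -> smooth1 (f \o g).
Proof. by move=> sf sg k; exact: cont_diff1_comp. Qed.

Lemma smooth1V f : (forall x, f x != 0) -> smooth1 f ->
  smooth1 (fun x => (f x)^-1).
Proof. by move=> f0 sf k; exact: cont_diff1V. Qed.

(** Derivatives are unique, so the witness hidden in [smooth1 f] is [g]. This passes the regularity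
    of a primitive on to the derivatives listed in a [cutoff]. *)
Lemma smooth1_derive f g : (forall x : R, is_derive x 1 f (g x)) ->
  smooth1 f -> smooth1 g.
Proof.
move=> fg sf k; have [h fh hk] := sf k.+1.
suff -> : g = h by [].
by apply/funext => x; rewrite -(@derive_val _ _ _ _ _ _ _ (fg x)) derive_val.
Qed.

(* The functions [x^-n * exp (-1/x)], extended by [0] to [x <= 0]. *)
Definition flat (n : nat) (x : R) : R :=
  if 0 < x then x^-1 ^+ n * expR (- x^-1) else 0.

Lemma flat_gt0 n x : 0 < x -> 0 < flat n x.
Proof. by move=> x0; rewrite /flat x0 mulr_gt0 ?expR_gt0// exprn_gt0// invr_gt0. Qed.

Lemma flat_eq0 n x : x <= 0 -> flat n x = 0.
Proof. by move=> x0; rewrite /flat ltNge x0. Qed.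

Lemma flat_ge0 n x : 0 <= flat n x.
Proof. by have [/(flat_gt0 n)/ltW//|/(flat_eq0 n) ->] := ltP 0 x. Qed.

(** With y = 1/x, the bound e^y >= y^(n+1)/(n+1)! absorbs the pole x^-n and leaves a spare factor x,
    which is what the difference quotient at 0 needs. *)
Lemma flat_le n x : flat n x <= n.+1`!%:R * `|x|.
Proof.
have [x0|x0] := ltP 0 x; last by rewrite flat_eq0// mulr_ge0.
rewrite /flat x0 expRN (gtr0_norm x0).
have y0 : 0 < x^-1 by rewrite invr_gt0.
rewrite ler_pdivrMr ?expR_gt0// -mulrA.
have h := expR_ge1Dxn n (ltW y0).
have f0 : (0 < n.+1`!%:R :> R) by rewrite ltr0n fact_gt0.
rewrite -ler_pdivrMl//; apply: (@le_trans _ _ (x * (1 + x^-1 ^+ n.+1 / n.+1`!%:R))).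
  rewrite mulrDr mulr1 exprS !mulrA divff ?gt_eqF// mul1r.
  by rewrite [leLHS]mulrC lerDr ltW.
by rewrite ler_pM2l.
Qed.

Lemma is_derive_flat (n : nat) (x : R) :
  is_derive x 1 (flat n) (flat n.+2 x - n%:R * flat n.+1 x).
Proof.
have [x0|x0|x0] := ltgtP x 0.
- rewrite !flat_eq0 ?ltW// mulr0 subr0.
  apply: (@near_eq_is_derive R R R (cst 0)).
  near=> y; rewrite /= flat_eq0// ltW//; near: y.
  exact: lt_nbhsl.
- have x00 : x != 0 by rewrite gt_eqF.
  apply: (@near_eq_is_derive R R R (fun y => y^-1 ^+ n * expR (- y^-1))).
    by near=> y; rewrite /flat ifT//; near: y; exact: lt_nbhsr.
  have dV : is_derive x 1 (fun y : R => y^-1) (- x^-1 ^+ 2).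
    have := @is_deriveV _ id x 1 1 x00 (is_derive_id _ _).
    move=> H; apply: (is_derive_eq H) => /=.
    by rewrite /GRing.scale/= -exprVn mulr1.
  have dE : is_derive x 1 (fun y : R => expR (- y^-1)) (expR (- x^-1) * x^-1 ^+ 2).
    have dN : is_derive x 1 (fun y : R => - y^-1) (x^-1 ^+ 2).
      by have := is_deriveN dV; rewrite opprK.
    exact: (@is_derive1_comp _ expR (fun y : R => - y^-1)).
  have dX := @is_deriveX _ _ (fun y : R => y^-1) n x 1 _ dV.
  have := is_deriveM dX dE.
  have -> : (fun y : R => y^-1 ^+ n * expR (- y^-1)) =
      ((fun y => y^-1) ^+ n * (fun y => expR (- y^-1))) by apply/funext => y; rewrite !fctE.
  move=> H; apply: (is_derive_eq H); rewrite !fctE /GRing.scale/= /flat x0.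
  by case: n {dX H} => [|n] /=; rewrite ?exprS ?expr0; ring.
- rewrite x0 !flat_eq0// mulr0 subr0.
  suff h0 : h^-1 *: (flat n (h *: 1 + 0) - flat n 0) @[h --> 0^'] --> (0 : R).
    apply: DeriveDef; last exact/cvg_lim.
    by apply/cvg_ex; exists 0.
  (* At 0 the difference quotient of [flat n] is exactly [flat n.+1], so its limit is controlled by
     [flat_le]. *)
  have -> : (fun h => h^-1 *: (flat n (h *: 1 + 0) - flat n 0)) = flat n.+1.
    apply/funext => h; rewrite addr0 (flat_eq0 n (lexx _)) subr0.
    rewrite /GRing.scale/= mulr1 /flat; case: ifPn => // _; last by rewrite mulr0.
    by rewrite exprS mulrA.
  apply: cvg_within_filter.
  apply: (@squeeze_cvgr _ _ _ _ (cst 0) (fun x => n.+2`!%:R * `|x|)).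
  + by near=> y; rewrite flat_ge0 flat_le.
  + exact: cvg_cst.
  + rewrite -[X in _ --> X](mulr0 (n.+2`!%:R : R)).
    apply: cvgM; first exact: cvg_cst. by have := @norm_continuous _ _ (0 : R); rewrite /continuous_at normr0.
Unshelve. all: by end_near.
Qed.

Lemma smooth1_flat n : smooth1 (flat n).
Proof.
move=> k; elim: k n => [|k IH] n.
  exact: is_derive_continuous (is_derive_flat n).
exists (flat n.+2 \+ (cst (- n%:R) \* flat n.+1)).
  by move=> x; apply: (is_derive_eq (is_derive_flat n x)); rewrite /= mulNr.
by apply: cont_diff1D => //; apply: cont_diff1M => //; exact: cont_diff1_cst.
Qed.

End smooth1.

(** * Calculus of C^k functions of several variables *)

Section cont_diff_theory.
Context {R : realType} {d : nat}.
Local Notation Rd := 'rV[R]_d.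
Implicit Types f g : Rd -> R.

(** Restriction to the line through [x] in direction [v]; the chain rule on the real line becomes
    available for directional derivatives. *)
Lemma is_derive_lineP f (x v : Rd) (b : R) :
  is_derive x v f b <-> is_derive (0 : R) 1 (fun h : R => f (h *: v + x)) b.
Proof.
have E : (fun h : R => h^-1 *: ((fun h : R => f (h *: v + x)) (h *: 1 + 0) -
            (fun h : R => f (h *: v + x)) 0)) =
         (fun h => h^-1 *: ((f \o shift x) (h *: v) - f x)).
  apply/funext => h /=.
  have -> : h *: (1 : R) + 0 = h by rewrite addr0 /GRing.scale/= mulr1.
  by rewrite scale0r add0r.
split=> -[d1 d2].
  apply: DeriveDef; first by move/derivable1P : d1.
  by rewrite -d2 /derive/= E.
apply: DeriveDef; first by apply/derivable1P.
by rewrite -d2 /derive/= E.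
Qed.

Lemma is_derive_comp1 (h : R -> R) f (x v : Rd) (a b : R) :
  is_derive (f x) 1 h a -> is_derive x v f b -> is_derive x v (h \o f) (a * b).
Proof.
move=> dh /is_derive_lineP df; apply/is_derive_lineP.
apply: (@is_derive1_comp _ h (fun t : R => f (t *: v + x))) => //.
by rewrite scale0r add0r.
Qed.

Lemma cont_diff_continuous k f : cont_diff k f -> continuous f.
Proof. by case: k => [[]|k []]. Qed.

Lemma cont_diffW k f : cont_diff k.+1 f -> cont_diff k f.
Proof.
elim: k f => [f []//|k IH f [cf df]]; split=> // i.
by have [fi fik] := df i; split=> //; exact: IH.
Qed.

Lemma cont_diff_le k m f : (k <= m)%N -> cont_diff m f -> cont_diff k f.
Proof.
elim: m => [|m IH]; first by rewrite leqn0 => /eqP ->.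
by rewrite leq_eqVlt => /orP[/eqP ->//|km /cont_diffW]; exact: IH.
Qed.

Lemma cont_diffS k f (f' : 'I_d -> Rd -> R) : continuous f ->
  (forall i x, is_derive x (delta_mx ord0 i) f (f' i x)) ->
  (forall i, cont_diff k (f' i)) -> cont_diff k.+1 f.
Proof.
move=> cf df f'k; split=> // i; split.
  by move=> x; have [] := df i x.
rewrite (_ : partial i f = f' i)//.
by apply/funext => x; rewrite /partial derive_val.
Qed.

Lemma cont_diff_derive k f i x : cont_diff k.+1 f ->
  is_derive x (delta_mx ord0 i) f (partial i f x).
Proof. by move=> [_ /(_ i)[/(_ x)/derivableP]]. Qed.

Lemma cont_diff_partial k f i : cont_diff k.+1 f -> cont_diff k (partial i f).
Proof. by move=> [_ /(_ i)[]]. Qed.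

Lemma cont_diff_cst k (c : R) : cont_diff k (cst c : Rd -> R).
Proof.
elim: k c => [c|k IH c]; first by split=> //; exact: cst_continuous.
by apply: (@cont_diffS _ _ (fun _ => cst 0)) => //; exact: cst_continuous.
Qed.

Lemma cont_diffD k f g : cont_diff k f -> cont_diff k g -> cont_diff k (f \+ g).
Proof.
elim: k f g => [f g [cf _] [cg _]|k IH f g fk gk].
  by split=> // x; apply: continuousD; [exact: cf|exact: cg].
apply: (@cont_diffS _ _ (fun i => partial i f \+ partial i g)).
- by move=> x; apply: continuousD; [exact: (proj1 fk)|exact: (proj1 gk)].
- by move=> i x; exact: (is_deriveD (cont_diff_derive i x fk) (cont_diff_derive i x gk)).
- by move=> i; apply: IH; exact: cont_diff_partial.
Qed.

Lemma cont_diffM k f g : cont_diff k f -> cont_diff k g -> cont_diff k (f \* g).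
Proof.
elim: k f g => [f g [cf _] [cg _]|k IH f g fk gk].
  by split=> // x; apply: continuousM; [exact: cf|exact: cg].
apply: (@cont_diffS _ _ (fun i => f \* partial i g \+ g \* partial i f)).
- by move=> x; apply: continuousM; [exact: (proj1 fk)|exact: (proj1 gk)].
- by move=> i x; exact: (is_deriveM (cont_diff_derive i x fk) (cont_diff_derive i x gk)).
- by move=> i; apply: cont_diffD; apply: IH; (exact: cont_diff_partial || exact: cont_diffW).
Qed.

Lemma partialM f g i x : cont_diff 1 f -> cont_diff 1 g ->
  partial i (f \* g) x = f x * partial i g x + g x * partial i f x.
Proof.
move=> f1 g1; have df := cont_diff_derive i x f1; have dg := cont_diff_derive i x g1.
exact: (@derive_val _ _ _ _ _ _ _ (is_deriveM df dg)).
Qed.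

Lemma partialD f g i x : cont_diff 1 f -> cont_diff 1 g ->
  partial i (f \+ g) x = partial i f x + partial i g x.
Proof.
move=> f1 g1; have df := cont_diff_derive i x f1; have dg := cont_diff_derive i x g1.
exact: (@derive_val _ _ _ _ _ _ _ (is_deriveD df dg)).
Qed.

Lemma partial_comp (h h' : R -> R) f i x : (forall y : R, is_derive y 1 h (h' y)) ->
  cont_diff 1 f -> partial i (h \o f) x = h' (f x) * partial i f x.
Proof.
move=> hh' f1; have df := cont_diff_derive i x f1.
exact: (@derive_val _ _ _ _ _ _ _ (is_derive_comp1 (hh' (f x)) df)).
Qed.

Lemma cont_diff_comp k (h : R -> R) f :
  cont_diff1 k h -> cont_diff k f -> cont_diff k (h \o f).
Proof.
elim: k h f => [h f ch [cf _]|k IH h f hk fk].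
  by split=> // x; apply: continuous_comp; [exact: cf|exact: ch].
have [h' hh' h'k] := hk.
apply: (@cont_diffS _ _ (fun i => (h' \o f) \* partial i f)).
- move=> x; apply: continuous_comp; first exact: (proj1 fk).
  exact: (cont_diff1_continuous hk).
- by move=> i x; exact: (is_derive_comp1 (hh' (f x)) (cont_diff_derive i x fk)).
- move=> i; apply: cont_diffM; last exact: cont_diff_partial.
  by apply: IH => //; exact: cont_diffW.
Qed.

Lemma is_derive_coord (j : 'I_d) (x v : Rd) :
  is_derive x v (fun y : Rd => y ord0 j) (v ord0 j).
Proof.
apply/is_derive_lineP; under eq_fun do rewrite !mxE.
apply: (@is_derive_eq _ _ _ _ _ _ _ (v ord0 j + 0)); last by rewrite addr0.
apply: is_deriveD.
have := @is_deriveM _ _ id (cst (v ord0 j)) (0 : R) 1 1 0 (is_derive_id _ _) (is_derive_cst _ _ _).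
by rewrite scaler0 add0r /GRing.scale/= mulr1.
Qed.

Lemma cont_diff_coord k (j : 'I_d) : cont_diff k (fun y : Rd => y ord0 j).
Proof.
case: k => [|k]; first by split=> // x; exact: coord_continuous.
apply: (@cont_diffS _ _ (fun i => cst ((delta_mx ord0 i : Rd) ord0 j))).
- by move=> x; exact: coord_continuous.
- by move=> i x; exact: is_derive_coord.
- by move=> i; exact: cont_diff_cst.
Qed.

Lemma cont_diff_prod k I (r : seq I) (f : I -> Rd -> R) :
  (forall i, cont_diff k (f i)) -> cont_diff k (fun x => \prod_(i <- r) f i x).
Proof.
move=> fk; elim: r => [|i r IH].
  by under eq_fun do rewrite big_nil; exact: cont_diff_cst.
by under eq_fun do rewrite big_cons; apply: cont_diffM.
Qed.

Lemma smoothM f g : smooth f -> smooth g -> smooth (f \* g).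
Proof. by move=> sf sg k; exact: cont_diffM. Qed.

Lemma smoothD f g : smooth f -> smooth g -> smooth (f \+ g).
Proof. by move=> sf sg k; exact: cont_diffD. Qed.

Lemma smooth_cst (c : R) : smooth (cst c : Rd -> R).
Proof. by move=> k; exact: cont_diff_cst. Qed.

Lemma smooth_comp (h : R -> R) f : smooth1 h -> smooth f -> smooth (h \o f).
Proof. by move=> sh sf k; exact: cont_diff_comp. Qed.

Lemma smooth_partial f i : smooth f -> smooth (partial i f).
Proof. by move=> sf k; exact: cont_diff_partial. Qed.

Lemma is_derive_affine f i (s b : R) (z x : Rd) :
  is_derive (s *: x + z) (delta_mx ord0 i) f b ->
  is_derive x (delta_mx ord0 i) (fun x => f (s *: x + z)) (s * b).
Proof.
move=> /is_derive_lineP df; apply/is_derive_lineP.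
have ds : is_derive (0 : R) 1 (fun h : R => s * h) s.
  have := @is_deriveM _ _ (cst s) id (0 : R) 1 0 1 (is_derive_cst _ _ _) (is_derive_id _ _).
  by rewrite scaler0 addr0 /GRing.scale/= mulr1.
have := @is_derive1_comp _ (fun h : R => f (h *: delta_mx ord0 i + (s *: x + z)))
  (fun h => s * h) 0 b s.
rewrite mulr0 => /(_ df ds).
rewrite mulrC; congr is_derive; apply/funext => h /=.
by rewrite scalerDr scalerA addrA.
Qed.

Lemma cont_diff_affine k f (s : R) (z : Rd) :
  cont_diff k f -> cont_diff k (fun x => f (s *: x + z)).
Proof.
have ca : continuous (fun x : Rd => s *: x + z).
  by move=> x; apply: continuousD; [exact: scaler_continuous|exact: cst_continuous].
elim: k f => [f [cf _]|k IH f fk].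
  by split=> // x; apply: continuous_comp; [exact: ca|exact: cf].
apply: (@cont_diffS _ _ (fun i => cst s \* (fun x => partial i f (s *: x + z)))).
- by move=> x; apply: continuous_comp; [exact: ca|exact: (proj1 fk)].
- by move=> i x; exact: (is_derive_affine (cont_diff_derive i (s *: x + z) fk)).
- by move=> i; apply: cont_diffM; [exact: cont_diff_cst|apply: IH; exact: cont_diff_partial].
Qed.

Lemma partial_affine f (s : R) (z x : Rd) i : cont_diff 1 f ->
  partial i (fun x => f (s *: x + z)) x = s * partial i f (s *: x + z).
Proof.
move=> f1; have := is_derive_affine (cont_diff_derive i (s *: x + z) f1).
by move=> H; rewrite /partial derive_val.
Qed.

End cont_diff_theory.

(** * Boxes and Lebesgue measure *)

Section boxes.
Context {R : realType}.

Definition obox d (a b : 'rV[R]_d) : set 'rV[R]_d :=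
  [set x | forall i, a ord0 i < x ord0 i < b ord0 i].

Lemma open_measurable_rV d (U : set 'rV[R]_d) : open U -> measurable U.
Proof. exact: sub_sigma_algebra. Qed.

Lemma closed_measurable_rV d (U : set 'rV[R]_d) : closed U -> measurable U.
Proof.
move=> cU; rewrite -[X in measurable X]setCK; apply: measurableC.
by apply: open_measurable_rV; exact: closed_openC.
Qed.

Lemma continuous_measurable_rV d (f : 'rV[R]_d -> R) (D : set 'rV[R]_d) :
  continuous f -> measurable_fun D f.
Proof.
move=> cf; apply: measurable_funTS.
apply: (measurability _ (RGenOInfty.measurableE R)) => _ [_ [x ->] <-].
rewrite setTI; apply: open_measurable_rV; apply: open_comp; last exact: interval_open.
by move=> y _; exact: cf.
Qed.

Lemma ball_obox d (x : 'rV[R]_d) e : 0 < e ->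
  ball x e = obox (x - const_mx e) (x + const_mx e).
Proof.
move=> e0; apply/seteqP; split=> y.
  move=> [_ xy] i; have := xy ord0 i; rewrite /ball/= /= !mxE ltr_norml.
  by move=> /andP[h1 h2]; apply/andP; split; lra.
move=> h; split=> // i j; rewrite (ord1 i); have := h j; rewrite !mxE /ball/= ltr_norml.
by move=> /andP[h1 h2]; apply/andP; split; lra.
Qed.

Lemma obox_setI d (a b a' b' : 'rV[R]_d) : obox a b `&` obox a' b' =
  obox (\row_i Num.max (a ord0 i) (a' ord0 i)) (\row_i Num.min (b ord0 i) (b' ord0 i)).
Proof.
apply/seteqP; split=> x /=.
  move=> [h h'] i; have := h i; have := h' i; rewrite !mxE gt_max lt_min.
  by move=> /andP[-> ->] /andP[-> ->].
move=> h; split=> i; have := h i; rewrite !mxE gt_max lt_min;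
  by move=> /andP[/andP[? ?] /andP[? ?]]; apply/andP.
Qed.

Lemma obox_cover d : \bigcup_n obox (const_mx (- n%:R)) (const_mx n%:R) = [set: 'rV[R]_d].
Proof.
apply/seteqP; split=> // x _.
pose m := \max_i (Num.truncn `|x ord0 i|).+1.
exists m => // i; rewrite !mxE -ltr_norml.
apply: (@lt_le_trans _ _ (Num.truncn `|x ord0 i|).+1%:R); first exact: truncnS_gt.
by rewrite ler_nat; exact: (leq_bigmax i).
Qed.

Lemma open_obox d (a b : 'rV[R]_d) : open (obox a b).
Proof.
rewrite openE => x hx.
apply: (@filter_forall _ _ (fun i (y : 'rV[R]_d) => a ord0 i < y ord0 i < b ord0 i) (nbhs x)) => i.
have := @coord_continuous R 1 d ord0 i x _ (near_in_itvoo _).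
by apply; rewrite in_itv/=; exact: hx.
Qed.

Lemma measurable_obox d (a b : 'rV[R]_d) : measurable (obox a b).
Proof. by apply: open_measurable_rV; exact: open_obox. Qed.

(** Open sets are countable unions of rational cubes, which are boxes. Since boxes are stable under
    intersection, a measure is determined by its values on them. *)
Lemma measurable_rV_obox d : @measurable _ 'rV[R]_d =
  <<s [set X | exists a b, X = obox a b] >>.
Proof.
apply/seteqP; split; apply: smallest_sub.
- exact: smallest_sigma_algebra.
- move=> U /open_countable_cubes ->; rewrite bigcup_mkcond.
  have sG := smallest_sigma_algebra [set: 'rV[R]_d] [set X | exists a b, X = obox a b].
  pose F := fun n => (if unpickle n is Some qn then
      if asbool (ball (map_mx ratr qn.1 : 'rV[R]_d) qn.2.+1%:R^-1 `<=` U) then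
        ball (map_mx ratr qn.1 : 'rV[R]_d) qn.2.+1%:R^-1 else set0 else set0).
  rewrite (_ : \bigcup_i _ = \bigcup_n F n); last first.
    apply/seteqP; split=> x.
      move=> [qn _]; case: ifPn => // /set_mem/= h hx; exists (pickle qn) => //.
      by rewrite /F pickleK; case: asboolP.
    move=> [n _]; rewrite /F; case: (unpickle n) => [qn|//]; case: asboolP => // h hx.
    by exists qn => //; rewrite mem_set.
  case: sG => s0 sC sU; apply: sU => n.
  rewrite /F; case: (unpickle n) => [qn|//]; case: asboolP => // _.
  by apply: sub_sigma_algebra => /=; rewrite ball_obox ?invr_gt0//; do 2 eexists.
- exact: smallest_sigma_algebra.
- by move=> _ [a [b ->]]; exact: measurable_obox.
Qed.

Lemma obox_measure_unique d (m1 m2 : {measure set 'rV[R]_d -> \bar R}) :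
  (forall a b, (m1 (obox a b) < +oo)%E) ->
  (forall a b, m1 (obox a b) = m2 (obox a b)) ->
  forall E, measurable E -> m1 E = m2 E.
Proof.
move=> m1oo m12 E; apply: (measure_unique [set X | exists a b, X = obox a b]
  (fun n : nat => obox (const_mx (- n%:R)) (const_mx n%:R))) => //.
- exact: measurable_rV_obox.
- by move=> _ _ [a [b ->]] [a' [b' ->]]; rewrite obox_setI; do 2 eexists.
- by move=> n; do 2 eexists.
- exact: obox_cover.
- by move=> _ [a [b ->]].
Qed.

Lemma leb_obox d (a b : 'rV[R]_d) : lebesgue_rV R d (obox a b) =
  (\prod_i Num.max (b ord0 i - a ord0 i) 0)%:E.
Proof.
elim: d a b => [a b|d IH a b].
  rewrite big_ord0 /= diracE mem_set//; by case.
rewrite (_ : obox a b = [set w : 'rV[R]_d.+1 |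
    `]a ord0 ord0, b ord0 ord0[%classic (w ord0 ord0) /\
    obox (uncons_rV a).2 (uncons_rV b).2 (uncons_rV w).2]); last first.
  apply/seteqP; split=> x /=.
    by move=> h; split; [rewrite in_itv/=|move=> i; rewrite !mxE].
  move=> [h1 h2] i; case: (unliftP ord0 i) => [j ->|->].
    by have := h2 j; rewrite !mxE.
  by move: h1; rewrite in_itv.
rewrite lebesgue_rV_cons//; last exact: measurable_obox.
rewrite IH lebesgue_measure_itv/= lte_fin big_ord_recl EFinM; congr (_ * _)%E; last first.
  by congr EFin; apply: eq_bigr => i _; rewrite !mxE.
case: ltP => h; first by rewrite max_l// subr_ge0 ltW.
by rewrite max_r// subr_le0.
Qed.

Lemma leb_obox_lty d (a b : 'rV[R]_d) : (lebesgue_rV R d (obox a b) < +oo)%E.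
Proof. by rewrite leb_obox ltry. Qed.

Lemma leb_obox_gt0 d (a b : 'rV[R]_d) : (forall i, a ord0 i < b ord0 i) ->
  (0 < lebesgue_rV R d (obox a b))%E.
Proof.
by move=> ab; rewrite leb_obox lte_fin prodr_gt0// => i _; rewrite lt_max subr_gt0 ab.
Qed.

Lemma leb_open_gt0 d (U : set 'rV[R]_d) : open U -> U !=set0 ->
  (0 < lebesgue_rV R d U)%E.
Proof.
move=> oU [x Ux]; have /nbhs_ballP[e /= e0 eU] : nbhs x U by exact: open_nbhs_nbhs.
apply: lt_le_trans (le_measure _ _ _ eU).
- by rewrite ball_obox//; apply: leb_obox_gt0 => i; rewrite !mxE; lra.
- by rewrite inE ball_obox//; exact: measurable_obox.
- by rewrite inE; exact: open_measurable_rV.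
Qed.

Lemma measurable_affine_rV d (s : R) (z : 'rV[R]_d) :
  measurable_fun setT (fun x : 'rV[R]_d => s *: x + z).
Proof.
apply: measurable_fun_rV => i; apply: continuous_measurable_rV => x.
under eq_fun do rewrite !mxE.
exact: (cont_diff_continuous (cont_diffD (cont_diffM (cont_diff_cst 0 s)
  (cont_diff_coord 0 i)) (cont_diff_cst 0 (z ord0 i)))).
Qed.

(* [s = 1] is invariance by translation, [s = -1] by central symmetry. *)
Lemma leb_isometry d (s : R) (z : 'rV[R]_d) (E : set 'rV[R]_d) :
  `|s| = 1 -> measurable E ->
  lebesgue_rV R d ((fun x => s *: x + z) @^-1` E) = lebesgue_rV R d E.
Proof.
move=> s1 mE.
pose f : {mfun 'rV[R]_d >-> 'rV[R]_d} := mfun_Sub (mem_set (measurable_affine_rV s z)).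
rewrite -[LHS]/(pushforward (lebesgue_rV R d) f E).
apply/esym; apply: obox_measure_unique => // [a b|a b]; first exact: leb_obox_lty.
have ss : s = 1 \/ s = -1.
  have : s ^+ 2 = 1 by rewrite -real_normK ?num_real// s1 expr1n.
  by move/eqP; rewrite sqrf_eq1 => /orP[/eqP ->|/eqP ->]; [left|right].
change (lebesgue_rV R d (obox a b) = lebesgue_rV R d ((fun x => s *: x + z) @^-1` obox a b)).
case: ss => {f s1}->.
  rewrite (_ : _ @^-1` _ = obox (a - z) (b - z)).
    rewrite !leb_obox; congr EFin; apply: eq_bigr => i _; rewrite !mxE.
    by congr Num.max; ring.
  apply/seteqP; split=> x /= h i; have := h i; rewrite !mxE => /andP[? ?];
    apply/andP; split; lra.
rewrite (_ : _ @^-1` _ = obox (z - b) (z - a)).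
  rewrite !leb_obox; congr EFin; apply: eq_bigr => i _; rewrite !mxE.
  by congr Num.max; ring.
apply/seteqP; split=> x /= h i; have := h i; rewrite !mxE => /andP[? ?];
    apply/andP; split; lra.
Qed.

Lemma integral_leb_isometry d (s : R) (z : 'rV[R]_d) (f : 'rV[R]_d -> \bar R) :
  `|s| = 1 -> measurable_fun setT f ->
  (\int[lebesgue_rV R d]_x f (s *: x + z)%R = \int[lebesgue_rV R d]_x f x)%E.
Proof.
move=> s1 mf.
pose g : {mfun 'rV[R]_d >-> 'rV[R]_d} := mfun_Sub (mem_set (measurable_affine_rV s z)).
have ge0 (h : 'rV[R]_d -> \bar R) : measurable_fun setT h -> (forall x, (0 <= h x)%E) ->
    (\int[lebesgue_rV R d]_x h (s *: x + z)%R = \int[lebesgue_rV R d]_x h x)%E.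
  move=> mh h0.
  have := @ge0_integral_pushforward _ _ _ _ R g (measurable_affine_rV s z) (lebesgue_rV R d) setT h measurableT mh (fun x _ => h0 x).
  rewrite preimage_setT => <-.
  by apply: eq_measure_integral => // E mE _; exact: leb_isometry.
rewrite integralE [RHS]integralE; congr (_ - _)%E.
  rewrite -(ge0 (f^\+)%E (measurable_funepos mf))//.
  by apply: eq_integral => x _; rewrite !funeposE.
rewrite -(ge0 (f^\-)%E (measurable_funeneg mf))//.
by apply: eq_integral => x _; rewrite !funenegE.
Qed.

End boxes.

(** * Real-valued integrals *)

Section real_integration.
Context d (T : measurableType d) (R : realType) (mu : {measure set T -> \bar R}).
Context (D : set T) (mD : measurable D).
Implicit Types f g : T -> R.

Lemma integrable_measurable f : mu.-integrable D (EFin \o f) -> measurable_fun D f.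
Proof. by move=> /measurable_int/measurable_EFinP. Qed.

Lemma integrable_dominated f g : measurable_fun D f ->
  (forall x, D x -> `|f x| <= g x) ->
  mu.-integrable D (EFin \o g) -> mu.-integrable D (EFin \o f).
Proof.
move=> mf fg; apply: le_integrable => //; first exact/measurable_EFinP.
by move=> x Dx /=; rewrite lee_fin (le_trans (fg x Dx))// ler_norm.
Qed.

Lemma integrable_dominated_ae f g : measurable_fun D f ->
  (\forall x \ae mu, D x -> `|f x| <= g x) ->
  mu.-integrable D (EFin \o g) -> mu.-integrable D (EFin \o f).
Proof.
move=> mf fg ig; apply/integrableP; split; first exact/measurable_EFinP.
have /integrableP[mg] := ig; apply: le_lt_trans.
apply: ae_ge0_le_integral => //.
- by apply: measurableT_comp => //; exact/measurable_EFinP.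
- by apply: measurableT_comp.
- apply: filterS fg => x h Dx /=; rewrite lee_fin.
  by rewrite (le_trans (h Dx))// ler_norm.
Qed.

Lemma ae_eq_integrable f g : measurable_fun D f -> measurable_fun D g ->
  ae_eq mu D f g -> mu.-integrable D (EFin \o f) -> mu.-integrable D (EFin \o g).
Proof.
move=> mf mg fg /(integrable_norm); apply: integrable_dominated_ae => //.
by apply: filterS fg => x h Dx /=; rewrite h.
Qed.

Lemma ae_eq_Rintegral f g : measurable_fun D f -> measurable_fun D g ->
  ae_eq mu D f g -> \int[mu]_(x in D) f x = \int[mu]_(x in D) g x.
Proof.
move=> mf mg fg; rewrite /Rintegral; congr fine; apply: ae_eq_integral => //.
- exact/measurable_EFinP.
- exact/measurable_EFinP.
- by apply: filterS fg => x h Dx; rewrite h.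
Qed.

Lemma integrable_EFinM f g (M : R) : mu.-integrable D (EFin \o f) ->
  measurable_fun D g -> (forall x, D x -> `|g x| <= M) ->
  mu.-integrable D (EFin \o (fun x => f x * g x)).
Proof.
move=> i_f mg gM.
apply: (@integrable_dominated _ (fun x => M * `|f x|)).
- by apply: measurable_funM => //; exact: integrable_measurable.
- by move=> x Dx; rewrite normrM mulrC ler_wpM2r// gM.
- have := integrableZl mD M (integrable_norm i_f).
  by apply: eq_integrable => // x _.
Qed.

Lemma integrable_indic_lty (A : set T) : measurable A -> (mu A < +oo)%E ->
  mu.-integrable D (EFin \o (\1_A : T -> R)).
Proof.
move=> mA Aoo; apply/integrableP; split; first by apply/measurable_EFinP.
rewrite (eq_integral (fun x => (\1_A x)%:E)); last first.
  by move=> t _; rewrite gee0_abs// lee_fin.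
rewrite integral_indic//; apply: le_lt_trans Aoo.
by apply: le_measure; rewrite ?inE//; exact: measurableI.
Qed.

Lemma integrable_EFinD f g : mu.-integrable D (EFin \o f) ->
  mu.-integrable D (EFin \o g) -> mu.-integrable D (EFin \o (fun x => f x + g x)).
Proof. by move=> i_f ig; have := integrableD mD i_f ig; apply: eq_integrable. Qed.

Lemma integrable_EFinB f g : mu.-integrable D (EFin \o f) ->
  mu.-integrable D (EFin \o g) -> mu.-integrable D (EFin \o (fun x => f x - g x)).
Proof. by move=> i_f ig; have := integrableB mD i_f ig; apply: eq_integrable. Qed.

Lemma integrable_EFinZ (c : R) f : mu.-integrable D (EFin \o f) ->
  mu.-integrable D (EFin \o (fun x => c * f x)).
Proof. by move=> i_f; have := integrableZl mD c i_f; apply: eq_integrable. Qed.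

Lemma integrable_EFinN f : mu.-integrable D (EFin \o f) ->
  mu.-integrable D (EFin \o (fun x => - f x)).
Proof.
by move=> /(integrable_EFinZ (-1)); apply: eq_integrable => // x _; rewrite /= mulN1r.
Qed.

Lemma integrable_EFin_sum (I : finType) (f : I -> T -> R) :
  (forall i, mu.-integrable D (EFin \o f i)) ->
  mu.-integrable D (EFin \o (fun x => \sum_i f i x)).
Proof.
move=> i_f; elim: (index_enum I) => [|i s IH].
  by under eq_fun do rewrite big_nil; exact: integrable0.
by under eq_fun do rewrite big_cons; exact: integrable_EFinD.
Qed.

Lemma Rintegral_sum (I : finType) (f : I -> T -> R) :
  (forall i, mu.-integrable D (EFin \o f i)) ->
  \int[mu]_(x in D) (\sum_i f i x) = \sum_i \int[mu]_(x in D) f i x.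
Proof.
move=> i_f; elim: (index_enum I) => [|i s IH].
  under eq_Rintegral do rewrite big_nil; rewrite big_nil.
  by rewrite Rintegral_cst// mul0r.
under eq_Rintegral do rewrite big_cons; rewrite big_cons RintegralD//; first by rewrite IH.
elim: s {IH} => [|j s IH]; first by under eq_fun do rewrite big_nil; exact: integrable0.
by under eq_fun do rewrite big_cons; exact: integrable_EFinD.
Qed.

Lemma EFin_Rintegral f : mu.-integrable D (EFin \o f) ->
  ((\int[mu]_(x in D) f x)%:E = \int[mu]_(x in D) (f x)%:E)%E.
Proof. by move=> i_f; rewrite /Rintegral fineK// integrable_fin_num. Qed.

Lemma le_Rintegral_ae f g : mu.-integrable D (EFin \o f) ->
  mu.-integrable D (EFin \o g) -> (\forall x \ae mu, D x -> f x <= g x) ->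
  \int[mu]_(x in D) f x <= \int[mu]_(x in D) g x.
Proof.
move=> i_f ig fg; rewrite -subr_ge0 -RintegralB//.
have ifg := integrable_EFinB ig i_f.
rewrite (@ae_eq_Rintegral _ (fun x => `|g x - f x|)).
- by apply: Rintegral_ge0.
- exact: integrable_measurable ifg.
- by apply: measurableT_comp => //; exact: integrable_measurable ifg.
- by apply: filterS fg => x h Dx; rewrite ger0_norm// subr_ge0 h.
Qed.

Lemma Rdominated_cvg (f_ : nat -> T -> R) f g :
  (forall n, measurable_fun D (f_ n)) -> measurable_fun D f ->
  (\forall x \ae mu, D x -> f_ n x @[n --> \oo] --> f x) ->
  mu.-integrable D (EFin \o g) ->
  (\forall x \ae mu, forall n, D x -> `|f_ n x| <= g x) ->
  [/\ mu.-integrable D (EFin \o f),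
    \int[mu]_(x in D) `|f_ n x - f x| @[n --> \oo] --> (0 : R) &
    \int[mu]_(x in D) f_ n x @[n --> \oo] --> \int[mu]_(x in D) f x].
Proof.
move=> mf_ mf f_f ig f_g.
have if_ n : mu.-integrable D (EFin \o f_ n).
  by apply: (@integrable_dominated_ae _ g) => //; apply: filterS f_g => x /(_ n).
have [|||||i_f h1 h2] := @dominated_convergence _ _ _ mu D mD
  (fun n => EFin \o f_ n) (EFin \o f) (EFin \o g).
- by move=> n; exact/measurable_EFinP.
- exact/measurable_EFinP.
- by apply: filterS f_f => x h Dx; apply/cvg_EFin; [near=> n|exact: h].
- exact: ig.
- by apply: filterS f_g => x h n Dx; rewrite /= lee_fin; exact: h.
split=> //.
- exact: (fine_cvg h1).
- by apply: fine_cvg; rewrite EFin_Rintegral.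
Unshelve. all: by end_near.
Qed.

Lemma integrable_sqM f g : measurable_fun D f -> measurable_fun D g ->
  mu.-integrable D (EFin \o (fun x => f x ^+ 2)) ->
  mu.-integrable D (EFin \o (fun x => g x ^+ 2)) ->
  mu.-integrable D (EFin \o (fun x => f x * g x)).
Proof.
move=> mf mg f2 g2.
apply: (@integrable_dominated _ (fun x => f x ^+ 2 + g x ^+ 2)).
- exact: measurable_funM.
- move=> x _; rewrite normrM -(real_normK (num_real (f x))) -(real_normK (num_real (g x))).
  by have := sqr_ge0 (`|f x| - `|g x|); nra.
- exact: integrable_EFinD.
Qed.

Lemma integrable_sqD f g : measurable_fun D f -> measurable_fun D g ->
  mu.-integrable D (EFin \o (fun x => f x ^+ 2)) ->
  mu.-integrable D (EFin \o (fun x => g x ^+ 2)) ->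
  mu.-integrable D (EFin \o (fun x => (f x + g x) ^+ 2)).
Proof.
move=> mf mg f2 g2.
apply: (@integrable_dominated _ (fun x => 2 * (f x ^+ 2 + g x ^+ 2))).
- by apply: measurable_funX; exact: measurable_funD.
- move=> x _; rewrite ger0_norm ?sqr_ge0//.
  by have := sqr_ge0 (f x - g x); nra.
- by apply: integrable_EFinZ; exact: integrable_EFinD.
Qed.

(* Cauchy-Schwarz, through the discriminant of [t |-> int (f + t g)^2]. *)
Lemma Rintegral_cauchy_schwarz f g : measurable_fun D f -> measurable_fun D g ->
  mu.-integrable D (EFin \o (fun x => f x ^+ 2)) ->
  mu.-integrable D (EFin \o (fun x => g x ^+ 2)) ->
  (\int[mu]_(x in D) (f x * g x)) ^+ 2 <=
  \int[mu]_(x in D) (f x ^+ 2) * \int[mu]_(x in D) (g x ^+ 2).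
Proof.
move=> mf mg f2 g2; have fg := integrable_sqM mf mg f2 g2.
set a := \int[mu]_(x in D) (f x ^+ 2); set b := \int[mu]_(x in D) (g x ^+ 2).
set c := \int[mu]_(x in D) (f x * g x).
have a0 : 0 <= a by apply: Rintegral_ge0 => x _; exact: sqr_ge0.
have b0 : 0 <= b by apply: Rintegral_ge0 => x _; exact: sqr_ge0.
have q (t : R) : 0 <= a + (2 * t * c + t ^+ 2 * b).
  have : 0 <= \int[mu]_(x in D) ((f x + t * g x) ^+ 2).
    by apply: Rintegral_ge0 => x _; exact: sqr_ge0.
  rewrite (@eq_Rintegral _ _ _ mu D (fun x => f x ^+ 2 + (2 * t * (f x * g x) + t ^+ 2 * g x ^+ 2))); last first.
    by move=> x _; ring.
  rewrite RintegralD//; last by apply: integrable_EFinD; exact: integrable_EFinZ.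
  by rewrite RintegralD ?RintegralZl//; exact: integrable_EFinZ.
have [b00|b0'] := eqVneq b 0.
  have [->|c0] := eqVneq c 0; first by rewrite expr0n/= mulr_ge0.
  (* When [b = 0] the polynomial is affine in [t]; for [c != 0] this [t] gives it the value -1. *)
  have := q (- (a + 1) / (2 * c)).
  rewrite b00 mulr0 addr0 (_ : 2 * _ * c = - (a + 1)); first lra.
  by field.
have bp : 0 < b by rewrite lt_def b0' b0.
(* The minimiser of the quadratic polynomial. *)
have := q (- c / b); rewrite (_ : _ + _ = (a * b - c ^+ 2) / b); last by field.
by rewrite pmulr_lge0 ?invr_gt0// subr_ge0.
Qed.

End real_integration.

(** * Test functions and integration by parts *)

Section test_functions.
Context {R : realType} {d : nat}.
Local Notation Rd := 'rV[R]_d.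
Local Notation leb := (lebesgue_rV R d).
Implicit Types (f g phi : Rd -> R) (V : set Rd).

Lemma compact_sub_obox (K : set Rd) : compact K ->
  exists2 r : R, 0 < r & K `<=` obox (const_mx (- r)) (const_mx r).
Proof.
move=> /compact_bounded[M [Mr KM]].
exists (`|M| + 2); first by rewrite ltr_wpDl.
have e0 : 0 < `|M| + 2 by rewrite ltr_wpDl.
move=> x /(KM (`|M| + 1)) h.
have : ball (0 : Rd) (`|M| + 2) x.
  rewrite -ball_normE /= sub0r normrN; apply: le_lt_trans (h _) _; last by rewrite ltrD2l ltr1n.
  by rewrite (le_lt_trans (ler_norm M))// ltrDl.
by rewrite ball_obox// sub0r add0r => h' i; have := h' i; rewrite !mxE.
Qed.

Lemma compact_closed_rV (K : set Rd) : compact K -> closed K.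
Proof. by apply: compact_closed; exact: norm_hausdorff. Qed.

Lemma compact_measurable_rV (K : set Rd) : compact K -> measurable K.
Proof. by move=> /compact_closed_rV; exact: closed_measurable_rV. Qed.

Lemma leb_compact_lty (K : set Rd) : compact K -> (leb K < +oo)%E.
Proof.
move=> cK; have [r _ Kr] := compact_sub_obox cK.
apply: le_lt_trans (leb_obox_lty (const_mx (- r)) (const_mx r)).
apply: le_measure => //; rewrite inE; first exact: compact_measurable_rV.
exact: measurable_obox.
Qed.

Lemma continuous_cpt_bounded (K : set Rd) f : compact K -> continuous f ->
  exists M : R, forall x, K x -> `|f x| <= M.
Proof.
move=> cK cf; have : compact (f @` K).
  by apply: continuous_compact => //; exact: continuous_subspaceT.
move=> /compact_bounded[M [Mr KM]]; exists (`|M| + 1) => x Kx.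
apply: (KM (`|M| + 1)); last by exists x.
by rewrite (le_lt_trans (ler_norm M))// ltrDl.
Qed.

Lemma partial_eq0 (K : set Rd) f i x : closed K -> (forall y, ~ K y -> f y = 0) ->
  ~ K x -> partial i f x = 0.
Proof.
move=> cK f0 Kx.
have h : is_derive x (delta_mx ord0 i) f 0.
  apply: (@near_eq_is_derive _ _ _ (cst 0)).
  have : nbhs x (~` K) by apply: open_nbhs_nbhs; split=> //; exact: closed_openC.
  by apply: filterS => y Ky; rewrite f0.
by rewrite /partial derive_val.
Qed.

Lemma test_fun_smooth V phi : test_fun V phi -> smooth phi.
Proof. by case. Qed.

Lemma test_fun_continuous V phi : test_fun V phi -> continuous phi.
Proof. by move=> [/(_ 0%N)/cont_diff_continuous]. Qed.

Lemma test_fun_bounded V phi : test_fun V phi ->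
  exists2 M : R, 0 <= M & forall x, `|phi x| <= M.
Proof.
move=> tp; have [_ [K [cK KV K0]]] := tp.
have [M hM] := continuous_cpt_bounded cK (test_fun_continuous tp).
exists (`|M|) => // x; have [Kx|Kx] := pselect (K x).
  by rewrite (le_trans (hM x Kx))// ler_norm.
by rewrite K0// normr0.
Qed.

Lemma test_fun_sub V V' phi : V `<=` V' -> test_fun V phi -> test_fun V' phi.
Proof. by move=> VV' [sp [K [cK KV K0]]]; split=> //; exists K; split=> // x /KV/VV'. Qed.

Lemma test_fun_eq0 V phi x : test_fun V phi -> ~ V x -> phi x = 0.
Proof. by move=> [_ [K [_ KV K0]]] Vx; apply: K0 => /KV. Qed.

Lemma test_funM V phi f : test_fun V phi -> smooth f -> test_fun V (phi \* f).
Proof.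
move=> [sp [K [cK KV K0]]] sf; split; first exact: smoothM.
by exists K; split=> // x Kx; rewrite /= K0// mul0r.
Qed.

Lemma test_fun_comp V phi (h : R -> R) : smooth1 h -> h 0 = 0 ->
  test_fun V phi -> test_fun V (h \o phi).
Proof.
move=> sh h0 [sp [K [cK KV K0]]]; split; first exact: smooth_comp.
by exists K; split=> // x Kx; rewrite /= K0.
Qed.

Lemma test_fun_partial V phi i : test_fun V phi -> test_fun V (partial i phi).
Proof.
move=> [sp [K [cK KV K0]]]; split; first exact: smooth_partial.
exists K; split=> // x; apply: partial_eq0 => //; exact: compact_closed_rV.
Qed.

Lemma test_funB V phi psi : test_fun V phi -> test_fun V psi ->
  test_fun V (phi \- psi).
Proof.
move=> [sp [K [cK KV K0]]] [sq [L [cL LV L0]]]; split.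
  have -> : phi \- psi = phi \+ (cst (-1) \* psi) by apply/funext => x /=; rewrite mulN1r.
  by apply: smoothD => //; apply: smoothM => //; exact: smooth_cst.
exists (K `|` L); split; first by apply: compactU.
  by move=> x [/KV|/LV].
by move=> x /= /not_orP[Kx Lx]; rewrite K0// L0// subr0.
Qed.

(** The usual exp(-1/(x_i - a_i)) exp(-1/(b_i - x_i)), multiplied over the coordinates; it is
    positive exactly on [obox a b]. *)
Definition box_bump (a b : Rd) (x : Rd) : R :=
  \prod_i (flat 0 (x ord0 i - a ord0 i) * flat 0 (b ord0 i - x ord0 i)).

Lemma box_bump_ge0 a b x : 0 <= box_bump a b x.
Proof. by apply: prodr_ge0 => i _; rewrite mulr_ge0 ?flat_ge0. Qed.

Lemma box_bump_gt0 a b x : obox a b x -> 0 < box_bump a b x.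
Proof.
move=> h; apply: prodr_gt0 => i _; have /andP[h1 h2] := h i.
by rewrite mulr_gt0// flat_gt0// subr_gt0.
Qed.

Lemma box_bump_eq0 a b x : ~ obox a b x -> box_bump a b x = 0.
Proof.
move=> /existsNP[i /negP]; rewrite negb_and -!leNgt => /orP h.
apply/eqP; rewrite /box_bump (bigD1 i)//= mulf_eq0; apply/orP; left.
by case: h => h; [rewrite (@flat_eq0 _ _ (x ord0 i - _)) ?mul0r|
  rewrite (@flat_eq0 _ _ (b ord0 i - _)) ?mulr0]; rewrite ?eqxx ?subr_le0.
Qed.

Lemma smooth_box_bump a b : smooth (box_bump a b).
Proof.
move=> k; apply: cont_diff_prod => i.
have dc (c : R) : cont_diff k (fun x : Rd => x ord0 i + c).
  by apply: cont_diffD; [exact: cont_diff_coord|exact: cont_diff_cst].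
apply: cont_diffM.
  exact: (cont_diff_comp (smooth1_flat 0 k) (dc (- a ord0 i))).
apply: (cont_diff_comp (smooth1_flat 0 k)).
have := cont_diffD (cont_diff_cst k (b ord0 i)) (cont_diffM (cont_diff_cst k (-1)) (cont_diff_coord k i)).
congr (cont_diff k _); apply/funext => x /=; by rewrite mulN1r.
Qed.

Definition cbox (a b : Rd) : set Rd := [set x | forall i, a ord0 i <= x ord0 i <= b ord0 i].

Lemma compact_cbox a b : compact (cbox a b).
Proof.
rewrite (_ : cbox a b = [set v | forall i, `[a ord0 i, b ord0 i]%classic (v ord0 i)]).
  exact: (@rV_compact R d (fun i => `[a ord0 i, b ord0 i]%classic) (fun i => @segment_compact R _ _)).
by apply/seteqP; split=> x /= h i; have := h i; rewrite in_itv.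
Qed.

Lemma obox_cbox a b : obox a b `<=` cbox a b.
Proof. by move=> x h i; have /andP[/ltW -> /ltW ->] := h i. Qed.

Lemma test_fun_box_bump V a b : cbox a b `<=` V -> test_fun V (box_bump a b).
Proof.
move=> abV; split; first exact: smooth_box_bump.
exists (cbox a b); split=> //; first exact: compact_cbox.
by move=> x h; apply: box_bump_eq0 => /obox_cbox.
Qed.

Lemma open_cbox V x : open V -> V x ->
  exists2 r : R, 0 < r & cbox (x - const_mx r) (x + const_mx r) `<=` V.
Proof.
move=> oV Vx; have /nbhs_ballP[e /= e0 eV] : nbhs x V by exact: open_nbhs_nbhs.
exists (e / 2); first by rewrite divr_gt0.
move=> y h; apply: eV; rewrite ball_obox// => i; have := h i; rewrite !mxE.
by move=> /andP[h1 h2]; apply/andP; split; lra.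
Qed.

Lemma harmonic_dnbhs : (fun n => n.+1%:R^-1 : R) @ \oo --> (0 : R)^'.
Proof.
move=> A /= [e /= e0 eA].
suff: \forall n \near \oo, A n.+1%:R^-1 by [].
near=> n; apply: eA; last by rewrite invr_eq0 pnatr_eq0.
rewrite /= sub0r normrN ger0_norm ?invr_ge0//; near: n.
exact: near_infty_natSinv_lt (PosNum e0).
Unshelve. all: by end_near.
Qed.

Lemma derive_line f i (x : Rd) (t : R) : cont_diff 1 f ->
  is_derive t 1 (fun h : R => f (h *: delta_mx ord0 i + x)) (partial i f (t *: delta_mx ord0 i + x)).
Proof.
move=> f1; have /is_derive_lineP := cont_diff_derive i (t *: delta_mx ord0 i + x) f1.
move=> df; have ds : is_derive t 1 (fun h : R => h - t) 1.
  have := is_deriveD (is_derive_id t 1) (is_derive_cst (- t) t 1).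
  by rewrite addr0.
have := @is_derive1_comp _ (fun h : R => f (h *: delta_mx ord0 i + (t *: delta_mx ord0 i + x)))
  (fun h => h - t) t (partial i f (t *: delta_mx ord0 i + x)) 1.
rewrite subrr => /(_ df ds); rewrite mulr1.
congr is_derive; apply/funext => h /=.
by rewrite addrA -scalerDl subrK.
Qed.

Lemma MVT_partial f i (x : Rd) (h M : R) : cont_diff 1 f -> 
  (forall y, `|partial i f y| <= M) ->
  `|f (h *: delta_mx ord0 i + x) - f x| <= M * `|h|.
Proof.
move=> f1 fM.
pose F (t : R) := f (t *: delta_mx ord0 i + x).
have dF t := derive_line i x t f1.
have cF : continuous F.
  by move=> t; apply/differentiable_continuous/derivable1_diffP; have [] := dF t.
have -> : f x = F 0 by rewrite /F scale0r add0r.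
rewrite -[f _]/(F h).
have [h0|h0|->] := ltgtP h 0; last by rewrite subrr normr0 mulr_ge0// (le_trans _ (fM 0)).
- have [c _] := MVT h0 (fun t _ => dF t) (continuous_subspaceT cF).
  rewrite sub0r distrC => ->; rewrite normrM normrN ler_wpM2r//.
- have [c _] := MVT h0 (fun t _ => dF t) (continuous_subspaceT cF).
  by rewrite subr0 => ->; rewrite normrM ler_wpM2r.
Qed.

Lemma diff_quotient_cvg f i (x : Rd) : cont_diff 1 f ->
  n.+1%:R * (f (n.+1%:R^-1 *: delta_mx ord0 i + x) - f x) @[n --> \oo] --> partial i f x.
Proof.
move=> f1; have [df <-] := cont_diff_derive i x f1.
have : h^-1 *: ((f \o shift x) (h *: delta_mx ord0 i) - f x) @[h --> (0 : R)^'] -->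
    'D_(delta_mx ord0 i) f x by exact: df.
move=> /(cvg_comp _ _ harmonic_dnbhs); apply: cvg_trans; apply: near_eq_cvg.
by near=> n; rewrite /= invrK.
Unshelve. all: by end_near.
Qed.

Lemma integrable_cpt (K : set Rd) f : compact K -> continuous f ->
  (forall x, ~ K x -> f x = 0) -> leb.-integrable setT (EFin \o f).
Proof.
move=> cK cf f0; have mK := compact_measurable_rV cK.
have [M fM] := continuous_cpt_bounded cK cf.
apply: (@integrable_dominated _ _ _ leb _ measurableT _ (fun x => M * \1_K x)).
- exact: continuous_measurable_rV.
- move=> x _; rewrite indicE; have [Kx|Kx] := pselect (K x).
    by rewrite mem_set// mulr1 fM.
  by rewrite memNset// mulr0 f0// normr0.
- by apply: integrable_EFinZ => //; apply: integrable_indic_lty => //; exact: leb_compact_lty.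
Qed.

Lemma Rintegral_leb_isometry (s : R) (z : Rd) f : `|s| = 1 ->
  measurable_fun setT f -> \int[leb]_x f (s *: x + z) = \int[leb]_x f x.
Proof.
move=> s1 mf; rewrite /Rintegral; congr fine.
by apply: (integral_leb_isometry z s1 (f := EFin \o f)); exact/measurable_EFinP.
Qed.

(** By translation invariance every difference quotient has integral 0. The quotients converge to
    the partial derivative and are dominated on a fixed box by the mean value theorem. *)
Lemma integral_partial_eq0 (K : set Rd) f i : cont_diff 1 f -> compact K ->
  (forall x, ~ K x -> f x = 0) -> \int[leb]_x partial i f x = 0.
Proof.
move=> f1 cK f0.
have cf := cont_diff_continuous f1.
have cdf := cont_diff_continuous (cont_diff_partial i f1).
have pf0 x : ~ K x -> partial i f x = 0.
  by apply: partial_eq0 => //; exact: compact_closed_rV.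
have [M0 fM0] := continuous_cpt_bounded cK cdf.
have fM y : `|partial i f y| <= `|M0|.
  have [/fM0 h|/pf0 ->] := pselect (K y); last by rewrite normr0.
  by rewrite (le_trans h)// ler_norm.
have [r r0 Kr] := compact_sub_obox cK.
(* The increment 1/(n+1) is at most 1, so enlarging the box by 1 contains the supports of all
   difference quotients. *)
pose B := obox (const_mx (- (r + 1)) : Rd) (const_mx (r + 1)).
have KB : K `<=` B.
  by move=> x /Kr h j; have := h j; rewrite !mxE => /andP[? ?]; apply/andP; split; lra.
pose F n x := n.+1%:R * (f (n.+1%:R^-1 *: delta_mx ord0 i + x) - f x).
have mshift n : measurable_fun setT (fun x => f (n.+1%:R^-1 *: delta_mx ord0 i + x)).
  have := measurableT_comp (continuous_measurable_rV (D := setT) cf)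
    (measurable_affine_rV 1 (n.+1%:R^-1 *: delta_mx ord0 i)).
  by congr measurable_fun; apply/funext => x /=; rewrite scale1r addrC.
have FB n x : `|F n x| <= `|M0| * \1_B x.
  have n0 : 0 <= n.+1%:R^-1 :> R by rewrite invr_ge0.
  rewrite indicE; have [Bx|Bx] := pselect (B x).
    rewrite mem_set// mulr1 normrM normr_nat -ler_pdivlMl// mulrC.
    by have := MVT_partial x (n.+1%:R^-1) f1 fM; rewrite (ger0_norm n0).
  rewrite memNset// mulr0 /F f0 ?f0 ?subrr ?mulr0 ?normr0//.
    by move=> /KB.
  move=> /Kr h; apply: Bx => j; have := h j; rewrite !mxE eqxx /=.
  have n1 : n.+1%:R^-1 <= 1 :> R by rewrite invf_le1// ler1n.
  have c0 : (0 : R) <= n.+1%:R^-1 * (j == i)%:R by apply: mulr_ge0.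
  have c1 : n.+1%:R^-1 * (j == i)%:R <= (1 : R).
    by case: (j == i); rewrite ?mulr1 ?mulr0 ?ler01.
  move: c0 c1; move: (n.+1%:R^-1 * (j == i)%:R) => c c0 c1.
  by move=> /andP[? ?]; apply/andP; split; lra.
have iB : leb.-integrable setT (EFin \o (fun x => `|M0| * \1_B x)).
  apply: integrable_EFinZ => //; apply: integrable_indic_lty => //.
    exact: measurable_obox.
  exact: leb_obox_lty.
have [//|||||_ _] := @Rdominated_cvg _ _ _ leb setT measurableT F (partial i f) (fun x => `|M0| * \1_B x).
- move=> n; apply: measurable_funM => //; apply: measurable_funB => //.
  exact: continuous_measurable_rV.
- exact: continuous_measurable_rV.
- by apply: aeW => x _; exact: diff_quotient_cvg.
- exact: iB.
- by apply: aeW => x n _; exact: FB.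
have -> : (fun n => \int[leb]_x F n x) = cst 0.
  apply/funext => n /=; rewrite /F.
  have i_f := integrable_cpt cK cf f0.
  have E : \int[leb]_x f (n.+1%:R^-1 *: delta_mx ord0 i + x) = \int[leb]_x f x.
    rewrite -(@Rintegral_leb_isometry 1 (n.+1%:R^-1 *: delta_mx ord0 i) f) ?normr1//.
      by apply: eq_Rintegral => x _; rewrite scale1r addrC.
    exact: continuous_measurable_rV.
  have i_s : leb.-integrable setT (EFin \o (fun x => f (n.+1%:R^-1 *: delta_mx ord0 i + x))).
    apply: (@integrable_dominated _ _ _ leb _ measurableT _ (fun x => `|f x| + `|M0| * \1_B x)) => //.
      move=> x _.
      have -> : f (n.+1%:R^-1 *: delta_mx ord0 i + x) = f x + n.+1%:R^-1 * F n x.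
        by rewrite /F mulrA mulVf ?mul1r ?subrKC// pnatr_eq0.
      rewrite (le_trans (ler_normD _ _))// lerD2l normrM ger0_norm ?invr_ge0//.
      by rewrite (le_trans _ (FB n x))// ler_piMl// invf_le1// ler1n.
    by apply: integrable_EFinD => //; exact: integrable_norm.
  rewrite RintegralZl//; last exact: integrable_EFinB.
  by rewrite RintegralB// E subrr mulr0.
by move=> /cvg_lim <-//; rewrite lim_cst.
Qed.

End test_functions.

(** * Densities and the fundamental lemma of the calculus of variations *)

Section density.
Context d (T : measurableType d) (R : realType) (mu : {measure set T -> \bar R}).
Context (h : T -> R) (mh : measurable_fun setT h) (h0 : forall x, 0 <= h x).

(** The proofs of measurability and nonnegativity are arguments, so that the measure structure can
    be attached to the term itself. *)
Definition density_measure (mh : measurable_fun setT h) (h0 : forall x, 0 <= h x)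
  (A : set T) : \bar R := (\int[mu]_(x in A) (h x)%:E)%E.

Let dens0 : density_measure mh h0 set0 = 0%E.
Proof. by rewrite /density_measure integral_set0. Qed.

Let dens_ge0 A : (0 <= density_measure mh h0 A)%E.
Proof. by apply: integral_ge0 => x _; rewrite lee_fin. Qed.

Let dens_sigma_additive : semi_sigma_additive (density_measure mh h0).
Proof.
move=> F mF tF mUF; rewrite /density_measure ge0_integral_bigcup//; last 2 first.
- by apply: measurable_funTS; exact/measurable_EFinP.
- by move=> x _; rewrite lee_fin.
by apply: is_cvg_nneseries => n _ _; exact: dens_ge0.
Qed.

HB.instance Definition _ := isMeasure.Build _ _ _ (density_measure mh h0)
  dens0 dens_ge0 dens_sigma_additive.

End density.

Section density_change_of_variables.
Context d (T : measurableType d) (R : realType) (mu m : {measure set T -> \bar R}).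
Context (h : T -> R) (mh : measurable_fun setT h) (h0 : forall x, 0 <= h x).
Hypothesis mE : forall A, measurable A -> m A = (\int[mu]_(x in A) (h x)%:E)%E.

Import HBNNSimple.

(** The measure [m] is known only through its values on sets, so the formula is checked on simple
    functions and carried to the limit by monotone convergence. *)
Lemma ge0_integral_density (D : set T) (f : T -> \bar R) : measurable D ->
  measurable_fun D f -> (forall x, D x -> (0 <= f x)%E) ->
  (\int[m]_(x in D) f x = \int[mu]_(x in D) (f x * (h x)%:E))%E.
Proof.
move=> mD mf f0; pose f_ := nnsfun_approx mD mf.
have h0' x : (0 <= (h x)%:E)%E by rewrite lee_fin.
have mhD E : measurable_fun E (EFin \o h) by apply: measurable_funTS; exact/measurable_EFinP.
transitivity (limn (fun n => \int[m]_(x in D) (f_ n x)%:E)%E).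
  rewrite -monotone_convergence//.
  - by apply: eq_integral => x /set_mem Dx; apply/esym/cvg_lim => //; apply: cvg_nnsfun_approx.
  - by move=> n; exact/measurable_EFinP/measurable_funTS.
  - by move=> n x _; rewrite lee_fin.
  - by move=> x _ a b ab; rewrite lee_fin; exact/lefP/nd_nnsfun_approx.
have -> : (\int[mu]_(x in D) (f x * (h x)%:E) =
    limn (fun n => \int[mu]_(x in D) ((f_ n x)%:E * (h x)%:E)))%E.
  rewrite -monotone_convergence//.
  - apply: eq_integral => x /set_mem Dx; apply/esym/cvg_lim => //.
    apply: cvgeZr => //; exact: cvg_nnsfun_approx.
  - by move=> n; apply: emeasurable_funM => //; exact/measurable_EFinP/measurable_funTS.
  - by move=> n x _; rewrite mule_ge0// lee_fin.
  - move=> x _ a b ab; rewrite lee_wpmul2r// lee_fin; exact/lefP/nd_nnsfun_approx.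
congr (limn _); apply/funext => n.
under eq_integral do rewrite fimfunE -fsumEFin//.
under [RHS]eq_integral do rewrite fimfunE -fsumEFin//.
rewrite ge0_integral_fsum//=; last 2 first.
- by move=> r; exact/measurable_EFinP/measurableT_comp.
- by move=> r x _; exact: nnfun_muleindic_ge0.
under [RHS]eq_integral => x _.
  rewrite ge0_mule_fsuml; last by move=> r; exact: nnfun_muleindic_ge0.
  over.
rewrite [RHS]ge0_integral_fsum//=; last 2 first.
- move=> r; apply: emeasurable_funM => //; exact/measurable_EFinP/measurableT_comp.
- by move=> r x _; rewrite mule_ge0//; exact: nnfun_muleindic_ge0.
apply: eq_fsbigr => r _.
have mr : measurable (f_ n @^-1` [set r]) by exact: measurable_funPTI.
have [r0|r0] := ltP r 0.
  have -> : f_ n @^-1` [set r] = set0.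
    by apply/seteqP; split=> x //= fr; move: r0; rewrite -fr ltNge fun_ge0.
  by rewrite !integral0_eq// => x _; rewrite indic0 mulr0 ?mul0e.
under eq_integral do rewrite EFinM.
rewrite ge0_integralZl//; last by apply/measurable_EFinP.
rewrite integral_indic//.
under [RHS]eq_integral do rewrite EFinM -muleA.
rewrite [RHS]ge0_integralZl//; last 2 first.
- by apply: emeasurable_funM => //; exact/measurable_EFinP.
- by move=> x _; rewrite mule_ge0// lee_fin.
congr (_ * _)%E; rewrite mE; last exact: measurableI.
rewrite integral_mkcond [RHS]integral_mkcond; apply: eq_integral => x _.
rewrite /patch in_setI indicE; case: (x \in D); rewrite ?andbT ?andbF//.
by case: (x \in _); rewrite ?mul1e ?mul0e.
Qed.

Lemma integrable_density (D : set T) (f : T -> R) : measurable D ->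
  measurable_fun D f ->
  m.-integrable D (EFin \o f) <-> mu.-integrable D (EFin \o (fun x => f x * h x)).
Proof.
move=> mD mf.
have mfh : measurable_fun D (fun x => f x * h x).
  by apply: measurable_funM => //; exact: measurable_funTS.
have E : (\int[m]_(x in D) `|(f x)%:E| = \int[mu]_(x in D) `|(f x * h x)%:E|)%E.
  rewrite ge0_integral_density//.
    by apply: eq_integral => x _; rewrite EFinM abseM (gee0_abs (_ : 0 <= (h x)%:E)%E)// lee_fin.
  by apply: measurableT_comp => //; exact/measurable_EFinP.
by split=> /integrableP[_ foo]; apply/integrableP; split;
  [exact/measurable_EFinP|rewrite -E|exact/measurable_EFinP|rewrite E].
Qed.

Lemma Rintegral_density (D : set T) (f : T -> R) : measurable D ->
  measurable_fun D f ->
  \int[m]_(x in D) f x = \int[mu]_(x in D) (f x * h x).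
Proof.
move=> mD mf; rewrite /Rintegral; congr fine.
have mf' : measurable_fun D (EFin \o f) by exact/measurable_EFinP.
rewrite integralE [RHS]integralE !ge0_integral_density//; last 2 first.
- exact: measurable_funeneg.
- exact: measurable_funepos.
have h0' x : (0 <= (h x)%:E)%E by rewrite lee_fin.
congr (_ - _)%E; apply: eq_integral => x _.
- rewrite !funeposE/=; have [f00|f00] := leP 0 (f x).
    by rewrite !max_l ?lee_fin ?mulr_ge0// EFinM.
  rewrite !max_r ?mul0e// lee_fin ?(ltW f00)//.
  by rewrite -oppr_ge0 -mulNr mulr_ge0// oppr_ge0 ltW.
- rewrite !funenegE/=; have [f00|f00] := leP 0 (f x).
    by rewrite !max_r ?mul0e// lee_fin oppr_le0// mulr_ge0.
  have fh : 0 <= - (f x * h x) by rewrite -mulNr mulr_ge0// oppr_ge0 ltW.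
  by rewrite !max_l ?lee_fin// ?oppr_ge0 ?(ltW f00)// -EFinM mulNr.
Qed.

End density_change_of_variables.

Section Lp_spaces.
Context {R : realType} {d : nat}.
Local Notation Rd := 'rV[R]_d.
Variable mu : {measure set Rd -> \bar R}.
Implicit Types (f g : Rd -> R) (V : set Rd).

Lemma integrable_patch V f : measurable V ->
  mu.-integrable V (EFin \o f) <-> mu.-integrable setT (EFin \o (f \_ V)).
Proof. by move=> mV; rewrite integrable_mkcond// restrict_EFin. Qed.

Lemma in_Lp1P V f : measurable V ->
  in_Lp mu V 1 f <-> mu.-integrable V (EFin \o f).
Proof. by move=> mV; rewrite integrable_patch//; exact: Lfun1_integrable. Qed.

Lemma in_Lp_measurable V s f : measurable V -> in_Lp mu V s f -> measurable_fun V f.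
Proof.
move=> mV; rewrite /in_Lp inE/= => /andP[/set_mem/= mf _].
by apply/(measurable_restrictT _ mV).
Qed.

Lemma in_LpP V (s : R) f : measurable V -> 1 <= s ->
  in_Lp mu V s%:E f <->
  measurable_fun V f /\ mu.-integrable V (EFin \o (fun x => `|f x| `^ s)).
Proof.
move=> mV s1; have s0 : s != 0 by rewrite gt_eqF// (lt_le_trans ltr01).
have E : (fun x => `|(f \_ V) x| `^ s) = (fun x => `|f x| `^ s) \_ V.
  apply/funext => x; rewrite /patch; case: ifPn => // _.
  by rewrite normr0 powR0.
split=> [fV|[mf i_f]].
  split; first exact: in_Lp_measurable fV.
  by rewrite integrable_patch// -E; exact: Lfun_integrable.
rewrite /in_Lp inE/=; apply/andP; split.
  exact: (mem_set (proj1 (measurable_restrictT f mV) mf)).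
apply: mem_set => /=; rewrite /finite_norm unlock; apply: poweR_lty.
move: i_f; rewrite integrable_patch// -E => /integrableP[_].
congr (_ < _)%E; apply: eq_integral => x _ /=.
by rewrite ger0_norm// powR_ge0.
Qed.

Lemma in_Lp2P V f : measurable V -> in_Lp mu V 2%:E f <->
  measurable_fun V f /\ mu.-integrable V (EFin \o (fun x => f x ^+ 2)).
Proof.
move=> mV; rewrite in_LpP// ?ler1n//.
have -> // : (fun x => `|f x| `^ 2) = (fun x => f x ^+ 2).
by apply/funext => x; rewrite powR_mulrn// real_normK// num_real.
Qed.

Lemma in_LpB V (s : \bar R) f g : (1 <= s)%E -> in_Lp mu V s f -> in_Lp mu V s g ->
  in_Lp mu V s (fun x => f x - g x).
Proof.
move=> s1 Lf Lg; rewrite /in_Lp.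
have -> : (fun x => f x - g x) \_ V = f \_ V - g \_ V.
  by apply/funext => x; rewrite !fctE /patch; case: ifPn => // _; rewrite subr0.
pose a := Lfun_Sub s1 Lf; pose b := Lfun_Sub s1 Lg.
exact: (@LfunP _ _ _ mu s s1 (a - b)).
Qed.

Lemma Rintegral_supp V f : (forall x, ~ V x -> f x = 0) ->
  \int[mu]_(x in V) f x = \int[mu]_x f x.
Proof.
move=> f0; rewrite Rintegral_mkcond; apply: eq_Rintegral => x _.
rewrite /patch; case: ifPn => // /negP Vx.
by rewrite f0// => /mem_set.
Qed.

Lemma integrable_supp V f : measurable V -> (forall x, ~ V x -> f x = 0) ->
  mu.-integrable V (EFin \o f) -> mu.-integrable setT (EFin \o f).
Proof.
move=> mV f0; rewrite integrable_patch//; congr (integrable _ _ (EFin \o _)).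
apply/funext => x; rewrite /patch; case: ifPn => // /negP Vx.
by rewrite f0// => /mem_set.
Qed.

End Lp_spaces.

Section fundamental_lemma.
Context {R : realType} {d : nat}.
Local Notation Rd := 'rV[R]_d.
Local Notation leb := (lebesgue_rV R d).
Implicit Types (f g phi : Rd -> R) (V : set Rd).

Lemma integrable_loc_test V g phi : in_Lp_loc V 1 g -> test_fun V phi ->
  leb.-integrable setT (EFin \o (fun x => g x * phi x)).
Proof.
move=> gV tp; have [_ [K [cK KV K0]]] := tp.
have mK := compact_measurable_rV cK.
have [M _ hM] := test_fun_bounded tp.
apply: (integrable_supp mK).
  by move=> x Kx; rewrite K0// mulr0.
apply: (@integrable_EFinM _ _ _ _ _ mK _ _ M) => //.
  by apply/in_Lp1P => //; exact: gV.
by apply: continuous_measurable_rV; exact: test_fun_continuous tp.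
Qed.

(** With e the bump of the box and c_n tending to 0, the functions e^2/(e^2 + c_n) are test
    functions with values in [0, 1] that tend to the indicator of the open box. *)
Lemma box_integral_eq0 V g (a b : Rd) : in_Lp_loc V 1 g ->
  (forall phi, test_fun V phi -> \int[leb]_(x in V) (g x * phi x) = 0) ->
  cbox a b `<=` V -> \int[leb]_(x in obox a b) g x = 0.
Proof.
move=> gV g0 abV.
pose K := cbox a b; have cK : compact K by exact: compact_cbox.
have mK := compact_measurable_rV cK.
have gK : leb.-integrable K (EFin \o g) by apply/in_Lp1P => //; exact: gV.
have mg := integrable_measurable gK.
pose c n : R := n.+1%:R^-1.
have c0 n : 0 < c n by rewrite invr_gt0.
pose h n (y : R) := y * y * (y * y + c n)^-1.
have den n (y : R) : 0 < y * y + c n by rewrite ltr_wpDl// -expr2 sqr_ge0.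
have sh n : smooth1 (h n).
  have sq : smooth1 (fun y : R => y * y) by apply: smooth1M; exact: smooth1_id.
  apply: smooth1M => //; apply: smooth1V; first by move=> y; rewrite gt_eqF.
  by apply: smooth1D => //; exact: smooth1_cst.
have h0 n : h n 0 = 0 by rewrite /h !mul0r.
have h1 n y : 0 <= h n y <= 1.
  rewrite /h divr_ge0 ?(ltW (den n y)) -?expr2 ?sqr_ge0//=.
  by rewrite ler_pdivrMr ?mul1r// ?expr2 ?den// lerDl ltW.
pose e := box_bump a b.
have te : test_fun V e by exact: test_fun_box_bump.
have th n : test_fun V (h n \o e) by exact: test_fun_comp.
have mh n D : measurable_fun D (h n \o e).
  by apply: continuous_measurable_rV; exact: test_fun_continuous (th n).
have I0 n : \int[leb]_(x in K) (g x * (h n \o e) x) = 0.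
  rewrite -(g0 _ (th n)); transitivity (\int[leb]_x (g x * (h n \o e) x)).
    by apply: Rintegral_supp => x Kx; rewrite /= /e box_bump_eq0 ?h0 ?mulr0// => /obox_cbox.
  by apply/esym/Rintegral_supp => x Vx; rewrite (test_fun_eq0 (th n))// mulr0.
have [|||||_ _ ] := @Rdominated_cvg _ _ _ leb K mK (fun n x => g x * (h n \o e) x)
  (fun x => g x * \1_(obox a b) x) (fun x => `|g x|).
- by move=> n; apply: measurable_funM.
- by apply: measurable_funM => //; apply: measurable_indic; exact: measurable_obox.
- apply: aeW => x _; apply: cvgM; first exact: cvg_cst.
  rewrite indicE; have [hx|hx] := pselect (obox a b x).
    rewrite mem_set//= /h; set y := e x * e x.
    have y0 : 0 < y by rewrite mulr_gt0 ?box_bump_gt0.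
    have -> : 1 = y * (y + 0)^-1 by rewrite addr0 divff// gt_eqF.
    apply: cvgM; first exact: cvg_cst.
    apply: cvgV; first by rewrite addr0 gt_eqF.
    by apply: cvgD; [exact: cvg_cst|exact: cvg_harmonic].
  by rewrite memNset//= /e box_bump_eq0//; under eq_fun do rewrite h0; exact: cvg_cst.
- exact: integrable_norm.
- apply: aeW => x n _; rewrite normrM ler_piMr//.
  by have /andP[? ?] := h1 n (e x); rewrite /= ger0_norm.
under eq_fun do rewrite I0.
move=> /cvg_lim; rewrite lim_cst// => ->//.
rewrite Rintegral_mkcond [RHS]Rintegral_mkcond; apply: eq_Rintegral => x _.
rewrite /patch indicE.
have [hx|hx] := pselect (obox a b x).
  by rewrite (mem_set hx) mem_set ?mulr1//; exact: obox_cbox.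
by rewrite (memNset hx) mulr0 if_same.
Qed.

(** The positive and the negative part of [g] on the box are densities of two finite measures that
    agree on all boxes, hence on all Borel sets. Evaluated on the set where [g] is positive, the
    second measure vanishes; so both do. *)
Lemma box_ae_eq0 V g (a b : Rd) : in_Lp_loc V 1 g ->
  (forall phi, test_fun V phi -> \int[leb]_(x in V) (g x * phi x) = 0) ->
  cbox a b `<=` V -> \forall x \ae leb, obox a b x -> g x = 0.
Proof.
move=> gV g0 abV.
pose B := obox a b; have mB : measurable B by exact: measurable_obox.
have mK := compact_measurable_rV (compact_cbox (a := a) (b := b)).
have gB : leb.-integrable B (EFin \o g).
  have : leb.-integrable (cbox a b) (EFin \o g).
    by apply/in_Lp1P => //; apply: gV => //; exact: compact_cbox.
  by apply: integrableS => //; exact: obox_cbox.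
pose f : Rd -> R := g \_ B.
have i_f : leb.-integrable setT (EFin \o f) by rewrite -integrable_patch.
have mf : measurable_fun setT f by exact: integrable_measurable i_f.
pose fp x := Num.max (f x) 0; pose fm x := Num.max (- f x) 0.
have fp0 x : 0 <= fp x by rewrite le_max lexx orbT.
have fm0 x : 0 <= fm x by rewrite le_max lexx orbT.
have mfp : measurable_fun setT fp by apply: measurable_maxr.
have mfm : measurable_fun setT fm by apply: measurable_maxr => //; exact: measurableT_comp.
have i_p : leb.-integrable setT (EFin \o fp).
  apply: (integrable_dominated measurableT mfp _ (integrable_norm i_f)).
  move=> x _; rewrite ger0_norm// ge_max normr_ge0 andbT; exact: ler_norm.
have i_m : leb.-integrable setT (EFin \o fm).
  apply: (integrable_dominated measurableT mfm _ (integrable_norm i_f)).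
  by move=> x _; rewrite ger0_norm// ge_max normr_ge0 andbT /= -[leRHS]normrN ler_norm.
have fE x : f x = fp x - fm x.
  rewrite /fp /fm; have [h|h] := leP 0 (f x).
    by rewrite max_r ?subr0// oppr_le0.
  by rewrite max_l ?sub0r ?opprK// oppr_ge0 ltW.
have iS h E : measurable E -> leb.-integrable setT (EFin \o h) -> leb.-integrable E (EFin \o h).
  by move=> mE; apply: integrableS.
have fin E : measurable E -> (density_measure leb mfp fp0 E < +oo)%E.
  move=> mE; rewrite /density_measure -EFin_Rintegral ?ltry//; exact: iS.
have eqE : forall E, measurable E -> density_measure leb mfp fp0 E = density_measure leb mfm fm0 E.
  apply: obox_measure_unique => a' b'; first exact: fin (measurable_obox _ _).
  have mab := measurable_obox a' b'.
  rewrite -[LHS]/(density_measure leb mfp fp0 _) -[RHS]/(density_measure leb mfm fm0 _).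
  have ip := iS _ _ mab i_p; have im := iS _ _ mab i_m.
  rewrite /density_measure -(EFin_Rintegral mab ip) -(EFin_Rintegral mab im).
  congr EFin.
  apply/eqP; rewrite -subr_eq0 -RintegralB//.
  apply/eqP; under eq_Rintegral do rewrite -fE.
  rewrite /f -Rintegral_mkcondr setIC obox_setI (@box_integral_eq0 V)//.
  by move=> x hx; apply: abV => i; have := hx i; rewrite !mxE ge_max le_min;
    move=> /andP[/andP[-> _] /andP[-> _]].
have fp_eq0 : ae_eq leb setT (EFin \o fp) (cst 0).
  apply/ae_eq_integral_abs => //; first exact/measurable_EFinP.
  under eq_integral do rewrite gee0_abs ?lee_fin//.
  have mP : measurable [set x | 0 < f x].
    rewrite (_ : [set x | 0 < f x] = f @^-1` `]0, +oo[%classic); last first.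
      by apply/seteqP; split=> x /=; rewrite in_itv/= andbT.
    by rewrite -[X in measurable X]setTI; apply: mf => //; exact: measurable_itv.
  have -> : (\int[leb]_x (fp x)%:E = \int[leb]_(x in [set x | (0 < f x)%R]) (fp x)%:E)%E.
    rewrite [RHS]integral_mkcond; apply: eq_integral => x _; rewrite /patch.
    case: ifPn => // /negP h; congr EFin; rewrite /fp max_r// leNgt.
    by apply/negP => h'; apply: h; rewrite inE.
  rewrite -[LHS]/(density_measure leb mfp fp0 _) eqE// /density_measure.
  apply: integral0_eq => x /= h; congr EFin; rewrite /fm max_r// oppr_le0 ltW//.
have fm_eq0 : ae_eq leb setT (EFin \o fm) (cst 0).
  apply/ae_eq_integral_abs => //; first exact/measurable_EFinP.
  under eq_integral do rewrite gee0_abs ?lee_fin//.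
  rewrite -[LHS]/(density_measure leb mfm fm0 _) -eqE//.
  have := fp_eq0; rewrite -(ae_eq_integral_abs _ _ (f := EFin \o fp))//; last exact/measurable_EFinP.
  by under eq_integral do rewrite gee0_abs ?lee_fin//.
apply: filterS2 fp_eq0 fm_eq0 => x /(_ I)/= hp /(_ I)/= hm Bx.
have := fE x; rewrite /f /patch mem_set// => ->.
by case: hp => ->; case: hm => ->; rewrite subrr.
Qed.

(** [V] is a countable union of rational cubes contained in it. Shrinking each cube by the factor 1
    - 1/(k+1) makes its closure stay in [V], so that [box_ae_eq0] applies to countably many boxes
    that still cover. *)
Lemma fundamental_lemma V g : open V -> in_Lp_loc V 1 g ->
  (forall phi, test_fun V phi -> \int[leb]_(x in V) (g x * phi x) = 0) ->
  \forall x \ae leb, V x -> g x = 0.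
Proof.
move=> oV gV g0.
pose A (q : 'rV[rat]_d * nat * nat) (x : Rd) :=
  let c := map_mx ratr q.1.1 : Rd in
  let r := const_mx (q.1.2.+1%:R^-1 * (1 - q.2.+1%:R^-1)) : Rd in
  cbox (c - r) (c + r) `<=` V -> obox (c - r) (c + r) x -> g x = 0.
have hA q : \forall x \ae leb, A q x.
  have [h|h] := pselect (cbox (map_mx ratr q.1.1 - const_mx (q.1.2.+1%:R^-1 * (1 - q.2.+1%:R^-1)))
      (map_mx ratr q.1.1 + const_mx (q.1.2.+1%:R^-1 * (1 - q.2.+1%:R^-1))) `<=` V).
    by have := box_ae_eq0 gV g0 h; apply: filterS => x hx; rewrite /A /= => _; exact: hx.
  by apply: aeW => x; rewrite /A /= => h'; case: (h h').
have : \forall x \ae leb, forall n, if unpickle n is Some q then A q x else True.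
  apply/ae_foralln => n; case: (unpickle n) => [q|]; first exact: hA.
  exact: aeW.
apply: filterS => x hx Vx.
have := Vx; rewrite {1}(open_countable_cubes oV) => -[[q n] /= qV qx].
set c := map_mx ratr q : Rd in qV qx.
have n0 : (0 : R) < n.+1%:R^-1 by rewrite invr_gt0.
have [k hk] : exists k : nat, forall i, `|x ord0 i - c ord0 i| < n.+1%:R^-1 * (1 - k.+1%:R^-1).
  suff : \forall k \near \oo, forall i, `|x ord0 i - c ord0 i| < n.+1%:R^-1 * (1 - k.+1%:R^-1).
    by move=> [k _ /(_ k)/= hk]; exists k; exact: hk.
  apply: filter_forall => i.
  have xi : `|x ord0 i - c ord0 i| < n.+1%:R^-1.
    by have [_ /(_ ord0 i)] := qx; rewrite /ball/= distrC.
  have cv : n.+1%:R^-1 * (1 - k.+1%:R^-1) @[k --> \oo] --> (n.+1%:R^-1 : R).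
    have : n.+1%:R^-1 * (1 - k.+1%:R^-1) @[k --> \oo] --> (n.+1%:R^-1 * (1 - 0) : R).
      apply: cvgM; first exact: cvg_cst.
      by apply: cvgB; [exact: cvg_cst|exact: cvg_harmonic].
    by rewrite subr0 mulr1.
  near=> k; near: k; exact: (cvgr_gt _ cv).
have := hx (pickle (q, n, k)); rewrite pickleK /A /= -/c; apply.
  move=> y hy; apply: qV; rewrite ball_obox// => i; have := hy i; rewrite !mxE.
  have lt : n.+1%:R^-1 * (1 - k.+1%:R^-1) < n.+1%:R^-1 :> R.
    by rewrite gtr_pMr// ltrBlDr ltrDl invr_gt0.
  move=> /andP[h1 h2]; apply/andP; split.
    by apply: lt_le_trans h1; rewrite ltrD2l ltrN2.
  by apply: le_lt_trans h2 _; rewrite ltrD2l.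
move=> i; have := hk i; rewrite !mxE ltr_norml.
by move=> /andP[h1 h2]; apply/andP; split; [rewrite -ltrBrDl|rewrite -ltrBlDl].
Unshelve. all: by end_near.
Qed.

Lemma weak_partial_unique V i f g g' : open V ->
  weak_partial V i f g -> weak_partial V i f g' -> ae_eq leb V g g'.
Proof.
move=> oV [_ gV hg] [_ g'V hg'].
have mV := open_measurable_rV oV.
have := @fundamental_lemma V (fun x => g x - g' x) oV.
have h1 : in_Lp_loc V 1 (fun x => g x - g' x).
  by move=> K cK KV; apply: in_LpB => //; [exact: gV|exact: g'V].
move=> /(_ h1); have h2 : forall phi, test_fun V phi -> \int[leb]_(x in V) ((g x - g' x) * phi x) = 0.
  move=> phi tp; under eq_Rintegral do rewrite mulrBl.
  rewrite RintegralB//.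
  - by have := hg phi tp; rewrite hg'// => /oppr_inj ->; rewrite subrr.
  - by apply: integrableS (integrable_loc_test gV tp).
  - by apply: integrableS (integrable_loc_test g'V tp).
move=> /(_ h2); apply: filterS => x h Vx; apply/eqP; rewrite -subr_eq0; apply/eqP; exact: h.
Qed.

Lemma wpartialP V i f g : weak_partial V i f g -> weak_partial V i f (wpartial V i f).
Proof. by move=> h; exact: (@xgetPex _ (fun=> 0) [set g | weak_partial V i f g] (ex_intro _ g h)). Qed.

End fundamental_lemma.

(** * Product rule for weak derivatives *)

Section product_rule.
Context {R : realType} {d : nat}.
Local Notation Rd := 'rV[R]_d.
Local Notation leb := (lebesgue_rV R d).
Implicit Types (f g phi u v k : Rd -> R) (V : set Rd).

Lemma measurable_sub_rV : measurable_fun setT (fun z : Rd * Rd => z.1 - z.2).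
Proof.
apply: measurable_fun_rV => i; under eq_fun do rewrite !mxE.
apply: measurable_funB.
- exact: (measurableT_comp (measurable_coord ord0 i) measurable_fst).
- exact: (measurableT_comp (measurable_coord ord0 i) measurable_snd).
Qed.

Lemma measurable_subl (x : Rd) : measurable_fun setT (fun y : Rd => x - y).
Proof.
have := measurable_affine_rV (-1) x; congr measurable_fun.
by apply/funext => y; rewrite scaleN1r addrC.
Qed.

Lemma measurable_subr (y : Rd) : measurable_fun setT (fun x : Rd => x - y).
Proof.
have := measurable_affine_rV 1 (- y); congr measurable_fun.
by apply/funext => x; rewrite scale1r.
Qed.

Section convolution.
Variables (u v k : Rd -> R) (M : R).
Hypotheses (i_u : leb.-integrable setT (EFin \o u)) (i_v : leb.-integrable setT (EFin \o v)).
Hypotheses (mk : measurable_fun setT k) (kM : forall z, `|k z| <= M).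

Let F (z : Rd * Rd) : \bar R := (u z.1 * v z.2 * k (z.1 - z.2))%:E.

Let mF : measurable_fun setT F.
Proof.
apply/measurable_EFinP; apply: measurable_funM; last first.
  exact: measurableT_comp measurable_sub_rV.
apply: measurable_funM.
- exact: (measurableT_comp (integrable_measurable i_u) measurable_fst).
- exact: (measurableT_comp (integrable_measurable i_v) measurable_snd).
Qed.

Let mul := measurable_funM.

Lemma integrable_convl x : leb.-integrable setT (EFin \o (fun y => v y * k (x - y))).
Proof.
apply: (integrable_EFinM measurableT i_v (M := M)) => //.
exact: measurableT_comp (measurable_subl x).
Qed.

Lemma integrable_convr y : leb.-integrable setT (EFin \o (fun x => u x * k (x - y))).
Proof.
apply: (integrable_EFinM measurableT i_u (M := M)) => //.
exact: measurableT_comp (measurable_subr y).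
Qed.

Let iF : (leb \x leb)%E.-integrable setT F.
Proof.
have M0 : 0 <= M by exact: le_trans (normr_ge0 _) (kM 0).
apply/integrable12ltyP => //.
apply: (@le_lt_trans _ _ (\int[leb]_x ((M * `|u x|)%:E * \int[leb]_y `|v y|%:E))%E).
  apply: ge0_le_integral => //.
  - by move=> x _; exact: integral_ge0.
  - apply: (measurable_fun_fubini_tonelli_F (abse \o F)).
      exact: measurableT_comp.
    by move=> z; exact: abse_ge0.
  - apply: emeasurable_funM => //; apply/measurable_EFinP.
    apply: measurable_funM => //; apply: measurableT_comp => //.
    exact: integrable_measurable i_u.
  - move=> x _; rewrite -ge0_integralZl//; last 2 first.
    + apply/measurable_EFinP/measurableT_comp => //; exact: integrable_measurable i_v.
    + by rewrite lee_fin mulr_ge0.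
    apply: ge0_le_integral => //.
    + apply: measurableT_comp => //; exact: (measurableT_comp mF (measurable_pair1 x)).
    + apply: emeasurable_funM => //; apply/measurable_EFinP/measurableT_comp => //.
      exact: integrable_measurable i_v.
    + move=> y _; rewrite /F /= -EFinM lee_fin !normrM mulrC mulrA ler_wpM2r//.
      by rewrite ler_wpM2r// kM.
have ev : (\int[leb]_y `|v y|%:E)%E = (\int[leb]_y `|v y|)%:E.
  by rewrite EFin_Rintegral//; exact: integrable_norm.
rewrite ev; under eq_integral do rewrite -EFinM.
rewrite -EFin_Rintegral ?ltry//.
set c := \int[leb]_y _.
apply: (integrable_EFinM measurableT _ (M := `| c |)) => //.
by apply: integrable_EFinZ => //; exact: integrable_norm.
Qed.

Lemma integrable_conv : leb.-integrable setT
  (EFin \o (fun x => u x * \int[leb]_y (v y * k (x - y)))).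
Proof.
have := integrable_fubini_F iF; congr (integrable _ _ _); apply/funext => x.
rewrite /fubini_F /F /=; under eq_integral do rewrite -mulrA EFinM.
rewrite (@integralZl _ _ _ leb setT measurableT (fun y => (v y * k (x - y))%:E))//.
  by rewrite EFinM EFin_Rintegral//; exact: integrable_convl.
exact: integrable_convl.
Qed.

Lemma conv_swap :
  \int[leb]_x (u x * \int[leb]_y (v y * k (x - y))) =
  \int[leb]_y (v y * \int[leb]_x (u x * k (x - y))).
Proof.
suff H : (\int[leb]_x (u x * \int[leb]_y (v y * k (x - y)))%:E =
    \int[leb]_y (v y * \int[leb]_x (u x * k (x - y)))%:E)%E by exact: (congr1 fine H).
transitivity (\int[leb]_x \int[leb]_y (u x * v y * k (x - y))%:E)%E.
  apply: eq_integral => x _; under [RHS]eq_integral do rewrite -mulrA EFinM.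
  rewrite (@integralZl _ _ _ leb setT measurableT (fun y => (v y * k (x - y))%:E))//.
    by rewrite EFinM EFin_Rintegral//; exact: integrable_convl.
  exact: integrable_convl.
rewrite (Fubini iF); apply: eq_integral => y _; rewrite /F /=.
under eq_integral do rewrite (mulrC (u _)) -mulrA EFinM.
rewrite (@integralZl _ _ _ leb setT measurableT (fun x => (u x * k (x - y))%:E))//.
  by rewrite EFinM EFin_Rintegral//; exact: integrable_convr.
exact: integrable_convr.
Qed.

End convolution.

Lemma integrable_conv' u v k (M : R) : leb.-integrable setT (EFin \o u) ->
  leb.-integrable setT (EFin \o v) -> measurable_fun setT k -> (forall z, `|k z| <= M) ->
  leb.-integrable setT (EFin \o (fun y => v y * \int[leb]_x (u x * k (x - y)))).
Proof.
move=> i_u i_v mk kM.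
have mk' : measurable_fun setT (fun z : Rd => k (- z)).
  have := measurableT_comp mk (measurable_subl 0).
  by congr measurable_fun; apply/funext => z /=; rewrite sub0r.
have := integrable_conv i_v i_u mk' (fun z => kM (- z)).
congr (integrable _ _ (EFin \o _)); apply/funext => y; congr (_ * _).
by apply: eq_Rintegral => x _; rewrite opprB.
Qed.

Definition mollifier_bump n : Rd -> R :=
  box_bump (const_mx (- n.+1%:R^-1)) (const_mx n.+1%:R^-1).

Lemma mollifier_bump_itg_gt0 n : 0 < \int[leb]_z mollifier_bump n z.
Proof.
have tb : test_fun setT (mollifier_bump n) by exact: test_fun_box_bump.
have ib : leb.-integrable setT (EFin \o mollifier_bump n).
  apply: (integrable_cpt (compact_cbox (a := _) (b := _))).
    exact: test_fun_continuous tb.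
  by move=> x hx; apply: box_bump_eq0 => /obox_cbox; exact: hx.
rewrite lt_def Rintegral_ge0 ?andbT; last by move=> x _; exact: box_bump_ge0.
apply/eqP => I0.
have : (\int[leb]_z (mollifier_bump n z)%:E)%E = 0%E by rewrite -EFin_Rintegral// I0.
under eq_integral do rewrite -[_%:E]gee0_abs ?lee_fin ?box_bump_ge0//.
move/ae_eq_integral_abs => /(_ measurableT).
move=> /(_ (proj2 (measurable_EFinP _ _) (integrable_measurable ib))).
move=> [N [mN N0 hN]].
have : (0 < leb (obox (const_mx (- n.+1%:R^-1)%R : Rd) (const_mx n.+1%:R^-1%R)))%E.
  by apply: leb_obox_gt0 => i; rewrite !mxE gtrN// invr_gt0.
apply/negP; rewrite -leNgt -N0; apply: le_measure; rewrite ?inE//.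
  exact: measurable_obox.
move=> x hx; apply: hN => /= /(_ I)[] /eqP; apply/negP.
by rewrite gt_eqF// box_bump_gt0.
Qed.

Definition mollifier n (z : Rd) : R :=
  (\int[leb]_z mollifier_bump n z)^-1 * mollifier_bump n z.

Lemma mollifier_ge0 n z : 0 <= mollifier n z.
Proof. by rewrite mulr_ge0 ?invr_ge0 ?(ltW (mollifier_bump_itg_gt0 n))// box_bump_ge0. Qed.

Lemma mollifier_test n : test_fun setT (mollifier n).
Proof.
have tb : test_fun setT (mollifier_bump n) by exact: test_fun_box_bump.
have := test_funM tb (smooth_cst (\int[leb]_z mollifier_bump n z)^-1).
by congr test_fun; apply/funext => z; rewrite /mollifier /= mulrC.
Qed.

Lemma mollifier_eq0 n (z : Rd) (i : 'I_d) : n.+1%:R^-1 <= `|z ord0 i| -> mollifier n z = 0.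
Proof.
move=> h; rewrite /mollifier /mollifier_bump box_bump_eq0 ?mulr0// => /(_ i).
by rewrite !mxE -ltr_norml ltNge h.
Qed.

Lemma mollifierN n z : mollifier n (- z) = mollifier n z.
Proof.
congr (_ * _); apply: eq_bigr => i _; rewrite !mxE mulrC opprK addrC.
by rewrite !opprK (addrC (- z ord0 i)).
Qed.

Lemma mollifier_measurable n : measurable_fun setT (mollifier n).
Proof. by apply: continuous_measurable_rV; exact: test_fun_continuous (mollifier_test n). Qed.

Lemma mollifier_integrable n x : leb.-integrable setT (EFin \o (fun y => mollifier n (y - x))) /\
  \int[leb]_y mollifier n (y - x) = 1.
Proof.
have tb : test_fun setT (mollifier_bump n) by exact: test_fun_box_bump.
have ib : leb.-integrable setT (EFin \o mollifier_bump n).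
  apply: (integrable_cpt (compact_cbox (a := _) (b := _))).
    exact: test_fun_continuous tb.
  by move=> y hy; apply: box_bump_eq0 => /obox_cbox; exact: hy.
have im : leb.-integrable setT (EFin \o mollifier n) by exact: integrable_EFinZ.
have E : (fun y => mollifier n (y - x)) = (fun y => mollifier n (1 *: y + - x)).
  by apply/funext => y; rewrite scale1r.
split; last first.
  rewrite E Rintegral_leb_isometry ?normr1//; last exact: mollifier_measurable.
  by rewrite RintegralZl// mulVf// gt_eqF// mollifier_bump_itg_gt0.
apply/integrableP; split.
  apply/measurable_EFinP; apply: measurableT_comp (measurable_subr x).
  exact: mollifier_measurable.
have /integrableP[_] := im; apply: le_lt_trans.
have I := integral_leb_isometry (- x) (normr1 R) (f := fun y => `|(mollifier n y)%:E|%E).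
rewrite le_eqVlt; apply/orP; left; apply/eqP; etransitivity; last first.
  by apply: I; apply: measurableT_comp => //; apply/measurable_EFinP; exact: mollifier_measurable.
by apply: eq_integral => y _; rewrite /= scale1r.
Qed.

Lemma mollifier_bounded n : exists M : R, forall z, `|mollifier n z| <= M.
Proof. by have [M _ hM] := test_fun_bounded (mollifier_test n); exists M. Qed.

Lemma mollifier_conv_integrable f (W : R) n x : measurable_fun setT f ->
  (forall y, `|f y| <= W) ->
  leb.-integrable setT (EFin \o (fun y => f y * mollifier n (y - x))).
Proof.
move=> mf fW; have [im _] := mollifier_integrable n x.
have := integrable_EFinM measurableT im mf (fun y _ => fW y).
by apply: eq_integrable => // y _; rewrite /= mulrC.
Qed.

Lemma mollifier_conv_le f (W : R) n x : measurable_fun setT f ->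
  (forall y, `|f y| <= W) -> `|\int[leb]_y (f y * mollifier n (y - x))| <= W.
Proof.
move=> mf fW; have i_f := mollifier_conv_integrable n x mf fW.
have [im m1] := mollifier_integrable n x.
apply: (le_trans (le_normr_Rintegral measurableT i_f)).
have -> : W = \int[leb]_y (W * mollifier n (y - x)) by rewrite RintegralZl// m1 mulr1.
apply: le_Rintegral => //; [exact: integrable_norm|exact: integrable_EFinZ|].
by move=> y _; rewrite normrM (ger0_norm (mollifier_ge0 _ _)) ler_wpM2r// mollifier_ge0.
Qed.

Lemma mollifier_cvg f (W : R) x : measurable_fun setT f ->
  (forall y, `|f y| <= W) -> {for x, continuous f} ->
  \int[leb]_y (f y * mollifier n (y - x)) @[n --> \oo] --> f x.
Proof.
move=> mf fW cf; apply/cvgrPdist_le => e e0.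
have /nbhs_ballP[r /= r0 hr] : nbhs x (fun y => `|f x - f y| <= e).
  by move/cvgrPdist_le : cf; exact.
near=> n.
have [im m1] := mollifier_integrable n x.
have i_f := mollifier_conv_integrable n x mf fW.
have -> : f x = \int[leb]_y (f x * mollifier n (y - x)) by rewrite RintegralZl// m1 mulr1.
have ic := integrable_EFinZ measurableT (f x) im.
rewrite -RintegralB//.
have ib := integrable_EFinB measurableT ic i_f.
apply: (le_trans (le_normr_Rintegral measurableT ib)).
have -> : e = \int[leb]_y (e * mollifier n (y - x)) by rewrite RintegralZl// m1 mulr1.
apply: le_Rintegral => //; [exact: integrable_norm|exact: integrable_EFinZ|].
move=> y _; rewrite -mulrBl normrM (ger0_norm (mollifier_ge0 _ _)).
have nr : n.+1%:R^-1 < r by near: n; exact: near_infty_natSinv_lt (PosNum r0).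
have [h|/existsNP[i /negP]] := pselect (forall i, `|(y - x) ord0 i| < n.+1%:R^-1).
  rewrite ler_wpM2r ?mollifier_ge0//; apply: hr; split=> // a i.
  rewrite (ord1 a) /ball/= distrC.
  by have := lt_trans (h i) nr; rewrite !mxE.
by rewrite -leNgt => /mollifier_eq0 ->; rewrite !mulr0.
Unshelve. all: by end_near.
Qed.

Lemma test_fun_affine phi (s : R) (z : Rd) : `|s| = 1 ->
  test_fun setT phi -> test_fun setT (fun x => phi (s *: x + z)).
Proof.
move=> s1 [sp [K [cK _ K0]]]; split.
  by move=> k; exact: cont_diff_affine.
have ss : s * s = 1.
  by rewrite -expr2 -(real_normK (num_real s)) s1 expr1n.
exists ((fun x => s *: x + - (s *: z)) @` K); split=> //.
  apply: continuous_compact => //; apply: continuous_subspaceT => x.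
  by apply: continuousD; [exact: scaler_continuous|exact: cst_continuous].
move=> x hx; apply: K0 => hK; apply: hx.
by exists (s *: x + z) => //; rewrite scalerDr addrK scalerA ss scale1r.
Qed.

Lemma continuous_patch_open (B : set Rd) f (y : Rd) : open B -> B y ->
  {for y, continuous f} -> {for y, continuous (f \_ B)}.
Proof.
move=> oB By cf A; rewrite /patch mem_set// => /cf h.
have nB : nbhs y B by exact: open_nbhs_nbhs.
by apply: (@filterS2 _ (nbhs y) (nbhs_filter y) _ _ _ _ nB h) => z Bz /=; rewrite mem_set.
Qed.

(** Only one mollified expression is needed: in the integral of a' times the mollification of r
    theta, the derivative moves from [a] to the mollifier for fixed y, and from the mollifier to r
    theta for fixed x. In the limit the continuity of [a] and [r] gives pointwise convergence of
    their mollifications, so no convergence of mollified weak derivatives is used. *)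
Lemma weak_partial_product (a r a' r' theta : Rd -> R) j :
  continuous a -> continuous r -> weak_partial setT j a a' -> weak_partial setT j r r' ->
  test_fun setT theta ->
  \int[leb]_x ((a' x * r x + a x * r' x) * theta x) =
  - \int[leb]_x (a x * r x * partial j theta x).
Proof.
move=> ca cr [_ a'L ha] [rL r'L hr] tt.
have [st [K [cK _ K0]]] := tt.
have [rK rK0 KrK] := compact_sub_obox cK.
(* Mollifiers have radius at most 1, so a mollifier centred in the support of [theta] vanishes
   outside this box. Cutting [a] and [a'] off there makes them integrable without changing the
   integrals. *)
pose B : set Rd := obox (const_mx (- (rK + 1))) (const_mx (rK + 1)).
have mB : measurable B by exact: measurable_obox.
have mT : measurable [set: Rd] by [].
pose CB : set Rd := cbox (const_mx (- (rK + 1))) (const_mx (rK + 1)).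
have cCB : compact CB by exact: compact_cbox.
have farB n (x y : Rd) : K y -> ~ B x -> mollifier n (x - y) = 0.
  move=> /KrK Ky /existsNP[i /negP hx]; apply: (mollifier_eq0 (i := i)).
  apply: (@le_trans _ _ 1); first by rewrite invf_le1// ler1n.
  have := Ky i; move: hx; rewrite !mxE -ltr_norml -leNgt -ltr_norml => h1 h2.
  have := lerB_dist (x ord0 i) (y ord0 i); lra.
have farB' n (x y : Rd) : K y -> ~ B x -> partial j (mollifier n) (x - y) = 0.
  move=> /KrK Ky /existsNP[i /negP hx].
  apply: (@partial_eq0 _ _ (cbox (const_mx (- n.+1%:R^-1)) (const_mx n.+1%:R^-1))).
  - by apply: compact_closed_rV; exact: compact_cbox.
  - move=> z hz; rewrite /mollifier /mollifier_bump box_bump_eq0 ?mulr0//.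
    by move=> /obox_cbox.
  - move=> /(_ i); rewrite !mxE -ler_norml => h.
    have n1 : n.+1%:R^-1 <= (1 : R) by rewrite invf_le1// ler1n.
    have := Ky i; move: hx; rewrite !mxE -ltr_norml -leNgt -ltr_norml => h1 h2.
    have := lerB_dist (x ord0 i) (y ord0 i).
    move: (le_trans h n1) h1 h2; clear; lra.
have KB : K `<=` B.
  by move=> x /KrK h i; have := h i; rewrite !mxE => /andP[? ?]; apply/andP; split; lra.
have BCB : B `<=` CB by exact: obox_cbox.
have [Wa hWa] := continuous_cpt_bounded cCB ca.
pose a1 : Rd -> R := a \_ B; pose a1' : Rd -> R := a' \_ B.
have a1E x : B x -> a1 x = a x by move=> Bx; rewrite /a1 /patch mem_set.
have a1'E x : B x -> a1' x = a' x by move=> Bx; rewrite /a1' /patch mem_set.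
have a1N x : ~ B x -> a1 x = 0 by move=> Bx; rewrite /a1 /patch memNset.
have a1'N x : ~ B x -> a1' x = 0 by move=> Bx; rewrite /a1' /patch memNset.
have a1W y : `|a1 y| <= `|Wa|.
  have [By|/a1N ->] := pselect (B y); last by rewrite normr0.
  by rewrite a1E// (le_trans (hWa y (BCB _ By)))// ler_norm.
have mCB := compact_measurable_rV cCB.
have ia1' : leb.-integrable setT (EFin \o a1').
  rewrite -integrable_patch//; apply: (integrableS mCB) => //.
  by apply/in_Lp1P => //; exact: a'L.
have ma1 : measurable_fun setT a1.
  exact: (proj1 (measurable_restrictT a mB) (continuous_measurable_rV ca)).
have ia1 : leb.-integrable setT (EFin \o a1).
  apply: (integrable_dominated mT (g := fun x => `|Wa| * \1_B x)) => //.
    move=> x _; rewrite indicE; have [Bx|Bx] := pselect (B x).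
      by rewrite mem_set// mulr1.
    by rewrite a1N// normr0 mulr_ge0.
  by apply: integrable_EFinZ => //; apply: integrable_indic_lty => //; exact: leb_obox_lty.
pose v1 x := r x * theta x; pose v2 x := r' x * theta x; pose v3 x := r x * partial j theta x.
have i1 : leb.-integrable setT (EFin \o v1) by exact: integrable_loc_test rL tt.
have i2 : leb.-integrable setT (EFin \o v2) by exact: integrable_loc_test r'L tt.
have i3 : leb.-integrable setT (EFin \o v3).
  exact: integrable_loc_test rL (test_fun_partial j tt).
have v1N y : ~ K y -> v1 y = 0 by move=> Ky; rewrite /v1 K0// mulr0.
have v2N y : ~ K y -> v2 y = 0 by move=> Ky; rewrite /v2 K0// mulr0.
have v3N y : ~ K y -> v3 y = 0.
  by move=> Ky; rewrite /v3 (partial_eq0 _ _ K0)// ?mulr0//; exact: compact_closed_rV.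
(* The three weights are [v1] = r theta, [v2] = r' theta and [v3] = r d_j theta; both uses of Fubini
   and both integrations by parts happen here. *)
have key n : \int[leb]_x (a1' x * \int[leb]_y (v1 y * mollifier n (x - y))) =
    - (\int[leb]_y (v2 y * \int[leb]_x (a1 x * mollifier n (x - y)))) -
      (\int[leb]_y (v3 y * \int[leb]_x (a1 x * mollifier n (x - y)))).
  have tm := mollifier_test n; have sm := test_fun_smooth tm.
  have [Mm hm] := mollifier_bounded n.
  have td := test_fun_partial j tm; have [Md _ hd] := test_fun_bounded td.
  have mm := mollifier_measurable n.
  have md : measurable_fun setT (partial j (mollifier n)).
    by apply: continuous_measurable_rV; exact: test_fun_continuous td.
  have E1 y : v1 y * \int[leb]_x (a1' x * mollifier n (x - y)) =
      -1 * (v1 y * \int[leb]_x (a1 x * partial j (mollifier n) (x - y))).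
    have [Ky|/v1N ->] := pselect (K y); last by rewrite !mul0r mulr0.
    have tx : test_fun setT (fun x => mollifier n (1 *: x + - y)) by apply: test_fun_affine => //; rewrite normr1.
    have Ha := ha _ tx.
    have A1 : \int[leb]_x (a' x * mollifier n (1 *: x - y)) = \int[leb]_x (a1' x * mollifier n (x - y)).
      apply: eq_Rintegral => x _; rewrite scale1r.
      have [Bx|Bx] := pselect (B x); first by rewrite a1'E.
      by rewrite farB// !mulr0.
    have A2 : \int[leb]_x (a x * partial j (fun x0 => mollifier n (1 *: x0 - y)) x) =
        \int[leb]_x (a1 x * partial j (mollifier n) (x - y)).
      apply: eq_Rintegral => x _; rewrite partial_affine ?mul1r ?scale1r; last exact: sm.
      have [Bx|Bx] := pselect (B x); first by rewrite a1E.
      rewrite (farB' n x y Ky Bx) mulr0 mulr0; exact: erefl.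
    by rewrite -A2 Ha -A1 mulrN mulN1r opprK.
  (* As a function of y, the mollifier at x - y has the opposite sign in its derivative; the weak
     derivative of [r] is tested against [theta] times this function. *)
  have E2 x : \int[leb]_y (v1 y * partial j (mollifier n) (x - y)) =
      \int[leb]_y (v2 y * mollifier n (x - y)) + \int[leb]_y (v3 y * mollifier n (x - y)).
    have ty : test_fun setT (fun y => mollifier n ((-1) *: y + x)) by apply: test_fun_affine => //; rewrite normrN1.
    have t2 := test_funM tt (test_fun_smooth ty).
    have := hr _ t2.
    have -> : \int[leb]_y (r' y * (theta \* (fun y0 => mollifier n (-1 *: y0 + x))) y) =
        \int[leb]_y (v2 y * mollifier n (x - y)).
      by apply: eq_Rintegral => y _; rewrite /v2 /= scaleN1r addrC mulrA.
    have -> : \int[leb]_y (r y * partial j (theta \* (fun y0 => mollifier n (-1 *: y0 + x))) y) =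
        \int[leb]_y (v3 y * mollifier n (x - y) - v1 y * partial j (mollifier n) (x - y)).
      apply: eq_Rintegral => y _; rewrite partialM; [|exact: st|exact: (test_fun_smooth ty)].
      rewrite partial_affine; last exact: sm.
      by rewrite scaleN1r (addrC (- y)) /v3 /v1; ring.
    have e3 := integrable_convl i3 mm hm x; have e1 := integrable_convl i1 md hd x.
    rewrite (RintegralB measurableT e3 e1) => /eqP; rewrite subr_eq => /eqP ->.
    by rewrite addrA subrr add0r.
  apply: (etrans (conv_swap ia1' i1 mm hm)).
  have S2 : \int[leb]_y (v1 y * \int[leb]_x (a1' x * mollifier n (x - y))) =
      \int[leb]_y (-1 * (v1 y * \int[leb]_x (a1 x * partial j (mollifier n) (x - y)))).
    by apply: eq_Rintegral => y _; exact: E1.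
  apply: (etrans S2).
  have iA := integrable_conv' ia1 i1 md hd.
  apply: (etrans (RintegralZl (-1) measurableT iA)).
  have S4 := conv_swap ia1 i1 md hd.
  have S5 : \int[leb]_x (a1 x * \int[leb]_y (v1 y * partial j (mollifier n) (x - y))) =
      \int[leb]_x (a1 x * \int[leb]_y (v2 y * mollifier n (x - y)) +
                   a1 x * \int[leb]_y (v3 y * mollifier n (x - y))).
    by apply: eq_Rintegral => x _; rewrite -mulrDr; congr (_ * _); exact: E2.
  have S6 := RintegralD measurableT (integrable_conv ia1 i2 mm hm) (integrable_conv ia1 i3 mm hm).
  apply: (etrans (congr1 (fun t => -1 * t) (etrans (esym S4) (etrans S5 S6)))).
  rewrite mulN1r opprD.
  exact: (congr2 (fun s t => - s - t) (conv_swap ia1 i2 mm hm) (conv_swap ia1 i3 mm hm)).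
have ca1 (y : Rd) : K y -> {for y, continuous a1}.
  by move=> Ky; apply: continuous_patch_open; [exact: open_obox|exact: KB|exact: ca].
have mollE n (w : Rd -> R) x : \int[leb]_y (w y * mollifier n (x - y)) = \int[leb]_y (w y * mollifier n (y - x)).
  by apply: eq_Rintegral => y _; rewrite -mollifierN opprB.
have cv1 : continuous v1.
  by move=> x; apply: (@continuousM _ _ r theta x); [exact: cr|exact: (test_fun_continuous tt)].
have mv1 := integrable_measurable i1.
have [W1 hW1] : exists W, forall x, `|v1 x| <= W.
  have [W hW] := continuous_cpt_bounded cK cv1; exists `|W| => x.
  have [Kx|/v1N ->] := pselect (K x); last by rewrite normr0.
  by rewrite (le_trans (hW x Kx))// ler_norm.
have lim1 : \int[leb]_x (a1' x * \int[leb]_y (v1 y * mollifier n (x - y))) @[n --> \oo] -->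
    \int[leb]_x (a1' x * v1 x).
  have [||||| _ _ //] := @Rdominated_cvg _ _ _ leb setT measurableT
    (fun n x => a1' x * \int[leb]_y (v1 y * mollifier n (x - y))) (fun x => a1' x * v1 x)
    (fun x => W1 * `|a1' x|).
  - move=> n; have [Mm hm] := mollifier_bounded n.
    exact: integrable_measurable (integrable_conv ia1' i1 (mollifier_measurable n) hm).
  - by apply: measurable_funM => //; exact: integrable_measurable ia1'.
  - apply: aeW => x _; apply: cvgM; first exact: cvg_cst.
    have -> : (fun n => \int[leb]_y (v1 y * mollifier n (x - y))) =
        (fun n => \int[leb]_y (v1 y * mollifier n (y - x))) by apply/funext => n; exact: mollE.
    exact: (mollifier_cvg mv1 hW1 (cv1 x)).
  - by apply: integrable_EFinZ => //; exact: integrable_norm.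
  - by apply: aeW => x n _; rewrite normrM mulrC ler_wpM2r// mollE; exact: mollifier_conv_le.
have lim23 (v : Rd -> R) : leb.-integrable setT (EFin \o v) -> (forall y, ~ K y -> v y = 0) ->
    leb.-integrable setT (EFin \o (fun y => v y * a y)) /\
    \int[leb]_y (v y * \int[leb]_x (a1 x * mollifier n (x - y))) @[n --> \oo] -->
    \int[leb]_y (v y * a y).
  move=> i_v vN.
  have [||||| h1 _ h2 //] := @Rdominated_cvg _ _ _ leb setT measurableT
    (fun n y => v y * \int[leb]_x (a1 x * mollifier n (x - y))) (fun y => v y * a y)
    (fun y => `|Wa| * `|v y|).
  - move=> n; have [Mm hm] := mollifier_bounded n.
    exact: integrable_measurable (integrable_conv' ia1 i_v (mollifier_measurable n) hm).
  - apply: measurable_funM; first exact: integrable_measurable i_v.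
    exact: continuous_measurable_rV.
  - apply: aeW => y _; have [Ky|/vN ->] := pselect (K y); last first.
      by rewrite mul0r; under eq_fun do rewrite mul0r; exact: cvg_cst.
    apply: cvgM; first exact: cvg_cst.
    by rewrite -(a1E y (KB _ Ky)); apply: mollifier_cvg ma1 a1W _; exact: ca1.
  - by apply: integrable_EFinZ => //; exact: integrable_norm.
  - apply: aeW => y n _; rewrite normrM mulrC ler_wpM2r//.
    exact: mollifier_conv_le.
have [j2 lim2] := lim23 _ i2 v2N; have [j3 lim3] := lim23 _ i3 v3N.
have fin : \int[leb]_x (a1' x * v1 x) =
    - (\int[leb]_y (v2 y * a y)) - (\int[leb]_y (v3 y * a y)).
  pose s2 n := \int[leb]_y (v2 y * \int[leb]_x (a1 x * mollifier n (x - y))).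
  pose s3 n := \int[leb]_y (v3 y * \int[leb]_x (a1 x * mollifier n (x - y))).
  have lim1' : - s2 n - s3 n @[n --> \oo] --> \int[leb]_x (a1' x * v1 x).
    have -> // : (fun n => - s2 n - s3 n) =
      (fun n => \int[leb]_x (a1' x * \int[leb]_y (v1 y * mollifier n (x - y)))).
    by apply/funext => n; exact: esym (key n).
  by apply: (cvg_unique _ lim1') => //; apply: cvgB => //; exact: cvgN.
have E1 x : a1' x * v1 x = a' x * r x * theta x.
  have [Bx|Bx] := pselect (B x); first by rewrite a1'E// /v1 mulrA.
  by rewrite v1N ?K0 ?mulr0// => /KB.
have j1 : leb.-integrable setT (EFin \o (fun x => a1' x * v1 x)).
  exact: (integrable_EFinM measurableT ia1' mv1 (fun x _ => hW1 x)).
transitivity (\int[leb]_x (a1' x * v1 x + v2 x * a x)).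
  by apply: eq_Rintegral => x _; rewrite E1 /v2; ring.
rewrite RintegralD// fin addrAC addNr add0r; congr (- _).
by apply: eq_Rintegral => x _; rewrite /v3; ring.
Qed.

End product_rule.

(** * Simultaneous almost everywhere subsequences in L^2 *)

Section riesz_fischer.

Lemma geometric_cauchy (R : realType) (a : nat -> R) (s : R) : 0 <= s ->
  (forall j : nat, `|a j.+1 - a j| <= s * 2^-1 ^+ j) ->
  cvgn a /\ forall n : nat, `|a n| <= `|a 0%N| + 2 * s.
Proof.
move=> s0 h; split.
  have cg : cvgn (series (geometric s (2^-1 : R))).
    by apply: is_cvg_geometric_series; rewrite ger0_norm ?invr_ge0// invf_lt1// ltr1n.
  have cn : cvgn [normed series (telescope a)].
    apply: (@series_le_cvg _ _ _ _ _ _ cg) => // n.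
    - exact: normr_ge0.
    - by rewrite /geometric /= mulr_ge0// exprn_ge0// invr_ge0.
  have -> : a = (fun n => a 0%N + series (telescope a) n).
    by apply/funext => n; exact: eq_sum_telescope.
  by apply: is_cvgD; [exact: is_cvg_cst|exact: normed_cvg].
move=> n; suff : `|a n| <= `|a 0%N| + 2 * s * (1 - 2^-1 ^+ n).
  move=> H; apply: (le_trans H); rewrite lerD2l ler_piMr ?mulr_ge0// gerBl exprn_ge0// invr_ge0.
elim: n => [|n IH]; first by rewrite expr0 subrr mulr0 addr0.
rewrite -(subrK (a n) (a n.+1)) (le_trans (ler_normD _ _))//.
apply: (le_trans (lerD (h n) IH)); rewrite exprS.
by rewrite le_eqVlt; apply/orP; left; apply/eqP; field.
Qed.

Lemma sqr_sum_le (R : realFieldType) (I : finType) (a : I -> R) :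
  (\sum_i `|a i|) ^+ 2 <= #|I|%:R * \sum_i a i ^+ 2.
Proof.
rewrite expr2 mulr_suml.
apply: (@le_trans _ _ (\sum_i \sum_j (a i ^+ 2 / 2 + a j ^+ 2 / 2))).
  apply: ler_sum => i _; rewrite mulr_sumr; apply: ler_sum => j _.
  rewrite -(real_normK (num_real (a i))) -(real_normK (num_real (a j))).
  by have := sqr_ge0 (`|a i| - `|a j|); nra.
under eq_bigr do rewrite big_split/= sumr_const -mulr_suml -[_ *+ _]mulr_natl.
rewrite big_split/= sumr_const -[X in _ + X]mulr_natl -mulr_sumr -mulr_suml.
by rewrite -mulrDr -splitr.
Qed.

Context d (T : measurableType d) (R : realType) (mu : {measure set T -> \bar R}).
Context (D : set T) (mD : measurable D).

Let aux (a b : R) (n m : nat) : (n = m)%N -> 0 < a -> 0 < b ->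
  a * (a^-1 / (m.+1%:R * b) *+ n) <= 1 / b.
Proof.
move=> -> a0 b0; rewrite -mulr_natl mulrCA [X in _ * X]mulrA mulfV ?gt_eqF// !mul1r invfM.
by rewrite mulrA ler_piMl ?invr_ge0 ?(ltW b0)// ler_pdivrMr// mul1r ler_nat.
Qed.

(** Riesz-Fischer for finitely many sequences with one common subsequence and one common dominating
    function in L^2. Along a fast subsequence, S = sum of 4^j times the squared increments is
    integrable, so each increment is at most sqrt(S) 2^-j; this gives convergence and the bound by
    the initial terms plus 2 sqrt(S). *)
Lemma L2_cauchy_subseq (I : finType) (f : I -> nat -> T -> R) :
  (forall i n, measurable_fun D (f i n)) ->
  (forall i n, mu.-integrable D (EFin \o (fun x => f i n x ^+ 2))) ->
  (forall i (e : R), 0 < e -> exists N, forall m n, (N <= m)%N -> (N <= n)%N ->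
    \int[mu]_(x in D) (f i m x - f i n x) ^+ 2 < e) ->
  exists (k : nat -> nat) (h : I -> T -> R) (G : T -> R), [/\ forall n, (n <= k n)%N,
    forall i, measurable_fun D (h i),
    measurable_fun D G /\ mu.-integrable D (EFin \o (fun x => G x ^+ 2)),
    forall i, \forall x \ae mu, D x -> f i (k n) x @[n --> \oo] --> h i x &
    forall i, \forall x \ae mu, forall n, D x -> `|f i (k n) x| <= G x].
Proof.
move=> mf f2 fC.
(* Summed over [I] and multiplied by 4^j, these tolerances are at most 2^-(j+1), which is
   summable. *)
pose e j : R := 4^-1 ^+ j / (#|I|.+1%:R * 2 ^+ j.+1).
have e0 j : 0 < e j by rewrite divr_gt0// ?exprn_gt0// ?invr_gt0// mulr_gt0// exprn_gt0.
have /choice[N hN] : forall j, exists N, forall i m n, (N <= m)%N -> (N <= n)%N ->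
    \int[mu]_(x in D) (f i m x - f i n x) ^+ 2 < e j.
  move=> j; have /choice[N hN] := fun i => fC i _ (e0 j).
  exists (\max_i N i)%N => i m n im jn; apply: hN.
    exact: leq_trans (leq_bigmax i) im.
  exact: leq_trans (leq_bigmax i) jn.
pose k j := (\sum_(l < j.+1) (N l).+1)%N.
have kN j : (N j <= k j)%N by rewrite /k big_ord_recr/= (leq_trans (leqnSn _))// leq_addl.
pose dd j x := \sum_i (f i (k j.+1) x - f i (k j) x) ^+ 2.
have dd0 j x : 0 <= dd j x by apply: sumr_ge0 => i _; exact: sqr_ge0.
have iB i m n : mu.-integrable D (EFin \o (fun x => (f i m x - f i n x) ^+ 2)).
  have := @integrable_sqD _ _ _ mu D mD (f i m) (fun x => - f i n x) (mf i m) _ (f2 i m) _.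
  apply; first exact: measurableT_comp.
  by apply: eq_integrable (f2 i n) => // x _ /=; rewrite sqrrN.
have idd j : mu.-integrable D (EFin \o dd j).
  by apply: (@integrable_EFin_sum _ _ _ mu D mD) => i; exact: iB.
have ddle j : \int[mu]_(x in D) (4 ^+ j * dd j x) <= 1 / (2 ^ j.+1)%:R.
  rewrite RintegralZl// Rintegral_sum//.
  have : \sum_i \int[mu]_(x in D) (f i (k j.+1) x - f i (k j) x) ^+ 2 <= \sum_(i : I) e j.
    apply: ler_sum => i _; apply: ltW; apply: hN => //.
    by rewrite (leq_trans (kN j))// /k [leqRHS]big_ord_recr/= leq_addr.
  rewrite sumr_const => /(ler_wpM2l (exprn_ge0 j (ler0n _ 4))) /le_trans; apply.
  rewrite /e natrX exprVn; by apply: aux; rewrite ?cardE// exprn_gt0.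
pose Se x : \bar R := (\sum_(0 <= j <oo) (4 ^+ j * dd j x)%:E)%E.
have t0 j x : (0 <= (4 ^+ j * dd j x)%:E)%E by rewrite lee_fin mulr_ge0// exprn_ge0.
have iF j : mu.-integrable D (EFin \o (fun x => 4 ^+ j * dd j x)) by exact: integrable_EFinZ.
have mSe : measurable_fun D Se.
  by apply: ge0_emeasurable_sum => // j _; have /measurable_int := iF j.
have Se0 x : (0 <= Se x)%E by exact: nneseries_ge0.
have iSe : mu.-integrable D Se.
  apply/integrableP; split=> //.
  under eq_integral do rewrite gee0_abs//.
  rewrite integral_nneseries//; last by move=> j; have /measurable_int := iF j.
  apply: (@le_lt_trans _ _ (1 : R)%:E); last by rewrite ltry.
  apply: (le_trans _ (epsilon_trick0 predT (@ler01 R))).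
  apply: lee_nneseries => j _; first by move=> _; exact: integral_ge0.
  by rewrite -EFin_Rintegral ?lee_fin//; exact: ddle.
pose S x := fine (Se x).
have S0 x : 0 <= S x by exact: fine_ge0.
have mS : measurable_fun D S by exact: measurableT_comp (fine_measurable measurableT) mSe.
have iS : mu.-integrable D (EFin \o S).
  apply: le_integrable iSe => //; first exact/measurable_EFinP.
  move=> x _ /=; rewrite ger0_norm// gee0_abs// /S.
  by case: (Se x) (Se0 x) => [r| |]//=; rewrite leey.
(* The upper limit is measurable without any exceptional set, and it agrees with the limit wherever
   that exists. *)
pose h i x := fine (limn_esup (fun n => (f i (k n) x)%:E)).
pose G x := \sum_i `|f i (k 0%N) x| + 2 * Num.sqrt (S x).
have good : \forall x \ae mu, D x -> forall i,
    cvgn (fun n => f i (k n) x) /\ forall n, `|f i (k n) x| <= G x.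
  apply: filterS (integrable_ae mD iSe) => x fx Dx i.
  have step j : `|f i (k j.+1) x - f i (k j) x| <= Num.sqrt (S x) * 2^-1 ^+ j.
    have Sj : 4 ^+ j * dd j x <= S x.
      rewrite -lee_fin fineK//; last exact: fx.
      have := @nneseries_lim_ge _ _ predT 0%N j.+1 (fun n _ _ => t0 n x).
      rewrite big_nat_recr//=; apply: le_trans; rewrite leeDr//.
      by apply: sume_ge0 => l _; exact: t0.
    have p2 : 0 < 2 ^+ j :> R by rewrite exprn_gt0.
    rewrite exprVn ler_pdivlMr// -ler_sqr ?nnegrE ?sqrtr_ge0 ?mulr_ge0 ?(ltW p2)//.
    rewrite sqr_sqrtr// exprMn real_normK ?num_real// mulrC; apply: le_trans Sj.
    rewrite -exprM mulnC exprM (_ : 2 ^+ 2 = 4 :> R); last by rewrite -natrX.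
    rewrite ler_wpM2l ?exprn_ge0// /dd (bigD1 i)//= lerDl.
    by apply: sumr_ge0 => l _; exact: sqr_ge0.
  have [c b] := geometric_cauchy (sqrtr_ge0 (S x)) step.
  split=> // n; rewrite (le_trans (b n))// lerD2r (bigD1 i)//= lerDl.
  by apply: sumr_ge0.
exists k, h, G; split.
- move=> n; rewrite /k; elim: n => // n IH; rewrite big_ord_recr/=.
  by rewrite (leq_ltn_trans IH)// addnS ltnS leq_addr.
- move=> i; apply: measurableT_comp (fine_measurable measurableT) _.
  by apply: measurable_fun_limn_esup => n; exact/measurable_EFinP.
- have SI : mu.-integrable D (EFin \o (fun x => (\sum_i `|f i (k 0%N) x|) ^+ 2)).
    apply: (integrable_dominated mD (g := fun x => #|I|%:R * \sum_i f i (k 0%N) x ^+ 2)).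
    + by apply: measurable_funX; apply: measurable_sum => i; exact: measurableT_comp.
    + move=> x _; rewrite ger0_norm ?sqr_ge0//; exact: sqr_sum_le.
    + by apply: integrable_EFinZ => //; exact: (@integrable_EFin_sum _ _ _ mu D mD).
  have mq : measurable_fun D (fun x => 2 * Num.sqrt (S x)).
    apply: measurable_funM => //; apply: measurableT_comp mS.
    by apply: continuous_measurable_fun; exact: sqrt_continuous.
  have mg : measurable_fun D (fun x => \sum_i `|f i (k 0%N) x|).
    by apply: measurable_sum => i; exact: measurableT_comp.
  split; first exact: measurable_funD.
  apply: (integrable_sqD mD) => //.
  have := integrable_EFinZ mD 4 iS; apply: eq_integrable => // x _ /=.
  by rewrite exprMn sqr_sqrtr// -natrX.
- move=> i; apply: filterS good => x H Dx; have [c _] := H Dx i.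
  have ce : (f i (k n) x)%:E @[n --> \oo] --> (lim (f i (k n) x @[n --> \oo]))%:E.
    by apply/cvg_EFin; [exact: nearW|exact: c].
  rewrite /h is_cvg_limn_esupE; last by apply: cvgP ce.
  by rewrite (cvg_lim _ ce).
- by move=> i; apply: filterS good => x H n Dx; have [_] := H Dx i.
Qed.

End riesz_fischer.

(** * Locally square integrable functions and Sobolev functions *)

Section locally_square_integrable.
Context {R : realType} {d : nat}.
Local Notation Rd := 'rV[R]_d.
Local Notation leb := (lebesgue_rV R d).
Implicit Types (f g c : Rd -> R) (K : set Rd).

Lemma continuous_mul_rV f g : continuous f -> continuous g ->
  continuous (fun x => f x * g x).
Proof. by move=> cf cg x; apply: continuousM; [exact: cf|exact: cg]. Qed.

Lemma measurable_fun_compacts f : (forall K, compact K -> measurable_fun K f) ->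
  measurable_fun setT f.
Proof.
move=> h; pose F (n : nat) : set Rd := cbox (const_mx (- n%:R)) (const_mx n%:R).
have -> : setT = \bigcup_n F n.
  apply/seteqP; split=> // x _.
  have [N hN] : exists N : nat, forall i, `|x ord0 i| <= N%:R.
    have /choice[N hN] : forall i, exists N : nat, `|x ord0 i| <= N%:R.
      by move=> i; exists (truncn `|x ord0 i|).+1; apply/ltW/truncnS_gt.
    exists (\max_i N i)%N => i; apply: (le_trans (hN i)); rewrite ler_nat.
    exact: leq_bigmax.
  by exists N => // i; rewrite !mxE -ler_norml.
apply/measurable_fun_bigcup => n; first by apply: compact_measurable_rV; exact: compact_cbox.
by apply: h; exact: compact_cbox.
Qed.

Definition L2loc f := measurable_fun setT f /\
  forall K, compact K -> leb.-integrable K (EFin \o (fun x => f x ^+ 2)).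

Lemma in_Lp_loc_L2 f (s : R) : 2 <= s -> in_Lp_loc setT s f -> L2loc f.
Proof.
move=> s2 fs; have s1 : 1 <= s by rewrite (le_trans _ s2)// ler1n.
have H K : compact K -> measurable_fun K f /\
    leb.-integrable K (EFin \o (fun x => `|f x| `^ s)).
  move=> cK; apply/in_LpP => //; first exact: compact_measurable_rV.
  exact: fs.
split; first by apply: measurable_fun_compacts => K /H[].
move=> K cK; have [mf i_f] := H K cK; have mK := compact_measurable_rV cK.
apply: (integrable_dominated mK (g := fun x => 1 * \1_K x + `|f x| `^ s)).
- exact: measurable_funX.
- move=> x Kx; rewrite ger0_norm ?sqr_ge0// indicE mem_set// mul1r.
  rewrite -(real_normK (num_real (f x))) -powR_mulrn//.
  have [f1|f1] := leP 1 `|f x|.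
    by rewrite (le_trans (ler_powR f1 s2))// lerDr.
  by rewrite powR_mulrn// (@le_trans _ _ 1) ?exprn_ile1 ?(ltW f1)// lerDl powR_ge0.
- apply: integrable_EFinD => //; apply: integrable_EFinZ => //.
  by apply: integrable_indic_lty => //; exact: leb_compact_lty.
Qed.

Lemma L2locM c f : continuous c -> L2loc f -> L2loc (fun x => c x * f x).
Proof.
move=> cc [mf f2]; have mc : measurable_fun setT c by exact: continuous_measurable_rV.
split; first exact: measurable_funM.
move=> K cK; have mK := compact_measurable_rV cK.
have [M hM] := continuous_cpt_bounded cK cc.
apply: (integrable_dominated mK (g := fun x => M ^+ 2 * f x ^+ 2)).
- by apply: measurable_funX; apply: measurable_funTS; exact: measurable_funM.
- move=> x Kx; rewrite ger0_norm ?sqr_ge0// exprMn ler_wpM2r ?sqr_ge0//.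
  by rewrite -(real_normK (num_real (c x))) lerXn2r ?nnegrE ?hM// (le_trans _ (hM x Kx)).
- by apply: integrable_EFinZ => //; exact: f2.
Qed.

Lemma L2locD f g : L2loc f -> L2loc g -> L2loc (fun x => f x + g x).
Proof.
move=> [mf f2] [mg g2]; split; first exact: measurable_funD.
move=> K cK; apply: integrable_sqD; [exact: compact_measurable_rV|exact: measurable_funTS..|exact: f2|exact: g2].
Qed.

Lemma L2loc_sum (I : finType) (f : I -> Rd -> R) : (forall i, L2loc (f i)) ->
  L2loc (fun x => \sum_i f i x).
Proof.
move=> h; elim: (index_enum I) => [|i r IH].
  have -> : (fun x => \sum_(i <- [::]) f i x) = cst 0 by apply/funext => x; rewrite big_nil.
  split; first exact: measurable_cst.
  move=> K cK; have mK := compact_measurable_rV cK.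
  have := @integrable0 _ _ _ leb K; apply: eq_integrable => // x _ /=.
  by rewrite expr0n.
have -> : (fun x => \sum_(i <- i :: r) f i x) = (fun x => f i x + \sum_(i <- r) f i x).
  by apply/funext => x; rewrite big_cons.
exact: L2locD.
Qed.

Lemma L2loc_integrable f K c : L2loc f -> compact K -> continuous c ->
  (forall x, ~ K x -> c x = 0) -> leb.-integrable setT (EFin \o (fun x => f x * c x)).
Proof.
move=> [mf f2] cK cc c0; have mK := compact_measurable_rV cK.
have mc : measurable_fun setT c by exact: continuous_measurable_rV.
have [M hM] := continuous_cpt_bounded cK cc.
apply: (integrable_supp mK); first by move=> x Kx; rewrite c0// mulr0.
apply: integrable_sqM => //; [exact: measurable_funTS..|exact: f2|].
apply: (integrable_dominated mK (g := fun x => M ^+ 2 * \1_K x)).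
- by apply: measurable_funX; exact: measurable_funTS.
- move=> x Kx; rewrite ger0_norm ?sqr_ge0// indicE mem_set// mulr1.
  by rewrite -(real_normK (num_real (c x))) lerXn2r ?nnegrE ?hM// (le_trans _ (hM x Kx)).
- by apply: integrable_EFinZ => //; apply: integrable_indic_lty => //; exact: leb_compact_lty.
Qed.

(** [wpartial] is an arbitrary choice among the weak derivatives; almost everywhere uniqueness
    transfers to it the local integrability of the one provided by [sobolev_loc]. *)
Lemma sobolev_wpartial (s : R) f j : 1 <= s -> sobolev_loc s f ->
  weak_partial setT j f (wpartial setT j f) /\ in_Lp_loc setT s (wpartial setT j f).
Proof.
move=> s1 [_ /(_ j)[g wg gs]]; have ww := wpartialP wg; split=> //.
have [_ w1 _] := ww.
have e := weak_partial_unique openT wg ww.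
move=> K cK _; have mK := compact_measurable_rV cK.
have [mg ig] : measurable_fun K g /\ leb.-integrable K (EFin \o (fun x => `|g x| `^ s)).
  by apply/in_LpP => //; exact: gs.
have mw : measurable_fun K (wpartial setT j f) by apply: in_Lp_measurable (w1 K cK _).
apply/in_LpP => //; split=> //.
apply: (ae_eq_integrable mK _ _ _ ig).
- by apply: (measurableT_comp (measurable_powR s)); exact: measurableT_comp.
- by apply: (measurableT_comp (measurable_powR s)); exact: measurableT_comp.
- by apply: filterS e => x h _; rewrite h.
Qed.

Lemma sobolev_locB (s : R) f g : 1 <= s -> sobolev_loc s f -> sobolev_loc s g ->
  sobolev_loc s (fun x => f x - g x).
Proof.
move=> s1 [fs fp] [gs gp]; split.
  by move=> K cK KT; apply: in_LpB; [rewrite lee_fin|exact: fs|exact: gs].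
move=> i; have [f' [f1 f'1 hf] f's] := fp i; have [g' [g1 g'1 hg] g's] := gp i.
exists (fun x => f' x - g' x); last first.
  by move=> K cK KT; apply: in_LpB; [rewrite lee_fin|exact: f's|exact: g's].
split.
- by move=> K cK KT; apply: in_LpB; [|exact: f1|exact: g1].
- by move=> K cK KT; apply: in_LpB; [|exact: f'1|exact: g'1].
- move=> phi tp; have tp' := test_fun_partial i tp.
  under eq_Rintegral do rewrite mulrBl.
  under [in RHS]eq_Rintegral do rewrite mulrBl.
  have i1 := integrable_loc_test f1 tp'; have i2 := integrable_loc_test g1 tp'.
  have i3 := integrable_loc_test f'1 tp; have i4 := integrable_loc_test g'1 tp.
  rewrite (RintegralB measurableT i1 i2) (RintegralB measurableT i3 i4).
  by rewrite hf// hg// opprD opprK.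
Qed.

End locally_square_integrable.

(** * The drift B is divergence free with respect to mu *)

Lemma sum_sym_mx (R : comPzRingType) (d : nat) (a : 'M[R]_d) (r : R) (h : 'I_d -> 'I_d -> R) :
  a^T = a -> \sum_i \sum_j a i j * r * h j i = (\sum_i \sum_j a i j * h i j) * r.
Proof.
move=> sa; rewrite exchange_big mulr_suml; apply: eq_bigr => i _.
rewrite mulr_suml; apply: eq_bigr => j _.
by rewrite -{1}sa mxE mulrAC.
Qed.

Lemma gen_L_mul (R : realType) (d : nat) (A : 'rV[R]_d -> 'M[R]_d) G (phi : 'rV[R]_d -> R)
  (r : R) (x : 'rV[R]_d) : (A x)^T = A x ->
  gen_L A G phi x * r = 2^-1 * (\sum_i \sum_j A x i j * r * partial j (partial i phi) x) +
    \sum_i G x ord0 i * (r * partial i phi x).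
Proof.
move=> sa; rewrite /gen_L mulrDl; congr (_ + _); last first.
  by rewrite mulr_suml; apply: eq_bigr => i _; rewrite mulrAC mulrA.
have e := sum_sym_mx r (fun i j => partial i (partial j phi) x) sa.
by apply: etrans (esym (mulrA _ _ _)) _; exact: (congr1 (fun z => 2^-1 * z) (esym e)).
Qed.

Section drift_divergence_free.
Context {R : realType} {d : nat} (p : R).
Local Notation Rd := 'rV[R]_d.
Local Notation leb := (lebesgue_rV R d).
Variables (A C : Rd -> 'M[R]_d) (H : Rd -> Rd) (rho : Rd -> R).
Variable mu : {measure set Rd -> \bar R}.
Hypotheses (d_ge2 : (2 <= d)%N) (p_gtd : d%:R < p).
Hypothesis ass_a : assumption_a p A C H.
Hypothesis mu_rho : inf_invariant_density p A (drift A C H) rho mu.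

Let p2 : 2 <= p.
Proof. by apply: le_trans (ltW p_gtd); rewrite ler_nat. Qed.

Let p1 : 1 <= p. Proof. by rewrite (le_trans _ p2)// ler1n. Qed.

Let rhoC : continuous rho := rho_continuous mu_rho.

Let rhoM : measurable_fun setT rho. Proof. exact: continuous_measurable_rV. Qed.

Let rho0 x : 0 <= rho x. Proof. exact/ltW/(rho_gt0 mu_rho). Qed.

Lemma integrable_rho (D : set Rd) (f : Rd -> R) : measurable D -> measurable_fun D f ->
  mu.-integrable D (EFin \o f) <-> leb.-integrable D (EFin \o (fun x => f x * rho x)).
Proof. exact: (integrable_density rhoM rho0 (mu_density mu_rho)). Qed.

Lemma Rintegral_rho (D : set Rd) (f : Rd -> R) : measurable D -> measurable_fun D f ->
  \int[mu]_(x in D) f x = \int[leb]_(x in D) (f x * rho x).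
Proof. exact: (Rintegral_density rhoM rho0 (mu_density mu_rho)). Qed.

Lemma mu_ae (P : Rd -> Prop) : (\forall x \ae leb, P x) -> \forall x \ae mu, P x.
Proof.
move=> [N [mN N0 NP]]; exists N; split=> //.
rewrite (mu_density mu_rho)//; apply: null_set_integral => //.
by apply/measurable_EFinP; exact: measurable_funTS.
Qed.

Let rhoVC : continuous (fun x => (rho x)^-1).
Proof.
move=> x; apply: continuousV; last exact: rhoC.
by apply: lt0r_neq0; exact: (rho_gt0 mu_rho).
Qed.

(** By antisymmetry of C the entries of A + C^T are those of A - C, whose weak derivatives are in
    L^2_loc, and [H] is in L^p_loc with p > d >= 2. *)
Lemma drift_L2loc i : L2loc (fun x => drift A C H x ord0 i).
Proof.
have E x : drift A C H x ord0 i =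
    2^-1 * \sum_j wpartial setT j (fun y => A y i j - C y i j) x + H x ord0 i.
  rewrite /drift !mxE; congr (_ * _ + _); apply: eq_bigr => j _.
  congr (wpartial setT j _ x); apply/funext => y.
  by rewrite mxE (c_antisym ass_a) mxE.
rewrite (funext E); apply: L2locD; last exact: in_Lp_loc_L2 p2 (h_Lp_loc ass_a i).
apply: L2locM; first exact: cst_continuous.
apply: L2loc_sum => j; apply: (@in_Lp_loc_L2 _ _ _ 2) => //.
have s2 : (1 : R) <= 2 by rewrite ler1n.
have := sobolev_locB s2 (a_sobolev ass_a i j) (c_sobolev ass_a i j).
by move=> /(sobolev_wpartial j s2)[].
Qed.

Lemma log_drift_L2loc i : L2loc (fun x => log_drift A rho x ord0 i).
Proof.
have s2 : (1 : R) <= 2 by rewrite ler1n.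
rewrite (_ : (fun x => _) = fun x => 2^-1 * \sum_j (wpartial setT j (fun y => A y i j) x +
    A x i j * ((rho x)^-1 * wpartial setT j rho x))); last first.
  apply/funext => x; rewrite mxE; congr (_ * _); apply: eq_bigr => j _.
  by rewrite [_ / _]mulrC.
apply: L2locM; first exact: cst_continuous.
apply: L2loc_sum => j; apply: L2locD.
  apply: (@in_Lp_loc_L2 _ _ _ 2) => //.
  by have [] := sobolev_wpartial j s2 (a_sobolev ass_a i j).
apply: L2locM; first exact: (a_continuous ass_a).
apply: L2locM; first exact: rhoVC.
apply: in_Lp_loc_L2 p2 _.
by have [] := sobolev_wpartial j p1 (rho_sobolev mu_rho).
Qed.

Definition div_free_drift x := drift A C H x - log_drift A rho x.

Lemma div_free_drift_L2loc i : L2loc (fun x => div_free_drift x ord0 i).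
Proof.
rewrite (_ : (fun x => _) =
    fun x => drift A C H x ord0 i + (-1) * log_drift A rho x ord0 i); last first.
  by apply/funext => x; rewrite !mxE mulN1r.
apply: L2locD; first exact: drift_L2loc.
by apply: L2locM; [exact: cst_continuous|exact: log_drift_L2loc].
Qed.

(** By the product rule for a_ij rho, the integral of the logarithmic drift against grad phi equals
    minus the second-order part of the integral of L phi dmu. Subtracting it from the contribution
    of G therefore reproduces the whole integral of L phi dmu, which is 0. *)
Lemma div_free (phi : Rd -> R) : test_fun setT phi ->
  \int[mu]_x dot (div_free_drift x) (grad phi x) = 0.
Proof.
move=> tp; have [sp [K [cK _ K0]]] := tp.
have tpi i : test_fun setT (partial i phi) by exact: test_fun_partial.
have cpi i : continuous (partial i phi) by exact: test_fun_continuous (tpi i).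
have K0i i x : ~ K x -> partial i phi x = 0.
  by apply: partial_eq0 => //; exact: compact_closed_rV.
have K0ij i j x : ~ K x -> partial j (partial i phi) x = 0.
  by apply: partial_eq0; [exact: compact_closed_rV|exact: K0i].
have cpij i j : continuous (partial j (partial i phi)).
  by apply: (@test_fun_continuous _ _ setT); exact: test_fun_partial.
have rpi i : continuous (fun x => rho x * partial i phi x).
  exact: continuous_mul_rV.
have rpi0 i x : ~ K x -> rho x * partial i phi x = 0 by move=> /K0i ->; rewrite mulr0.
have iG i : leb.-integrable setT (EFin \o (fun x => drift A C H x ord0 i * (rho x * partial i phi x))).
  exact: (L2loc_integrable (drift_L2loc i) cK (rpi i) (rpi0 i)).
have iL i : leb.-integrable setT (EFin \o (fun x => log_drift A rho x ord0 i * (rho x * partial i phi x))).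
  exact: (L2loc_integrable (log_drift_L2loc i) cK (rpi i) (rpi0 i)).
have iA i j : leb.-integrable setT (EFin \o (fun x => A x i j * rho x * partial j (partial i phi) x)).
  apply: (integrable_cpt cK).
    apply: continuous_mul_rV; last exact: cpij.
    by apply: continuous_mul_rV; [exact: (a_continuous ass_a)|exact: rhoC].
  by move=> x /K0ij ->; rewrite mulr0.
have mG i : measurable_fun setT (fun x => drift A C H x ord0 i) by have [] := drift_L2loc i.
have mL i : measurable_fun setT (fun x => log_drift A rho x ord0 i) by have [] := log_drift_L2loc i.
have mp i : measurable_fun setT (partial i phi) by exact: continuous_measurable_rV.
pose X := \sum_i \sum_j \int[leb]_x (A x i j * rho x * partial j (partial i phi) x).
have inv : 2^-1 * X + \sum_i \int[leb]_x (drift A C H x ord0 i * (rho x * partial i phi x)) = 0.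
  apply: etrans (mu_inf_invariant mu_rho tp); rewrite Rintegral_rho//; last first.
    apply: measurable_funD.
      apply: measurable_funM => //; apply: measurable_sum => i; apply: measurable_sum => j.
      apply: measurable_funM; apply: continuous_measurable_rV; last exact: cpij.
      exact: (a_continuous ass_a).
    by apply: measurable_sum => i; apply: measurable_funM.
  transitivity (\int[leb]_x (2^-1 * (\sum_i \sum_j A x i j * rho x * partial j (partial i phi) x) +
     \sum_i drift A C H x ord0 i * (rho x * partial i phi x))).
    rewrite RintegralD//; last 2 first.
    - apply: integrable_EFinZ => //; apply: integrable_EFin_sum => // i.
      by apply: integrable_EFin_sum => // j.
    - by apply: integrable_EFin_sum => // i.
    congr (_ + _); last by rewrite Rintegral_sum.
    rewrite RintegralZl//; last first.
      by apply: integrable_EFin_sum => // i; apply: integrable_EFin_sum => // j.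
    congr (_ * _); rewrite Rintegral_sum//; last first.
      by move=> i; apply: integrable_EFin_sum => // j.
    by apply: eq_bigr => i _; rewrite Rintegral_sum.
  by apply: eq_Rintegral => x _; rewrite gen_L_mul// (a_sym ass_a).
have prod i j : \int[leb]_x ((wpartial setT j (fun y => A y i j) x * rho x +
      A x i j * wpartial setT j rho x) * partial i phi x) =
    - \int[leb]_x (A x i j * rho x * partial j (partial i phi) x).
  have s2 : (1 : R) <= 2 by rewrite ler1n.
  apply: weak_partial_product => //; first exact: (a_continuous ass_a).
    by have [] := sobolev_wpartial j s2 (a_sobolev ass_a i j).
  by have [] := sobolev_wpartial j p1 (rho_sobolev mu_rho).
have iP i j : leb.-integrable setT (EFin \o (fun x =>
    (wpartial setT j (fun y => A y i j) x * rho x + A x i j * wpartial setT j rho x) *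
    partial i phi x)).
  have s2 : (1 : R) <= 2 by rewrite ler1n.
  apply: (@L2loc_integrable _ _ _ K) => //; last exact: K0i.
  apply: L2locD.
    rewrite (_ : (fun x => _) = fun x => rho x * wpartial setT j (fun y => A y i j) x); last first.
      by apply/funext => x; rewrite mulrC.
    apply: L2locM => //; apply: (@in_Lp_loc_L2 _ _ _ 2) => //.
    by have [] := sobolev_wpartial j s2 (a_sobolev ass_a i j).
  apply: L2locM; first exact: (a_continuous ass_a).
  apply: in_Lp_loc_L2 p2 _.
  by have [] := sobolev_wpartial j p1 (rho_sobolev mu_rho).
have LE i : \int[leb]_x (log_drift A rho x ord0 i * (rho x * partial i phi x)) =
    - (2^-1 * \sum_j \int[leb]_x (A x i j * rho x * partial j (partial i phi) x)).
  transitivity (\int[leb]_x (2^-1 * \sum_j (wpartial setT j (fun y => A y i j) x * rho x +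
      A x i j * wpartial setT j rho x) * partial i phi x)).
    apply: eq_Rintegral => x _; rewrite mxE -mulrA mulr_suml; congr (_ * _).
    apply: eq_bigr => j _; have := rho_gt0 mu_rho x => r0.
    by rewrite mulrA; congr (_ * _); field; rewrite gt_eqF.
  rewrite RintegralZl//; last by apply: integrable_EFin_sum.
  rewrite Rintegral_sum// -mulrN -sumrN; congr (_ * _); apply: eq_bigr => j _.
  exact: prod.
rewrite Rintegral_rho//; last first.
  apply: measurable_sum => i; apply: measurable_funM.
    by have [] := div_free_drift_L2loc i.
  by rewrite (_ : (fun x => _) = partial i phi)//; apply/funext => x; rewrite mxE.
transitivity (\int[leb]_x \sum_i (drift A C H x ord0 i * (rho x * partial i phi x) -
   log_drift A rho x ord0 i * (rho x * partial i phi x))).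
  apply: eq_Rintegral => x _; rewrite mulr_suml; apply: eq_bigr => i _.
  by rewrite !mxE; ring.
rewrite Rintegral_sum//; last by move=> i; exact: integrable_EFinB.
under eq_bigr do rewrite RintegralB//.
rewrite sumrB (eq_bigr _ (fun i _ => LE i)) sumrN opprK -mulr_sumr addrC.
exact: inv.
Qed.

End drift_divergence_free.

(** * Convergence in L^p distance as convergence of integrals *)

Section Lp_distance.
Context {R : realType}.

Lemma ge0_cvge0P {I : Type} (F : set_system I) (FF : Filter F) (f : I -> \bar R) :
  (forall i, (0 <= f i)%E) ->
  f @ F --> 0%E <-> forall e : R, 0 < e -> \forall i \near F, (f i <= e%:E)%E.
Proof.
move=> f0; split=> [/fine_cvgP[ff /cvgr0Pnorm_le h] e e0|h].
  apply: filterS2 (ff) (h e e0) => i fi /=.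
  by rewrite ger0_norm ?fine_ge0// -lee_fin fineK.
apply/fine_cvgP; split.
  apply: filterS (h 1 ltr01) => i fi.
  by rewrite ge0_fin_numE// (le_lt_trans fi)// ltry.
apply/cvgr0Pnorm_le => e e0; apply: filterS (h e e0) => i fi /=.
rewrite ger0_norm ?fine_ge0// -lee_fin fineK//.
by rewrite ge0_fin_numE// (le_lt_trans fi)// ltry.
Qed.

Lemma lee_poweR (x : \bar R) (r s : R) : 0 < s -> 0 <= r -> (0 <= x)%E ->
  (x `^ s <= (r `^ s)%:E)%E = (x <= r%:E)%E.
Proof.
move=> s0 r0; case: x => [x| |]//=; rewrite ?lee_fin.
  move=> x0; apply/idP/idP => [|xr]; last by apply: ge0_ler_powR; rewrite ?nnegrE// ltW.
  apply: contraTT; rewrite -!ltNge => rx.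
  by apply: gt0_ltr_powR; rewrite ?nnegrE.
by rewrite gt_eqF.
Qed.

Context {d : nat}.
Local Notation Rd := 'rV[R]_d.
Variable mu : {measure set Rd -> \bar R}.
Implicit Types (f g : Rd -> R) (V : set Rd).

Lemma Lp_dist1E V f g :
  Lp_dist mu V 1 f g = (\int[mu]_(x in V) `|f x - g x|%:E)%E.
Proof.
rewrite /Lp_dist Lnorm1 [RHS]integral_mkcond; apply: eq_integral => x _ /=.
by rewrite /patch; case: ifPn => //; rewrite normr0.
Qed.

Lemma Lp_dist_poweR V f g (s : R) : s != 0 ->
  (Lp_dist mu V s%:E f g `^ s)%E = (\int[mu]_(x in V) (`|f x - g x| `^ s)%:E)%E.
Proof.
move=> s0; rewrite [RHS]integral_mkcond /Lp_dist (poweR_Lnorm _ _ s0).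
congr (integral _ _ _); apply/funext => x /=.
by rewrite /patch; case: ifPn => //=; rewrite normr0 powR0.
Qed.

Lemma Lp_dist_cvg {I : Type} (F : set_system I) (FF : Filter F) V (s : R)
    (f : I -> Rd -> R) (g : I -> Rd -> R) : 0 < s ->
  Lp_dist mu V s%:E (f i) (g i) @[i --> F] --> 0%E <->
  (\int[mu]_(x in V) (`|f i x - g i x| `^ s)%:E)%E @[i --> F] --> 0%E.
Proof.
move=> s0; have sn0 : s != 0 by rewrite gt_eqF.
have E i := esym (Lp_dist_poweR V (f i) (g i) sn0).
have N0 i : (0 <= Lp_dist mu V s%:E (f i) (g i))%E by exact: Lnorm_ge0.
under [X in _ <-> X @ _ --> _]eq_fun do rewrite E.
split=> /ge0_cvge0P h; apply/ge0_cvge0P => //.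
- by move=> i; exact: poweR_ge0.
- move=> e e0; apply: filterS (h N0 (e `^ s^-1) (powR_gt0 _ e0)) => i Ni.
  have e1 : (e `^ s^-1) `^ s = e by rewrite -powRrM mulVf// powRr1// ltW.
  by rewrite -e1 lee_poweR// powR_ge0.
- move=> e e0; apply: filterS (h _ (e `^ s) (powR_gt0 _ e0)) => i; last exact: poweR_ge0.
  by rewrite lee_poweR// ltW.
Qed.

Lemma Rintegral_sqr V f : \int[mu]_(x in V) f x ^+ 2 =
  fine (\int[mu]_(x in V) (`|f x| `^ 2)%:E).
Proof.
congr fine; apply: eq_integral => x _; congr EFin.
by rewrite powR_mulrn// real_normK// num_real.
Qed.

Lemma Lp_dist2_cvg V (f : nat -> Rd -> R) g :
  Lp_dist mu V 2%:E (f n) g @[n --> \oo] --> 0%E ->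
  \int[mu]_(x in V) (f n x - g x) ^+ 2 @[n --> \oo] --> (0 : R).
Proof.
move=> /Lp_dist_cvg -/(_ ltac:(by [])) /fine_cvgP[_].
by under [X in _ -> X @ _ --> _]eq_fun do rewrite Rintegral_sqr.
Qed.

End Lp_distance.

(** * The form domain, described by converging gradients *)

Lemma lim_norm_le (R : realType) (u : nat -> R) (l M : R) : u n @[n --> \oo] --> l ->
  (forall n, `|u n| <= M) -> `|l| <= M.
Proof.
move=> ul uM; apply: (cvgr_to_le (cvg_norm ul)); exact: nearW.
Qed.

Lemma integrable_sqr_finite {d} {T : measurableType d} {R : realType}
    (mu : {measure set T -> \bar R}) (D : set T) (f : T -> R) : measurable D ->
  (mu D < +oo)%E -> measurable_fun D f ->
  mu.-integrable D (EFin \o (fun x => f x ^+ 2)) -> mu.-integrable D (EFin \o f).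
Proof.
move=> mD Doo mf f2; apply: (integrable_dominated mD (g := fun x => f x ^+ 2 + \1_D x)) => //.
  move=> x Dx; rewrite indicE mem_set// (_ : true%:R = 1)// -(real_normK (num_real (f x))).
  by have := sqr_ge0 (`|f x| - 1); have := normr_ge0 (f x); nra.
by apply: integrable_EFinD => //; exact: integrable_indic_lty.
Qed.

Lemma test_fun_ibp {R : realType} {d : nat} (V : set 'rV[R]_d) f phi i :
  test_fun V f -> test_fun V phi ->
  \int[lebesgue_rV R d]_(x in V) (f x * partial i phi x) =
  - \int[lebesgue_rV R d]_(x in V) (partial i f x * phi x).
Proof.
move=> tf tp; have [sf [K [cK KV K0]]] := tf; have [sp _] := tp.
have tfi := test_fun_partial i tf; have tpi := test_fun_partial i tp.
rewrite (Rintegral_supp _ (V := V) (f := fun x => f x * partial i phi x)); last first.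
  by move=> x Vx; rewrite (test_fun_eq0 tf)// mul0r.
rewrite (Rintegral_supp _ (V := V) (f := fun x => partial i f x * phi x)); last first.
  by move=> x Vx; rewrite (test_fun_eq0 tp)// mulr0.
apply/eqP; rewrite -addr_eq0.
have i1 : (lebesgue_rV R d).-integrable setT (EFin \o (fun x => f x * partial i phi x)).
  apply: (integrable_cpt cK); last by move=> x /K0 ->; rewrite mul0r.
  by apply: continuous_mul_rV; [exact: test_fun_continuous tf|exact: test_fun_continuous tpi].
have i2 : (lebesgue_rV R d).-integrable setT (EFin \o (fun x => partial i f x * phi x)).
  apply: (integrable_cpt cK); last first.
    by move=> x Kx; rewrite (partial_eq0 i (compact_closed_rV cK) K0 Kx) mul0r.
  by apply: continuous_mul_rV; [exact: test_fun_continuous tfi|exact: test_fun_continuous tp].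
rewrite -RintegralD//; apply/eqP.
have fp1 : cont_diff 1 (f \* phi) by exact: smoothM.
have := integral_partial_eq0 i fp1 cK; rewrite -[X in _ -> _ = X]/(0 : R) => <-.
  by apply: eq_Rintegral => x _; rewrite partialM// [phi x * _]mulrC.
by move=> x /K0 /= ->; rewrite mul0r.
Qed.

Section form_domain.
Context {R : realType} {d : nat} (p : R).
Local Notation Rd := 'rV[R]_d.
Local Notation leb := (lebesgue_rV R d).
Variables (A C : Rd -> 'M[R]_d) (H : Rd -> Rd) (rho : Rd -> R).
Variable mu : {measure set Rd -> \bar R}.
Hypotheses (d_ge2 : (2 <= d)%N) (p_gtd : d%:R < p).
Hypothesis ass_a : assumption_a p A C H.
Hypothesis mu_rho : inf_invariant_density p A (drift A C H) rho mu.
Variable V : set Rd.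
Hypotheses (oV : open V) (cV : relatively_compact V).

Let mV : measurable V := open_measurable_rV oV.

Let rhoC : continuous rho := rho_continuous mu_rho.

Let VcV : V `<=` closure V. Proof. exact: subset_closure. Qed.

Lemma mu_lty : (mu V < +oo)%E.
Proof.
have : mu.-integrable V (EFin \o (cst (1 : R))).
  apply/(integrable_rho mu_rho) => //.
  have [M hM] := continuous_cpt_bounded cV rhoC.
  apply: (integrable_dominated mV (g := fun x => M * \1_V x)).
  - apply: measurable_funM => //; apply: measurable_funTS.
    exact: continuous_measurable_rV.
  - by move=> x Vx; rewrite mul1r indicE mem_set// mulr1 hM//; exact: VcV.
  - apply: integrable_EFinZ => //; apply: integrable_indic_lty => //.
    apply: le_lt_trans (leb_compact_lty cV); apply: le_measure; rewrite ?inE//.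
    exact: compact_measurable_rV.
move=> /integrableP[_]; under eq_integral do rewrite /= normr1.
by rewrite integral_cst// mul1e.
Qed.

Lemma integrable_mu_leb (f : Rd -> R) : measurable_fun V f ->
  mu.-integrable V (EFin \o f) -> leb.-integrable V (EFin \o f).
Proof.
move=> mf /(integrable_rho mu_rho mV mf) i_f.
have cr : continuous (fun x => (rho x)^-1).
  by move=> x; apply: continuousV; [apply: lt0r_neq0; exact: (rho_gt0 mu_rho)|exact: rhoC].
have [M hM] := continuous_cpt_bounded cV cr.
have := integrable_EFinM mV i_f (g := fun x => (rho x)^-1) (M := M).
have h1 : measurable_fun V (fun x => (rho x)^-1).
  by apply: measurable_funTS; exact: continuous_measurable_rV.
move=> /(_ h1 (fun x Vx => hM x (VcV Vx))); apply: eq_integrable => // x _ /=.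
by rewrite mulfK// gt_eqF// (rho_gt0 mu_rho).
Qed.

Lemma mu_leb_ae (P : Rd -> Prop) : (\forall x \ae mu, P x) -> \forall x \ae leb, P x.
Proof.
move=> [N [mN N0 NP]]; exists N; split=> //.
have mr : measurable_fun N (EFin \o rho).
  by apply/measurable_EFinP/measurable_funTS; exact: continuous_measurable_rV.
have h : (\int[leb]_(x in N) `|(rho x)%:E| = 0)%E.
  rewrite -N0 (mu_density mu_rho)//; apply: eq_integral => x _.
  by rewrite gee0_abs// lee_fin ltW// (rho_gt0 mu_rho).
have [N' [mN' N'0 hN']] : ae_eq leb N (EFin \o rho) (cst 0%E) by exact/(ae_eq_integral_abs leb mN mr).
apply: (subset_measure0 mN mN') => // x Nx; apply: hN' => /(_ Nx)[] rx.
by have := rho_gt0 mu_rho x; rewrite rx ltxx.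
Qed.

(* Square integrability on [V] with respect to [mu]. *)
Let L2V (f : Rd -> R) := measurable_fun V f /\ mu.-integrable V (EFin \o (fun x => f x ^+ 2)).

Lemma test_fun_L2V phi : test_fun V phi -> L2V phi.
Proof.
move=> tp; have [M M0 hM] := test_fun_bounded tp.
have mp : measurable_fun V phi.
  by apply: measurable_funTS; apply: continuous_measurable_rV; exact: test_fun_continuous tp.
split=> //; apply: (integrable_dominated mV (g := fun x => M ^+ 2 * \1_V x)).
- exact: measurable_funX.
- move=> x Vx; rewrite ger0_norm ?sqr_ge0// indicE mem_set// mulr1.
  by rewrite -(real_normK (num_real (phi x))) lerXn2r ?nnegrE ?hM.
- by apply: integrable_EFinZ => //; apply: integrable_indic_lty => //; exact: mu_lty.
Qed.


Let dom2 (f g : Rd -> R) : measurable_fun V f -> (forall x, V x -> f x ^+ 2 <= g x) ->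
  mu.-integrable V (EFin \o g) -> mu.-integrable V (EFin \o (fun x => f x ^+ 2)).
Proof.
move=> mf fg; apply: integrable_dominated => //; first exact: measurable_funX.
by move=> x Vx; rewrite ger0_norm ?sqr_ge0// fg.
Qed.

Lemma entries_bounded : exists2 M : R, 0 <= M & forall i j x, V x -> `|A x i j| <= M.
Proof.
have /choice[N hN] : forall ij : 'I_d * 'I_d, exists M : R,
    forall x, closure V x -> `|A x ij.1 ij.2| <= M.
  by move=> ij; exact: (continuous_cpt_bounded cV (a_continuous ass_a (i := _) (j := _))).
exists (\sum_ij `|N ij|); first exact: sumr_ge0.
move=> i j x Vx; rewrite (le_trans (hN (i, j) x (VcV Vx)))//.
rewrite (bigD1 (i, j))//= (le_trans (ler_norm _))// lerDl.
exact: sumr_ge0.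
Qed.

(* A sequence in [C_0^oo(V)] that converges together with its gradients, pointwise and
   dominated in [L^2]. *)
Definition grad_cvg (v : Rd -> R) (D : 'I_d -> Rd -> R) (G : Rd -> R) (v_ : nat -> Rd -> R) :=
  [/\ forall n, test_fun V (v_ n),
    measurable_fun V v, forall i, measurable_fun V (D i), L2V G &
    \forall x \ae mu, V x -> [/\ v_ n x @[n --> \oo] --> v x,
      forall i, partial i (v_ n) x @[n --> \oo] --> D i x,
      forall n, `|v_ n x| <= G x & forall i n, `|partial i (v_ n) x| <= G x]].

(** Integration by parts passes to the limit, so [D] is the weak gradient of [v]. In particular it
    depends on [v] alone and not on the approximating sequence, which is what later identifies the
    closed form. *)
Lemma grad_cvg_wpartial v D G v_ : grad_cvg v D G v_ ->
  forall i, weak_partial V i v (D i) /\ ae_eq mu V (wpartial V i v) (D i).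
Proof.
move=> [tv mv mD [mG G2] h] i.
have LG : leb.-integrable V (EFin \o (fun x => G x ^+ 2)).
  by apply: integrable_mu_leb => //; exact: measurable_funX.
have h' := mu_leb_ae h.
have G0 : \forall x \ae leb, V x -> 0 <= G x.
  by apply: filterS h' => x hx Vx; have [_ _ /(_ 0%N) + _] := hx Vx; exact: le_trans.
have leb_lty : (lebesgue_rV R d V < +oo)%E.
  apply: le_lt_trans (leb_compact_lty cV); apply: le_measure; rewrite ?inE//.
  exact: compact_measurable_rV.
have iG : leb.-integrable V (EFin \o G) by exact: integrable_sqr_finite.
have iv : leb.-integrable V (EFin \o v).
  apply: (integrable_dominated_ae mV mv _ iG).
  by apply: filterS h' => x hx Vx; have [c _ b _] := hx Vx; exact: lim_norm_le c b.
have iD : leb.-integrable V (EFin \o D i).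
  apply: (integrable_dominated_ae mV (mD i) _ iG).
  by apply: filterS h' => x hx Vx; have [_ c _ b] := hx Vx; exact: lim_norm_le (c i) (b i).
have sub (f : Rd -> R) : leb.-integrable V (EFin \o f) -> in_Lp_loc V 1 f.
  move=> fV K cK KV; apply/in_Lp1P; first exact: compact_measurable_rV.
  by apply: integrableS fV => //; exact: compact_measurable_rV.
have w : weak_partial V i v (D i).
  split; [exact: sub|exact: sub|] => phi tp.
  have tpi : test_fun V (partial i phi) by exact: test_fun_partial.
  have mt psi : test_fun V psi -> measurable_fun V psi.
    by move=> /test_fun_continuous c; apply: measurable_funTS; exact: continuous_measurable_rV.
  have key (f_ : nat -> Rd -> R) (f psi : Rd -> R) : (forall n, test_fun V (f_ n)) -> measurable_fun V f ->
      test_fun V psi ->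
      (\forall x \ae leb, V x -> f_ n x @[n --> \oo] --> f x /\ forall n, `|f_ n x| <= G x) ->
      \int[leb]_(x in V) (f_ n x * psi x) @[n --> \oo] --> \int[leb]_(x in V) (f x * psi x).
    move=> tf mf tps hf; have [M M0 hM] := test_fun_bounded tps.
    have [|||||_ _ //] := @Rdominated_cvg _ _ _ leb V mV (fun n x => f_ n x * psi x)
        (fun x => f x * psi x) (fun x => M * G x).
    - by move=> n; apply: measurable_funM; exact: mt.
    - by apply: measurable_funM => //; exact: mt.
    - by apply: filterS hf => x hx Vx; have [c _] := hx Vx; exact: cvgMr_tmp.
    - exact: integrable_EFinZ.
    - apply: filterS hf => x hx n Vx; have [_ b] := hx Vx.
      by rewrite normrM mulrC ler_pM.
  have l1 := key v_ v _ tv mv tpi _.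
  have l2 := key (fun n => partial i (v_ n)) (D i) _ (fun n => test_fun_partial i (tv n)) (mD i) tp _.
  have {}l1 : \int[leb]_(x in V) (v_ n x * partial i phi x) @[n --> \oo] -->
      \int[leb]_(x in V) (v x * partial i phi x).
    by apply: l1; apply: filterS h' => x hx Vx; have [] := hx Vx.
  have {}l2 : \int[leb]_(x in V) (partial i (v_ n) x * phi x) @[n --> \oo] -->
      \int[leb]_(x in V) (D i x * phi x).
    by apply: l2; apply: filterS h' => x hx Vx; have [_ c _ b] := hx Vx.
  apply: (cvg_unique _ l1); first exact: norm_hausdorff.
  rewrite /= (_ : (fun n => _) = fun n => - \int[leb]_(x in V) (partial i (v_ n) x * phi x)).
    exact: cvgN.
  by apply/funext => n; rewrite test_fun_ibp.
split=> //; apply: (mu_ae mu_rho).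
exact: (weak_partial_unique oV (wpartialP w) w).
Qed.

End form_domain.

Lemma partialB {R : realType} {d : nat} (f g : 'rV[R]_d -> R) i x :
  cont_diff 1 f -> cont_diff 1 g ->
  partial i (f \- g) x = partial i f x - partial i g x.
Proof.
move=> /(cont_diff_derive i x) df /(cont_diff_derive i x) dg.
by rewrite /partial deriveB.
Qed.

Lemma cvg_ge_id (k : nat -> nat) : (forall n, (n <= k n)%N) -> k n @[n --> \oo] --> \oo.
Proof.
move=> kn; apply/cvgnyPge => N; near=> n.
by apply: leq_trans (kn n); near: n; exact: nbhs_infty_ge.
Unshelve. all: by end_near.
Qed.

Lemma Rintegral_eq0_ae {d} {T : measurableType d} {R : realType}
    (mu : {measure set T -> \bar R}) (D : set T) (f : T -> R) : measurable D ->
  (forall x, D x -> 0 <= f x) -> mu.-integrable D (EFin \o f) ->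
  \int[mu]_(x in D) f x = 0 -> \forall x \ae mu, D x -> f x = 0.
Proof.
move=> mD f0 i_f h0.
have mf : measurable_fun D (EFin \o f) by case/integrableP: i_f.
have : ae_eq mu D (EFin \o f) (cst 0%E).
  apply/(ae_eq_integral_abs mu mD mf).
  transitivity (\int[mu]_(x in D) (f x)%:E)%E.
    by apply: eq_integral => x /[!inE] Dx; rewrite gee0_abs// lee_fin f0.
  by rewrite -EFin_Rintegral// h0.
by apply: filterS => x h Dx; have [] := h Dx.
Qed.

Lemma Rintegral_sqr_eq0 {d} {T : measurableType d} {R : realType}
    (mu : {measure set T -> \bar R}) (D : set T) (f : T -> R) : measurable D ->
  measurable_fun D f -> mu.-integrable D (EFin \o (fun x => f x ^+ 2)) ->
  \int[mu]_(x in D) f x ^+ 2 = 0 -> \forall x \ae mu, D x -> f x = 0.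
Proof.
move=> mD mf i2 h0.
have := Rintegral_eq0_ae mD (fun x _ => sqr_ge0 (f x)) i2 h0.
by apply: filterS => x h Dx; have /eqP := h Dx; rewrite sqrf_eq0 => /eqP.
Qed.

Section form_domain.
Context {R : realType} {d : nat} (p : R).
Local Notation Rd := 'rV[R]_d.
Local Notation leb := (lebesgue_rV R d).
Variables (A C : Rd -> 'M[R]_d) (H : Rd -> Rd) (rho : Rd -> R).
Variable mu : {measure set Rd -> \bar R}.
Hypothesis ass_a : assumption_a p A C H.
Hypothesis mu_rho : inf_invariant_density p A (drift A C H) rho mu.
Variable V : set Rd.
Hypotheses (oV : open V) (cV : relatively_compact V).

Let mV : measurable V := open_measurable_rV oV.

Let VcV : V `<=` closure V. Proof. exact: subset_closure. Qed.

Let muV : (mu V < +oo)%E. Proof. exact: (mu_lty mu_rho). Qed.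

Let mA i j : measurable_fun V (fun x => A x i j).
Proof.
by apply: measurable_funTS; apply: continuous_measurable_rV; exact: (a_continuous ass_a).
Qed.

Let mtest phi : test_fun V phi -> measurable_fun V phi.
Proof. by move=> t; have [] := test_fun_L2V mu_rho oV cV t. Qed.

Lemma dot_mulmx_tr (a : 'M[R]_d) (xi eta : Rd) :
  dot (xi *m a^T) eta = \sum_i \sum_j a i j * xi ord0 j * eta ord0 i.
Proof.
rewrite /dot; apply: eq_bigr => i _; rewrite mxE mulr_suml; apply: eq_bigr => j _.
by rewrite mxE [a i j * _]mulrC.
Qed.

Let cvg_sum (I : finType) (w : I -> nat -> R) (l : I -> R) :
  (forall i, w i n @[n --> \oo] --> l i) -> \sum_i w i n @[n --> \oo] --> \sum_i l i.
Proof.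
move=> h; elim: (index_enum I) => [|i r IH].
  by rewrite big_nil; under eq_fun do rewrite big_nil; exact: cvg_cst.
by rewrite big_cons; under eq_fun do rewrite big_cons; exact: cvgD.
Qed.

Definition energy_density (D D' : 'I_d -> Rd -> R) (x : Rd) : R :=
  \sum_i \sum_j A x i j * D j x * D' i x.

Lemma energy_densityE D D' x :
  energy_density D D' x = dot ((\row_i D i x) *m (A x)^T) (\row_i D' i x).
Proof.
rewrite dot_mulmx_tr; apply: eq_bigr => i _; apply: eq_bigr => j _.
by rewrite !mxE.
Qed.

Lemma measurable_energy_density D D' : (forall i, measurable_fun V (D i)) ->
  (forall i, measurable_fun V (D' i)) -> measurable_fun V (energy_density D D').
Proof.
move=> mD mD'; apply: measurable_sum => i; apply: measurable_sum => j.
by apply: measurable_funM => //; apply: measurable_funM.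
Qed.

Lemma energy_density_le D D' x (M g g' : R) : (forall i j, `|A x i j| <= M) ->
  (forall i, `|D i x| <= g) -> (forall i, `|D' i x| <= g') ->
  `|energy_density D D' x| <= \sum_(i < d) \sum_(j < d) M * (g * g').
Proof.
move=> AM Dg Dg'; rewrite (le_trans (ler_norm_sum _ _ _))//; apply: ler_sum => i _.
rewrite (le_trans (ler_norm_sum _ _ _))//; apply: ler_sum => j _.
by rewrite !normrM -mulrA !ler_pM// ?mulr_ge0.
Qed.

Lemma energy_cvg u v D D' G G' u_ v_ : grad_cvg mu V u D G u_ -> grad_cvg mu V v D' G' v_ ->
  [/\ mu.-integrable V (EFin \o energy_density D D') &
  dirichlet_form mu A V (u_ n) (v_ n) @[n --> \oo] -->
    2^-1 * \int[mu]_(x in V) energy_density D D' x].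
Proof.
move=> [tu mu' mD [mG G2] hu] [tv mv mD' [mG' G'2] hv].
have [M M0 AM] := entries_bounded ass_a cV.
pose DD n := energy_density (fun i => partial i (u_ n)) (fun i => partial i (v_ n)).
have [|||||iE _ lE] := @Rdominated_cvg _ _ _ mu V mV DD (energy_density D D')
    (fun x => \sum_(i < d) \sum_(j < d) M * (G x * G' x)).
- by move=> n; apply: measurable_energy_density => i; apply: mtest; exact: test_fun_partial.
- exact: measurable_energy_density.
- apply: filterS2 hu hv => x hx hx' Vx.
  have [_ c _ _] := hx Vx; have [_ c' _ _] := hx' Vx.
  apply: cvg_sum => i; apply: cvg_sum => j.
  by apply: cvgM; [apply: cvgMl_tmp; exact: c|exact: c'].
- apply: integrable_EFin_sum => // i; apply: integrable_EFin_sum => // j.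
  by apply: integrable_EFinZ => //; exact: integrable_sqM.
- apply: filterS2 hu hv => x hx hx' n Vx.
  have [_ _ _ b] := hx Vx; have [_ _ _ b'] := hx' Vx.
  by apply: energy_density_le => // i j; exact: AM.
split=> //; rewrite (_ : (fun n => _) = fun n => 2^-1 * \int[mu]_(x in V) DD n x).
  exact: cvgMl_tmp.
apply/funext => n; rewrite /dirichlet_form; congr (_ * _).
by apply: eq_Rintegral => x _; rewrite /DD energy_densityE.
Qed.

(** [None] stands for the function and [Some i] for its i-th partial derivative, so that one finite
    index set serves the extraction of subsequences. *)
Let f (w_ : nat -> Rd -> R) (o : option 'I_d) n : Rd -> R :=
  if o is Some i then partial i (w_ n) else w_ n.

(** Ellipticity on [V] bounds the L^2 norm of each partial derivative by the form, so a form-Cauchy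
    sequence is Cauchy in L^2 together with its gradients. *)
Lemma form_approx_cauchy u u_ : in_Lp mu V 2%:E u -> form_approx mu A V u u_ ->
  forall o (e : R), 0 < e -> exists N, forall m n, (N <= m)%N -> (N <= n)%N ->
    \int[mu]_(x in V) (f u_ o m x - f u_ o n x) ^+ 2 < e.
Proof.
move=> uL [tu uC uu].
have [mu' u2] : measurable_fun V u /\ mu.-integrable V (EFin \o (fun x => u x ^+ 2)).
  exact/in_Lp2P.
case=> [i|] e e0; last first.
  have /cvgrPdist_lt/(_ (e / 4) (divr_gt0 e0 (ltr0n _ 4)))[N _ hN] := Lp_dist2_cvg uu.
  exists N => m n Nm Nn /=.
  have iu k : mu.-integrable V (EFin \o (fun x => (u_ k x - u x) ^+ 2)).
    have [mk k2] := test_fun_L2V mu_rho oV cV (tu k).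
    have := @integrable_sqD _ _ _ mu V mV (u_ k) (fun x => - u x) mk _ k2 _.
    apply; first exact: measurableT_comp.
    by apply: eq_integrable u2 => // x _ /=; rewrite sqrrN.
  have bd k : (N <= k)%N -> \int[mu]_(x in V) (u_ k x - u x) ^+ 2 < e / 4.
    by move=> /(hN k); rewrite /= sub0r normrN; apply: le_lt_trans; exact: ler_norm.
  apply: (@le_lt_trans _ _ (\int[mu]_(x in V) (2 * (u_ m x - u x) ^+ 2 + 2 * (u_ n x - u x) ^+ 2))).
    apply: le_Rintegral => //.
    - have [mm m2] := test_fun_L2V mu_rho oV cV (test_funB (tu m) (tu n)).
      exact: m2.
    - by apply: integrable_EFinD => //; apply: integrable_EFinZ.
    - by move=> x _; have := sqr_ge0 ((u_ m x - u x) + (u_ n x - u x)); lra.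
  rewrite RintegralD//; [|by apply: integrable_EFinZ..].
  by rewrite !RintegralZl//; have := bd m Nm; have := bd n Nn; lra.
have [nu nu0 hnu] := a_elliptic ass_a cV.
have e'0 : 0 < e / (2 * nu) by rewrite divr_gt0// mulr_gt0.
have [N hN] := uC _ e'0; exists N => m n Nm Nn.
have tmn : test_fun V (u_ m \- u_ n) by exact: test_funB.
apply: (@le_lt_trans _ _ (nu * (2 * dirichlet_form mu A V (u_ m \- u_ n) (u_ m \- u_ n)))); last first.
  by have := hN _ _ Nm Nn; rewrite ltr_pdivlMr ?mulr_gt0//; lra.
have dE x : dot (grad (u_ m \- u_ n) x *m (A x)^T) (grad (u_ m \- u_ n) x) =
   energy_density (fun i => partial i (u_ m \- u_ n)) (fun i => partial i (u_ m \- u_ n)) x.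
  by rewrite energy_densityE.
rewrite /dirichlet_form mulVKf//.
have tp j := test_fun_partial j tmn.
have [M M0 AM] := entries_bounded ass_a cV.
have iE : mu.-integrable V (EFin \o (fun x =>
    dot (grad (u_ m \- u_ n) x *m (A x)^T) (grad (u_ m \- u_ n) x))).
  under [X in _ \o X]eq_fun do rewrite dE.
  apply: integrable_EFin_sum => // k; apply: integrable_EFin_sum => // j.
  under eq_fun do rewrite -mulrA mulrC.
  apply: (@integrable_EFinM _ _ _ _ _ mV _ _ M) => //; last by move=> x; exact: AM.
  have [m1 m2] := test_fun_L2V mu_rho oV cV (tp j).
  have [m1' m2'] := test_fun_L2V mu_rho oV cV (tp k).
  exact: (integrable_sqM mV m1 m1' m2 m2').
rewrite -RintegralZl//; apply: le_Rintegral => //.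
- have [_] := test_fun_L2V mu_rho oV cV (test_funB (test_fun_partial i (tu m)) (test_fun_partial i (tu n))).
  exact.
- exact: integrable_EFinZ.
- move=> x Vx; have /andP[+ _] := hnu (grad (u_ m \- u_ n) x) x Vx.
  rewrite mulrC ler_pdivrMr// [X in _ <= X]mulrC; apply: le_trans.
  rewrite /dot (bigD1 i)//= -expr2 mxE.
  have -> : partial i (u_ m \- u_ n) x = partial i (u_ m) x - partial i (u_ n) x.
    by apply: partialB; [exact: (test_fun_smooth (tu m))|exact: (test_fun_smooth (tu n))].
  by rewrite lerDl; apply: sumr_ge0 => j _; rewrite -expr2 sqr_ge0.
Qed.

(** Both sequences are fed into a single extraction, indexed by a boolean and the option above. The
    same subsequence then serves both arguments of the form. *)
Lemma form_approx_grad_cvg u v u_ v_ : in_Lp mu V 2%:E u -> in_Lp mu V 2%:E v ->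
  form_approx mu A V u u_ -> form_approx mu A V v v_ ->
  exists k D D' G, [/\ forall n, (n <= k n)%N,
    grad_cvg mu V u D G (u_ \o k) & grad_cvg mu V v D' G (v_ \o k)].
Proof.
move=> uL vL ua va; have [tu _ uu] := ua; have [tv _ vv] := va.
pose F (o : bool * option 'I_d) := f (if o.1 then u_ else v_) o.2.
have tF o n : test_fun V (F o n).
  by case: o => [[] [i|]]; rewrite /F /=; [exact: test_fun_partial|exact: tu|exact: test_fun_partial|exact: tv].
have [|||k [h [G [kn mh [mG G2] Fh FG]]]] := @L2_cauchy_subseq _ _ _ mu V mV _ F.
- by move=> o n; exact: mtest.
- by move=> o n; have [] := test_fun_L2V mu_rho oV cV (tF o n).
- by case=> [[] o] e e0; [exact: (form_approx_cauchy uL ua o e0)|exact: (form_approx_cauchy vL va o e0)].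
have lim_eq w w_ (b : bool) : in_Lp mu V 2%:E w -> Lp_dist mu V 2%:E (w_ n) w @[n --> \oo] --> 0%E ->
    (forall n, F (b, None) n = w_ n) -> ae_eq mu V (h (b, None)) w.
  move=> wL ww wF.
  have [mw w2] : measurable_fun V w /\ mu.-integrable V (EFin \o (fun x => w x ^+ 2)).
    exact/in_Lp2P.
  have mh' := mh (b, None).
  have bG := FG (b, None); have lh := Fh (b, None).
  have iGw : mu.-integrable V (EFin \o (fun x => 2 * G x ^+ 2 + 2 * w x ^+ 2)).
    by apply: integrable_EFinD => //; exact: integrable_EFinZ.
  have mF n : measurable_fun V (F (b, None) n) by exact: mtest.
  have [|||||ih _ l1] := @Rdominated_cvg _ _ _ mu V mV
      (fun n x => (F (b, None) (k n) x - w x) ^+ 2) (fun x => (h (b, None) x - w x) ^+ 2)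
      (fun x => 2 * G x ^+ 2 + 2 * w x ^+ 2).
  - by move=> n; apply: measurable_funX; exact: measurable_funB.
  - by apply: measurable_funX; exact: measurable_funB.
  - apply: filterS lh => x hx Vx; rewrite expr2; under eq_fun do rewrite expr2.
    by apply: cvgM; (apply: cvgB; [exact: hx|exact: cvg_cst]).
  - exact: iGw.
  - apply: filterS bG => x hx n Vx; rewrite ger0_norm ?sqr_ge0//.
    have : F (b, None) (k n) x ^+ 2 <= G x ^+ 2.
      by rewrite -(real_normK (num_real (F _ _ _))) lerXn2r ?nnegrE ?hx// (le_trans _ (hx n Vx)).
    by have := sqr_ge0 (F (b, None) (k n) x + w x); lra.
  have l2 : \int[mu]_(x in V) (F (b, None) (k n) x - w x) ^+ 2 @[n --> \oo] --> (0 : R).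
    rewrite (_ : (fun n => _) = (fun n => \int[mu]_(x in V) (w_ n x - w x) ^+ 2) \o k).
      exact: cvg_comp (cvg_ge_id kn) (Lp_dist2_cvg ww).
    by apply/funext => n /=; rewrite wF.
  have h0 : \int[mu]_(x in V) (h (b, None) x - w x) ^+ 2 = 0.
    exact: (cvg_unique (@norm_hausdorff _ _) l1 l2).
  have := Rintegral_sqr_eq0 mV (measurable_funB mh' mw) ih h0.
  by apply: filterS => x hx Vx; have /eqP := hx Vx; rewrite subr_eq0 => /eqP.
have hu := lim_eq u u_ true uL uu (fun=> erefl).
have hv := lim_eq v v_ false vL vv (fun=> erefl).
have gc w w_ (b : bool) : (forall n, test_fun V (w_ n)) ->
    (forall o n, F (b, o) n = f w_ o n) -> measurable_fun V w -> ae_eq mu V (h (b, None)) w ->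
    grad_cvg mu V w (fun i => h (b, Some i)) G (w_ \o k).
  move=> tw Fw mw hw; split=> //.
  - by move=> n; exact: tw.
  - have h1 : \forall x \ae mu, forall o, V x -> F (b, o) (k n) x @[n --> \oo] --> h (b, o) x.
      by apply: filter_forall => o; exact: Fh.
    have h2 : \forall x \ae mu, forall o n, V x -> `|F (b, o) (k n) x| <= G x.
      by apply: filter_forall => o; exact: FG.
    apply: filterS3 h1 h2 hw => x h1 h2 h3 Vx; split.
    + by rewrite -h3//; have := h1 None Vx; under eq_fun do rewrite Fw.
    + by move=> i; have := h1 (Some i) Vx; under eq_fun do rewrite Fw.
    + by move=> n; have := h2 None n Vx; rewrite Fw.
    + by move=> i n; have := h2 (Some i) n Vx; rewrite Fw.
exists k, (fun i => h (true, Some i)), (fun i => h (false, Some i)), G; split=> //.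
- by apply: gc => //; exact: in_Lp_measurable uL.
- by apply: gc => //; exact: in_Lp_measurable vL.
Qed.

End form_domain.

Lemma L2_dominated_cvg {d} {T : measurableType d} {R : realType}
    (mu : {measure set T -> \bar R}) (D : set T) (f_ : nat -> T -> R) (f G : T -> R) :
  measurable D -> (forall n, measurable_fun D (f_ n)) -> measurable_fun D f ->
  mu.-integrable D (EFin \o (fun x => G x ^+ 2)) ->
  (\forall x \ae mu, D x -> f_ n x @[n --> \oo] --> f x /\ forall n, `|f_ n x| <= G x) ->
  [/\ mu.-integrable D (EFin \o (fun x => f x ^+ 2)),
    forall n, mu.-integrable D (EFin \o (fun x => (f_ n x - f x) ^+ 2)) &
    \int[mu]_(x in D) (f_ n x - f x) ^+ 2 @[n --> \oo] --> (0 : R)].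
Proof.
move=> mD mf_ mf G2 h.
have sq (a b : R) : `|a| <= b -> a ^+ 2 <= b ^+ 2.
  by move=> ab; rewrite -(real_normK (num_real a)) lerXn2r ?nnegrE// (le_trans _ ab).
have iG : mu.-integrable D (EFin \o (fun x => 4 * G x ^+ 2)) by exact: integrable_EFinZ.
have b x n : D x -> f_ n x @[n --> \oo] --> f x /\ (forall n, `|f_ n x| <= G x) ->
    `|(f_ n x - f x) ^+ 2| <= 4 * G x ^+ 2.
  move=> Dx [fl fb]; rewrite ger0_norm ?sqr_ge0//.
  have := sq _ _ (fb n); have := sq _ _ (lim_norm_le fl fb).
  by have := sqr_ge0 (f_ n x + f x); lra.
have mB n : measurable_fun D (fun x => (f_ n x - f x) ^+ 2).
  by apply: measurable_funX; exact: measurable_funB.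
split.
- apply: (integrable_dominated_ae mD _ _ G2); first exact: measurable_funX.
  apply: filterS h => x hx Dx; have [fl fb] := hx Dx.
  by rewrite ger0_norm ?sqr_ge0// sq//; exact: lim_norm_le fl fb.
- move=> n; apply: (integrable_dominated_ae mD _ _ iG) => //.
  by apply: filterS h => x hx Dx; apply: b => //; exact: hx.
- have [|||||_ _] := @Rdominated_cvg _ _ _ mu D mD (fun n x => (f_ n x - f x) ^+ 2)
     (cst 0) (fun x => 4 * G x ^+ 2) => //.
  + apply: filterS h => x hx Dx; have [fl _] := hx Dx.
    have -> : cst (0 : R) x = (f x - f x) * (f x - f x) by rewrite subrr mulr0.
    under eq_fun do rewrite expr2.
    by apply: cvgM; (apply: cvgB; [exact: fl|exact: cvg_cst]).
  + by apply: filterS h => x hx n Dx; apply: b => //; exact: hx.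
  + by rewrite Rintegral_cst// mul0r.
Qed.

Section form_domain.
Context {R : realType} {d : nat} (p : R).
Local Notation Rd := 'rV[R]_d.
Local Notation leb := (lebesgue_rV R d).
Variables (A C : Rd -> 'M[R]_d) (H : Rd -> Rd) (rho : Rd -> R).
Variable mu : {measure set Rd -> \bar R}.
Hypothesis ass_a : assumption_a p A C H.
Hypothesis mu_rho : inf_invariant_density p A (drift A C H) rho mu.
Variable V : set Rd.
Hypotheses (oV : open V) (cV : relatively_compact V).

Let mV : measurable V := open_measurable_rV oV.

Let muV : (mu V < +oo)%E. Proof. exact: (mu_lty mu_rho). Qed.

Let mtest phi : test_fun V phi -> measurable_fun V phi.
Proof. by move=> t; have [] := test_fun_L2V mu_rho oV cV t. Qed.

Let L2_test phi : test_fun V phi -> mu.-integrable V (EFin \o (fun x => phi x ^+ 2)).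
Proof. by move=> t; have [] := test_fun_L2V mu_rho oV cV t. Qed.

Lemma grad_cvg_L2 v D G v_ : grad_cvg mu V v D G v_ ->
  mu.-integrable V (EFin \o (fun x => v x ^+ 2)) /\
  forall i, mu.-integrable V (EFin \o (fun x => D i x ^+ 2)).
Proof.
move=> [tv mv mD [mG G2] h]; split=> [|i].
  have [||? _ _] := @L2_dominated_cvg _ _ _ mu V v_ v G mV _ mv G2; last by [].
    by move=> n; exact: mtest.
  by apply: filterS h => x hx Vx; have [] := hx Vx.
have [||? _ _] := @L2_dominated_cvg _ _ _ mu V (fun n => partial i (v_ n)) (D i) G mV _ (mD i) G2; last by [].
  by move=> n; apply: mtest; exact: test_fun_partial.
by apply: filterS h => x hx Vx; have [_ c _ b] := hx Vx.
Qed.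

Lemma grad_cvg_cst phi : test_fun V phi ->
  grad_cvg mu V phi (fun i => partial i phi) (fun x => `|phi x| + \sum_i `|partial i phi x|)
    (fun=> phi).
Proof.
move=> t; have tp i : test_fun V (partial i phi) by exact: test_fun_partial.
split=> //; [exact: mtest|by move=> i; exact: mtest| |].
  split.
    apply: measurable_funD; first by apply: measurableT_comp => //; exact: mtest.
    by apply: measurable_sum => i; apply: measurableT_comp => //; exact: mtest.
  apply: integrable_sqD => //.
  - by apply: measurableT_comp => //; exact: mtest.
  - by apply: measurable_sum => i; apply: measurableT_comp => //; exact: mtest.
  - by apply: eq_integrable (L2_test t) => // x _ /=; rewrite real_normK// num_real.
  - apply: (integrable_dominated mV (g := fun x => #|'I_d|%:R * \sum_i partial i phi x ^+ 2)).
    + by apply: measurable_funX; apply: measurable_sum => i; apply: measurableT_comp => //; exact: mtest.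
    + by move=> x _; rewrite ger0_norm ?sqr_ge0//; exact: sqr_sum_le.
    + apply: integrable_EFinZ => //; apply: (@integrable_EFin_sum _ _ _ mu V mV) => i.
      exact: L2_test.
apply: aeW => x Vx; split.
- exact: cvg_cst.
- by move=> i; exact: cvg_cst.
- by move=> _; rewrite lerDl sumr_ge0.
- move=> i _; rewrite (bigD1 i)//= addrCA lerDl addr_ge0//.
  by rewrite sumr_ge0.
Qed.

(** Converse direction: dominated convergence gives convergence of the gradients in L^2, and the
    upper ellipticity bound turns it into the form-Cauchy property. This is how functions such as
    Phi(u) c are shown to lie in the form domain. *)
Lemma grad_cvg_form_approx v D G v_ : grad_cvg mu V v D G v_ ->
  in_Lp mu V 2%:E v /\ form_approx mu A V v v_.
Proof.
move=> gv; have [v2 D2] := grad_cvg_L2 gv; have [tv mv mD [mG G2] h] := gv.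
split; first exact/in_Lp2P.
have tp i n : test_fun V (partial i (v_ n)) by exact: test_fun_partial.
split=> //.
- move=> e e0.
  have [nu nu0 hnu] := a_elliptic ass_a cV.
  have H2 i : (forall n, mu.-integrable V (EFin \o (fun x => (partial i (v_ n) x - D i x) ^+ 2))) /\
      \int[mu]_(x in V) (partial i (v_ n) x - D i x) ^+ 2 @[n --> \oo] --> (0 : R).
    have [||_ ? ?] := @L2_dominated_cvg _ _ _ mu V (fun n => partial i (v_ n)) (D i) G mV _ (mD i) G2; last by [].
      by move=> n; exact: mtest.
    by apply: filterS h => x hx Vx; have [_ c _ b] := hx Vx.
  (* The d coordinates together contribute at most e d/(d+1), which is strictly less than [e]. *)
  have e'0 : 0 < e / (2 * nu * d.+1%:R) by rewrite divr_gt0// !mulr_gt0.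
  have /choice[N hN] : forall i, exists N, forall n, (N <= n)%N ->
      \int[mu]_(x in V) (partial i (v_ n) x - D i x) ^+ 2 < e / (2 * nu * d.+1%:R).
    move=> i; have [_ /cvgrPdist_lt/(_ _ e'0)[N _ hN]] := H2 i.
    by exists N => n /hN; rewrite /= sub0r normrN; apply: le_lt_trans; exact: ler_norm.
  exists (\max_i N i)%N => m n Nm Nn.
  have {}hN i k : (\max_i N i <= k)%N ->
      \int[mu]_(x in V) (partial i (v_ k) x - D i x) ^+ 2 < e / (2 * nu * d.+1%:R).
    by move=> ik; apply: hN; exact: leq_trans (leq_bigmax i) ik.
  have tmn : test_fun V (v_ m \- v_ n) by exact: test_funB.
  have pB i x : partial i (v_ m \- v_ n) x = partial i (v_ m) x - partial i (v_ n) x.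
    by apply: partialB; [exact: (test_fun_smooth (tv m))|exact: (test_fun_smooth (tv n))].
  have [gmn1 _] := energy_cvg ass_a mu_rho oV cV (grad_cvg_cst tmn) (grad_cvg_cst tmn).
  have iS i : mu.-integrable V (EFin \o (fun x => 2 * (partial i (v_ m) x - D i x) ^+ 2 +
      2 * (partial i (v_ n) x - D i x) ^+ 2)).
    have [h2 _] := H2 i.
    by apply: integrable_EFinD => //; exact: integrable_EFinZ.
  apply: (@le_lt_trans _ _ (2^-1 * \int[mu]_(x in V) (nu * \sum_i
      (2 * (partial i (v_ m) x - D i x) ^+ 2 + 2 * (partial i (v_ n) x - D i x) ^+ 2)))).
    rewrite /dirichlet_form ler_wpM2l//; apply: le_Rintegral => //.
    - apply: eq_integrable gmn1 => // x _ /=; by rewrite energy_densityE.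
    - by apply: integrable_EFinZ => //; exact: integrable_EFin_sum.
    - move=> x Vx; have /andP[_] := hnu (grad (v_ m \- v_ n) x) x Vx.
      move=> /le_trans; apply; rewrite ler_wpM2l ?(ltW nu0)//; apply: ler_sum => i _.
      rewrite mxE pB -expr2.
      by have := sqr_ge0 ((partial i (v_ m) x - D i x) + (partial i (v_ n) x - D i x)); lra.
  rewrite RintegralZl//; last exact: integrable_EFin_sum.
  rewrite Rintegral_sum//.
  have : \sum_i \int[mu]_(x in V) (2 * (partial i (v_ m) x - D i x) ^+ 2 +
      2 * (partial i (v_ n) x - D i x) ^+ 2) <= \sum_(i < d) 2 * (2 * (e / (2 * nu * d.+1%:R))).
    apply: ler_sum => i _; have [h2 _] := H2 i.
    rewrite RintegralD//; [|exact: integrable_EFinZ..].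
    rewrite (RintegralZl _ mV (h2 m)) (RintegralZl _ mV (h2 n)) -mulrDr ler_wpM2l//.
    by rewrite [leRHS]mulr_natl mulr2n lerD// ltW// hN.
  rewrite sumr_const card_ord => hS; apply: (le_lt_trans (ler_wpM2l _ (ler_wpM2l (ltW nu0) hS))) => //.
  rewrite [X in X < _](_ : _ = e * (d%:R / d.+1%:R)).
    by rewrite gtr_pMr// ltr_pdivrMr// mul1r ltr_nat.
  rewrite -[_ *+ d]mulr_natl; have : (0 : R) < d.+1%:R by [].
  set a : R := d%:R; set b : R := d.+1%:R => b0; field.
  by rewrite !gt_eqF.
- apply/Lp_dist_cvg => //.
  have [||_ iB l] := @L2_dominated_cvg _ _ _ mu V v_ v G mV _ mv G2.
    by move=> n; exact: mtest.
    by apply: filterS h => x hx Vx; have [] := hx Vx.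
  have -> : (fun n => \int[mu]_(x in V) (`|v_ n x - v x| `^ 2)%:E)%E =
      EFin \o (fun n => \int[mu]_(x in V) (v_ n x - v x) ^+ 2).
    apply/funext => n /=; rewrite EFin_Rintegral//; apply: eq_integral => x _.
    by rewrite powR_mulrn// real_normK// num_real.
  by apply: cvg_EFin => //; exact: nearW.
Qed.

Lemma grad_cvg_unique v D G v_ D' G' v_' :
  grad_cvg mu V v D G v_ -> grad_cvg mu V v D' G' v_' -> forall i, ae_eq mu V (D i) (D' i).
Proof.
move=> g g' i; have [_ h] := grad_cvg_wpartial mu_rho oV cV g i.
have [_ h'] := grad_cvg_wpartial mu_rho oV cV g' i.
by apply: filterS2 h h' => x hx hx' Vx; rewrite -hx// -hx'.
Qed.

(** [closed_form] only provides some pair of approximating sequences; along a subsequence their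
    gradients converge, and uniqueness of weak gradients shows that the value is the energy computed
    with any other gradients of [u] and [v]. *)
Lemma closed_form_energy u v e D G u_ D' G' v_ : closed_form mu A V u v e ->
  grad_cvg mu V u D G u_ -> grad_cvg mu V v D' G' v_ ->
  mu.-integrable V (EFin \o energy_density A D D') /\
  e = 2^-1 * \int[mu]_(x in V) energy_density A D D' x.
Proof.
move=> [u1 [v1 [au av le]]] gu gv.
have [uL _] := grad_cvg_form_approx gu; have [vL _] := grad_cvg_form_approx gv.
have [k [D1 [D1' [G1 [kn gu1 gv1]]]]] := form_approx_grad_cvg ass_a mu_rho oV cV uL vL au av.
have [i1 l1] := energy_cvg ass_a mu_rho oV cV gu1 gv1.
have [i2 _] := energy_cvg ass_a mu_rho oV cV gu gv.
split=> //.
have -> : e = 2^-1 * \int[mu]_(x in V) energy_density A D1 D1' x.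
  apply: (cvg_unique (@norm_hausdorff _ _) _ l1).
  exact: cvg_comp (cvg_ge_id kn) le.
congr (_ * _); apply: ae_eq_Rintegral => //.
- exact: integrable_measurable i1.
- exact: integrable_measurable i2.
have h1 : \forall x \ae mu, forall i, V x -> D1 i x = D i x.
  by apply: filter_forall => i; exact: grad_cvg_unique gu1 gu i.
have h2 : \forall x \ae mu, forall i, V x -> D1' i x = D' i x.
  by apply: filter_forall => i; exact: grad_cvg_unique gv1 gv i.
apply: filterS2 h1 h2 => x h1 h2 Vx; apply: eq_bigr => i _; apply: eq_bigr => j _.
by rewrite h1// h2.
Qed.

(** The chain and product rules are inherited from the approximants, domination being kept by the
    bounds on Phi and Phi'. The last hypothesis covers the two cases in use: [c] a test function, or
    [c] constant and Phi(0) = 0. *)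
Lemma grad_cvg_comp u D G u_ (Phi Phi' : R -> R) c (M K : R) : grad_cvg mu V u D G u_ ->
  smooth1 Phi -> (forall y : R, is_derive y 1 Phi (Phi' y)) -> continuous Phi' ->
  (forall y : R, `|Phi y| <= M) -> (forall y : R, `|Phi' y| <= M) ->
  smooth c -> (forall x, `|c x| <= K) -> (forall i x, `|partial i c x| <= K) ->
  (forall phi, test_fun V phi -> test_fun V ((Phi \o phi) \* c)) ->
  grad_cvg mu V (fun x => Phi (u x) * c x)
    (fun i x => Phi (u x) * partial i c x + c x * (Phi' (u x) * D i x))
    (fun x => M * K + K * (M * G x)) (fun n => (Phi \o u_ n) \* c).
Proof.
move=> [tu mu' mD [mG G2] h] sP dP cP' PM P'M sc cK pcK tPc.
have cP : continuous Phi by exact: cont_diff1_continuous (sP 0%N).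
have mP : measurable_fun setT Phi by exact: continuous_measurable_fun.
have mP' : measurable_fun setT Phi' by exact: continuous_measurable_fun.
have cc : continuous c by have [] := sc 0%N.
have mc : measurable_fun V c by apply: measurable_funTS; exact: continuous_measurable_rV.
have mpc i : measurable_fun V (partial i c).
  apply: measurable_funTS; apply: continuous_measurable_rV.
  by have [] := smooth_partial i sc 0%N.
have M0 : 0 <= M by exact: le_trans (PM 0).
have K0 : 0 <= K by exact: le_trans (cK 0).
split.
- by move=> n; exact: tPc.
- by apply: measurable_funM => //; exact: measurableT_comp.
- move=> i; apply: measurable_funD; apply: measurable_funM => //; first exact: measurableT_comp.
  by apply: measurable_funM => //; exact: measurableT_comp.
- split; first by apply: measurable_funD => //; do 2 apply: measurable_funM => //.
  apply: integrable_sqD => //.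
  + by do 2 apply: measurable_funM => //.
  + have := integrable_EFinZ mV ((M * K) ^+ 2) (integrable_indic_lty mV mV muV).
    by apply: eq_integrable => // x /[!inE] Vx /=; rewrite indicE mem_set// mulr1.
  + have := integrable_EFinZ mV ((K * M) ^+ 2) G2.
    by apply: eq_integrable => // x _ /=; rewrite -exprMn mulrA.
- apply: filterS h => x hx Vx; have [c1 c2 b1 b2] := hx Vx.
  have G0 : 0 <= G x by exact: le_trans (b1 0%N).
  have pE n i : partial i ((Phi \o u_ n) \* c) x =
      Phi (u_ n x) * partial i c x + c x * (Phi' (u_ n x) * partial i (u_ n) x).
    have sun : smooth (u_ n) := test_fun_smooth (tu n).
    rewrite partialM//; last by apply: cont_diff_comp; [exact: sP|exact: sun].
    by rewrite (partial_comp _ _ dP).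
  have cvPhi := continuous_cvg _ (cP (u x)) c1; have cvPhi' := continuous_cvg _ (cP' (u x)) c1.
  split.
  + by apply: cvgMr_tmp; exact: cvPhi.
  + move=> i; under eq_fun do rewrite pE.
    apply: cvgD; first by apply: cvgMr_tmp; exact: cvPhi.
    by apply: cvgMl_tmp; apply: cvgM; [exact: cvPhi'|exact: c2].
  + move=> n; rewrite normrM (le_trans (ler_pM _ _ (PM _) (cK _)))// lerDl.
    by rewrite !mulr_ge0.
  + move=> i n; rewrite pE (le_trans (ler_normD _ _))// !normrM lerD//.
      by rewrite ler_pM.
    by rewrite ler_pM ?mulr_ge0// ler_pM.
Qed.

End form_domain.

(** * Weak formulation of the local operator *)

Section perturbed_generator_test.
Context {R : realType} {d : nat} (p : R).
Local Notation Rd := 'rV[R]_d.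
Local Notation leb := (lebesgue_rV R d).
Variables (A C : Rd -> 'M[R]_d) (H : Rd -> Rd) (rho : Rd -> R).
Variable mu : {measure set Rd -> \bar R}.
Hypotheses (d_ge2 : (2 <= d)%N) (p_gtd : d%:R < p).
Hypothesis ass_a : assumption_a p A C H.
Hypothesis mu_rho : inf_invariant_density p A (drift A C H) rho mu.
Variable V : set Rd.
Hypotheses (oV : open V) (cV : relatively_compact V).
Local Notation B := (div_free_drift A C H rho).

Let mV : measurable V := open_measurable_rV oV.

Let muV : (mu V < +oo)%E. Proof. exact: (mu_lty mu_rho). Qed.

Let rhoC : continuous rho := rho_continuous mu_rho.

Lemma L2loc_mu f K : L2loc f -> compact K -> mu.-integrable K (EFin \o (fun x => f x ^+ 2)).
Proof.
move=> [mf f2] cK; have mK := compact_measurable_rV cK.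
have mfK : measurable_fun K (fun x => f x ^+ 2).
  by apply: measurable_funX; exact: measurable_funTS.
apply/(integrable_rho mu_rho) => //.
have [M hM] := continuous_cpt_bounded cK rhoC.
apply: (integrable_EFinM mK (f2 K cK) _ hM).
by apply: measurable_funTS; exact: continuous_measurable_rV.
Qed.

Let mB i : measurable_fun V (fun x => B x ord0 i).
Proof.
by have [m _] := div_free_drift_L2loc d_ge2 p_gtd ass_a mu_rho i; exact: measurable_funTS.
Qed.

Let B2 i : mu.-integrable V (EFin \o (fun x => B x ord0 i ^+ 2)).
Proof.
have h := div_free_drift_L2loc d_ge2 p_gtd ass_a mu_rho i.
apply: integrableS (L2loc_mu h cV) => //; first exact: compact_measurable_rV.
exact: subset_closure.
Qed.

Lemma integrable_drift_grad (D : 'I_d -> Rd -> R) (v : Rd -> R) (M : R) :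
  (forall i, measurable_fun V (D i)) ->
  (forall i, mu.-integrable V (EFin \o (fun x => D i x ^+ 2))) ->
  measurable_fun V v -> (forall x, V x -> `|v x| <= M) ->
  mu.-integrable V (EFin \o (fun x => (\sum_i B x ord0 i * D i x) * v x)).
Proof.
move=> mD D2 mv vM; apply: (integrable_EFinM mV _ mv vM).
apply: (@integrable_EFin_sum _ _ _ mu V mV) => i.
exact: (integrable_sqM mV (mB i) (mD i) (B2 i) (D2 i)).
Qed.

(** The symmetric part is given by the closed form, hence by the energy; the drift part involves
    [wgrad], which is almost everywhere the gradient [D] of the approximating sequence. Bounded [v]
    make the pairing with the drift integrable. *)
Lemma perturbed_generator_test u w : perturbed_generator mu A B V u w ->
  mu.-integrable V (EFin \o w) /\
  exists D G u_, grad_cvg mu V u D G u_ /\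
  forall v D' G' v_ (M : R), grad_cvg mu V v D' G' v_ -> (forall x, V x -> `|v x| <= M) ->
    mu.-integrable V (EFin \o energy_density A D D') /\
    \int[mu]_(x in V) (w x * v x) = - (2^-1 * \int[mu]_(x in V) energy_density A D D' x) +
      \int[mu]_(x in V) ((\sum_i B x ord0 i * D i x) * v x).
Proof.
move=> [uL wL [w0 [w0L [uL2 [u1 au]] fg] wE]].
have iw : mu.-integrable V (EFin \o w) by exact/in_Lp1P.
split=> //.
have [k [D [_ [G [kn gu _]]]]] := form_approx_grad_cvg ass_a mu_rho oV cV uL2 uL2 au au.
exists D, G, (u1 \o k); split=> // v D' G' v_ M gv vM.
have [vL av] := grad_cvg_form_approx ass_a mu_rho oV cV gv.
have cf := fg v (conj vL (ex_intro _ v_ av)).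
have [iE E] := closed_form_energy ass_a mu_rho oV cV cf gu gv.
split=> //.
have [_ D2] := grad_cvg_L2 mu_rho oV cV gu.
have [v2 _] := grad_cvg_L2 mu_rho oV cV gv.
have [tu mu' mD _ _] := gu; have [tv mv _ _ _] := gv.
have [mw0 w02] : measurable_fun V w0 /\ mu.-integrable V (EFin \o (fun x => w0 x ^+ 2)).
  exact/in_Lp2P.
have iB := integrable_drift_grad mD D2 mv vM.
have iw0 : mu.-integrable V (EFin \o (fun x => w0 x * v x)) by exact: integrable_sqM.
rewrite -E opprK -RintegralD//.
apply: ae_eq_Rintegral => //.
- by apply: measurable_funM => //; exact: integrable_measurable iw.
- exact: measurable_funD (integrable_measurable iw0) (integrable_measurable iB).
have hD : \forall x \ae mu, forall i, V x -> wpartial V i u x = D i x.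
  by apply: filter_forall => i; have [_] := grad_cvg_wpartial mu_rho oV cV gu i.
apply: filterS2 wE hD => x hw hD Vx; rewrite hw// mulrDl; congr (_ + _ * _).
by apply: eq_bigr => i _; rewrite /wgrad [X in _ * X = _]mxE hD.
Qed.

(** Since Z' = zeta, the integrand is B paired with the gradient of Z(u). For the approximants
    Z(u_n) is a test function, because Z(0) = 0, and [div_free] applies. *)
Lemma drift_primitive_eq0 u D G u_ (Z zeta : R -> R) (M : R) : grad_cvg mu V u D G u_ ->
  smooth1 Z -> Z 0 = 0 -> (forall y : R, is_derive y 1 Z (zeta y)) -> continuous zeta ->
  (forall y : R, `|zeta y| <= M) ->
  \int[mu]_(x in V) ((\sum_i B x ord0 i * D i x) * zeta (u x)) = 0.
Proof.
move=> gu sZ Z0 dZ cz zM; have [tu mu' mD [mG G2] h] := gu.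
have [_ D2] := grad_cvg_L2 mu_rho oV cV gu.
have M0 : 0 <= M by exact: le_trans (zM 0).
have mz : measurable_fun setT zeta by exact: continuous_measurable_fun.
have mp n i : measurable_fun V (partial i (u_ n)).
  by have [] := test_fun_L2V mu_rho oV cV (test_fun_partial i (tu n)).
have mun n : measurable_fun V (u_ n) by have [] := test_fun_L2V mu_rho oV cV (tu n).
pose f_ n x := (\sum_i B x ord0 i * partial i (u_ n) x) * zeta (u_ n x).
have [|||||_ _ l] := @Rdominated_cvg _ _ _ mu V mV f_
   (fun x => (\sum_i B x ord0 i * D i x) * zeta (u x))
   (fun x => (\sum_i `|B x ord0 i| * G x) * M).
- move=> n; apply: measurable_funM; last exact: measurableT_comp.
  by apply: measurable_sum => i; exact: measurable_funM.
- apply: measurable_funM; last exact: measurableT_comp.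
  by apply: measurable_sum => i; exact: measurable_funM.
- apply: filterS h => x hx Vx; have [c1 c2 _ _] := hx Vx.
  apply: cvgM; last exact: (continuous_cvg _ (cz (u x)) c1).
  apply: cvg_big => [|i _]; first exact: add_continuous.
  by apply: cvgMl_tmp; exact: c2.
- under [X in _ \o X]eq_fun do rewrite mulrC.
  apply: integrable_EFinZ => //; apply: (@integrable_EFin_sum _ _ _ mu V mV) => i.
  apply: integrable_sqM => //; first by apply: measurableT_comp.
  by apply: eq_integrable (B2 i) => // x _ /=; rewrite real_normK// num_real.
- apply: filterS h => x hx n Vx; have [_ _ _ b] := hx Vx.
  rewrite normrM ler_pM// (le_trans (ler_norm_sum _ _ _))//; apply: ler_sum => i _.
  by rewrite normrM ler_wpM2l.
have f0 n : \int[mu]_(x in V) f_ n x = 0.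
  have tZ : test_fun V (Z \o u_ n) by exact: test_fun_comp.
  apply: etrans (div_free d_ge2 p_gtd ass_a mu_rho (test_fun_sub (@subsetT _ V) tZ)).
  rewrite (Rintegral_supp mu (f := f_ n)); last first.
    move=> x Vx; rewrite /f_ big1 ?mul0r// => i _.
    by rewrite (test_fun_eq0 (test_fun_partial i (tu n)))// mulr0.
  apply: eq_Rintegral => x _; rewrite /f_ /dot mulr_suml; apply: eq_bigr => i _.
  rewrite /grad [X in _ = _ * X]mxE (partial_comp _ _ dZ); last exact: (test_fun_smooth (tu n)).
  by rewrite -mulrA [_ * zeta _]mulrC.
have e : (fun n => \int[mu]_(x in V) f_ n x) = cst 0 by exact/funext.
by rewrite e in l; exact: (cvg_unique (@norm_hausdorff _ _) l (cvg_cst 0)).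
Qed.

End perturbed_generator_test.

(** * Pointwise lower bound for the tested energy *)

Section pointwise_estimate.
Context {R : realFieldType}.

Lemma young (del x y : R) : 0 < del -> - (del * x ^+ 2 + (4 * del)^-1 * y ^+ 2) <= x * y.
Proof.
move=> d0; rewrite -subr_ge0.
have -> : x * y - - (del * x ^+ 2 + (4 * del)^-1 * y ^+ 2) = del * (x + y / (2 * del)) ^+ 2.
  by field; rewrite gt_eqF.
by rewrite mulr_ge0 ?sqr_ge0// ltW.
Qed.

Let comb1 (x e b2 g2 g' k z beta2 : R) : 3 / 4 * x <= b2 * e * (3 / 4 * g2) ->
  b2 * e * (3 / 4 * g2) <= b2 * e * (- g' + k * z) ->
  b2 * (k * z * e) <= beta2 * (k * z * e) ->
  3 / 8 * x - 2^-1 * (k * beta2 * (z * e)) <= - (2^-1 * (b2 * g' * e)).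
Proof. by lra. Qed.

Let comb2 (lhs n s w p q w' x kb ze t : R) : - (s + w) <= p -> q <= x + w' ->
  n - 2^-1 * (kb * ze) <= - (2^-1 * t) -> lhs = n - (x + s) ->
  lhs <= - (2^-1 * (2 * q + t)) + p + kb * (2^-1 * ze) + (w' + w).
Proof. by lra. Qed.

(** This is the integrand of the weak formulation tested with g(u) b^2, where [D] is the gradient of
    u and [q] that of b. The inequality for [g'] makes the main term worth 3/8 of S/nu, with S the
    sum of squares on the left. Young's inequality absorbs the cross terms at cost d [del] S and the
    drift term at cost [del] S; [del] is chosen so that (d+1) [del] = 1/(8 nu), which leaves 1/4 of
    S/nu. *)
Lemma energy_lower_bound (d : nat) (a : 'I_d -> 'I_d -> R) (D q B : 'I_d -> R)
    (b g g' z K M nu beta : R) :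
  let del := (8 * nu * d.+1%:R)^-1 in
  let E := \sum_i \sum_j a i j * D j * D i in
  0 < nu -> nu^-1 * \sum_i D i ^+ 2 <= E -> (forall i j, `|a i j| <= M) ->
  `|b| <= beta -> 0 <= z -> 0 <= K -> 3 / 4 * g ^+ 2 <= - g' + K * z ->
  (4 * nu)^-1 * \sum_i (D i * g * b) ^+ 2 <=
    - (2^-1 * \sum_i \sum_j a i j * D j * (g * (2 * b * q i) + b ^+ 2 * (g' * D i))) +
    (\sum_i B i * D i) * (g * b ^+ 2) + K * beta ^+ 2 * (2^-1 * (z * E)) +
    ((4 * del)^-1 * (\sum_(i < d) \sum_(j < d) (M * q i) ^+ 2) +
     (4 * del)^-1 * \sum_i (B i * b) ^+ 2).
Proof.
move=> del E nu0 ell aM bb z0 K0 hg.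
have del0 : 0 < del by rewrite invr_gt0 !mulr_gt0.
have M0 (i : 'I_d) : 0 <= M by apply: le_trans (aM i i).
pose S := \sum_i (D i * g * b) ^+ 2.
have SE : S = g ^+ 2 * b ^+ 2 * \sum_i D i ^+ 2.
  by rewrite mulr_sumr; apply: eq_bigr => i _; ring.
have E0 : 0 <= E.
  apply: le_trans ell; rewrite mulr_ge0 ?invr_ge0 ?(ltW nu0)//.
  by apply: sumr_ge0 => i _; exact: sqr_ge0.
have -> : \sum_i \sum_j a i j * D j * (g * (2 * b * q i) + b ^+ 2 * (g' * D i)) =
    2 * (\sum_i \sum_j a i j * q i * (D j * g * b)) + b ^+ 2 * g' * E.
  rewrite !mulr_sumr -big_split/=; apply: eq_bigr => i _.
  by rewrite !mulr_sumr -big_split/=; apply: eq_bigr => j _; ring.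
have -> : (\sum_i B i * D i) * (g * b ^+ 2) = \sum_i (D i * g * b) * (B i * b).
  by rewrite mulr_suml; apply: eq_bigr => i _; ring.
have h1 : - (del * S + (4 * del)^-1 * \sum_i (B i * b) ^+ 2) <= \sum_i (D i * g * b) * (B i * b).
  rewrite /S !mulr_sumr -big_split/= -sumrN; apply: ler_sum => i _.
  exact: young.
have h2 : \sum_i \sum_j a i j * q i * (D j * g * b) <=
    d%:R * del * S + (4 * del)^-1 * \sum_(i < d) \sum_(j < d) (M * q i) ^+ 2.
  have -> : d%:R * del * S = \sum_(i < d) \sum_(j < d) del * (D j * g * b) ^+ 2.
    rewrite sumr_const card_ord -mulr_sumr -[RHS]mulr_natl; rewrite /S; ring.
  rewrite mulr_sumr -big_split/=; apply: ler_sum => i _.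
  rewrite mulr_sumr -big_split/=; apply: ler_sum => j _.
  have := young (D j * g * b) (- (a i j * q i)) del0.
  rewrite mulrN lerN2 sqrrN [X in X <= _]mulrC => /le_trans; apply; rewrite lerD2l.
  rewrite ler_wpM2l ?invr_ge0 ?mulr_ge0 ?(ltW del0)//.
  rewrite !exprMn ler_wpM2r ?sqr_ge0// -(real_normK (num_real (a i j))).
  by rewrite lerXn2r ?nnegrE ?aM// (M0 i).
have h3 : 3 / 8 * (nu^-1 * S) - 2^-1 * (K * beta ^+ 2 * (z * E)) <= - (2^-1 * (b ^+ 2 * g' * E)).
  have b2 : b ^+ 2 <= beta ^+ 2.
    by rewrite -(real_normK (num_real b)) lerXn2r ?nnegrE// (le_trans _ bb).
  have k1 : 3 / 4 * (nu^-1 * S) <= b ^+ 2 * E * (3 / 4 * g ^+ 2).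
    rewrite SE [X in _ <= X](_ : _ = 3 / 4 * (g ^+ 2 * b ^+ 2 * E)); last by ring.
    by rewrite ler_wpM2l// mulrCA ler_wpM2l// mulr_ge0// sqr_ge0.
  have k2 : b ^+ 2 * E * (3 / 4 * g ^+ 2) <= b ^+ 2 * E * (- g' + K * z).
    by rewrite ler_wpM2l// mulr_ge0// sqr_ge0.
  have k3 : b ^+ 2 * (K * z * E) <= beta ^+ 2 * (K * z * E).
    by rewrite ler_wpM2r// !mulr_ge0.
  exact: comb1 k1 k2 k3.
have dd : (d.+1%:R * del) * S = 8^-1 * (nu^-1 * S).
  rewrite /del; have : (0 : R) < d.+1%:R by []. 
  by set n : R := d.+1%:R => n0; field; rewrite !gt_eqF.
have h4 : (4 * nu)^-1 * S = 3 / 8 * (nu^-1 * S) - (d%:R * del * S + del * S).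
  have -> : d%:R * del * S + del * S = (d.+1%:R * del) * S by rewrite -natr1; ring.
  by rewrite dd; field; rewrite gt_eqF.
exact: comb2 h1 h2 h3 h4.
Qed.

End pointwise_estimate.

(** * The logarithmic energy estimate for the local operators *)

Lemma partial_cst {R : realType} {d : nat} i (c : R) (x : 'rV[R]_d) : partial i (cst c) x = 0.
Proof. by rewrite /partial derive_cst. Qed.

Lemma test_fun_bounded1 {R : realType} {d : nat} (V : set 'rV[R]_d) phi : test_fun V phi ->
  exists L : R, (forall x, `|phi x| <= L) /\ forall i x, `|partial i phi x| <= L.
Proof.
move=> t; have [L0 L00 hL0] := test_fun_bounded t.
have /choice[L hL] : forall i, exists L : R, 0 <= L /\ forall x, `|partial i phi x| <= L.
  by move=> i; have [L] := test_fun_bounded (test_fun_partial i t); exists L.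
exists (L0 + \sum_i L i); split=> [x|i x].
  by rewrite (le_trans (hL0 x))// lerDl sumr_ge0// => i _; have [] := hL i.
have [_ h] := hL i; rewrite (le_trans (h x))// (bigD1 i)//= addrCA lerDl addr_ge0//.
by rewrite sumr_ge0// => j _; have [] := hL j.
Qed.

Lemma le_Rintegral_subset {d} {T : measurableType d} {R : realType}
    (mu : {measure set T -> \bar R}) (D : set T) (f : T -> R) : measurable D ->
  (forall x, 0 <= f x) -> mu.-integrable setT (EFin \o f) ->
  \int[mu]_(x in D) f x <= \int[mu]_x f x.
Proof.
move=> mD f0 i_f; rewrite -lee_fin !EFin_Rintegral//; last exact: integrableS i_f.
apply: ge0_subset_integral => //; first by case/integrableP: i_f.
by move=> x _; rewrite lee_fin.
Qed.

Lemma integrable_sqr_bounded {d} {T : measurableType d} {R : realType}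
    (mu : {measure set T -> \bar R}) (D : set T) (f h : T -> R) (M : R) : measurable D ->
  mu.-integrable D (EFin \o (fun x => f x ^+ 2)) -> measurable_fun D h ->
  (forall x, D x -> `|h x| <= M) ->
  mu.-integrable D (EFin \o (fun x => (f x * h x) ^+ 2)).
Proof.
move=> mD f2 mh hM; under [X in _ \o X]eq_fun do rewrite exprMn.
apply: (integrable_EFinM mD f2 (M := M ^+ 2)); first exact: measurable_funX.
by move=> x Dx; rewrite normrX lerXn2r ?nnegrE ?hM// (le_trans _ (hM x Dx)).
Qed.

Lemma final_bound {R : realFieldType} (I K J c n b2 X r r' : R) : n <= c -> 0 <= J -> 0 <= K ->
  0 <= c -> X <= n * (I + K * b2 * J + r) -> 0 <= X -> r <= r' -> b2 <= c -> r' <= c -> 0 < n ->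
  X <= c * (I + c + K * c * J).
Proof.
move=> nc J0 K0 c0 Xn X0 rr bc rc n0.
have Y0 : 0 <= I + K * b2 * J + r by move: (le_trans X0 Xn); rewrite pmulr_rge0.
apply: (le_trans Xn); apply: (le_trans (ler_wpM2r Y0 nc)); apply: ler_wpM2l => //.
have : K * b2 * J <= K * c * J by rewrite ler_wpM2r// ler_wpM2l.
by move: (le_trans rr rc); lra.
Qed.

Lemma final_bound2 {R : realFieldType} (I K J c X k k' : R) : 0 <= c -> 0 <= J ->
  0 <= X -> 0 <= k -> X <= c * (I + c + K * c * J) -> k <= k' -> 0 <= K ->
  X * k <= c * (1 + k') * (I + c * (1 + k') + K * (c * (1 + k')) * J).
Proof.
move=> c0 J0 X0 k0 XY kk K0; have k'0 : 0 <= k' by exact: le_trans kk.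
set Y := c * _ in XY; have Y0 : 0 <= Y by exact: le_trans XY.
apply: (@le_trans _ _ (Y * (1 + k'))).
  by rewrite ler_pM// (le_trans kk)// lerDr.
rewrite /Y mulrAC ler_wpM2l ?mulr_ge0 ?addr_ge0//.
have c1 : c <= c * (1 + k') by rewrite ler_peMr// lerDl.
by rewrite -!addrA lerD2l lerD// ler_wpM2r// ler_wpM2l.
Qed.

Section core_estimate.
Context {R : realType} {d : nat} (p : R).
Local Notation Rd := 'rV[R]_d.
Local Notation leb := (lebesgue_rV R d).
Variables (A C : Rd -> 'M[R]_d) (H : Rd -> Rd) (rho : Rd -> R).
Variable mu : {measure set Rd -> \bar R}.
Hypotheses (d_ge2 : (2 <= d)%N) (p_gtd : d%:R < p).
Hypothesis ass_a : assumption_a p A C H.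
Hypothesis mu_rho : inf_invariant_density p A (drift A C H) rho mu.
Local Notation B := (div_free_drift A C H rho).

(** [F] imitates the logarithm, for which g = 1/y satisfies g^2 = -g'. The inequality is needed on
    the whole line because approximants of a nonnegative function may be negative; there the term K
    z repairs it. Its primitives [zeta] and [Z] allow testing with zeta(u), and zeta vanishes on the
    half-line where the limit takes its values. *)
Record cutoff (F g g' Z zeta z : R -> R) (M K : R) : Prop := {
  cutoff_F : smooth1 F; cutoff_Z : smooth1 Z; cutoff_Z0 : Z 0 = 0;
  cutoff_dF : forall y : R, is_derive y 1 F (g y);
  cutoff_dg : forall y : R, is_derive y 1 g (g' y);
  cutoff_dZ : forall y : R, is_derive y 1 Z (zeta y);
  cutoff_dzeta : forall y : R, is_derive y 1 zeta (z y);
  cutoff_FM : forall y : R, `|F y| <= M; cutoff_gM : forall y : R, `|g y| <= M;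
  cutoff_g'M : forall y : R, `|g' y| <= M; cutoff_zetaM : forall y : R, `|zeta y| <= M;
  cutoff_zM : forall y : R, `|z y| <= M; cutoff_z0 : forall y, 0 <= z y;
  cutoff_zeta0 : forall y, 0 <= y -> zeta y = 0; cutoff_K : 0 <= K;
  cutoff_ineq : forall y, 3 / 4 * g y ^+ 2 <= - g' y + K * z y }.

(** Testing with g(u) b^2 and integrating [energy_lower_bound] controls g(u) b grad u in L^2; the
    correction K z(u) is controlled by testing with zeta(u). Ellipticity and the bounds on A are
    taken on the support of [b] only, so [c] depends neither on [V] nor on the cutoff nor on [u]. *)
Lemma core_gradient b : test_fun setT b -> exists2 c, 0 <= c &
  forall F g g' Z zeta z M K V u w, cutoff F g g' Z zeta z M K ->
  open V -> relatively_compact V -> test_fun V b -> perturbed_generator mu A B V u w ->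
  exists D G u_, [/\ grad_cvg mu V u D G u_,
    0 <= - (\int[mu]_(x in V) (w x * zeta (u x))) &
    \int[mu]_(x in V) (\sum_i (D i x * g (u x) * b x) ^+ 2) <=
    c * (\int[mu]_(x in V) (w x * (g (u x) * b x ^+ 2)) + c +
      K * c * - (\int[mu]_(x in V) (w x * zeta (u x))))].
Proof.
move=> tb; have [sb [K0 [cK0 _ bK0]]] := tb.
have rK0 : relatively_compact K0.
  by rewrite /relatively_compact -(closure_id K0).1//; exact: compact_closed_rV.
have [nu nu0 hnu] : exists2 nu : R, 0 < nu & forall xi x, K0 x ->
      nu^-1 * dot xi xi <= dot (xi *m (A x)^T) xi <= nu * dot xi xi.
  exact: (a_elliptic ass_a rK0).
have [MA MA0 AM] : exists2 M : R, 0 <= M & forall i j x, K0 x -> `|A x i j| <= M.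
  exact: (entries_bounded ass_a rK0).
have [beta beta0 bb] := test_fun_bounded tb.
pose del := (8 * nu * d.+1%:R)^-1.
pose r x := (4 * del)^-1 * (\sum_(i < d) \sum_(j < d) (MA * partial i b x) ^+ 2) +
     (4 * del)^-1 * \sum_i (B x ord0 i * b x) ^+ 2.
have del0 : 0 < del by rewrite invr_gt0 !mulr_gt0.
have r0 x : 0 <= r x.
  have k0 : 0 <= (4 * del)^-1 by rewrite invr_ge0 mulr_ge0// ltW.
  rewrite addr_ge0 ?mulr_ge0 ?sumr_ge0// => i _; last exact: sqr_ge0.
  by apply: sumr_ge0 => j _; exact: sqr_ge0.
have mK0 := compact_measurable_rV cK0.
have tp i : test_fun setT (partial i b) by exact: test_fun_partial.
have pK0 i x : ~ K0 x -> partial i b x = 0.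
  by apply: partial_eq0 => //; exact: compact_closed_rV.
have cb := test_fun_continuous tb.
have ir : mu.-integrable setT (EFin \o r).
  apply: (integrable_supp mK0).
    move=> x Kx; rewrite /r big1 ?big1 ?mulr0 ?addr0// => i _.
      by rewrite bK0// mulr0 expr0n.
    by rewrite big1// => j _; rewrite pK0// mulr0 expr0n.
  have L2c f : L2loc f -> mu.-integrable K0 (EFin \o (fun x => f x ^+ 2)).
    by move=> h; exact: (L2loc_mu mu_rho h cK0).
  have L2t phi : continuous phi -> L2loc phi.
    move=> cphi; have := L2locM cphi (in_Lp_loc_L2 (s := 2) (f := cst 1) (lexx _) _).
    under eq_fun do rewrite mulr1.
    apply => K cK _; apply/in_Lp2P; first exact: compact_measurable_rV.
    split; first exact: measurable_cst.
    have mK := compact_measurable_rV cK.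
    have := integrable_indic_lty mK mK (leb_compact_lty cK).
    by apply: eq_integrable => // x /[!inE] Kx /=; rewrite indicE mem_set// expr1n.
  apply: integrable_EFinD => //; apply: integrable_EFinZ => //.
    do 2 apply: (@integrable_EFin_sum _ _ _ mu K0 mK0) => ?.
    apply: L2c; apply: L2t; apply: continuous_mul_rV; first exact: cst_continuous.
    exact: test_fun_continuous (tp _).
  apply: (@integrable_EFin_sum _ _ _ mu K0 mK0) => i.
  apply: L2c; under eq_fun do rewrite mulrC.
  by apply: L2locM => //; exact: (div_free_drift_L2loc d_ge2 p_gtd ass_a mu_rho).
(* One constant dominating each of 4 nu, beta^2 and the total integral of the remainder [r]. *)
pose c := 1 + 4 * nu + beta ^+ 2 + \int[mu]_x r x.
have ir0 : 0 <= \int[mu]_x r x by exact: Rintegral_ge0.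
have c0 : 0 <= c by rewrite !addr_ge0// ?sqr_ge0// mulr_ge0// ltW.
exists c => // F g g' Z zeta z M K V u w cut oV cV tbV pg.
have mV := open_measurable_rV oV.
have [iw [D [G [u_ [gu hpg]]]]] := perturbed_generator_test d_ge2 p_gtd ass_a mu_rho oV cV pg.
exists D, G, u_.
have sg : smooth1 g := smooth1_derive (cutoff_dF cut) (cutoff_F cut).
have cg' : continuous g'.
  exact: cont_diff1_continuous (smooth1_derive (cutoff_dg cut) sg 0%N).
have szeta : smooth1 zeta := smooth1_derive (cutoff_dZ cut) (cutoff_Z cut).
have cz : continuous z.
  exact: cont_diff1_continuous (smooth1_derive (cutoff_dzeta cut) szeta 0%N).
have tbb : test_fun V (b \* b) by exact: test_funM tbV sb.
have [L [Lc Lp]] := test_fun_bounded1 tbb.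
have gv := grad_cvg_comp mu_rho oV cV gu sg (cutoff_dg cut) cg' (cutoff_gM cut)
  (cutoff_g'M cut) (test_fun_smooth tbb) Lc Lp.
have tgb phi : test_fun V phi -> test_fun V ((g \o phi) \* (b \* b)).
  move=> tphi; have := test_funM tbb (smooth_comp sg (test_fun_smooth tphi)).
  by congr test_fun; apply/funext => x /=; rewrite mulrC.
have {}gv := gv tgb.
have M0 : 0 <= M by exact: le_trans (cutoff_gM cut 0).
have eE x : energy_density A D (fun i x => g (u x) * partial i (b \* b) x +
    (b \* b) x * (g' (u x) * D i x)) x =
  energy_density A D (fun i x => g (u x) * (2 * b x * partial i b x) +
      b x ^+ 2 * (g' (u x) * D i x)) x.
  apply: eq_bigr => i _; apply: eq_bigr => j _; congr (_ * _).
  by rewrite (partialM i x (sb 1%N) (sb 1%N)) /=; ring.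
have [|iE1 E1] := hpg _ _ _ _ (M * L) gv.
  by move=> x _; rewrite normrM ler_pM// (cutoff_gM cut).
(* The second test function, zeta(u): by [drift_primitive_eq0] its drift term vanishes, so it yields
   the integral of z(u) times half the energy density. *)
have gz : grad_cvg mu V (fun x => zeta (u x) * cst 1 x) (fun i x => zeta (u x) * partial i (cst 1) x
    + cst 1 x * (z (u x) * D i x)) (fun x => M * 1 + 1 * (M * G x)) (fun n => (zeta \o u_ n) \* cst 1).
  apply: (grad_cvg_comp mu_rho oV cV gu szeta (cutoff_dzeta cut) cz (cutoff_zetaM cut)
    (cutoff_zM cut)) => //.
  - exact: smooth_cst.
  - by move=> x; rewrite normr1.
  - by move=> i x; rewrite partial_cst normr0.
  - move=> phi tphi; have := test_fun_comp szeta (cutoff_zeta0 cut (lexx 0)) tphi.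
    by congr test_fun; apply/funext => x /=; rewrite mulr1.
have [|iE2 E2] := hpg _ _ _ _ M gz.
  by move=> x _; rewrite mulr1 (cutoff_zetaM cut).
have [tu mu' mD [mG G2] _] := gu.
have [_ D2] := grad_cvg_L2 mu_rho oV cV gu.
pose E x := energy_density A D D x.
have EzE x : energy_density A D (fun i x => zeta (u x) * partial i (cst 1) x
    + cst 1 x * (z (u x) * D i x)) x = z (u x) * E x.
  rewrite /E /energy_density mulr_sumr; apply: eq_bigr => i _; rewrite mulr_sumr.
  by apply: eq_bigr => j _; rewrite partial_cst mulr0 add0r mul1r mulrCA.
have {E2} : - (\int[mu]_(x in V) (w x * zeta (u x))) = \int[mu]_(x in V) (2^-1 * (z (u x) * E x)).
  have dp0 := drift_primitive_eq0 d_ge2 p_gtd ass_a mu_rho oV cV gu (cutoff_Z cut) (cutoff_Z0 cut)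
    (cutoff_dZ cut) (cont_diff1_continuous (szeta 0%N)) (cutoff_zetaM cut).
  have -> : \int[mu]_(x in V) (w x * zeta (u x)) = \int[mu]_(x in V) (w x * (zeta (u x) * cst 1 x)).
    by apply: eq_Rintegral => x _; rewrite mulr1.
  rewrite E2 RintegralZl//; last by apply: eq_integrable iE2 => // x _; rewrite /= EzE.
  have -> : \int[mu]_(x in V) ((\sum_i B x ord0 i * D i x) * (zeta (u x) * cst 1 x)) = 0.
    by rewrite -[RHS]dp0; apply: eq_Rintegral => x _; rewrite mulr1.
  by rewrite addr0 opprK; congr (_ * _); apply: eq_Rintegral => x _; rewrite EzE.
set J := - (\int[mu]_(x in V) (w x * zeta (u x))) => JE.
have iEz : mu.-integrable V (EFin \o (fun x => z (u x) * E x)).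
  by apply: eq_integrable iE2 => // x _; rewrite /= EzE.
have iX i : mu.-integrable V (EFin \o (fun x => (D i x * g (u x) * b x) ^+ 2)).
  under [X in _ \o X]eq_fun do rewrite -mulrA.
  apply: (integrable_sqr_bounded mV (D2 i) (M := M * beta)).
    apply: measurable_funM.
      apply: measurableT_comp => //; apply: continuous_measurable_fun.
      exact: cont_diff1_continuous (sg 0%N).
    by apply: measurable_funTS; exact: continuous_measurable_rV.
  by move=> x _; rewrite normrM ler_pM// (cutoff_gM cut).
set I := \int[mu]_(x in V) (w x * (g (u x) * b x ^+ 2)).
have IE : I = \int[mu]_(x in V) (- (2^-1 * energy_density A D (fun i x => g (u x) * (2 * b x * partial i b x) +
      b x ^+ 2 * (g' (u x) * D i x)) x) + (\sum_i B x ord0 i * D i x) * (g (u x) * b x ^+ 2)).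
  have -> : I = \int[mu]_(x in V) (w x * (g (u x) * (b \* b) x)).
    by apply: eq_Rintegral => x _; rewrite /= expr2.
  rewrite E1 -mulNr -RintegralZl// -RintegralD//; last 2 first.
  - exact: integrable_EFinZ.
  - apply: (integrable_drift_grad d_ge2 p_gtd ass_a mu_rho oV cV _ D2 _ (M := M * L)) => //.
      by have [_ ? _ _] := gv.
    by move=> x _; rewrite normrM ler_pM// (cutoff_gM cut).
  by apply: eq_Rintegral => x _; rewrite mulNr eE expr2.
have irV : mu.-integrable V (EFin \o r) by exact: integrableS ir.
have main : (4 * nu)^-1 * \int[mu]_(x in V) (\sum_i (D i x * g (u x) * b x) ^+ 2) <=
    I + K * beta ^+ 2 * J + \int[mu]_(x in V) r x.
  have iS : mu.-integrable V (EFin \o (fun x => \sum_i (D i x * g (u x) * b x) ^+ 2)).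
    exact: (@integrable_EFin_sum _ _ _ mu V mV).
  have iz2 : mu.-integrable V (EFin \o (fun x => 2^-1 * (z (u x) * E x))).
    exact: integrable_EFinZ.
  rewrite -RintegralZl// JE -RintegralZl// IE.
  have iP : mu.-integrable V (EFin \o (fun x =>
     - (2^-1 * energy_density A D (fun i x => g (u x) * (2 * b x * partial i b x) +
        b x ^+ 2 * (g' (u x) * D i x)) x) + (\sum_i B x ord0 i * D i x) * (g (u x) * b x ^+ 2))).
    apply: integrable_EFinD => //.
      apply: integrable_EFinN => //; apply: integrable_EFinZ => //.
      apply: eq_integrable iE1 => // x _ /=; congr EFin.
      exact: eE.
    have mgb : measurable_fun V (fun x => g (u x) * b x ^+ 2) by have [_ + _ _ _] := gv.
    apply: (integrable_drift_grad d_ge2 p_gtd ass_a mu_rho oV cV _ D2 mgb (M := M * L)) => //.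
    by move=> x _; rewrite normrM expr2 ler_pM// ?(cutoff_gM cut)//; exact: Lc.
  rewrite -RintegralD//; last exact: integrable_EFinZ.
  rewrite -RintegralD//; last by apply: integrable_EFinD => //; exact: integrable_EFinZ.
  apply: le_Rintegral => //.
  - exact: integrable_EFinZ.
  - by apply: integrable_EFinD => //; apply: integrable_EFinD => //; exact: integrable_EFinZ.
  move=> x Vx; have [Kx|nKx] := pselect (K0 x).
    have := @energy_lower_bound R d (A x) (D^~ x) (fun i => partial i b x) (fun i => B x ord0 i)
      (b x) (g (u x)) (g' (u x)) (z (u x)) K MA nu beta nu0 _ (fun i j => AM i j x Kx) (bb x)
      (cutoff_z0 cut _) (cutoff_K cut) (cutoff_ineq cut _).
    apply; have /andP[+ _] := hnu (\row_i D i x) x Kx; rewrite -energy_densityE.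
    by congr (_ * _ <= _); apply: eq_bigr => i _; rewrite mxE expr2.
  have b0 := bK0 _ nKx.
  rewrite big1 ?mulr0; last by move=> i _; rewrite b0 mulr0 expr0n.
  rewrite b0 expr0n/= !mulr0 addr0 addr_ge0// addr_ge0//.
    rewrite -mulrN mulr_ge0// oppr_ge0 /energy_density big1// => i _.
    by rewrite big1// => j _; rewrite b0; ring.
  have Ex0 : 0 <= E x.
    have [nuV nuV0 hV] := a_elliptic ass_a cV.
    have /andP[+ _] := hV (\row_i D i x) x Vx; rewrite -energy_densityE; apply: le_trans.
    rewrite mulr_ge0 ?invr_ge0 ?(ltW nuV0)//; apply: sumr_ge0 => i _.
    by rewrite -expr2 sqr_ge0.
  by rewrite !mulr_ge0 ?sqr_ge0 ?(cutoff_K cut) ?(cutoff_z0 cut).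
have J0 : 0 <= J.
  have [nuV nuV0 hV] := a_elliptic ass_a cV.
  rewrite JE; apply: Rintegral_ge0 => x Vx; rewrite mulr_ge0// mulr_ge0 ?(cutoff_z0 cut)//.
  have /andP[+ _] := hV (\row_i D i x) x Vx; rewrite -energy_densityE; apply: le_trans.
  rewrite mulr_ge0 ?invr_ge0 ?(ltW nuV0)//; apply: sumr_ge0 => i _.
  by rewrite -expr2 sqr_ge0.
have rV : \int[mu]_(x in V) r x <= \int[mu]_x r x.
  by apply: le_Rintegral_subset.
have X0 : 0 <= \int[mu]_(x in V) (\sum_i (D i x * g (u x) * b x) ^+ 2).
  by apply: Rintegral_ge0 => x _; apply: sumr_ge0 => i _; exact: sqr_ge0.
move: main; rewrite ler_pdivrMl ?mulr_gt0// => main.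
split=> //; apply: (final_bound _ J0 (cutoff_K cut) c0 main X0 rV).
- by rewrite /c -!addrA addrCA lerDl !addr_ge0// sqr_ge0.
- by rewrite /c addrAC lerDr !addr_ge0// mulr_ge0// ltW.
- by rewrite /c lerDr !addr_ge0// ?sqr_ge0// mulr_ge0// ltW.
- by rewrite mulr_gt0.
Qed.

(** Integrating by parts, the integral of F(u) d_i b dx is minus that of g(u) b D_i dx. Rewritten
    against mu, Cauchy-Schwarz reduces it to [core_gradient]. *)
Lemma core_estimate b i : test_fun setT b -> exists2 c, 0 <= c &
  forall F g g' Z zeta z M K V u w, cutoff F g g' Z zeta z M K ->
  open V -> relatively_compact V -> test_fun V b -> perturbed_generator mu A B V u w ->
  (\int[leb]_(x in V) (F (u x) * partial i b x)) ^+ 2 <=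
    c * (\int[mu]_(x in V) (w x * (g (u x) * b x ^+ 2)) + c +
      K * c * - (\int[mu]_(x in V) (w x * zeta (u x)))).
Proof.
move=> tb; have [c c0 hc] := core_gradient tb.
have [sb [K0 [cK0 _ bK0]]] := tb.
have mK0 := compact_measurable_rV cK0.
have rhoC : continuous rho := rho_continuous mu_rho.
have rVC : continuous (fun x => (rho x)^-1).
  by move=> x; apply: continuousV; [apply: lt0r_neq0; exact: (rho_gt0 mu_rho)|exact: rhoC].
(* The factor 1/rho converts dx into mu; restricted to the support of [b] it is square
   integrable. *)
pose k x := (rho x)^-1 * \1_K0 x.
have mk : measurable_fun setT k.
  by apply: measurable_funM; [exact: continuous_measurable_rV|exact: measurable_indic].
have ik : mu.-integrable setT (EFin \o (fun x => k x ^+ 2)).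
  have [N hN] := continuous_cpt_bounded cK0 rVC.
  apply: (@integrable_supp _ _ mu K0) => //.
    by move=> x Kx; rewrite /k indicE memNset// mulr0 expr0n.
  apply/(integrable_rho mu_rho) => //; first by apply: measurable_funX; exact: measurable_funTS.
  apply: (integrable_dominated mK0 (g := fun x => N * \1_K0 x)).
  - apply: measurable_funM; first by apply: measurable_funX; exact: measurable_funTS.
    by apply: measurable_funTS; exact: continuous_measurable_rV.
  - move=> x Kx; have := hN x Kx; rewrite /k indicE mem_set// !mulr1.
    have r0 : rho x != 0 by apply: lt0r_neq0; exact: (rho_gt0 mu_rho).
    by rewrite expr2 -mulrA mulVf// mulr1.
  - by apply: integrable_EFinZ => //; apply: integrable_indic_lty => //; exact: leb_compact_lty.
have c'0 : 0 <= \int[mu]_x k x ^+ 2 by apply: Rintegral_ge0 => x _; exact: sqr_ge0.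
exists (c * (1 + \int[mu]_x k x ^+ 2)); first by rewrite mulr_ge0// addr_ge0.
move=> F g g' Z zeta z M K V u w cut oV cV tbV pg.
have mV := open_measurable_rV oV.
have [D [G [u_ [gu J0 hD]]]] := hc _ _ _ _ _ _ _ _ _ _ _ cut oV cV tbV pg.
have sg : smooth1 g := smooth1_derive (cutoff_dF cut) (cutoff_F cut).
have cg : continuous g := cont_diff1_continuous (sg 0%N).
(* Only a function vanishing at 0 keeps compositions with test functions compactly supported. The
   constant F(0) is harmless, because d_i b has integral 0. *)
pose F0 y := F y - F 0.
have cF : continuous F := cont_diff1_continuous (cutoff_F cut 0%N).
have M0 : 0 <= M by exact: le_trans (cutoff_gM cut 0).
have gF : grad_cvg mu V (fun x => F0 (u x) * cst 1 x) (fun i x => F0 (u x) * partial i (cst 1) x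
    + cst 1 x * (g (u x) * D i x)) (fun x => M *+ 2 * 1 + 1 * (M *+ 2 * G x))
    (fun n => (F0 \o u_ n) \* cst 1).
  have sF0 : smooth1 F0 by apply: smooth1D; [exact: (cutoff_F cut)|exact: smooth1_cst].
  apply: (grad_cvg_comp mu_rho oV cV gu sF0 _ cg) => //.
  - move=> y; have := cutoff_dF cut y => dF.
    have := is_deriveB dF (is_derive_cst (F 0) y 1).
    by rewrite subr0.
  - move=> y; rewrite (le_trans (ler_normB _ _))// mulr2n lerD// (cutoff_FM cut)//.
  - by move=> y; rewrite (le_trans (cutoff_gM cut y))// mulr2n lerDl.
  - exact: smooth_cst.
  - by move=> x; rewrite normr1.
  - by move=> j x; rewrite partial_cst normr0.
  - move=> phi tphi; have := test_fun_comp sF0 (subrr _) tphi.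
    by congr test_fun; apply/funext => x /=; rewrite mulr1.
have [[_ _ hw] _] := grad_cvg_wpartial mu_rho oV cV gF i.
have [tu mu' mD [mG G2] _] := gu.
have [_ D2] := grad_cvg_L2 mu_rho oV cV gu.
pose X x := D i x * g (u x) * b x.
have mX : measurable_fun V X.
  apply: measurable_funM; last first.
    by apply: measurable_funTS; apply: continuous_measurable_rV; exact: test_fun_continuous tb.
  apply: measurable_funM => //; apply: measurableT_comp => //.
  exact: continuous_measurable_fun.
have cb := test_fun_continuous tb.
have tbi := test_fun_partial i tb.
have E : \int[leb]_(x in V) (F (u x) * partial i b x) = - (\int[mu]_(x in V) (X x * k x)).
  have ib : leb.-integrable V (EFin \o partial i b).
    apply: (@integrableS _ _ _ leb setT) => //.
    apply: (integrable_cpt cK0 (test_fun_continuous tbi)) => x Kx.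
    by rewrite (partial_eq0 i (compact_closed_rV cK0) bK0 Kx).
  have iF : leb.-integrable V (EFin \o (fun x => F (u x) * partial i b x)).
    under [Y in _ \o Y]eq_fun do rewrite mulrC.
    apply: (integrable_EFinM mV ib (M := M)).
      by apply: measurableT_comp => //; exact: continuous_measurable_fun.
    by move=> x _; exact: (cutoff_FM cut).
  have z0 : \int[leb]_(x in V) (F 0 * partial i b x) = 0.
    rewrite RintegralZl// (Rintegral_supp leb (f := partial i b)).
      by rewrite (integral_partial_eq0 i (sb 1%N) cK0 bK0) mulr0.
    by move=> x Vx; rewrite (test_fun_eq0 (test_fun_partial i tbV)).
  have -> : \int[leb]_(x in V) (F (u x) * partial i b x) =
      \int[leb]_(x in V) (F0 (u x) * cst 1 x * partial i b x).
    rewrite -[LHS]subr0 -z0 -RintegralB//; last exact: integrable_EFinZ.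
    by apply: eq_Rintegral => x _; rewrite mulr1 mulrBl.
  rewrite (hw b tbV) (Rintegral_rho mu_rho mV); last first.
    by apply: measurable_funM => //; exact: measurable_funTS.
  congr (- _); apply: eq_Rintegral => x _; rewrite partial_cst mulr0 add0r mul1r.
  rewrite /X /k indicE; have [Kx|nKx] := pselect (K0 x).
    have r0 : rho x != 0 by apply: lt0r_neq0; exact: (rho_gt0 mu_rho).
    by rewrite mem_set// mulr1 -[RHS]mulrA mulVf// mulr1; congr (_ * _); rewrite mulrC.
  by rewrite bK0// !mulr0 !mul0r.
rewrite E sqrrN.
have [beta beta0 bb] := test_fun_bounded tb.
have iXj j : mu.-integrable V (EFin \o (fun x => (D j x * g (u x) * b x) ^+ 2)).
  under [Y in _ \o Y]eq_fun do rewrite -mulrA.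
  apply: (integrable_sqr_bounded mV (D2 j) (M := M * beta)).
    apply: measurable_funM.
      by apply: measurableT_comp => //; exact: continuous_measurable_fun.
    by apply: measurable_funTS; exact: continuous_measurable_rV.
  by move=> x _; rewrite normrM ler_pM// (cutoff_gM cut).
have iX : mu.-integrable V (EFin \o (fun x => \sum_i (D i x * g (u x) * b x) ^+ 2)).
  apply: (@integrable_EFin_sum _ _ _ mu V mV) => j; exact: iXj.
have iX2 : mu.-integrable V (EFin \o (fun x => X x ^+ 2)) by exact: iXj.
have ikV : mu.-integrable V (EFin \o (fun x => k x ^+ 2)) by exact: integrableS ik.
apply: (le_trans (Rintegral_cauchy_schwarz mV mX (measurable_funTS mk) iX2 ikV)).
have XS : \int[mu]_(x in V) X x ^+ 2 <= \int[mu]_(x in V) (\sum_i (D i x * g (u x) * b x) ^+ 2).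
  apply: le_Rintegral => // x _; rewrite (bigD1 i)//= lerDl.
  by apply: sumr_ge0 => j _; exact: sqr_ge0.
have kV : \int[mu]_(x in V) k x ^+ 2 <= \int[mu]_x k x ^+ 2.
  by apply: le_Rintegral_subset => // x; exact: sqr_ge0.
apply: final_bound2 (le_trans XS hD) kV _ => //; last exact: (cutoff_K cut).
- by apply: Rintegral_ge0 => x _; exact: sqr_ge0.
- by apply: Rintegral_ge0 => x _; exact: sqr_ge0.
Qed.

End core_estimate.

(** * Smooth bounded substitutes for the logarithm *)

Section log_cutoff.
Context {R : realType}.
Variable k : R.
Hypotheses (k0 : 0 < k) (k8 : k <= 8^-1).

Let k2 : 0 < k ^+ 2. Proof. by rewrite exprn_gt0. Qed.

Lemma flat_bounded n (x : R) : flat n x <= n`!%:R.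
Proof.
have f0 : (0 < n`!%:R :> R) by rewrite ltr0n fact_gt0.
have [x0|x0] := ltP 0 x; last by rewrite flat_eq0// ltW.
rewrite /flat x0 expRN ler_pdivrMr ?expR_gt0//.
case: n f0 => [|n] f0; first by rewrite expr0 fact0 mul1r -expR0 ler_expR invr_ge0 ltW.
have y0 : 0 < x^-1 by rewrite invr_gt0.
rewrite mulrC -ler_pdivrMr//; apply: le_trans (expR_ge1Dxn n (ltW y0)).
by rewrite lerDr.
Qed.

(** The derivative of half of ln(y^2 + a). *)
Definition ratio (a y : R) : R := y / (y ^+ 2 + a).

Let den_gt0 (a y : R) : 0 < a -> 0 < y ^+ 2 + a.
Proof. by move=> a0; rewrite ltr_wpDl// sqr_ge0. Qed.

Let is_derive_sqrD (a y : R) : is_derive y 1 (fun y : R => y ^+ 2 + a) (2 * y).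
Proof.
have h := is_deriveD (is_deriveM (is_derive_id y (1 : R)) (is_derive_id y (1 : R))) (is_derive_cst a y 1).
by apply: (is_derive_eq h); rewrite addr0 /GRing.scale/= mulr1 mulr_natl mulr2n.
Qed.

Lemma is_derive_ratio (a y : R) : 0 < a ->
  is_derive y 1 (ratio a) ((a - y ^+ 2) / (y ^+ 2 + a) ^+ 2).
Proof.
move=> a0; have d0 : y ^+ 2 + a != 0 by rewrite gt_eqF// den_gt0.
have h := is_deriveM (is_derive_id y (1 : R)) (@is_deriveV _ (fun y : R => y ^+ 2 + a) y (2 * y) 1 d0 (is_derive_sqrD a y)).
apply: (is_derive_eq h); rewrite /GRing.scale/= /GRing.scale/=.
by field.
Qed.

Lemma is_derive_half_ln (a y : R) : 0 < a ->
  is_derive y 1 (fun y : R => 2^-1 * ln (y ^+ 2 + a)) (ratio a y).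
Proof.
move=> a0; have d0 := den_gt0 y a0.
have dl := is_derive1_ln d0.
have h := is_deriveZ 2^-1 (@is_derive1_comp _ (@ln R) (fun y : R => y ^+ 2 + a) y _ _ dl (is_derive_sqrD a y)).
apply: (is_derive_eq h); rewrite /GRing.scale/= /ratio.
by field; rewrite gt_eqF.
Qed.

Let smooth1_sqrD (a : R) : smooth1 (fun y : R => y ^+ 2 + a).
Proof. by apply: smooth1D (smooth1_cst a); exact: smooth1M smooth1_id smooth1_id. Qed.

Lemma smooth1_ratio (a : R) : 0 < a -> smooth1 (ratio a).
Proof.
move=> a0; apply: smooth1M smooth1_id _; apply: smooth1V (smooth1_sqrD a) => y.
by rewrite gt_eqF// den_gt0.
Qed.

(** With y = r + 4k this is half of ln((y^2 + k^2)/(y^2 + 1)): smooth on the whole line, close to ln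
    y between the scales k and 1, with values between ln k and 0. The shift by 4k makes the
    concavity inequality hold on r >= -2k without correction. *)
Definition cutF (r : R) := 2^-1 * ln ((r + 4 * k) ^+ 2 + k ^+ 2) - 2^-1 * ln ((r + 4 * k) ^+ 2 + 1).
Definition cutg (r : R) := ratio (k ^+ 2) (r + 4 * k) - ratio 1 (r + 4 * k).
Definition cutg' (r : R) := (k ^+ 2 - (r + 4 * k) ^+ 2) / ((r + 4 * k) ^+ 2 + k ^+ 2) ^+ 2 -
  (1 - (r + 4 * k) ^+ 2) / ((r + 4 * k) ^+ 2 + 1) ^+ 2.
(** A smooth function supported on the negative half-line with second derivative [flat 3] of -r; its
    derivative [cutzeta] vanishes for r >= 0. *)
Definition cutZ (r : R) := - r * flat 0 (- r).
Definition cutzeta (r : R) := - (flat 0 (- r) + flat 1 (- r)).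
Definition cutz (r : R) := flat 3 (- r).

Let is_derive_shift (f : R -> R) (r c l : R) : is_derive (r + c) 1 f l ->
  is_derive r 1 (fun r => f (r + c)) l.
Proof.
move=> h; have hs := is_deriveD (is_derive_id r (1 : R)) (is_derive_cst c r 1).
have := @is_derive1_comp _ f (fun r => r + c) r l (1 + 0) h hs.
by rewrite addr0 mulr1.
Qed.

Let is_derive_opp (f : R -> R) (r l : R) : is_derive (- r) 1 f l ->
  is_derive r 1 (fun r => f (- r)) (- l).
Proof.
move=> h; have hs := is_deriveN (is_derive_id r (1 : R)).
have := @is_derive1_comp _ f (fun r => - r) r l (- 1) h hs.
by rewrite mulrN1.
Qed.

Lemma is_derive_cutF (r : R) : is_derive r 1 cutF (cutg r).
Proof.
have h1 := is_derive_shift (@is_derive_half_ln _ (r + 4 * k) k2).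
have h2 := is_derive_shift (@is_derive_half_ln _ (r + 4 * k) ltr01).
exact: (is_deriveB h1 h2).
Qed.

Lemma is_derive_cutg (r : R) : is_derive r 1 cutg (cutg' r).
Proof.
have h1 := is_derive_shift (@is_derive_ratio _ (r + 4 * k) k2).
have h2 := is_derive_shift (@is_derive_ratio _ (r + 4 * k) ltr01).
exact: (is_deriveB h1 h2).
Qed.

Let flatS n (s : R) : s * flat n.+1 s = flat n s.
Proof.
have [s0|s0] := ltP 0 s; last by rewrite !flat_eq0// mulr0.
by rewrite /flat s0 exprS !mulrA mulfV ?gt_eqF// mul1r.
Qed.

Lemma is_derive_cutZ (r : R) : is_derive r 1 cutZ (cutzeta r).
Proof.
have h1 := is_derive_opp (is_derive_flat 0 (- r)).
have h := is_deriveM (is_deriveN (is_derive_id r (1 : R))) h1.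
apply: (is_derive_eq h); rewrite /GRing.scale/= mul0r subr0 /cutzeta.
by rewrite !fctE /= -(flatS 1); ring.
Qed.

Lemma is_derive_cutzeta (r : R) : is_derive r 1 cutzeta (cutz r).
Proof.
have h1 := is_derive_opp (is_derive_flat 0 (- r)).
have h2 := is_derive_opp (is_derive_flat 1 (- r)).
by apply: (is_derive_eq (is_deriveN (is_deriveD h1 h2))); rewrite /cutz; ring.
Qed.

Lemma smooth1_cutF : smooth1 cutF.
Proof.
have sh : smooth1 (fun r : R => r + 4 * k) by apply: smooth1D smooth1_id (smooth1_cst _).
have sg : smooth1 cutg.
  apply: (smooth1D (f := fun r => ratio (k ^+ 2) (r + 4 * k)) (g := fun r => - ratio 1 (r + 4 * k))).
    exact: (smooth1_comp (smooth1_ratio k2) sh).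
  rewrite (_ : (fun r => _) = cst (-1) \* (fun r => ratio 1 (r + 4 * k))).
    by apply: smooth1M (smooth1_cst _) _; exact: (smooth1_comp (smooth1_ratio ltr01) sh).
  by apply/funext => r /=; rewrite mulN1r.
case=> [|n]; first exact: is_derive_continuous is_derive_cutF.
by exists cutg; [exact: is_derive_cutF|exact: sg].
Qed.

Lemma smooth1_cutZ : smooth1 cutZ.
Proof.
have sN : smooth1 (fun r : R => - r).
  rewrite (_ : (fun r => _) = cst (-1) \* id); last by apply/funext => r /=; rewrite mulN1r.
  exact: smooth1M (smooth1_cst _) smooth1_id.
by apply: (smooth1M sN); exact: (smooth1_comp (smooth1_flat 0) sN).
Qed.

Lemma cutF_bounded r : 0 <= - cutF r <= - ln k.
Proof.
set y := r + 4 * k; have a0 := den_gt0 y k2; have b0 := den_gt0 y ltr01.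
have k1 : k ^+ 2 <= 1 by rewrite exprn_ile1// ?ltW// (le_lt_trans k8)// invf_lt1// ltr1n.
have h1 : ln (y ^+ 2 + k ^+ 2) <= ln (y ^+ 2 + 1) by rewrite ler_ln ?posrE// lerD2l.
have h2 : ln (y ^+ 2 + 1) + ln k *+ 2 <= ln (y ^+ 2 + k ^+ 2).
  rewrite -lnXn// -lnM ?posrE// ler_ln ?posrE ?mulr_gt0//.
  by rewrite mulrDl mul1r lerD2r ler_piMr ?sqr_ge0.
by rewrite /cutF -/y; apply/andP; split; move: h1 h2; rewrite mulr2n; lra.
Qed.

Lemma ratio_bounded (a y : R) : 0 < a -> a <= 1 -> `|ratio a y| <= a^-1.
Proof.
move=> a0 a1; have d0 := den_gt0 y a0.
rewrite normrM normfV (gtr0_norm d0) ler_pdivrMr// ler_pdivlMl// mulrC.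
rewrite -(real_normK (num_real y)); have := normr_ge0 y; set z := `|y| => z0.
have [z1|z1] := leP 1 z.
  by rewrite (@le_trans _ _ (z ^+ 2))// ?lerDl ?(ltW a0)// expr2 ler_wpM2l// (le_trans a1).
rewrite (@le_trans _ _ a)// ?ler_piMl ?(ltW a0) ?(ltW z1)//.
by rewrite lerDr sqr_ge0.
Qed.

Lemma ratio'_bounded (a y : R) : 0 < a -> `|(a - y ^+ 2) / (y ^+ 2 + a) ^+ 2| <= a^-1.
Proof.
move=> a0; have d0 := den_gt0 y a0.
rewrite normrM normfV (gtr0_norm (exprn_gt0 2 d0)) ler_pdivrMr ?exprn_gt0//.
rewrite ler_pdivlMl// expr2 (@le_trans _ _ (a * (y ^+ 2 + a)))//.
  rewrite ler_wpM2l ?(ltW a0)//; apply/ler_normlP; have := sqr_ge0 y.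
  by split; lra.
by rewrite ler_wpM2r ?(ltW d0)// lerDr sqr_ge0.
Qed.

Let k1 : k ^+ 2 <= 1.
Proof. by rewrite exprn_ile1// ?ltW// (le_lt_trans k8)// invf_lt1// ltr1n. Qed.

(* With [y = r + 4 k] and [N = (y^2 + k^2) (y^2 + 1)], one has [g = (1 - k^2) y / N] and
   [g' = - (1 - k^2) (3 y^4 + (1 + k^2) y^2 - k^2) / N^2]. *)
Lemma cut_ineq : exists2 K : R, 0 <= K &
  forall r, 3 / 4 * cutg r ^+ 2 <= - cutg' r + K * cutz r.
Proof.
(* For r < -2k put s = -r > 2k. The excess is at most 2 k^-4 s^-3, and [cutz] equals s^-3 e^(-1/s);
   the exponential in [K] compensates, since 1/s < 1/(2k). *)
pose K := 2 * k^-1 ^+ 4 * expR ((2 * k)^-1).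
have K0 : 0 <= K by rewrite !mulr_ge0 ?expR_ge0// ?exprn_ge0// invr_ge0 ltW.
exists K => // r; set y := r + 4 * k.
have a0 := den_gt0 y k2; have b0 := den_gt0 y ltr01.
pose N := (y ^+ 2 + k ^+ 2) * (y ^+ 2 + 1).
have N0 : 0 < N by rewrite mulr_gt0.
have gE : cutg r ^+ 2 = (1 - k ^+ 2) ^+ 2 * y ^+ 2 / N ^+ 2.
  by rewrite /cutg /ratio -/y /N; field; rewrite !gt_eqF.
have g'E : - cutg' r = (1 - k ^+ 2) * (3 * (y ^+ 2 * y ^+ 2) + (1 + k ^+ 2) * y ^+ 2 - k ^+ 2) / N ^+ 2.
  by rewrite /cutg' -/y /N; field; rewrite !gt_eqF.
have Y0 := sqr_ge0 y; have k1' := k1.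
(* For y >= 2k one has y^2 >= 4k^2, and the logarithm-like inequality is a polynomial one; otherwise
   the correction term takes over. *)
have [ry|ry] := leP (2 * k) y.
  apply: (@le_trans _ _ (- cutg' r)); last by rewrite lerDl mulr_ge0// flat_ge0.
  rewrite gE g'E [X in X <= _]mulrA ler_wpM2r ?invr_ge0 ?sqr_ge0//.
  have y2 : 4 * k ^+ 2 <= y ^+ 2.
    rewrite -[4](_ : 2 ^+ 2 = _) -?exprMn ?lerXn2r ?nnegrE ?mulr_ge0 ?(ltW k0)//.
      by rewrite (le_trans _ ry)// mulr_ge0// ltW.
    by rewrite -natrX.
  move: y2 k1' Y0; have := sqr_ge0 k; set Y := y ^+ 2; set k' := k ^+ 2.
  move=> k'0 y2 k1' Y0.
  have h : 3 / 4 * (1 - k') * Y <= 3 * (Y * Y) + (1 + k') * Y - k'.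
    by have := mulr_ge0 k'0 Y0; have := mulr_ge0 Y0 Y0; lra.
  have := ler_wpM2l (_ : 0 <= 1 - k') h; rewrite subr_ge0 => /(_ k1').
  by lra.
pose s := - r; have sE : s = 4 * k - y by rewrite /s /y; ring.
have s0 : 0 < s by move: k0 ry; rewrite sE; lra.
have zK : 2 * k^-1 ^+ 4 * s^-1 ^+ 3 <= K * cutz r.
  have -> : K * cutz r = 2 * k^-1 ^+ 4 * s^-1 ^+ 3 * expR ((2 * k)^-1 - s^-1).
    by rewrite /cutz /flat -/s s0 /K expRD; ring.
  rewrite ler_peMr//; first by rewrite !mulr_ge0 ?exprn_ge0// invr_ge0 ltW.
  rewrite -[X in X <= _]expR0 ler_expR subr_ge0 lef_pV2 ?posrE ?mulr_gt0//.
  by move: ry; rewrite sE; lra.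
suff h : 3 / 4 * cutg r ^+ 2 - - cutg' r <= 2 * k^-1 ^+ 4 * s^-1 ^+ 3.
  by rewrite -lerBlDl (le_trans h).
have h1 : 3 / 4 * cutg r ^+ 2 - - cutg' r <= (y ^+ 2 + 1) / N ^+ 2.
  rewrite gE g'E [X in X - _]mulrA -mulrBl ler_wpM2r ?invr_ge0 ?sqr_ge0//.
  move: k1' Y0 (sqr_ge0 k); set Y := y ^+ 2; set k' := k ^+ 2 => k1' Y0 k'0.
  have q0 : 0 <= 1 - k' by rewrite subr_ge0.
  have := mulr_ge0 q0 (mulr_ge0 Y0 Y0); have := mulr_ge0 q0 Y0.
  have := mulr_ge0 q0 (mulr_ge0 k'0 Y0); have := mulr_ge0 k'0 Y0.
  have := mulr_ge0 k'0 k'0; have := mulr_ge0 q0 k'0; lra.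
apply: (le_trans h1); rewrite ler_pdivrMr ?exprn_gt0//.
(* Since s = 4k - y with k at most 1/8, s is bounded by 1 + y^2 and s^2 by twice that. *)
have s3 : s ^+ 3 <= 2 * (1 + y ^+ 2) ^+ 2.
  have sa : s <= 1 + y ^+ 2.
    by have := sqr_ge0 (y + 2^-1); rewrite sE; move: k8; lra.
  have sb : s ^+ 2 <= 2 * (1 + y ^+ 2).
    have : s ^+ 2 <= 2 * (4 * k) ^+ 2 + 2 * y ^+ 2.
      by have := sqr_ge0 (4 * k + y); rewrite sE; lra.
    have : (4 * k) ^+ 2 <= 1 ^+ 2.
      by rewrite lerXn2r ?nnegrE ?mulr_ge0 ?(ltW k0)//; move: k8; lra.
    by rewrite expr1n; lra.
  rewrite exprS mulrC [X in _ <= X](_ : _ = 2 * (1 + y ^+ 2) * (1 + y ^+ 2)); last by ring.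
  by rewrite ler_pM ?sqr_ge0 ?(ltW s0).
have kN : k ^+ 2 * (1 + y ^+ 2) <= y ^+ 2 + k ^+ 2.
  by rewrite mulrDr mulr1 addrC lerD2r ler_piMl.
have kN2 : k ^+ 4 * (1 + y ^+ 2) ^+ 2 <= (y ^+ 2 + k ^+ 2) ^+ 2.
  rewrite -[4%N]/(2 * 2)%N exprM -exprMn lerXn2r ?nnegrE ?(ltW a0)//.
  by rewrite mulr_ge0 ?sqr_ge0 ?addr_ge0.
have sk : (y ^+ 2 + 1) * (k ^+ 4 * s ^+ 3) <= 2 * N ^+ 2.
  apply: (@le_trans _ _ ((y ^+ 2 + 1) * (k ^+ 4 * (2 * (1 + y ^+ 2) ^+ 2)))).
    by rewrite ler_wpM2l ?(ltW b0)// ler_wpM2l// exprn_ge0// ltW.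
  rewrite [leLHS](_ : _ = 2 * ((y ^+ 2 + 1) * (k ^+ 4 * (1 + y ^+ 2) ^+ 2))); last by ring.
  rewrite ler_wpM2l// /N exprMn mulrC ler_pM ?(ltW b0)//.
    by rewrite mulr_ge0 ?sqr_ge0 ?exprn_ge0// ltW.
  by rewrite expr2 ler_peMl ?(ltW b0)// lerDr.
have p1 : 0 < k ^+ 4 * s ^+ 3 by rewrite mulr_gt0 ?exprn_gt0.
rewrite [leRHS](_ : _ = 2 * N ^+ 2 / (k ^+ 4 * s ^+ 3)); last first.
  by rewrite !exprVn; field; rewrite !gt_eqF.
by rewrite ler_pdivlMr.
Qed.

Lemma log_cutoff : exists M K : R, cutoff cutF cutg cutg' cutZ cutzeta cutz M K.
Proof.
have [K K0 hK] := cut_ineq.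
pose M := - ln k + 2 * (k ^+ 2)^-1 + 6 + 2.
have lk : 0 <= - ln k.
  by have /andP[] := cutF_bounded 0; exact: le_trans.
have i1 : 1 <= (k ^+ 2)^-1 by rewrite invf_ge1.
exists M, K; split.
- exact: smooth1_cutF.
- exact: smooth1_cutZ.
- by rewrite /cutZ oppr0 mul0r.
- exact: is_derive_cutF.
- exact: is_derive_cutg.
- exact: is_derive_cutZ.
- exact: is_derive_cutzeta.
- move=> r; have /andP[h1 h2] := cutF_bounded r.
  by rewrite -normrN ger0_norm// /M (le_trans h2)// -!addrA lerDl; lra.
- move=> r; rewrite (le_trans (ler_normB _ _))//.
  have := ratio_bounded (r + 4 * k) k2 k1; have := ratio_bounded (r + 4 * k) ltr01 (lexx _).
  by rewrite invr1 /M; lra.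
- move=> r; rewrite (le_trans (ler_normB _ _))//.
  have := ratio'_bounded (r + 4 * k) k2; have := ratio'_bounded (r + 4 * k) ltr01.
  by rewrite invr1 /M; lra.
- move=> r; rewrite normrN ger0_norm ?addr_ge0 ?flat_ge0//.
  have := flat_bounded 0 (- r); have := flat_bounded 1 (- r); rewrite fact0 (_ : 1`!%:R = 1)//.
  by rewrite /M; lra.
- move=> r; rewrite ger0_norm ?flat_ge0//.
  by have := flat_bounded 3 (- r); rewrite (_ : 3`!%:R = 6)// /M /cutz; lra.
- by move=> r; exact: flat_ge0.
- by move=> y y0; rewrite /cutzeta !flat_eq0 ?oppr_le0// addr0 oppr0.
- exact: K0.
- exact: hK.
Qed.

End log_cutoff.

(** * From the local operators to the generator of the L^1 semigroup *)

Section L1_subsequence.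
Context d (T : measurableType d) (R : realType) (mu : {measure set T -> \bar R}).

(** Along a subsequence whose integrals are summable, the series of the functions is integrable,
    hence finite almost everywhere, so its terms tend to 0. *)
Lemma L1_cvg_subseq (f : nat -> T -> R) :
  (forall n, measurable_fun setT (f n)) -> (forall n x, 0 <= f n x) ->
  (\int[mu]_x (f n x)%:E)%E @[n --> \oo] --> 0%E ->
  exists k : nat -> nat, (forall n, (n <= k n)%N) /\
    \forall x \ae mu, f (k n) x @[n --> \oo] --> (0 : R).
Proof.
move=> mf f0 /ge0_cvge0P h.
have I0 n : (0 <= \int[mu]_x (f n x)%:E)%E by apply: integral_ge0 => x _; rewrite lee_fin.
have e0 n : (0 : R) < 1 / (2 ^ n.+1)%:R by rewrite divr_gt0// ltr0n expn_gt0.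
have /choice[k hk] : forall n, exists k, (n <= k)%N /\ (\int[mu]_x (f k x)%:E <= (1 / (2 ^ n.+1)%:R)%:E)%E.
  move=> n; have [N _ hN] := h I0 _ (e0 n).
  by exists (maxn n N); split; [exact: leq_maxl|apply: hN => /=; exact: leq_maxr].
exists k; split; first by move=> n; have [] := hk n.
have mF n : measurable_fun setT (fun x => (f (k n) x)%:E) by exact/measurable_EFinP.
have F0 n x : (0 <= (f (k n) x)%:E)%E by rewrite lee_fin.
pose S x : \bar R := (\sum_(0 <= n <oo) (f (k n) x)%:E)%E.
have S0 x : (0 <= S x)%E by exact: nneseries_ge0.
have iS : mu.-integrable setT S.
  apply/integrableP; split; first by apply: ge0_emeasurable_sum.
  under eq_integral do rewrite gee0_abs//.
  rewrite integral_nneseries//; apply: (@le_lt_trans _ _ (1 : R)%:E); last by rewrite ltry.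
  apply: (le_trans _ (epsilon_trick0 predT (@ler01 R))).
  apply: lee_nneseries => n _; first by move=> _; exact: integral_ge0.
  by have [] := hk n.
apply: filterS (integrable_ae measurableT iS) => x /(_ I) Sx.
have : cvgn (series (fun n => f (k n) x)).
  apply: nondecreasing_is_cvgn; first by apply: nondecreasing_series => n _ _.
  exists (fine (S x)) => _ [n _ <-]; rewrite -lee_fin fineK//.
  have := @nneseries_lim_ge _ _ predT 0%N n (fun n _ _ => F0 n x).
  by rewrite sumEFin /series/=.
by move=> /cvg_series_cvg_0.
Qed.

End L1_subsequence.

Section generator_estimate.
Context {R : realType} {d : nat} (p : R).
Local Notation Rd := 'rV[R]_d.
Local Notation leb := (lebesgue_rV R d).
Variables (A C : Rd -> 'M[R]_d) (H : Rd -> Rd) (rho : Rd -> R).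
Variable mu : {measure set Rd -> \bar R}.
Variable T : R -> (Rd -> R) -> (Rd -> R).
Hypotheses (d_ge2 : (2 <= d)%N) (p_gtd : d%:R < p).
Hypothesis ass_a : assumption_a p A C H.
Hypothesis mu_rho : inf_invariant_density p A (drift A C H) rho mu.
Hypothesis T_mu : L1_semigroup_construction mu A (drift A C H) rho T.
Local Notation B := (div_free_drift A C H rho).

Let sgT := glob_semigroup T_mu.

Lemma Lp_dist1_triangle V f g h : measurable V -> measurable_fun V f -> measurable_fun V g ->
  measurable_fun V h -> (Lp_dist mu V 1 f h <= Lp_dist mu V 1 f g + Lp_dist mu V 1 g h)%E.
Proof.
move=> mV mf mg mh; rewrite !Lp_dist1E -ge0_integralD//; last 2 first.
- by apply/measurable_EFinP; apply: measurableT_comp => //; exact: measurable_funB.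
- by apply/measurable_EFinP; apply: measurableT_comp => //; exact: measurable_funB.
apply: ge0_le_integral => //.
- by apply/measurable_EFinP; apply: measurableT_comp => //; exact: measurable_funB.
- by apply: emeasurable_funD; apply/measurable_EFinP; apply: measurableT_comp => //; exact: measurable_funB.
- by move=> x _; rewrite -EFinD lee_fin -[f x - h x](subrKA (g x)) ler_normD.
Qed.

Lemma Lp_dist1_fin V f g : measurable V -> in_Lp mu V 1 f -> in_Lp mu V 1 g ->
  Lp_dist mu V 1 f g = (\int[mu]_(x in V) `|f x - g x|)%:E.
Proof.
move=> mV fL gL; rewrite Lp_dist1E EFin_Rintegral//.
by apply: integrable_norm; apply: integrable_EFinB => //; exact/in_Lp1P.
Qed.

Let i1 f : in_Lp mu setT 1 f <-> mu.-integrable setT (EFin \o f).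
Proof. exact: in_Lp1P. Qed.

Let i1B f g : in_Lp mu setT 1 f -> in_Lp mu setT 1 g -> mu.-integrable setT (EFin \o (fun x => `|f x - g x|)).
Proof. by move=> /i1 ? /i1 ?; apply: integrable_norm; exact: integrable_EFinB. Qed.

Let quot_L1 t u : 0 < t -> in_Lp mu setT 1 u ->
  in_Lp mu setT 1 (fun x => (T t u x - u x) / t).
Proof.
move=> t0 uL; apply/i1; under [X in _ \o X]eq_fun do rewrite mulrC.
apply: integrable_EFinZ => //; apply: integrable_EFinB => //; apply/i1 => //.
exact: (sg_L1 sgT).
Qed.

Lemma contraction_Rintegral t f : 0 < t -> in_Lp mu setT 1 f ->
  \int[mu]_x `|T t f x| <= \int[mu]_x `|f x|.
Proof.
move=> t0 fL; have := sg_contraction sgT t0 fL.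
have z : in_Lp mu setT 1 (cst 0 : Rd -> R) by apply/i1; exact: integrable0.
rewrite !Lp_dist1_fin//; last exact: (sg_L1 sgT).
rewrite lee_fin; under eq_Rintegral do rewrite subr0.
by under [X in _ <= X -> _]eq_Rintegral do rewrite subr0.
Qed.

(** Injectivity of 1 - L for the generator L of a contraction semigroup. With v = u' - u one has L v
    = v, so (1 + 1/t) v differs from T_t v / t by an error tending to 0 in L^1; contraction cancels
    the 1/t terms and leaves the norm of v below the error. *)
Lemma generator_ext u u' w w' : generator mu setT T u w -> generator mu setT T u' w' ->
  ae_eq mu setT (fun x => u' x - w' x) (fun x => u x - w x) ->
  ae_eq mu setT u' u /\ ae_eq mu setT w' w.
Proof.
move=> [uL wL uw] [u'L w'L u'w'] e.
suff h : ae_eq mu setT u' u.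
  by split=> //; apply: filterS2 e h => x e h _; have := e I; have := h I; lra.
pose v x := (-1) * u x + u' x.
have vL : in_Lp mu setT 1 v.
  by apply/i1; apply: integrable_EFinD; [| apply: integrable_EFinZ|] => //; exact/i1.
have iv : mu.-integrable setT (EFin \o (fun x => `|v x|)) by apply: integrable_norm; exact/i1.
suff v0 : \int[mu]_x `|v x| = 0.
  have := Rintegral_eq0_ae measurableT (fun x _ => normr_ge0 (v x)) iv v0.
  apply: filterS => x hx _; have /eqP := hx I; rewrite normr_eq0 /v => /eqP.
  by lra.
apply/eqP; rewrite eq_le Rintegral_ge0// andbT; apply/ler_addgt0Pr => e' e'0; rewrite add0r.
have e20 : 0 < e' / 2 by rewrite divr_gt0.
have /ge0_cvge0P -/(_ (fun=> Lnorm_ge0 _ _ _) _ e20) n1 := uw.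
have /ge0_cvge0P -/(_ (fun=> Lnorm_ge0 _ _ _) _ e20) n2 := u'w'.
have [t [t0 n1t n2t]] : exists t : R, [/\ 0 < t,
    (Lp_dist mu setT 1 (fun x => ((T t u x - u x) / t)%R) w <= (e' / 2)%:E)%E &
    (Lp_dist mu setT 1 (fun x => ((T t u' x - u' x) / t)%R) w' <= (e' / 2)%:E)%E].
  apply: (@filter_ex _ (0 : R)^'+); near=> t; split; near: t.
  - exact: nbhs_right_gt.
  - exact: n1.
  - exact: n2.
move: n1t n2t; rewrite !Lp_dist1_fin//; [|exact: quot_L1..]; rewrite !lee_fin => n1t n2t.
have TvL := sg_L1 sgT t0 vL.
have iTv : mu.-integrable setT (EFin \o (fun x => `|T t v x|)) by apply: integrable_norm; exact/i1.
have q1 := i1B (quot_L1 t0 uL) wL; have q2 := i1B (quot_L1 t0 u'L) w'L.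
have lin := sg_linear sgT (-1) t0 uL u'L.
have : \int[mu]_x ((t^-1 + 1) * `|v x|) <= \int[mu]_x (t^-1 * `|T t v x| +
   (`|(T t u' x - u' x) / t - w' x| + `|(T t u x - u x) / t - w x|)).
  apply: le_Rintegral_ae => //.
  - exact: integrable_EFinZ.
  - by apply: integrable_EFinD => //; [exact: integrable_EFinZ|exact: integrable_EFinD].
  - apply: filterS2 lin e => x lin e _.
    have ti : 0 < t^-1 by rewrite invr_gt0.
    have t1 : 0 <= t^-1 + 1 by rewrite addr_ge0// ltW.
    rewrite -{1}(ger0_norm t1) -normrM -[in X in X * `|T t v x|](gtr0_norm ti) -normrM.
    rewrite (_ : (t^-1 + 1) * v x = t^-1 * T t v x - (((T t u' x - u' x) / t - w' x) -
       ((T t u x - u x) / t - w x))).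
      by rewrite (le_trans (ler_normB _ _))// lerD2l ler_normB.
    rewrite (lin I) /v; have := e I; set a := T t u x; set b := T t u' x; move=> ee.
    have -> : w' x = u' x - (u x - w x) by rewrite -ee; ring.
    by ring.
rewrite RintegralZl// RintegralD//; last 2 first.
- exact: integrable_EFinZ.
- exact: integrable_EFinD.
rewrite RintegralZl// RintegralD// mulrDl mul1r.
have := ler_wpM2l (ltW (_ : 0 < t^-1)) (contraction_Rintegral t0 vL); rewrite invr_gt0 => /(_ t0).
set a := t^-1 * _; set b := t^-1 * _ => ab h; move: (lerD n2t n1t); rewrite -splitr => h3.
by have := le_trans h (lerD ab h3); rewrite lerD2l.
Unshelve. all: by end_near.
Qed.

(** With f = u - w, the local resolvents at 1 of f converge to the global one, which is [u] by
    [generator_ext]. Each local resolvent is approximated within 1/(n+1) by the operator before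
    closure, which is where the energy estimate is available. The boxes start from one containing
    the support of [b]. *)
Lemma generator_approx b u w : test_fun setT b -> generator mu setT T u w ->
  exists (V : nat -> set Rd) (u_ w_ : nat -> Rd -> R),
  [/\ forall n, [/\ open (V n), relatively_compact (V n) & test_fun (V n) b],
    forall n, perturbed_generator mu A B (V n) (u_ n) (w_ n),
    forall x, \forall n \near \oo, V n x,
    forall n, (measurable_fun (V n) (u_ n)) /\ mu.-integrable (V n) (EFin \o w_ n) &
    (\int[mu]_x `|((u_ n \- u) \_ (V n)) x|%:E)%E @[n --> \oo] --> 0%E /\
    (\int[mu]_x `|((w_ n \- w) \_ (V n)) x|%:E)%E @[n --> \oo] --> 0%E].
Proof.
move=> tb guw; have [sb [K [cK _ bK]]] := tb.
have [r r0 Kr] := compact_sub_obox cK.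
pose V n : set Rd := obox (const_mx (- (r + n%:R))) (const_mx (r + n%:R)).
have oV n : open (V n) by exact: open_obox.
have mV n : measurable (V n) := open_measurable_rV (oV n).
have cV n : relatively_compact (V n).
  have cc := @compact_cbox R d (const_mx (- (r + n%:R))) (const_mx (r + n%:R)).
  apply: (subclosed_compact _ cc); first exact: closed_closure.
  rewrite [X in _ `<=` X](closure_id _).1; last exact: compact_closed_rV.
  by apply: closure_subset; exact: obox_cbox.
have tV n : test_fun (V n) b.
  split=> //; exists K; split=> // x /Kr h i; have := h i; rewrite !mxE => /andP[h1 h2].
  by rewrite (le_lt_trans _ h1) ?(lt_le_trans h2)// ?lerN2 lerDl.
have Vx (x : Rd) : \forall n \near \oo, V n x.
  have [N hN] : exists N : nat, forall i, `|x ord0 i| <= N%:R.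
    have /choice[N hN] : forall i, exists N : nat, `|x ord0 i| <= N%:R.
      by move=> i; exists (truncn `|x ord0 i|).+1; apply/ltW/truncnS_gt.
    exists (\max_i N i)%N => i; apply: (le_trans (hN i)); rewrite ler_nat.
    exact: leq_bigmax.
  exists N => // n /= Nn i; rewrite !mxE -ltr_norml (le_lt_trans (hN i))//.
  by rewrite (@le_lt_trans _ _ n%:R) ?ler_nat// ltrDr.
have exh : exhaustion V.
  split=> //.
  - move=> n x h i; have := h i; rewrite !mxE => /andP[h1 h2].
    by rewrite (le_lt_trans _ h1) ?(lt_le_trans h2)// ?lerN2 lerD2l ler_nat.
  - apply/seteqP; split=> // x _; have [N _ hN] := Vx x.
    by exists N => //; apply: hN => /=.
have [uL wL _] := guw.
pose f x := u x - w x.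
have fL : in_Lp mu setT 1 f by apply/i1; apply: integrable_EFinB => //; exact/i1.
have [g_ [u' [lr [w' gu'w' eu'] gcv]]] := glob_resolvent T_mu ltr01 fL exh.
have [u'u w'w] : ae_eq mu setT u' u /\ ae_eq mu setT w' w.
  apply: (generator_ext guw gu'w').
  by apply: filterS eu' => x h _; have := h I; rewrite mul1r.
have /choice[W_ hW] : forall n, exists W, closed_perturbed_generator mu A B (V n) (g_ n) W /\
    ae_eq mu (V n) (fun x => 1 * g_ n x - W x) f.
  by move=> n; have [[W c e] _] := lr n; exists W.
have n0 n : (0 : R) < n.+1%:R^-1 by rewrite invr_gt0.
have /choice[uw huw] : forall n, exists uw : (Rd -> R) * (Rd -> R),
   [/\ perturbed_generator mu A B (V n) uw.1 uw.2,
    (Lp_dist mu (V n) 1 uw.1 (g_ n) <= n.+1%:R^-1%:E)%E &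
    (Lp_dist mu (V n) 1 uw.2 (W_ n) <= n.+1%:R^-1%:E)%E].
  move=> n; have [[gL WL [a_ [c_ [pg /ge0_cvge0P ha /ge0_cvge0P hc]]]] _] := hW n.
  have h1 := ha (fun=> Lnorm_ge0 _ _ _) _ (n0 n).
  have h2 := hc (fun=> Lnorm_ge0 _ _ _) _ (n0 n).
  have [m [h1m h2m]] := @filter_ex _ \oo _ _ (filterI h1 h2).
  by exists (a_ m, c_ m); split=> //; exact: pg.
pose u_ n := (uw n).1; pose w_ n := (uw n).2.
exists V, u_, w_.
have iu n : in_Lp mu (V n) 1 (g_ n) by have [[]] := hW n.
have iW n : in_Lp mu (V n) 1 (W_ n) by have [[]] := hW n.
have wnL n : in_Lp mu (V n) 1 (w_ n) by have [[]] := huw n.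
have mu_ n : measurable_fun (V n) (u_ n).
  by have [[uoo _ _] _ _] := huw n; exact: in_Lp_measurable uoo.
split=> //.
- by move=> n; have [] := huw n.
- by move=> n; split=> //; apply/in_Lp1P.
have mu0 : measurable_fun setT u by exact: in_Lp_measurable uL.
have mw0 : measurable_fun setT w by exact: in_Lp_measurable wL.
have restr (f1 f2 : Rd -> R) n : (\int[mu]_x `|((f1 \- f2) \_ (V n)) x|%:E)%E = Lp_dist mu (V n) 1 f1 f2.
  rewrite Lp_dist1E [RHS]integral_mkcond; apply: eq_integral => x _.
  by rewrite /patch; case: ifPn => // _; rewrite normr0.
pose e n := (n.+1%:R^-1%:E + Lp_dist mu setT 1 (g_ n) u')%E.
have e0 : e n @[n --> \oo] --> 0%E.
  rewrite -[X in _ --> X]adde0; apply: cvgeD => //.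
  by apply: cvg_EFin; [exact: nearW|exact: cvg_harmonic].
have gn n : (Lp_dist mu (V n) 1 (g_ n) u <= Lp_dist mu setT 1 (g_ n) u')%E.
  have gm : measurable_fun setT (g_ n).
    rewrite (_ : g_ n = g_ n \_ (V n)).
      exact: (proj1 (measurable_restrictT _ (mV n)) (in_Lp_measurable (mV n) (iu n))).
    have [_ g0] := lr n; apply/funext => x; rewrite /patch; case: ifPn => // /negP Vn.
    by rewrite g0// => /mem_set.
  have mu'0 : measurable_fun setT u' by have [u'L _ _] := gu'w'; exact: in_Lp_measurable u'L.
  rewrite !Lp_dist1E (@le_trans _ _ (\int[mu]_(x in V n) `|g_ n x - u' x|%:E)%E)//.
    apply: ae_ge0_le_integral => //.
    - by apply/measurable_EFinP/measurable_funTS; apply: measurableT_comp => //; exact: measurable_funB.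
    - by apply/measurable_EFinP/measurable_funTS; apply: measurableT_comp => //; exact: measurable_funB.
    - by apply: filterS u'u => x h _; rewrite h.
  apply: ge0_subset_integral => //.
  by apply/measurable_EFinP; apply: measurableT_comp => //; exact: measurable_funB.
have Wn n : Lp_dist mu (V n) 1 (W_ n) w = Lp_dist mu (V n) 1 (g_ n) u.
  have mW := in_Lp_measurable (mV n) (iW n); have mg := in_Lp_measurable (mV n) (iu n).
  rewrite !Lp_dist1E; apply: ge0_ae_eq_integral => //.
  - apply/measurable_EFinP; apply: measurableT_comp => //; apply: measurable_funB => //.
    exact: measurable_funTS.
  - apply/measurable_EFinP; apply: measurableT_comp => //; apply: measurable_funB => //.
    exact: measurable_funTS.
  have [_ h] := hW n; apply: filterS h => x h Vnx; have := h Vnx; rewrite /f => h'.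
  by congr (`| _ |)%:E; lra.
split; apply: (squeeze_cvge _ (cvg_cst 0%E) e0); apply: nearW => n; rewrite integral_ge0//= restr.
- apply: (le_trans (Lp_dist1_triangle (mV n) (mu_ n) (in_Lp_measurable (mV n) (iu n)) (measurable_funTS mu0))).
  by have [_ h _] := huw n; apply: leeD.
- apply: (le_trans (Lp_dist1_triangle (mV n) (in_Lp_measurable (mV n) (wnL n)) (in_Lp_measurable (mV n) (iW n)) (measurable_funTS mw0))).
  by have [_ _ h] := huw n; rewrite Wn; apply: leeD.
Qed.

End generator_estimate.

Section generator_estimate.
Context {R : realType} {d : nat} (p : R).
Local Notation Rd := 'rV[R]_d.
Local Notation leb := (lebesgue_rV R d).
Variables (A C : Rd -> 'M[R]_d) (H : Rd -> Rd) (rho : Rd -> R).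
Variable mu : {measure set Rd -> \bar R}.
Variable T : R -> (Rd -> R) -> (Rd -> R).
Hypotheses (d_ge2 : (2 <= d)%N) (p_gtd : d%:R < p).
Hypothesis ass_a : assumption_a p A C H.
Hypothesis mu_rho : inf_invariant_density p A (drift A C H) rho mu.
Hypothesis T_mu : L1_semigroup_construction mu A (drift A C H) rho T.

(** Convergence of w_n in L^1 is paired with uniformly bounded factors, and the remaining factor
    converges almost everywhere with u_n and is dominated. *)
Lemma local_limit (V : nat -> set Rd) (u_ w_ : nat -> Rd -> R) (u w : Rd -> R)
    (Phi : R -> R) (h : Rd -> R) (M N : R) :
  (forall n, measurable (V n)) -> (forall x, \forall n \near \oo, V n x) ->
  (forall n, measurable_fun (V n) (u_ n)) -> measurable_fun setT u ->
  (forall n, mu.-integrable (V n) (EFin \o w_ n)) -> mu.-integrable setT (EFin \o w) ->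
  (\forall x \ae mu, u_ n x @[n --> \oo] --> u x) ->
  (\int[mu]_x `|((w_ n \- w) \_ (V n)) x|%:E)%E @[n --> \oo] --> 0%E ->
  continuous Phi -> (forall y, `|Phi y| <= M) ->
  measurable_fun setT h -> (forall x, `|h x| <= N) ->
  \int[mu]_(x in V n) (w_ n x * (Phi (u_ n x) * h x)) @[n --> \oo] -->
    \int[mu]_x (w x * (Phi (u x) * h x)).
Proof.
move=> mV Vx mu_ mu0 iw_ iw uu ww cP PM mh hN.
have mP : measurable_fun setT Phi by exact: continuous_measurable_fun.
have M0 : 0 <= M by exact: le_trans (PM 0).
pose Q n x := ((fun x => Phi (u_ n x) * h x) \_ (V n)) x.
have mQ n : measurable_fun setT (Q n).
  apply: (proj1 (measurable_restrictT _ (mV n))); apply: measurable_funM; last exact: measurable_funTS.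
  exact: measurableT_comp.
have QMN n x : `|Q n x| <= M * N.
  rewrite /Q /patch; case: ifPn => _; first by rewrite normrM ler_pM.
  by rewrite normr0 mulr_ge0// (le_trans _ (hN x)).
have iwQ n : mu.-integrable setT (EFin \o (fun x => w x * Q n x)).
  by apply: (integrable_EFinM measurableT iw (mQ n)) => x _; exact: QMN.
have iwB n : mu.-integrable setT (EFin \o ((w_ n \- w) \_ (V n))).
  apply: (proj1 (integrable_patch _ _ (mV n))); apply: integrable_EFinB => //.
  exact: integrableS iw.
have iwBQ n : mu.-integrable setT (EFin \o (fun x => ((w_ n \- w) \_ (V n)) x * Q n x)).
  by apply: (integrable_EFinM measurableT (iwB n) (mQ n)) => x _; exact: QMN.
have E n : \int[mu]_(x in V n) (w_ n x * (Phi (u_ n x) * h x)) =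
    \int[mu]_x (((w_ n \- w) \_ (V n)) x * Q n x) + \int[mu]_x (w x * Q n x).
  rewrite -RintegralD// Rintegral_mkcond; apply: eq_Rintegral => x _.
  by rewrite /Q /patch; case: ifPn => _; [rewrite /=; ring|rewrite !mulr0 addr0].
rewrite (funext E) -[X in _ --> X]add0r; apply: cvgD.
  apply: norm_cvg0.
  have ww' : \int[mu]_x `|((w_ n \- w) \_ (V n)) x| @[n --> \oo] --> (0 : R).
    by move/fine_cvgP : ww => [_]; exact.
  have z0 : M * N * \int[mu]_x `|((w_ n \- w) \_ (V n)) x| @[n --> \oo] --> (0 : R).
    by rewrite -[X in _ --> X](mulr0 (M * N)); exact: cvgMl_tmp.
  apply: (squeeze_cvgr _ (cvg_cst 0) z0); apply: nearW => n; rewrite normr_ge0/=.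
  apply: (le_trans (le_normr_Rintegral measurableT (iwBQ n))).
  rewrite -RintegralZl//; last exact: integrable_norm.
  apply: le_Rintegral => //.
  - exact: integrable_norm.
  - by apply: integrable_EFinZ => //; exact: integrable_norm.
  - by move=> x _; rewrite normrM mulrC ler_wpM2r// QMN.
have [|||||_ _ //] := @Rdominated_cvg _ _ _ mu setT measurableT (fun n x => w x * Q n x)
  (fun x => w x * (Phi (u x) * h x)) (fun x => M * N * `|w x|).
- by move=> n; exact: integrable_measurable (iwQ n).
- apply: measurable_funM; first exact: integrable_measurable iw.
  by apply: measurable_funM => //; exact: measurableT_comp.
- apply: filterS uu => x ux _; apply: cvgMl_tmp.
  apply: (cvg_trans (G := Phi (u_ n x) * h x @[n --> \oo])); last first.
    by apply: cvgMr_tmp; exact: (continuous_cvg _ (cP (u x)) ux).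
  apply: near_eq_cvg; apply: filterS (Vx x) => n Vn.
  by rewrite /Q /patch mem_set.
- by apply: integrable_EFinZ => //; exact: integrable_norm.
- by apply: aeW => x n _; rewrite normrM mulrC ler_wpM2r// QMN.
Qed.

(** Limit of [core_estimate] along the local approximants. As u >= 0, zeta(u) = 0, so the term
    carrying [K] disappears; this matters because [K] blows up as the scale of the cutoff tends to
    0, whereas [c] is independent of the cutoff. *)
Lemma generator_estimate b i : test_fun setT b -> exists2 c, 0 <= c &
  forall F g g' Z zeta z M K u w, cutoff F g g' Z zeta z M K ->
  generator mu setT T u w -> (\forall x \ae mu, 0 <= u x) ->
  (\int[leb]_x (F (u x) * partial i b x)) ^+ 2 <=
    c * (\int[mu]_x (w x * (g (u x) * b x ^+ 2)) + c).
Proof.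
move=> tb; have [c c0 hc] := core_estimate d_ge2 p_gtd ass_a mu_rho i tb.
exists c => // F g g' Z zeta z M K u w cut guw u0.
have [V [u1 [w1 [hV pg Vx mi [uu ww]]]]] := generator_approx T_mu tb guw.
have oV n : open (V n) by have [] := hV n.
have mV n : measurable (V n) := open_measurable_rV (oV n).
have [uL wL _] := guw.
have mu0 : measurable_fun setT u by exact: in_Lp_measurable uL.
have iw : mu.-integrable setT (EFin \o w) by exact/in_Lp1P.
have mu1 n : measurable_fun (V n) (u1 n) by have [] := mi n.
have [k [kn hk]] : exists k : nat -> nat, (forall n, (n <= k n)%N) /\
    \forall x \ae mu, `|((u1 (k n) \- u) \_ (V (k n))) x| @[n --> \oo] --> (0 : R).
  apply: (L1_cvg_subseq (f := fun n x => `|((u1 n \- u) \_ (V n)) x|)) => // n.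
  apply: measurableT_comp => //; apply: (proj1 (measurable_restrictT _ (mV n))).
  by apply: measurable_funB => //; exact: measurable_funTS.
have Vkx x : \forall n \near \oo, V (k n) x by exact: (cvg_ge_id kn) (Vx x).
have uk : \forall x \ae mu, u1 (k n) x @[n --> \oo] --> u x.
  apply: filterS hk => x hx; apply/cvgrPdist_lt => e e0.
  have /cvgr0Pnorm_lt/(_ e e0) he := hx.
  apply: filterS2 he (Vkx x) => n; rewrite normr_id /patch => h Vn.
  by move: h; rewrite mem_set// distrC.
have wk := cvg_comp _ _ (cvg_ge_id kn) ww.
have sg : smooth1 g := smooth1_derive (cutoff_dF cut) (cutoff_F cut).
have cg := cont_diff1_continuous (sg 0%N).
have sz : smooth1 zeta := smooth1_derive (cutoff_dZ cut) (cutoff_Z cut).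
have cz := cont_diff1_continuous (sz 0%N).
have [beta beta0 bb] := test_fun_bounded tb.
have cb := test_fun_continuous tb.
have mb2 : measurable_fun setT (fun x => b x ^+ 2).
  by apply: measurable_funX; exact: continuous_measurable_rV.
have iwk n : mu.-integrable (V (k n)) (EFin \o w1 (k n)) by have [] := mi (k n).
have l1 := local_limit (fun n => mV (k n)) Vkx (fun n => mu1 (k n)) mu0 iwk iw uk wk cg
  (cutoff_gM cut) mb2 (fun x => _ : `|b x ^+ 2| <= beta ^+ 2).
have {}l1 : \int[mu]_(x in V (k n)) (w1 (k n) x * (g (u1 (k n) x) * b x ^+ 2)) @[n --> \oo] -->
    \int[mu]_x (w x * (g (u x) * b x ^+ 2)).
  by apply: l1 => x; rewrite normrX lerXn2r ?nnegrE.
have m1 : measurable_fun setT (cst 1 : Rd -> R) by exact: measurable_cst.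
have := local_limit (fun n => mV (k n)) Vkx (fun n => mu1 (k n)) mu0 iwk iw uk wk cz
  (cutoff_zetaM cut) m1 (N := 1).
have -> : \int[mu]_x (w x * (zeta (u x) * cst 1 x)) = 0.
  have -> : \int[mu]_x (w x * (zeta (u x) * cst 1 x)) = \int[mu]_x (cst (0 : R) x).
    apply: ae_eq_Rintegral => //.
      apply: measurable_funM; first exact: integrable_measurable iw.
      apply: measurable_funM => //; apply: measurableT_comp mu0.
      exact: continuous_measurable_fun.
    by apply: filterS u0 => x u0 _; rewrite (cutoff_zeta0 cut)// mul0r mulr0.
  by rewrite Rintegral_cst// mul0r.
move=> l2.
have {l2}l2 : - (\int[mu]_(x in V (k n)) (w1 (k n) x * zeta (u1 (k n) x))) @[n --> \oo] --> (0 : R).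
  rewrite -oppr0; apply: cvgN; rewrite (_ : (fun n => _) = fun n =>
    \int[mu]_(x in V (k n)) (w1 (k n) x * (zeta (u1 (k n) x) * cst 1 x))).
    by apply: l2 => x; rewrite normr1.
  by apply/funext => n; apply: eq_Rintegral => x _; rewrite mulr1.
have tbi := test_fun_partial i tb.
have [beta' beta'0 bb'] := test_fun_bounded tbi.
have ib : leb.-integrable setT (EFin \o partial i b).
  have [_ [K0 [cK0 _ K00]]] := tbi.
  by apply: (integrable_cpt cK0) => //; exact: test_fun_continuous tbi.
have cF : continuous F := cont_diff1_continuous (cutoff_F cut 0%N).
have mF : measurable_fun setT F by exact: continuous_measurable_fun.
have mbi : measurable_fun setT (partial i b).
  by apply: continuous_measurable_rV; exact: test_fun_continuous tbi.
have uk' := mu_leb_ae mu_rho uk.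
pose f_ n x := ((fun x => F (u1 (k n) x) * partial i b x) \_ (V (k n))) x.
have [|||||_ _ l3] := @Rdominated_cvg _ _ _ leb setT measurableT f_
    (fun x => F (u x) * partial i b x) (fun x => M * `|partial i b x|).
- move=> n; apply: (proj1 (measurable_restrictT _ (mV (k n)))).
  apply: measurable_funM; last exact: measurable_funTS.
  by apply: measurableT_comp => //; exact: mu1.
- by apply: measurable_funM => //; exact: measurableT_comp.
- apply: filterS uk' => x ux _.
  apply: (cvg_trans (G := F (u1 (k n) x) * partial i b x @[n --> \oo])); last first.
    by apply: cvgMr_tmp; exact: (continuous_cvg _ (cF (u x)) ux).
  apply: near_eq_cvg; apply: filterS (Vkx x) => n Vn.
  by rewrite /f_ /patch mem_set.
- by apply: integrable_EFinZ => //; exact: integrable_norm.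
- apply: aeW => x n _; rewrite /f_ /patch; case: ifPn => _.
    by rewrite normrM ler_wpM2r// (cutoff_FM cut).
  by rewrite normr0 mulr_ge0// (le_trans _ (cutoff_FM cut 0)).
have l3' : (\int[leb]_x f_ n x) * (\int[leb]_x f_ n x) @[n --> \oo] -->
    (\int[leb]_x (F (u x) * partial i b x)) * (\int[leb]_x (F (u x) * partial i b x)).
  by apply: cvgM; exact: l3.
have l4 : c * (\int[mu]_(x in V (k n)) (w1 (k n) x * (g (u1 (k n) x) * b x ^+ 2)) + c +
      K * c * - (\int[mu]_(x in V (k n)) (w1 (k n) x * zeta (u1 (k n) x)))) @[n --> \oo] -->
    c * (\int[mu]_x (w x * (g (u x) * b x ^+ 2)) + c + K * c * 0).
  apply: cvgMl_tmp; apply: cvgD; last exact: cvgMl_tmp.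
  by apply: cvgD => //; exact: cvg_cst.
rewrite mulr0 addr0 in l4; rewrite expr2.
apply: (ler_cvg_to l3' l4); apply: nearW => n.
have [_ rVn tVn] := hV (k n).
have := hc _ _ _ _ _ _ _ _ _ _ _ cut (oV (k n)) rVn tVn (pg (k n)).
by rewrite /f_ -Rintegral_mkcond expr2.
Qed.

End generator_estimate.

(** * The continuous versions P_t *)

Section continuous_version.
Context {R : realType} {d : nat} (p : R).
Local Notation Rd := 'rV[R]_d.
Local Notation leb := (lebesgue_rV R d).
Variables (A C : Rd -> 'M[R]_d) (H : Rd -> Rd) (rho : Rd -> R).
Variable mu : {measure set Rd -> \bar R}.
Variables T P : R -> (Rd -> R) -> (Rd -> R).
Hypothesis mu_rho : inf_invariant_density p A (drift A C H) rho mu.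
Hypothesis T_mu : L1_semigroup_construction mu A (drift A C H) rho T.
Hypothesis P_T : continuous_versions mu T P.

Let sgT := glob_semigroup T_mu.

(** [mu] has the null sets of Lebesgue measure, and a nonempty open set where two continuous
    functions differ would not be null. Every almost everywhere identity for T_t thus becomes a
    pointwise identity for P_t. *)
Lemma continuous_ae_eq (f g : Rd -> R) : continuous f -> continuous g ->
  (\forall x \ae mu, f x = g x) -> f = g.
Proof.
move=> cf cg /(mu_leb_ae mu_rho) [N [mN N0 NP]]; apply/funext => x; apply/eqP/negPn/negP => fg.
pose D := [set y : Rd | f y - g y != 0].
have oD : open D.
  apply: (@open_comp _ _ (fun y => f y - g y) [set r : R | r != 0]).
    by move=> y _; apply: continuousB; [exact: cf|exact: cg].
  exact: open_neq.
have : (0 < leb D)%E.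
  by apply: leb_open_gt0 => //; exists x; rewrite /D /= subr_eq0.
apply/negP; rewrite -leNgt -N0; apply: le_measure; rewrite ?inE//.
  exact: open_measurable_rV.
by move=> y Dy; apply: NP => /=; move/eqP; rewrite -subr_eq0; exact/negP.
Qed.

Let i1 f : in_Lp mu setT 1 f <-> mu.-integrable setT (EFin \o f).
Proof. exact: in_Lp1P. Qed.

Lemma L1_dist_T t f g : 0 < t -> in_Lp mu setT 1 f -> in_Lp mu setT 1 g ->
  \int[mu]_x `|T t f x - T t g x| <= \int[mu]_x `|f x - g x|.
Proof.
move=> t0 fL gL.
have hL : in_Lp mu setT 1 (fun x => (-1) * g x + f x).
  by apply/i1; apply: integrable_EFinD => //; [apply: integrable_EFinZ => //|]; exact/i1.
have lin := sg_linear sgT (-1) t0 gL fL.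
have mT h : in_Lp mu setT 1 h -> measurable_fun setT (T t h).
  by move=> hh; apply: in_Lp_measurable (sg_L1 sgT t0 hh).
have -> : \int[mu]_x `|T t f x - T t g x| = \int[mu]_x `|T t (fun x => (-1) * g x + f x) x|.
  apply: ae_eq_Rintegral => //.
  - by apply: measurableT_comp => //; apply: measurable_funB; exact: mT.
  - by apply: measurableT_comp => //; exact: mT.
  - by apply: filterS lin => x h _; rewrite h// mulN1r addrC.
apply: (le_trans (contraction_Rintegral T_mu t0 hL)).
by under eq_Rintegral do rewrite mulN1r addrC.
Qed.

Lemma T_ae_eq t f g : 0 < t -> in_Lp mu setT 1 f -> in_Lp mu setT 1 g ->
  ae_eq mu setT f g -> ae_eq mu setT (T t f) (T t g).
Proof.
move=> t0 fL gL fg.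
have [TfL TgL] := (sg_L1 sgT t0 fL, sg_L1 sgT t0 gL).
have iB : mu.-integrable setT (EFin \o (fun x => `|T t f x - T t g x|)).
  by apply: integrable_norm; apply: integrable_EFinB => //; exact/i1.
have z : \int[mu]_x `|T t f x - T t g x| = 0.
  apply/eqP; rewrite eq_le Rintegral_ge0// andbT (le_trans (L1_dist_T t0 fL gL))//.
  rewrite (@ae_eq_Rintegral _ _ _ mu setT measurableT _ (cst 0)) ?Rintegral_cst ?mul0r//.
    apply: measurableT_comp => //; apply: measurable_funB.
      exact: in_Lp_measurable fL.
    exact: in_Lp_measurable gL.
  by apply: filterS fg => x h _; rewrite h// subrr normr0.
have := Rintegral_eq0_ae measurableT (fun x _ => normr_ge0 _) iB z.
by apply: filterS => x h _; have /eqP := h I; rewrite normr_eq0 subr_eq0 => /eqP.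
Qed.

(** [Lp_semigroup] links P_t f to T_t only through approximations of f; the L^1 contraction
    identifies the limit with T_t f. *)
Lemma P_T_ae t f : 0 < t -> in_Lp mu setT 1 f ->
  [/\ continuous (P t f), in_Lp mu setT 1 (P t f) & ae_eq mu setT (P t f) (T t f)].
Proof.
move=> t0 fL; have [_ /(_ 1%E t f (lexx _) t0 fL)[cP [_ PL [f_ [fL1 ff Tf]]]]] := P_T.
split=> //.
have TfL := sg_L1 sgT t0 fL.
have fnL n : in_Lp mu setT 1 (f_ n) by have [] := fL1 n.
have TfnL n : in_Lp mu setT 1 (T t (f_ n)) := sg_L1 sgT t0 (fnL n).
have iB : mu.-integrable setT (EFin \o (fun x => `|P t f x - T t f x|)).
  by apply: integrable_norm; apply: integrable_EFinB => //; exact/i1.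
suff z : \int[mu]_x `|P t f x - T t f x| = 0.
  have := Rintegral_eq0_ae measurableT (fun x _ => normr_ge0 _) iB z.
  by apply: filterS => x h _; have /eqP := h I; rewrite normr_eq0 subr_eq0 => /eqP.
apply/eqP; rewrite eq_le Rintegral_ge0// andbT; apply/ler_addgt0Pr => e e0; rewrite add0r.
have e20 : 0 < e / 2 by rewrite divr_gt0.
have /ge0_cvge0P -/(_ (fun=> Lnorm_ge0 _ _ _) _ e20) n1 := ff.
have /ge0_cvge0P -/(_ (fun=> Lnorm_ge0 _ _ _) _ e20) n2 := Tf.
have [m [h1 h2]] := @filter_ex _ \oo _ _ (filterI n1 n2).
move: h1 h2; rewrite /= !Lp_dist1_fin// !lee_fin => h1 h2.
have iX f1 f2 : in_Lp mu setT 1 f1 -> in_Lp mu setT 1 f2 ->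
    mu.-integrable setT (EFin \o (fun x => `|f1 x - f2 x|)).
  by move=> /i1 ? /i1 ?; apply: integrable_norm; exact: integrable_EFinB.
apply: (@le_trans _ _ (\int[mu]_x (`|T t (f_ m) x - P t f x| + `|T t (f_ m) x - T t f x|))).
  apply: le_Rintegral => //; first by apply: integrable_EFinD => //; exact: iX.
  move=> x _; rewrite -[P t f x - _](subrKA (T t (f_ m) x)) (le_trans (ler_normD _ _))//.
  by rewrite lerD2r distrC.
rewrite RintegralD//; [|exact: iX..].
by rewrite [leRHS](splitr e) lerD// (le_trans (L1_dist_T t0 (fnL m) fL)).
Qed.

Lemma P_linear t a f g : 0 < t -> in_Lp mu setT 1 f -> in_Lp mu setT 1 g ->
  P t (fun x => a * f x + g x) = fun x => a * P t f x + P t g x.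
Proof.
move=> t0 fL gL.
have hL : in_Lp mu setT 1 (fun x => a * f x + g x).
  by apply/i1; apply: integrable_EFinD => //; [apply: integrable_EFinZ => //|]; exact/i1.
have [c1 _ e1] := P_T_ae t0 hL; have [c2 _ e2] := P_T_ae t0 fL; have [c3 _ e3] := P_T_ae t0 gL.
apply: continuous_ae_eq => //.
  have h : continuous (fun x => a * P t f x).
    by apply: continuous_mul_rV c2; exact: cst_continuous.
  by move=> x; exact: (@continuousD _ _ _ (fun x => a * P t f x) (P t g) x (h x) (c3 x)).
have lin := sg_linear sgT a t0 fL gL.
apply: filterS2 (filterI e1 e2) (filterI e3 lin) => x [h1 h2] [h3 h4].
by rewrite h1// h4// h2// h3.
Qed.

Lemma P_semigroup s t f : 0 < s -> 0 < t -> in_Lp mu setT 1 f -> P (s + t) f = P s (P t f).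
Proof.
move=> s0 t0 fL; have [ct PtL et] := P_T_ae t0 fL.
have [c1 _ e1] := P_T_ae (addr_gt0 s0 t0) fL; have [c2 _ e2] := P_T_ae s0 PtL.
apply: continuous_ae_eq => //.
have e3 := T_ae_eq s0 PtL (sg_L1 sgT t0 fL) et.
have e4 := sg_semigroup sgT s0 t0 fL.
apply: filterS2 (filterI e1 e2) (filterI e3 e4) => x [h1 h2] [h3 h4].
by rewrite h1// h4// h2// h3.
Qed.

Lemma P_L1_contraction t f : 0 < t -> in_Lp mu setT 1 f ->
  \int[mu]_x `|P t f x| <= \int[mu]_x `|f x|.
Proof.
move=> t0 fL; have [c PL e] := P_T_ae t0 fL.
rewrite (@ae_eq_Rintegral _ _ _ mu setT measurableT _ (fun x => `|T t f x|)).
- exact: (contraction_Rintegral T_mu).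
- by apply: measurableT_comp => //; exact: continuous_measurable_rV.
- by apply: measurableT_comp => //; exact: in_Lp_measurable (sg_L1 sgT t0 fL).
- by apply: filterS e => x h _; rewrite h.
Qed.

(** Contraction gives P_t 1_E = 0 almost everywhere and continuity gives it at every point, so each
    P_t(x, .) is absolutely continuous with respect to [mu]. *)
Lemma P_null t E : 0 < t -> measurable E -> mu E = 0%E -> P t \1_E = cst 0.
Proof.
move=> t0 mE E0.
have EL : in_Lp mu setT 1 (\1_E : Rd -> R) by apply/i1; apply: integrable_indic_lty => //; rewrite E0.
have [c PL e] := P_T_ae t0 EL; apply: continuous_ae_eq => //; first exact: cst_continuous.
have i := integrable_norm (proj1 (i1 _) PL).
have z : \int[mu]_x `|P t \1_E x| = 0.
  apply/eqP; rewrite eq_le Rintegral_ge0// andbT (le_trans (P_L1_contraction t0 EL))//.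
  under eq_Rintegral do rewrite ger0_norm//.
  by rewrite /Rintegral integral_indic// setIT E0.
have := Rintegral_eq0_ae measurableT (fun x _ => normr_ge0 _) i z.
by apply: filterS => x h; have /eqP := h I; rewrite normr_eq0 => /eqP.
Qed.

End continuous_version.

(** * Radon-Nikodym densities for plain measures *)

Section radon_nikodym_density.
Context d (T : measurableType d) (R : realType).
Variables (mu nu : {measure set T -> \bar R}).

(** Copies of the measures indexed by the finiteness proofs, on which the sigma-finite and finite
    structures required by the Radon-Nikodym theorem can be declared. *)
Definition sigma_finite_copy (_ : sigma_finite setT mu) : set T -> \bar R := mu.

Definition finite_copy (_ : fin_num_fun nu) : set T -> \bar R := nu.

Hypotheses (sf : sigma_finite setT mu) (nuf : fin_num_fun nu).

HB.instance Definition _ := isMeasure.Build _ _ _ (sigma_finite_copy sf)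
  (@measure0 _ _ _ mu) (@measure_ge0 _ _ _ mu) (@measure_semi_sigma_additive _ _ _ mu).

HB.instance Definition _ := Measure_isSigmaFinite.Build _ _ _ (sigma_finite_copy sf) sf.

HB.instance Definition _ := isMeasure.Build _ _ _ (finite_copy nuf)
  (@measure0 _ _ _ nu) (@measure_ge0 _ _ _ nu) (@measure_semi_sigma_additive _ _ _ nu).

HB.instance Definition _ := Measure_isFinite.Build _ _ _ (finite_copy nuf) nuf.

Lemma radon_nikodym_density : nu `<< mu ->
  exists h : T -> R, [/\ forall x, 0 <= h x, mu.-integrable setT (EFin \o h) &
    forall A, measurable A -> nu A = (\int[mu]_(x in A) (h x)%:E)%E].
Proof.
move=> numu.
have [f [f0 ff i_f fE]] := @radon_nikodym_sigma_finite _ _ _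
  (sigma_finite_copy sf) (finite_copy nuf) numu.
exists (fine \o f); split=> [x||A mA].
- by rewrite /= fine_ge0.
- by apply: eq_integrable i_f => // x _ /=; rewrite fineK.
- by rewrite [LHS]fE//; apply: eq_integral => x _ /=; rewrite fineK.
Qed.

End radon_nikodym_density.

(** * The transition function of the Hunt process *)

Section hunt_process_basics.
Context {R : realType} {d : nat} {dO : measure_display} {Omega : measurableType dO}.
Local Notation Rd := 'rV[R]_d.
Local Notation RdD := (one_point_compactification Rd).
Variable M : @hunt_process R d dO Omega.

Lemma sigma_Some (E : set Rd) : measurable E -> <<s (@open RdD) >> (Some @` E).
Proof.
pose G : set (set Rd) := [set E | <<s (@open RdD) >> (Some @` E)].
have sG : sigma_algebra setT G.
  split; rewrite /G /=.
  - by rewrite image_set0; exact: sigma_algebra0.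
  - move=> D GD; pose S := g_sigma_algebraType (@open RdD).
    have mS : @measurable _ S (Some @` [set: Rd]).
      by apply: sub_sigma_algebra; apply: one_point_compactification_open_some; exact: openT.
    have -> : Some @` ([set: Rd] `\` D) = (Some @` [set: Rd] : set S) `\` (Some @` D).
      apply/seteqP; split=> x /=.
        by move=> [y [_ Dy] <-]; split; [exists y|move=> [z Dz [zy]]; apply: Dy; rewrite -zy].
      by move=> [[y _ <-] h]; exists y => //; split=> // Dy; apply: h; exists y.
    exact: (@measurableD _ S).
  - move=> F GF; rewrite image_bigcup; exact: sigma_algebra_bigcup.
move=> mE; have : (@measurable _ Rd) `<=` G.
  apply: smallest_sub => // U oU; apply: sub_sigma_algebra.
  exact: one_point_compactification_open_some.
exact.
Qed.

Lemma measurable_state_in t E : 0 <= t -> measurable E -> measurable (state_in M t E).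
Proof.
move=> t0 mE; have [_ sub] := filtration_sigma_algebra M t0.
by apply: sub; apply: state_adapted => //; exact: sigma_Some.
Qed.

Lemma measurable_state_oapp t (f : Rd -> R) : 0 <= t -> measurable_fun setT f ->
  measurable_fun setT (fun w => oapp f 0 (state M t w)).
Proof.
move=> t0 mf _ Y mY; rewrite setTI.
have [Y0|Y0] := pselect (Y 0).
  rewrite (_ : _ @^-1` _ = ~` state_in M t (f @^-1` ~` Y)).
    by apply: measurableC; apply: measurable_state_in => //; rewrite -[X in measurable X]setTI; apply: mf => //; exact: measurableC.
  apply/seteqP; split=> w; rewrite /state_in /=.
    by move=> h [y hy yE]; move: h; rewrite -yE.
  move=> h; case E : (state M t w) => [y|]//=; apply: contrapT => hy; apply: h.
  by exists y => //; rewrite E.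
rewrite (_ : _ @^-1` _ = state_in M t (f @^-1` Y)).
  by apply: measurable_state_in => //; rewrite -[X in measurable X]setTI; exact: mf.
apply/seteqP; split=> w; rewrite /state_in /=; last by case=> y hy <-.
by case E : (state M t w) => [y|]//= h; exists y.
Qed.

Lemma oapp_indic t E w : oapp (\1_E : Rd -> R) 0 (state M t w) = \1_(state_in M t E) w.
Proof.
rewrite [RHS]indicE; case E' : (state M t w) => [y|] /=.
  rewrite indicE; congr (_ %:R); congr nat_of_bool; apply/idP/idP => /set_mem h; apply/mem_set.
    by exists y.
  by move: h; rewrite /state_in/= E' => -[z hz [<-]].
by rewrite memNset// /state_in /= E' => -[].
Qed.

Variable P : R -> (Rd -> R) -> (Rd -> R).
Hypothesis M_P : has_transition M P.

Lemma has_transition_indic (t : R) (x : Rd) (E : set Rd) : 0 <= t -> measurable E ->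
  law M (Some x) (state_in M t E) = (P t \1_E x)%:E.
Proof.
move=> t0 mE; rewrite -(M_P x t0); last 2 first.
- exact: (measurable_indic mE).
- by exists 1 => y; rewrite ger0_norm ?indic_le1.
under eq_integral do rewrite oapp_indic.
by rewrite integral_indic ?setIT//; exact: measurable_state_in.
Qed.

Lemma has_transition_Rintegral (t : R) (x : Rd) (f : Rd -> R) : 0 <= t -> measurable_fun setT f ->
  (exists K : R, forall y, `|f y| <= K) ->
  [/\ (law M (Some x)).-integrable setT (EFin \o (fun w => oapp f 0 (state M t w))) &
  P t f x = \int[law M (Some x)]_w oapp f 0 (state M t w)].
Proof.
move=> t0 mf [K fK].
have i : (law M (Some x)).-integrable setT (EFin \o (fun w => oapp f 0 (state M t w))).
  apply: (@integrable_dominated _ _ _ _ _ measurableT _ (cst `|K|)).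
  - exact: measurable_state_oapp.
  - move=> w _; case: (state M t w) => [y|] /=; last by rewrite normr0.
    by rewrite (le_trans (fK y))// ler_norm.
  - by apply: finite_measure_integrable_cst.
split=> //; have := M_P x t0 mf (ex_intro _ K fK).
by rewrite -EFin_Rintegral// => -[].
Qed.

Lemma P_ge0_le (t : R) (x : Rd) (f g : Rd -> R) : 0 <= t -> measurable_fun setT f -> measurable_fun setT g ->
  (forall y, 0 <= f y <= g y) -> (exists K : R, forall y, g y <= K) -> 0 <= P t f x <= P t g x.
Proof.
move=> t0 mf mg fg [K gK].
have fK : exists K : R, forall y, `|f y| <= K.
  by exists K => y; have /andP[f0 h] := fg y; rewrite ger0_norm// (le_trans h).
have gK' : exists K : R, forall y, `|g y| <= K.
  by exists K => y; have /andP[f0 h] := fg y; rewrite ger0_norm// (le_trans f0 h).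
have [i1 ->] := has_transition_Rintegral x t0 mf fK.
have [i2 ->] := has_transition_Rintegral x t0 mg gK'.
apply/andP; split.
  apply: Rintegral_ge0 => w _; case: (state M t w) => [y|] //=.
  by have /andP[] := fg y.
apply: le_Rintegral => // w _; case: (state M t w) => [y|] //=.
by have /andP[] := fg y.
Qed.

(** A compactly supported continuous function extends continuously by 0 to the one-point
    compactification, where sample paths are continuous; dominated convergence under the law of the
    process gives continuity in time. *)
Lemma P_cvg_time (f : Rd -> R) (K : set Rd) (x : Rd) (t : R) (u : R^nat) :
  continuous f -> compact K -> (forall y, ~ K y -> f y = 0) ->
  (forall n, 0 <= u n) -> u n @[n --> \oo] --> t ->
  P (u n) f x @[n --> \oo] --> P t f x.
Proof.
move=> cf cK f0 u0 ut.
have mf : measurable_fun setT f by exact: continuous_measurable_rV.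
have [B fB] : exists B : R, forall y, `|f y| <= B.
  have [B hB] := continuous_cpt_bounded cK cf; exists `|B| => y.
  have [Ky|nKy] := pselect (K y); first by rewrite (le_trans (hB _ Ky))// ler_norm.
  by rewrite f0// normr0.
have t0 : 0 <= t.
  rewrite -(cvg_lim (@Rhausdorff _) ut); apply: limr_ge; first by apply/cvg_ex; exists t.
  exact: nearW.
have clK : closed K by apply: compact_closed => //; exact: norm_hausdorff.
have cF : continuous (oapp f 0 : RdD -> R).
  move=> [y|] V /=.
    by move=> hV; have := cf y V hV; rewrite nbhs_simpl.
  move=> hV; exists K; first by split.
  move=> z [[y Ky <-]|->] /=; last exact: nbhs_singleton hV.
  by rewrite f0//; exact: nbhs_singleton hV.
have h n : P (u n) f x = \int[law M (Some x)]_w oapp f 0 (state M (u n) w).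
  by have [] := has_transition_Rintegral x (u0 n) mf (ex_intro _ B fB).
have [i ->] := has_transition_Rintegral x t0 mf (ex_intro _ B fB).
rewrite (_ : (fun n => _) = (fun n => \int[law M (Some x)]_w oapp f 0 (state M (u n) w))); last by apply/funext.
have [|||||j _ l] := @Rdominated_cvg _ _ _ (law M (Some x)) setT measurableT
  (fun n w => oapp f 0 (state M (u n) w)) (fun w => oapp f 0 (state M t w)) (cst `|B|).
- by move=> n; exact: measurable_state_oapp.
- exact: measurable_state_oapp.
- apply: aeW => w _.
  have cw : {within `[0, +oo[, continuous (fun t => state M t w)} := @state_continuous _ _ _ _ M w.
  have /subspace_continuousP/(_ t) := cw; rewrite /= in_itv/= andbT => /(_ t0) ct.
  move=> V /cF /ct; rewrite /= => hV; have hn := ut _ hV.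
  by apply: (@filterS _ \oo _ _ _ _ hn) => n /=; apply; rewrite in_itv/= andbT.
- exact: finite_measure_integrable_cst.
- apply: aeW => w n _; case: (state M (u n) w) => [y|] /=; last by rewrite normr0.
  by rewrite (le_trans (fB y))// ler_norm.
- exact: l.
Qed.

End hunt_process_basics.

(** * Concavity of the cutoffs and differentiation in time *)

Section concave_cutoff.
Context {R : realType}.
Variables (F g g' Z zeta z : R -> R) (M K : R).
Hypothesis cut : cutoff F g g' Z zeta z M K.

Lemma cutoff_slope_le0 (y : R) : 0 < y -> g' y <= 0.
Proof.
move=> y0; have z0 : z y = 0.
  have dz := cutoff_dzeta cut y; rewrite -(derive_val (is_derive := dz)).
  have -> : 'D_1 zeta y = 'D_1 (cst 0) y; last by rewrite derive_cst.
  apply: near_eq_derive; near=> s; apply: (cutoff_zeta0 cut); apply: ltW; near: s.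
  exact: lt_nbhsr.
have := cutoff_ineq cut y; rewrite z0 mulr0 addr0.
have := sqr_ge0 (g y); lra.
Unshelve. all: by end_near.
Qed.

Lemma cutoff_slope_noninc (x y : R) : 0 <= x -> x <= y -> g y <= g x.
Proof.
move=> x0; rewrite le_eqVlt => /predU1P[->//|xy].
have [s] := @MVT _ g g' x y xy (fun s _ => cutoff_dg cut s) (continuous_subspaceT (is_derive_continuous (cutoff_dg cut))).
rewrite in_itv/= => /andP[xs _] e.
by rewrite -subr_le0 e mulr_le0_ge0 ?subr_ge0 ?(ltW xy)// cutoff_slope_le0// (le_lt_trans x0).
Qed.

(** On the positive half-line zeta is 0, hence so is z, and the cutoff inequality gives g' <= 0: F
    is concave there. *)
Lemma cutoff_tangent (x y : R) : 0 <= x -> 0 <= y -> g y * (y - x) <= F y - F x.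
Proof.
have cF : continuous F := is_derive_continuous (cutoff_dF cut).
move=> x0 y0; have [xy|xy|->] := ltgtP x y; last by rewrite !subrr mulr0.
- have [s] := @MVT _ F g x y xy (fun s _ => cutoff_dF cut s) (continuous_subspaceT cF).
  rewrite in_itv/= => /andP[xs sy] ->; rewrite ler_pM2r ?subr_gt0//.
  by apply: cutoff_slope_noninc (ltW sy); rewrite (le_trans x0)// ltW.
- have [s] := @MVT _ F g y x xy (fun s _ => cutoff_dF cut s) (continuous_subspaceT cF).
  rewrite in_itv/= => /andP[ys sx] e; rewrite -[F y - _]opprB e -mulrN opprB.
  rewrite -[y - x]opprB !mulrN lerN2 ler_pM2r ?subr_gt0//.
  by apply: cutoff_slope_noninc (ltW ys).
Qed.

End concave_cutoff.

(** The difference between h and a primitive of phi is nondecreasing. The derivative of h is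
    compared pointwise and never integrated, so no regularity of it is required. *)
Lemma integral_le_increment {R : realType} (h dh phi : R -> R) (a b : R) : a < b -> continuous phi ->
  (forall t : R, a <= t <= b -> is_derive t 1 h (dh t)) ->
  (forall t : R, a <= t <= b -> phi t <= dh t) ->
  \int[lebesgue_measure]_(t in `]a, b]) phi t <= h b - h a.
Proof.
move=> ab cphi dh_ phi_dh.
have iphi u v : (@lebesgue_measure R).-integrable `[u, v] (EFin \o phi).
  by apply: continuous_compact_integrable; [exact: segment_compact|exact: continuous_subspaceT].
pose Phi (x : R) : R := \int[lebesgue_measure]_(t in `[a - 1, x]) phi t.
have dPhi (x : R) : a <= x -> is_derive x 1 Phi (phi x).
  move=> ax; have ax1 : a - 1 < x by lra.
  have [|dx <-] := continuous_FTC1_closed (_ : x < x + 1) (iphi _ _) ax1 (cphi x); first by rewrite ltrDl.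
  by rewrite derive1E; exact: derivableP.
have dPsi (x : R) : a <= x <= b -> is_derive x 1 (fun x => h x - Phi x) (dh x - phi x).
  by move=> /[dup] xab /andP[ax xb]; apply: is_deriveB; [exact: dh_|exact: dPhi].
have le : h a - Phi a <= h b - Phi b.
  apply: (@ger0_derive1_le_cc _ (fun x => h x - Phi x) a b); rewrite ?in_itv/= ?lexx ?ltW//.
  - move=> x; rewrite in_itv/= => /andP[/ltW ax /ltW xb].
    have xab : a <= x <= b by rewrite ax xb.
    by have [] := dPsi x xab.
  - move=> x; rewrite in_itv/= => /andP[/ltW ax /ltW xb].
    have xab : a <= x <= b by rewrite ax xb.
    by rewrite derive1E (derive_val (is_derive := dPsi x xab)) subr_ge0 phi_dh.
  - apply: derivable_within_continuous => x; rewrite in_itv/= => xab.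
    by have [] := dPsi x xab.
have <- := @Rintegral_itvB _ phi (BLeft (a - 1)) (BRight b) a (iphi _ _) _ _.
- by rewrite -/(Phi a) -/(Phi b); lra.
- have a1 : a - 1 <= a by lra.
  exact: a1.
- exact: ltW ab.
Qed.

Section time_evolution.
Context {R : realType} {d : nat} (p : R).
Local Notation Rd := 'rV[R]_d.
Local Notation leb := (lebesgue_rV R d).
Variables (A C : Rd -> 'M[R]_d) (H : Rd -> Rd) (rho : Rd -> R).
Variable mu : {measure set Rd -> \bar R}.
Variables T P : R -> (Rd -> R) -> (Rd -> R).
Context {dO : measure_display} {Omega : measurableType dO}.
Variable M : @hunt_process R d dO Omega.
Hypothesis mu_rho : inf_invariant_density p A (drift A C H) rho mu.
Hypothesis T_mu : L1_semigroup_construction mu A (drift A C H) rho T.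
Hypothesis P_T : continuous_versions mu T P.
Hypothesis M_P : has_transition M P.
Variable f : Rd -> R.
Hypotheses (tf : test_fun setT f) (f0 : forall x, 0 <= f x).

Let sgT := glob_semigroup T_mu.

Let i1 (u : Rd -> R) : in_Lp mu setT 1 u <-> mu.-integrable setT (EFin \o u).
Proof. exact: in_Lp1P. Qed.

(** The absolute value extends t -> P_t f evenly to negative times, so that continuity and
    derivatives in time can be stated on the whole line. *)
Definition evolution (t : R) : Rd -> R := P `|t| f.
Local Notation U := evolution.

Let Lf := gen_L A (drift A C H) f.

Let fL : in_Lp mu setT 1 f. Proof. by have [] := glob_extends T_mu tf. Qed.

Let LfL : in_Lp mu setT 1 Lf. Proof. by have [] := glob_extends T_mu tf. Qed.

Let cf : continuous f. Proof. by have [/(_ 0%N) []] := tf. Qed.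

Lemma evolution_continuous_time (x : Rd) : continuous (fun t => U t x).
Proof.
move=> t; apply/continuous_withinNx/cvgr_dnbhsP => u [_ ut].
have [_ [K [cK _ fK]]] := tf.
have um : `|u n| @[n --> \oo] --> `|t| by exact: cvg_norm.
exact: (P_cvg_time M_P cf cK fK (fun n => normr_ge0 (u n)) um).
Qed.

Lemma evolution_continuous (t : R) : continuous (U t).
Proof.
rewrite /U; have [->|t0] := eqVneq t 0; first by rewrite normr0 (proj1 P_T).
by have [] := P_T_ae T_mu P_T (_ : 0 < `|t|) fL; rewrite ?normr_gt0.
Qed.

Lemma evolution_bound : exists S : R, forall t x, 0 <= U t x <= S.
Proof.
have [_ [K [cK _ fK]]] := tf.
have [B hB] := continuous_cpt_bounded cK cf.
have fB y : `|f y| <= `|B|.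
  have [Ky|nKy] := pselect (K y); first by rewrite (le_trans (hB _ Ky))// ler_norm.
  by rewrite fK// normr0.
exists `|B| => t x; rewrite /U.
have [i ->] := has_transition_Rintegral M_P x (normr_ge0 t) (continuous_measurable_rV cf) (ex_intro _ `|B| fB).
apply/andP; split.
  by apply: Rintegral_ge0 => w _; case: (state _ _ _) => /=.
have -> : `|B| = \int[law M (Some x)]_w (cst `|B| w).
  rewrite Rintegral_cst//.
  by rewrite [X in fine X]probability_setT mulr1.
apply: le_Rintegral => //; first exact: finite_measure_integrable_cst.
by move=> w _; case: (state _ _ _) => [y|] //=; rewrite (le_trans (ler_norm _)).
Qed.

Lemma evolution_integral_continuous (m : {measure set Rd -> \bar R}) (F : R -> R) (B : R)
    (psi : Rd -> R) : continuous F -> (forall y, `|F y| <= B) -> m.-integrable setT (EFin \o psi) ->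
  continuous (fun t => \int[m]_x (F (U t x) * psi x)).
Proof.
move=> cF FB ipsi t; apply/continuous_withinNx/cvgr_dnbhsP => u [_ ut].
have mFU s : measurable_fun setT (fun x => F (U s x)).
  apply: measurableT_comp; first exact: continuous_measurable_fun.
  exact: continuous_measurable_rV (@evolution_continuous s).
have mpsi : measurable_fun setT psi by exact: integrable_measurable ipsi.
have [|||||_ _ l] := @Rdominated_cvg _ _ _ m setT measurableT
  (fun n x => F (U (u n) x) * psi x) (fun x => F (U t x) * psi x) (fun x => `|B| * `|psi x|).
- by move=> n; apply: measurable_funM.
- exact: measurable_funM.
- apply: aeW => x _; have l : F (U (u n) x) @[n --> \oo] --> F (U t x).
    apply: continuous_cvg; first exact: cF.
    exact: (cvg_comp _ _ ut (@evolution_continuous_time x t)).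
  by apply: cvgMl.
- by apply: integrable_EFinZ => //; exact: integrable_norm.
- apply: aeW => x n _; rewrite normrM ler_wpM2r// (le_trans (FB _))// ler_norm//.
- exact: l.
Qed.

Lemma evolution_ae_eq (t : R) : 0 < t -> ae_eq mu setT (U t) (T t f).
Proof.
by move=> t0; rewrite /U gtr0_norm//; have [] := P_T_ae T_mu P_T t0 fL.
Qed.

Lemma evolution_L1 (t : R) : in_Lp mu setT 1 (U t).
Proof.
rewrite /U; have [->|t0] := eqVneq t 0; first by rewrite normr0 (proj1 P_T).
by have [] := P_T_ae T_mu P_T (_ : 0 < `|t|) fL; rewrite ?normr_gt0.
Qed.

Let quot_L1 (s : R) (g h : Rd -> R) : in_Lp mu setT 1 g -> in_Lp mu setT 1 h ->
  in_Lp mu setT 1 (fun x => (g x - h x) / s).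
Proof.
move=> /i1 ig /i1 ih; apply/i1; under eq_fun do rewrite mulrC.
by apply: integrable_EFinZ => //; exact: integrable_EFinB.
Qed.

(** T_t commutes with the difference quotient at 0 and contracts L^1. *)
Lemma evolution_quotient_le (s t : R) (v : Rd -> R) : 0 < s -> 0 < t -> in_Lp mu setT 1 v ->
  \int[mu]_x `|(U (t + s) x - U t x) / s - T t v x| <= \int[mu]_x `|(T s f x - f x) / s - v x|.
Proof.
move=> s0 t0 vL.
have TsL := sg_L1 sgT s0 fL; have TtL := sg_L1 sgT t0 fL.
have qL := quot_L1 s TsL fL.
set q := fun x => (T s f x - f x) / s in qL *.
have lin := sg_linear sgT s t0 qL fL.
have qE : (fun x => s * q x + f x) = T s f.
  by apply/funext => x; rewrite /q mulrC divfK ?gt_eqF// subrK.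
rewrite qE in lin.
have e1 := evolution_ae_eq (addr_gt0 t0 s0); have e2 := evolution_ae_eq t0.
have e3 := sg_semigroup sgT t0 s0 fL.
apply: le_trans (L1_dist_T T_mu t0 qL vL).
rewrite (@ae_eq_Rintegral _ _ _ mu setT measurableT _ (fun x => `|T t q x - T t v x|))//.
- apply: measurableT_comp => //; apply: measurable_funB.
    exact: in_Lp_measurable (quot_L1 s (evolution_L1 _) (evolution_L1 _)).
  exact: in_Lp_measurable (sg_L1 sgT t0 vL).
- apply: measurableT_comp => //; apply: measurable_funB.
    exact: in_Lp_measurable (sg_L1 sgT t0 qL).
  exact: in_Lp_measurable (sg_L1 sgT t0 vL).
- apply: filterS2 (filterI e1 e2) (filterI e3 lin) => x [h1 h2] [h3 h4] _.
  by rewrite h1// h2// h3// h4// addrK mulrC mulKf ?gt_eqF.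
Qed.

Lemma evolution_generator (t : R) : 0 < t -> generator mu setT T (U t) (T t Lf).
Proof.
move=> t0; have [_ _ gf] := glob_extends T_mu tf; rewrite -/Lf in gf.
split; [exact: evolution_L1|exact: (sg_L1 sgT)|].
have UL := evolution_L1 t.
apply/ge0_cvge0P; [by move=> s; exact: Lnorm_ge0|move=> e e0].
have /ge0_cvge0P -/(_ (fun=> Lnorm_ge0 _ _ _) _ e0) := gf.
apply: filterS2 (nbhs_right_gt 0) => s s0.
have qL := quot_L1 s (sg_L1 sgT s0 fL) fL.
have qL' := quot_L1 s (sg_L1 sgT s0 UL) UL.
rewrite /= !Lp_dist1_fin//; last exact: (sg_L1 sgT).
rewrite !lee_fin; apply: le_trans; apply: le_trans (evolution_quotient_le s0 t0 LfL).
have -> // : \int[mu]_x `|(T s (U t) x - U t x) / s - T t Lf x| =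
  \int[mu]_x `|(U (t + s) x - U t x) / s - T t Lf x|.
apply: ae_eq_Rintegral => //.
- apply: measurableT_comp => //; apply: measurable_funB.
    exact: in_Lp_measurable qL'.
  exact: in_Lp_measurable (sg_L1 sgT t0 LfL).
- apply: measurableT_comp => //; apply: measurable_funB.
    exact: in_Lp_measurable (quot_L1 s (evolution_L1 _) (evolution_L1 _)).
  exact: in_Lp_measurable (sg_L1 sgT t0 LfL).
have e3 := T_ae_eq T_mu s0 UL (sg_L1 sgT t0 fL) (evolution_ae_eq t0).
have e4 := sg_semigroup sgT s0 t0 fL.
have e1 := evolution_ae_eq (addr_gt0 t0 s0).
apply: filterS3 e1 e3 e4 => x h1 h3 h4 _.
by rewrite h1// h3// [t + s]addrC h4.
Qed.

(** The semigroup is only differentiable from the right at 0. A quotient to the left of t is a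
    quotient to the right of t + r, and T_t L f is T_(t+r) applied to T_(-r) L f; strong continuity
    then replaces T_(-r) L f by L f. *)
Lemma evolution_quotient_cvg (t e : R) : 0 < t -> 0 < e ->
  \forall r \near (0 : R)^', \int[mu]_x `|(U (t + r) x - U t x) / r - T t Lf x| <= e.
Proof.
move=> t0 e0; have e20 : 0 < e / 2 by rewrite divr_gt0.
have [_ _ gf] := glob_extends T_mu tf; rewrite -/Lf in gf.
have /ge0_cvge0P -/(_ (fun=> Lnorm_ge0 _ _ _) _ e20) n1 := gf.
have /ge0_cvge0P -/(_ (fun=> Lnorm_ge0 _ _ _) _ e20) n2 := sg_strong_continuity sgT LfL.
have : \forall s \near (0 : R)^'+, [/\ 0 < s, s < t,
    \int[mu]_x `|(T s f x - f x) / s - Lf x| <= e / 2 & \int[mu]_x `|T s Lf x - Lf x| <= e / 2].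
  apply: filterS3 n1 n2 (filterI (nbhs_right_gt (0 : R)) (nbhs_right_lt t0)) => s h1 h2 [s0 st].
  have TsL := sg_L1 sgT s0 fL; have TLL := sg_L1 sgT s0 LfL.
  by move: h1 h2; rewrite !Lp_dist1_fin// ?lee_fin//; exact: quot_L1.
move=> [del /= del0 hdel].
exists del => // r /= rdel rne0; have {}rdel : `|r| < del by rewrite -normrN -(sub0r r).
have [r0|r0|r0] := ltgtP r 0; last by rewrite r0 eqxx in rne0.
  have nr0 : 0 < - r by rewrite oppr_gt0.
  have [_ srt h1 h2] : [/\ 0 < - r, - r < t,
    \int[mu]_x `|(T (- r) f x - f x) / (- r) - Lf x| <= e / 2 & \int[mu]_x `|T (- r) Lf x - Lf x| <= e / 2].
    by apply: hdel => //=; rewrite sub0r opprK.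
  have tr0 : 0 < t + r by rewrite -subr_gt0 opprK addrC in srt *.
  have TrL := sg_L1 sgT nr0 LfL.
  have h3 := evolution_quotient_le nr0 tr0 TrL.
  have -> : \int[mu]_x `|(U (t + r) x - U t x) / r - T t Lf x| =
      \int[mu]_x `|(U (t + r - r) x - U (t + r) x) / (- r) - T (t + r) (T (- r) Lf) x|.
    apply: ae_eq_Rintegral => //.
    - apply: measurableT_comp => //; apply: measurable_funB.
        exact: in_Lp_measurable (quot_L1 r (evolution_L1 _) (evolution_L1 _)).
      exact: in_Lp_measurable (sg_L1 sgT t0 LfL).
    - apply: measurableT_comp => //; apply: measurable_funB.
        exact: in_Lp_measurable (quot_L1 (- r) (evolution_L1 _) (evolution_L1 _)).
      exact: in_Lp_measurable (sg_L1 sgT tr0 TrL).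
    have := sg_semigroup sgT tr0 nr0 LfL; rewrite addrK.
    by apply: filterS => x h _; rewrite h// invrN mulrN -mulNr opprB.
  apply: (le_trans h3).
  have qL := quot_L1 (- r) (sg_L1 sgT nr0 fL) fL.
  have iX f1 f2 : in_Lp mu setT 1 f1 -> in_Lp mu setT 1 f2 ->
      mu.-integrable setT (EFin \o (fun x => `|f1 x - f2 x|)).
    by move=> /i1 ? /i1 ?; apply: integrable_norm; exact: integrable_EFinB.
  rewrite [leRHS](splitr e); apply: le_trans (lerD h1 h2).
  rewrite -RintegralD//; [|exact: iX..].
  apply: le_Rintegral => //; [exact: iX|by apply: integrable_EFinD => //; exact: iX|].
  move=> x _; rewrite -[X in `|X| <= _](subrKA (Lf x)) (le_trans (ler_normD _ _))//.
  by rewrite lerD2l distrC.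
have [_ _ h1 h2] : [/\ 0 < r, r < t,
    \int[mu]_x `|(T r f x - f x) / r - Lf x| <= e / 2 & \int[mu]_x `|T r Lf x - Lf x| <= e / 2].
  by apply: hdel => //=; rewrite sub0r normrN.
apply: le_trans (evolution_quotient_le r0 t0 LfL) _; lra.
Qed.

Variables (F g g' Z zeta z : R -> R) (B K : R).
Hypothesis cut : cutoff F g g' Z zeta z B K.

Let cF : continuous F := is_derive_continuous (cutoff_dF cut).

Let cg : continuous g := is_derive_continuous (cutoff_dg cut).

Lemma evolution_integrable (G : R -> R) (D : R) (v : Rd -> R) (t : R) : continuous G ->
  (forall y, `|G y| <= D) -> mu.-integrable setT (EFin \o v) ->
  mu.-integrable setT (EFin \o (fun x => v x * G (U t x))).
Proof.
move=> cG GD iv; apply: (integrable_EFinM (M := D) measurableT iv) => //.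
apply: measurableT_comp; first exact: continuous_measurable_fun.
exact: continuous_measurable_rV (@evolution_continuous t).
Qed.

(** U_t is differentiable in time only in L^1, which does not allow differentiating F(U_t)
    pointwise. Concavity squeezes the increment of F(U) between the increment of U times g(U) at
    either end, and both bounds have the same first-order term. *)
Lemma evolution_entropy_derive (psi : Rd -> R) (D t : R) : (forall x, 0 <= psi x <= D) ->
  mu.-integrable setT (EFin \o psi) -> 0 < t ->
  is_derive t 1 (fun s => \int[mu]_x (F (U s x) * psi x))
    (\int[mu]_x (T t Lf x * (g (U t x) * psi x))).
Proof.
move=> psiD ipsi t0.
have wL : in_Lp mu setT 1 (T t Lf) by exact: (sg_L1 sgT).
have mpsi : measurable_fun setT psi by exact: integrable_measurable ipsi.
have D0 : 0 <= D by have /andP[/le_trans] := psiD 0; apply.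
have B0 : 0 <= B by rewrite (le_trans _ (cutoff_gM cut 0)).
have aD x : `|psi x| <= D by have /andP[p0 pD] := psiD x; rewrite ger0_norm.
have ig (s : R) : mu.-integrable setT (EFin \o (fun x => g (U s x) * psi x)).
  by under eq_fun do rewrite mulrC; exact: (evolution_integrable s cg (cutoff_gM cut)).
have gB s x : `|g (U s x) * psi x| <= B * D by rewrite normrM ler_pM// (cutoff_gM cut).
have iG (v : Rd -> R) (s : R) : in_Lp mu setT 1 v ->
    mu.-integrable setT (EFin \o (fun x => v x * (g (U s x) * psi x))).
  move=> /i1 iv; apply: (integrable_EFinM (M := B * D) measurableT iv) => //.
  exact: integrable_measurable (ig s).
set L := \int[mu]_x (T t Lf x * (g (U t x) * psi x)).
pose h s := \int[mu]_x (F (U s x) * psi x).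
suff l : r^-1 *: ((h \o shift t) (r *: 1) - h t) @[r --> 0^'] --> L.
  by split; [apply/cvg_ex; exists L|exact: cvg_lim l].
apply/cvgrPdist_le => e e0.
pose Lt s := \int[mu]_x (T t Lf x * (g (U s x) * psi x)).
have l1 : \forall r \near (0 : R)^', `|L - Lt (t + r)| <= e / 2.
  have cL : {for t, continuous Lt}.
    have -> : Lt = fun s => \int[mu]_x (g (U s x) * (T t Lf x * psi x)).
      by apply/funext => s; apply: eq_Rintegral => x _; rewrite mulrCA.
    apply: (evolution_integral_continuous cg (cutoff_gM cut)).
    by apply: (integrable_EFinM (M := D) measurableT) => //; exact/i1.
  have /cvgrPdist_le/(_ (e / 2)) h1 : Lt (t + r) @[r --> 0^'] --> L.
    apply: continuous_cvg; first exact: cL.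
    have l : t + r @[r --> (0 : R)] --> t + 0 by apply: cvgD; [exact: cvg_cst|exact: cvg_id].
    by rewrite addr0 in l; exact: cvg_within_filter.
  by apply: h1; rewrite divr_gt0.
pose E0 := B * D + 1.
have E00 : 0 < E0 by rewrite ltr_wpDl// mulr_ge0.
have e2E0 : 0 < e / 2 / E0 by rewrite !divr_gt0.
have l2 := evolution_quotient_cvg t0 e2E0.
have n0 : \forall r \near (0 : R)^', r != 0 by exact: nbhs_dnbhs_neq.
near=> r.
have r0 : r != 0 by near: r.
have h1 : `|L - Lt (t + r)| <= e / 2 by near: r.
have h2 : \int[mu]_x `|(U (t + r) x - U t x) / r - T t Lf x| <= e / 2 / E0 by near: r.
set X := \int[mu]_x _ in h2.
pose a s := \int[mu]_x ((U (t + r) x - U t x) * (g (U s x) * psi x)).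
have UL : in_Lp mu setT 1 (fun x => U (t + r) x - U t x).
  by apply/i1; apply: integrable_EFinB => //; apply/i1; exact: evolution_L1.
have ha s : `|a s - r * Lt s| <= `|r| * (e / 2).
  have iw := iG _ s wL.
  rewrite /a /Lt -RintegralZl// -RintegralB//; [|exact: iG|by apply: integrable_EFinZ].
  apply: (le_trans (le_normr_Rintegral measurableT _)).
    by apply: integrable_EFinB => //; [exact: iG|apply: integrable_EFinZ].
  have iX : mu.-integrable setT (EFin \o (fun x => `|(U (t + r) x - U t x) / r - T t Lf x|)).
    apply: integrable_norm; apply: integrable_EFinB => //; last exact/i1.
    by apply/i1; apply: quot_L1; exact: evolution_L1.
  apply: (@le_trans _ _ (\int[mu]_x (`|r| * (B * D) * `|(U (t + r) x - U t x) / r - T t Lf x|))).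
    apply: le_Rintegral => //; first last.
    - move=> x _; have -> : (U (t + r) x - U t x) * (g (U s x) * psi x) - r * (T t Lf x * (g (U s x) * psi x)) =
        r * ((g (U s x) * psi x) * ((U (t + r) x - U t x) / r - T t Lf x)) by field.
      by rewrite normrM -[leRHS]mulrA ler_wpM2l// normrM ler_wpM2r.
    - exact: integrable_EFinZ.
    - by apply: integrable_norm; apply: integrable_EFinB => //; [exact: iG|apply: integrable_EFinZ].
  rewrite RintegralZl// -mulrA ler_wpM2l// -/X.
  have BD0 : 0 <= B * D by rewrite mulr_ge0.
  have X0 : 0 <= X by exact: Rintegral_ge0.
  apply: (@le_trans _ _ (E0 * X)); first by rewrite ler_wpM2r// lerDl.
  by rewrite mulrC -ler_pdivlMr.
(* The tangent inequality at the new and at the old value gives the lower and the upper bound. *)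
have [hl hr] : a (t + r) <= h (t + r) - h t /\ h (t + r) - h t <= a t.
  have iF s : mu.-integrable setT (EFin \o (fun x => F (U s x) * psi x)).
    by under eq_fun do rewrite mulrC; exact: (evolution_integrable s cF (cutoff_FM cut)).
  have [S US] := evolution_bound.
  rewrite /h -RintegralB//; split; apply: le_Rintegral => //; try exact: iG; try exact: integrable_EFinB.
    move=> x _; rewrite mulrA -mulrBl mulrC [leRHS]mulrC ler_wpM2l//; first by case/andP: (psiD x).
    by rewrite mulrC (cutoff_tangent cut)//; [case/andP: (US t x)|case/andP: (US (t + r) x)].
  move=> x _; rewrite mulrA -mulrBl mulrC [leRHS]mulrC ler_wpM2l//; first by case/andP: (psiD x).
  have /andP[p1 _] := US (t + r) x; have /andP[p2 _] := US t x.
  by have := cutoff_tangent cut p1 p2; lra.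
have hq : `|h (t + r) - h t - r * L| <= `|r| * e.
  have a1 := ha t; have a2 := ha (t + r); rewrite [Lt t]/Lt -/L in a1.
  have : `|r| * `|L - Lt (t + r)| <= `|r| * (e / 2) by rewrite ler_wpM2l.
  rewrite -normrM mulrBr => h3.
  have -> : `|r| * e = `|r| * (e / 2) + `|r| * (e / 2) by field.
  move: a1 a2 h3; rewrite !ler_norml; lra.
rewrite /= -(ler_pM2l (_ : 0 < `|r|)) ?normr_gt0// -normrM mulrBr.
rewrite /GRing.scale/= mulr1 [r + t]addrC mulVKf//.
by rewrite distrC.
Unshelve. all: by end_near.
Qed.

End time_evolution.

(** * Normalised cutoffs tending to the indicator of zero *)

Section normalized_cutoff.
Context {R : realType}.
Implicit Types k y : R.

(** A bound that does not depend on k: away from 0 the cutoffs stay bounded while their value at 0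
    grows like -ln k, so normalisation separates 0 from the rest. *)
Lemma cutF_le_inv_sqr k y : 0 < k -> 0 < y -> - cutF k y <= (y ^+ 2)^-1.
Proof.
move=> k0 y0; rewrite /cutF; set Y := y + 4 * k.
have y20 : 0 < y ^+ 2 by rewrite exprn_gt0.
have yY : y ^+ 2 <= Y ^+ 2 + k ^+ 2.
  rewrite -[leLHS]addr0 lerD ?sqr_ge0// lerXn2r ?nnegrE ?ltW// /Y; first by rewrite addr_gt0// mulr_gt0.
  by rewrite ltrDl mulr_gt0.
have Yk : 0 < Y ^+ 2 + k ^+ 2 by exact: lt_le_trans yY.
have Y1 : 0 < Y ^+ 2 + 1 by rewrite ltr_wpDl ?sqr_ge0.
have i0 : 0 < (Y ^+ 2 + k ^+ 2)^-1 by rewrite invr_gt0.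
have h : ln (Y ^+ 2 + 1) - ln (Y ^+ 2 + k ^+ 2) <= (Y ^+ 2 + k ^+ 2)^-1.
  rewrite -ln_div ?posrE//.
  have e : (Y ^+ 2 + 1) / (Y ^+ 2 + k ^+ 2) <= 1 + (Y ^+ 2 + k ^+ 2)^-1.
    rewrite ler_pdivrMr// mulrDl mul1r mulVf ?gt_eqF// lerD2r lerDl.
    by rewrite exprn_ge0 ?ltW.
  apply: le_trans (le_ln1Dx _); last by rewrite (lt_trans _ i0)// ltrN10.
  by rewrite ler_ln ?posrE ?divr_gt0// ltr_wpDl.
have h2 : (Y ^+ 2 + k ^+ 2)^-1 <= (y ^+ 2)^-1 by rewrite lef_pV2 ?posrE.
move: h h2 i0; set u := ln _; set v := ln _; set w := _^-1; set w' := _^-1; lra.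
Qed.

Lemma cutF0_ge k : 0 < k -> k <= 8^-1 -> - ln k - 9 <= - cutF k 0.
Proof.
move=> k0 k8; rewrite /cutF add0r.
have -> : (4 * k) ^+ 2 + k ^+ 2 = 17 * k ^+ 2 by ring.
have k20 : 0 < k ^+ 2 by rewrite exprn_gt0.
have -> : ln (17 * k ^+ 2) = ln 17 + 2 * ln k.
  by rewrite lnM ?posrE// lnXn// mulr2n; lra.
have h1 : ln 17 < 17 :> R by exact: ln_sublinear.
have h2 : 0 <= ln ((4 * k) ^+ 2 + 1) by apply: ln_ge0; rewrite lerDr sqr_ge0.
lra.
Qed.

(** The logarithm of the scale is -(n+3), so that division by n+3 normalises the cutoff; the offset
    3 ensures that the scale is at most 1/8, as e^3 >= 8. *)
Definition cut_scale (n : nat) : R := expR (- n.+3%:R).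

Lemma cut_scale_gt0 n : 0 < cut_scale n. Proof. exact: expR_gt0. Qed.

Lemma cut_scale_le n : cut_scale n <= 8^-1.
Proof.
rewrite /cut_scale expRN lef_pV2 ?posrE ?expR_gt0//.
have h : 2 <= expR 1 :> R by rewrite (le_trans _ (expR_ge1Dx _)).
have h3 : 2 ^+ 3 <= expR 1 ^+ 3 :> R by rewrite lerXn2r ?nnegrE ?expR_ge0.
rewrite (@le_trans _ _ (expR 3))//; last by rewrite ler_expR ler_nat.
have -> : expR 3 = expR 1 ^+ 3 :> R by rewrite -expRM_natl mulr1.
by rewrite (le_trans _ h3)// -natrX ler_nat.
Qed.

Definition unit_cutoff (n : nat) (y : R) : R := - cutF (cut_scale n) y / n.+3%:R.

Lemma unit_cutoff_ge0_le1 n y : 0 <= unit_cutoff n y <= 1.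
Proof.
have n3 : 0 < n%:R + 3 :> R by rewrite ltr_wpDl.
have := cutF_bounded (cut_scale_gt0 n) (cut_scale_le n) y.
rewrite [ln _]expRK opprK => /andP[h1 h2].
by rewrite /unit_cutoff; apply/andP; split; [rewrite divr_ge0// ltW|rewrite ler_pdivrMr// mul1r].
Qed.

Lemma cvg_div_natS3 (a : R) : a / n.+3%:R @[n --> \oo] --> (0 : R).
Proof.
have h : (n + 2).+1%:R^-1 @[n --> \oo] --> (0 : R).
  by rewrite (@cvg_shiftn 2 _ (@harmonic R)); exact: cvg_harmonic.
rewrite -(mulr0 a); under eq_fun do rewrite -addn2.
by apply: cvgMr.
Qed.

Lemma unit_cutoff_cvg y : 0 <= y ->
  unit_cutoff n y @[n --> \oo] --> ((y == 0)%:R : R).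
Proof.
have n3 n : 0 < n%:R + 3 :> R by rewrite ltr_wpDl.
rewrite le_eqVlt => /predU1P[<-|y0].
  rewrite eqxx.
  apply: (@squeeze_cvgr _ _ _ _ (fun n => 1 - 9 / n.+3%:R) (cst 1)).
  - apply: nearW => n; have /andP[_ ->] := unit_cutoff_ge0_le1 n 0; rewrite andbT.
    rewrite /unit_cutoff ler_pdivlMr// mulrBl mul1r divfK ?gt_eqF//.
    have := cutF0_ge (cut_scale_gt0 n) (cut_scale_le n).
    by rewrite [ln _]expRK opprK.
  - by rewrite -[X in _ --> X]subr0; apply: cvgB; [exact: cvg_cst|exact: cvg_div_natS3].
  - exact: cvg_cst.
rewrite gt_eqF//; apply: (@squeeze_cvgr _ _ _ _ (cst 0) (fun n => (y ^+ 2)^-1 / n.+3%:R)).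
- apply: nearW => n; have /andP[-> _] := unit_cutoff_ge0_le1 n y.
  by rewrite /unit_cutoff /= ler_pM2r ?invr_gt0// cutF_le_inv_sqr ?cut_scale_gt0.
- exact: cvg_cst.
- exact: cvg_div_natS3.
Qed.

End normalized_cutoff.

(** * The zero set of P_t f has no flux *)

Section evolution_zero_set.
Context {R : realType} {d : nat} (p : R).
Local Notation Rd := 'rV[R]_d.
Local Notation leb := (lebesgue_rV R d).
Variables (A C : Rd -> 'M[R]_d) (H : Rd -> Rd) (rho : Rd -> R).
Variable mu : {measure set Rd -> \bar R}.
Variables T P : R -> (Rd -> R) -> (Rd -> R).
Context {dO : measure_display} {Omega : measurableType dO}.
Variable M : @hunt_process R d dO Omega.
Hypotheses (d_ge2 : (2 <= d)%N) (p_gtd : d%:R < p).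
Hypothesis ass_a : assumption_a p A C H.
Hypothesis mu_rho : inf_invariant_density p A (drift A C H) rho mu.
Hypothesis T_mu : L1_semigroup_construction mu A (drift A C H) rho T.
Hypothesis P_T : continuous_versions mu T P.
Hypothesis M_P : has_transition M P.
Variable f : Rd -> R.
Hypotheses (tf : test_fun setT f) (f0 : forall x, 0 <= f x).

Local Notation U := (evolution P f).

Let U0 t x : 0 <= U t x.
Proof. by have [S US] := evolution_bound M_P tf f0; have /andP[] := US t x. Qed.

Let cU t : continuous (U t).
Proof. exact: (evolution_continuous T_mu P_T tf). Qed.

Let mu_test_integrable b : test_fun setT b -> mu.-integrable setT (EFin \o b).
Proof. by move=> tb; apply/in_Lp1P => //; have [] := glob_extends T_mu tb. Qed.

(** [generator_estimate] at time t bounds the squared integral by the time derivative of the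
    entropy, up to constants. Integration in time leaves the increment of the entropy, which is
    linear in the bound [N] of the cutoff, while the left side is quadratic in F. *)
Lemma evolution_energy b i (a a' : R) : test_fun setT b -> 0 < a -> a < a' ->
  exists2 c, 0 <= c & forall F g g' Z zeta z B K N, cutoff F g g' Z zeta z B K ->
    (forall y, 0 <= y -> `|F y| <= N) ->
    \int[lebesgue_measure]_(t in `]a, a']) (\int[leb]_x (F (U t x) * partial i b x)) ^+ 2 <= c * (N + 1).
Proof.
move=> tb a0 aa'; have [c c0 hc] := generator_estimate d_ge2 p_gtd ass_a mu_rho T_mu i tb.
have tb2 : test_fun setT (fun x => b x ^+ 2) := test_funM tb (test_fun_smooth tb).
have ib2 := mu_test_integrable tb2.
have [D b2D] : exists D, forall x, 0 <= b x ^+ 2 <= D.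
  have [D _ hD] := test_fun_bounded tb2; exists D => x.
  by rewrite sqr_ge0 (le_trans (ler_norm _) (hD x)).
pose I := \int[mu]_x (b x ^+ 2).
have I0 : 0 <= I by apply: Rintegral_ge0 => x _; exact: sqr_ge0.
exists (c * (2 * I + c * (a' - a))).
  by rewrite mulr_ge0// addr_ge0 ?mulr_ge0// subr_ge0 ltW.
move=> F g g' Z zeta z B K N cut FN.
have N0 : 0 <= N by rewrite (le_trans _ (FN 0 (lexx _))).
have cF : continuous F := is_derive_continuous (cutoff_dF cut).
pose h t := \int[mu]_x (F (U t x) * b x ^+ 2).
have iFb t : mu.-integrable setT (EFin \o (fun x => F (U t x) * b x ^+ 2)).
  under eq_fun do rewrite mulrC.
  exact: (evolution_integrable T_mu P_T tf t cF (cutoff_FM cut) ib2).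
have hI t : `|h t| <= N * I.
  apply: (le_trans (le_normr_Rintegral measurableT (iFb t))).
  rewrite -RintegralZl//; apply: le_Rintegral => //.
  - exact: integrable_norm (iFb t).
  - exact: integrable_EFinZ.
  - by move=> x _; rewrite normrM [`|_ ^+ 2|]ger0_norm ?sqr_ge0// ler_wpM2r ?sqr_ge0 ?FN.
pose phi t := (\int[leb]_x (F (U t x) * partial i b x)) ^+ 2.
pose H1 (t : R) := c * (h t + c * t).
pose dH1 t := c * (\int[mu]_x (T t (gen_L A (drift A C H) f) x * (g (U t x) * b x ^+ 2)) + c).
apply: (le_trans (@integral_le_increment _ H1 dH1 phi a a' aa' _ _ _)).
- have cJ : continuous (fun t => \int[leb]_x (F (U t x) * partial i b x)).
    apply: (evolution_integral_continuous T_mu P_T M_P tf cF (cutoff_FM cut)).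
    have [sb [K0 [cK0 _ bK0]]] := test_fun_partial i tb.
    exact: integrable_cpt cK0 (test_fun_continuous (test_fun_partial i tb)) bK0.
  move=> t; exact: (@continuousM _ _ _ _ _ (cJ t) (cJ t)).
- move=> t /andP[at_ _]; have t0 : 0 < t by exact: lt_le_trans at_.
  have dh := evolution_entropy_derive T_mu P_T M_P tf f0 cut b2D ib2 t0.
  have dH := is_deriveZ c (is_deriveD dh (is_deriveZ c (is_derive_id t (1 : R)))).
  by apply: (is_derive_eq dH); rewrite /dH1 /GRing.scale/= mulr1.
- move=> t /andP[at_ _]; have t0 : 0 < t by exact: lt_le_trans at_.
  apply: (hc _ _ _ _ _ _ _ _ _ _ cut); last exact: aeW.
  exact: (evolution_generator T_mu P_T tf).
have -> : H1 a' - H1 a = c * (h a' - h a + c * (a' - a)) by rewrite /H1; ring.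
rewrite -mulrA ler_wpM2l// mulrDl; have := hI a'; have := hI a; rewrite !ler_norml => /andP[h1 h2] /andP[h3 h4].
rewrite lerD//; last by rewrite ler_peMr// ?lerDr// mulr_ge0// subr_ge0 ltW.
by lra.
Qed.

(** For the cutoff of scale e^-(n+3) the bound in [evolution_energy] is of order n; dividing by
    (n+3)^2 makes the right side tend to 0, and the normalised cutoffs tend to the indicator of the
    zero set of U_t. *)
Lemma evolution_zero_set_flux b i (a a' : R) : test_fun setT b -> 0 < a -> a < a' ->
  \forall t \ae lebesgue_measure, t \in `]a, a'] ->
    \int[leb]_x ((U t x == 0)%:R * partial i b x) = 0.
Proof.
move=> tb a0 aa'; have [c c0 hc] := evolution_energy i tb a0 aa'.
have tbi := test_fun_partial i tb.
have ibi : leb.-integrable setT (EFin \o partial i b).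
  have [sb [K0 [cK0 _ bK0]]] := tbi.
  exact: integrable_cpt cK0 (test_fun_continuous tbi) bK0.
pose G (n : nat) : R -> R := unit_cutoff n.
have G1 n y : `|G n y| <= 1.
  by have /andP[g0 g1] := unit_cutoff_ge0_le1 n y; rewrite ger0_norm.
have cG n : continuous (G n).
  have [B [K cut]] := @log_cutoff R _ (cut_scale_gt0 n) (cut_scale_le n).
  have cF : continuous (cutF (cut_scale n)) := is_derive_continuous (cutoff_dF cut).
  move=> y; apply: (@continuousM _ _ (fun y => - cutF (cut_scale n) y) (cst n.+3%:R^-1)).
    by apply: continuousN; exact: cF.
  exact: cst_continuous.
have mGU n t : measurable_fun setT (fun x => G n (U t x)).
  apply: measurableT_comp; first exact: continuous_measurable_fun.
  exact: continuous_measurable_rV (@cU t).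
pose J_ n t := \int[leb]_x (G n (U t x) * partial i b x).
pose J t := \int[leb]_x ((U t x == 0)%:R * partial i b x).
have cJ n : continuous (J_ n).
  exact: (evolution_integral_continuous T_mu P_T M_P tf (cG n) (G1 n) ibi).
have i_ n t : leb.-integrable setT (EFin \o (fun x => G n (U t x) * partial i b x)).
  under eq_fun do rewrite mulrC.
  by apply: (integrable_EFinM (M := 1) measurableT ibi).
pose I := \int[leb]_x `|partial i b x|.
have JI n t : `|J_ n t| <= I.
  apply: (le_trans (le_normr_Rintegral measurableT (i_ n t))).
  apply: le_Rintegral => //; [exact: integrable_norm|exact: integrable_norm|].
  by move=> x _; rewrite normrM ler_piMl.
have J_J t : J_ n t @[n --> \oo] --> J t.
  have [|||||_ _ l] := @Rdominated_cvg _ _ _ leb setT measurableT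
    (fun n x => G n (U t x) * partial i b x) (fun x => (U t x == 0)%:R * partial i b x) (fun x => `|partial i b x|).
  - by move=> n; exact: integrable_measurable (i_ n t).
  - apply: measurable_funM; last exact: integrable_measurable ibi.
    by apply: (measurable_fun_cvg (mGU ^~ t)) => x _; exact: unit_cutoff_cvg.
  - apply: aeW => x _.
    have l := unit_cutoff_cvg (U0 t x).
    by apply: cvgMl.
  - exact: integrable_norm.
  - by apply: aeW => x n _; rewrite normrM ler_piMl.
  - exact: l.
have mD : measurable (`]a, a'] : set (measurableTypeR R)) by exact: measurable_itv.
have mJ_ n : measurable_fun (`]a, a'] : set (measurableTypeR R)) (J_ n).
  by apply: measurable_funTS; exact: continuous_measurable_fun.
have iI : lebesgue_measure.-integrable `]a, a'] (EFin \o cst (I ^+ 2)).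
  have h : lebesgue_measure.-integrable `[a, a'] (EFin \o cst (I ^+ 2)).
    apply: continuous_compact_integrable; first exact: segment_compact.
    by apply: continuous_subspaceT => t; exact: cst_continuous.
  by apply: integrableS h => //; exact: subset_itv_oc_cc.
have J2I n t : `|J_ n t ^+ 2| <= I ^+ 2.
  by rewrite normrX lerXn2r ?nnegrE// (le_trans _ (JI n t)).
have iJ2 n : lebesgue_measure.-integrable `]a, a'] (EFin \o (fun t => J_ n t ^+ 2)).
  have mJ2 : measurable_fun (`]a, a'] : set (measurableTypeR R)) (fun t => J_ n t ^+ 2) by exact: measurable_funX.
  exact: (integrable_dominated mD mJ2 (fun t _ => J2I n t) iI).
(* The estimate reads (n+3)^2 X <= c (n+4), and n+4 is at most 2(n+3). *)
have J2_le n : \int[lebesgue_measure]_(t in `]a, a']) (J_ n t ^+ 2) <= 2 * c / n.+3%:R.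
  have n3 : 0 < n.+3%:R :> R by rewrite ltr0n.
  have [B [K cut]] := @log_cutoff R _ (cut_scale_gt0 n) (cut_scale_le n).
  have := hc _ _ _ _ _ _ _ _ n.+3%:R cut _.
  set E := \int[_]_(_ in _) _ => hE.
  have {}hE : E <= c * (n.+3%:R + 1).
    apply: hE => y y0; have := cutF_bounded (cut_scale_gt0 n) (cut_scale_le n) y.
    rewrite [ln _]expRK opprK => /andP[h1 h2].
    by rewrite -normrN ger0_norm.
  have EE : E = n.+3%:R ^+ 2 * \int[lebesgue_measure]_(t in `]a, a']) (J_ n t ^+ 2).
    rewrite -RintegralZl//; apply: eq_Rintegral => t _.
    have -> : \int[leb]_x (cutF (cut_scale n) (U t x) * partial i b x) = - n.+3%:R * J_ n t.
      rewrite /J_ -RintegralZl//; apply: eq_Rintegral => x _.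
      rewrite mulrA; congr (_ * _); rewrite /G /unit_cutoff.
      by rewrite mulNr [n.+3%:R * _]mulrC divfK ?gt_eqF// opprK.
    by rewrite exprMn sqrrN.
  move: hE; rewrite EE; set X := \int[_]_(_ in _) _ => hX.
  rewrite ler_pdivlMr// -(ler_pM2l n3) [2 * c]mulrC mulrCA -[X * _]mulrC mulrA -expr2.
  apply: (le_trans hX); have n1 : 0 <= n.+3%:R - 1 :> R by rewrite subr_ge0 ler1n.
  by have := mulr_ge0 c0 n1; lra.
have mJ : measurable_fun (`]a, a'] : set (measurableTypeR R)) J.
  by apply: (measurable_fun_cvg mJ_) => t _; exact: J_J.
have [|||||iJ _ l] := @Rdominated_cvg _ _ _ lebesgue_measure `]a, a'] mD
    (fun n t => J_ n t ^+ 2) (fun t => J t ^+ 2) (cst (I ^+ 2)).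
- by move=> n; exact: measurable_funX.
- exact: measurable_funX.
- apply: aeW => t _; rewrite expr2; under eq_fun do rewrite expr2.
  by have l := J_J t; apply: cvgM.
- exact: iI.
- by apply: aeW => t n _ /=; exact: J2I.
have z : \int[lebesgue_measure]_(t in `]a, a']) (J t ^+ 2) = 0.
  have l0 : \int[lebesgue_measure]_(t in `]a, a']) (J_ n t ^+ 2) @[n --> \oo] --> 0.
    apply: (@squeeze_cvgr _ _ _ _ (cst 0) (fun n => 2 * c / n.+3%:R)).
    - apply: nearW => n; rewrite J2_le andbT; apply: Rintegral_ge0 => t _; exact: sqr_ge0.
    - exact: cvg_cst.
    - exact: cvg_div_natS3.
  exact: (cvg_unique (@Rhausdorff R) l l0).
have := Rintegral_eq0_ae mD (fun t _ => sqr_ge0 (J t)) iJ z.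
by apply: filterS => t h /h /eqP; rewrite sqrf_eq0 => /eqP.
Qed.

End evolution_zero_set.

(** * Sets without flux in any direction *)

Lemma quadratic_increment_const {R : realType} (q : rat -> R) (h : rat) (H c : R) : 0 <= c ->
  (forall n k : nat, (0 < n)%N -> (k <= n)%N -> `|H| <= n%:R ->
    `|q (h * (k%:R / n%:R) + h / n%:R) - q (h * (k%:R / n%:R))| <= c * (H / n%:R) ^+ 2) ->
  q h = q 0.
Proof.
move=> c0 step.
(* Cutting the segment into n steps gives n increments of size c (H/n)^2, whose sum c H^2/n tends to
   0. *)
have tele (n : nat) : (0 < n)%N -> `|H| <= n%:R -> `|q h - q 0| <= c * H ^+ 2 / n%:R.
  move=> n0 hn; have nR0 : n%:R != 0 :> R by rewrite pnatr_eq0 -lt0n.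
  have nQ0 : n%:R != 0 :> rat by rewrite pnatr_eq0 -lt0n.
  pose u (k : nat) := q (h * (k%:R / n%:R)).
  have un : u n = q h by rewrite /u (divff nQ0) mulr1.
  have u0 : u 0%N = q 0 by rewrite /u mul0r mulr0.
  rewrite -un -u0 -(telescope_sumr u (leq0n n)).
  apply: (le_trans (ler_norm_sum _ _ _)).
  apply: (@le_trans _ _ (\sum_(0 <= k < n) (c * (H / n%:R) ^+ 2))).
    rewrite !big_nat; apply: ler_sum => k /andP[_ kn].
    have -> : u k.+1 = q (h * (k%:R / n%:R) + h / n%:R).
      by rewrite /u -natr1 mulrDl mulrDr mul1r.
    exact: (step n k n0 (ltnW kn) hn).
  rewrite sumr_const_nat subn0 -[leLHS]mulr_natr.
  by have -> : c * (H / n%:R) ^+ 2 * n%:R = c * H ^+ 2 / n%:R by field.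
apply/eqP/negPn/negP; rewrite -subr_eq0 => qn0; have X0 : 0 < `|q h - q 0| by rewrite normr_gt0.
set X := `|q h - q 0| in X0 tele.
have [n hn] : exists n : nat, `|H| + c * H ^+ 2 / X < n%:R.
  by exists (Num.truncn (`|H| + c * H ^+ 2 / X)).+1; exact: truncnS_gt.
have cX : 0 <= c * H ^+ 2 / X by rewrite divr_ge0// ?(ltW X0)// mulr_ge0 ?sqr_ge0.
have h0 : 0 <= `|H| by [].
have n0 : 0 < n%:R :> R by apply: le_lt_trans hn; exact: addr_ge0.
have hn1 : `|H| <= n%:R by apply: ltW; apply: le_lt_trans hn; rewrite lerDl.
have hn2 : c * H ^+ 2 / X < n%:R by apply: le_lt_trans hn; rewrite lerDr.
have := tele n; rewrite -(ltr0n R) => /(_ n0 hn1); rewrite ler_pdivlMr// leNgt [X * _]mulrC.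
by rewrite -ltr_pdivrMr// hn2.
Qed.

Section flux_free.
Context {R : realType} {d : nat}.
Local Notation Rd := 'rV[R]_d.
Local Notation leb := (lebesgue_rV R d).

Lemma partial_taylor f i (x : Rd) (h B : R) : cont_diff 2 f ->
  (forall y, `|partial i (partial i f) y| <= B) ->
  `|f (h *: delta_mx ord0 i + x) - f x - h * partial i f x| <= B * h ^+ 2.
Proof.
move=> f2 fB; have f1 : cont_diff 1 f.
  have [cf hf] := f2; split=> // j; have [df [cdf _]] := hf j; split=> //.
have p1 : cont_diff 1 (partial i f) by have [_ /(_ i) []] := f2.
have B0 : 0 <= B by rewrite (le_trans _ (fB x)).
pose F (t : R) := f (t *: delta_mx ord0 i + x) - t * partial i f x.
have dF (t : R) : is_derive t 1 F (partial i f (t *: delta_mx ord0 i + x) - partial i f x).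
  have dl : is_derive t 1 (fun t : R => t * partial i f x) (partial i f x).
    have := is_deriveM (is_derive_id t (1 : R)) (is_derive_cst (partial i f x) t 1).
    by move=> dm; apply: (is_derive_eq dm); rewrite scaler0 add0r /GRing.scale/= mulr1.
  by have := is_deriveB (derive_line i x t f1) dl.
have cF : continuous F by exact: is_derive_continuous dF.
have hd (c : R) : `|c| <= `|h| -> `|partial i f (c *: delta_mx ord0 i + x) - partial i f x| * `|h| <= B * h ^+ 2.
  move=> ch; rewrite -real_normK ?num_real// expr2 mulrA ler_wpM2r//.
  by rewrite (le_trans (MVT_partial x c p1 fB))// ler_wpM2l.
have -> : f (h *: delta_mx ord0 i + x) - f x - h * partial i f x = F h - F 0.
  by rewrite /F scale0r add0r mul0r subr0; ring.
have [h0|h0|->] := ltgtP h 0; last by rewrite subrr normr0 mulr_ge0// sqr_ge0.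
- have [c] := MVT h0 (fun t _ => dF t) (continuous_subspaceT cF).
  rewrite in_itv/= sub0r distrC => /andP[hc c0] ->; rewrite normrM normrN hd//.
  by rewrite !ltr0_norm// lerN2 ltW.
- have [c] := MVT h0 (fun t _ => dF t) (continuous_subspaceT cF).
  rewrite in_itv/= subr0 => /andP[c0 ch] ->; rewrite normrM hd//.
  by rewrite !gtr0_norm// ltW.
Qed.

Variables (chi m : Rd -> R).
Hypotheses (mchi : measurable_fun setT chi) (chi1 : forall x, `|chi x| <= 1).
Hypothesis tm : test_fun setT m.

Definition shifted_test (z x : Rd) : R := m (1 *: x - z).

Lemma test_fun_shifted z : test_fun setT (shifted_test z).
Proof. exact: (@test_fun_affine _ _ m 1 (- z) (normr1 _) tm). Qed.

Let leb_test_integrable phi : test_fun setT phi -> leb.-integrable setT (EFin \o phi).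
Proof.
by move=> tp; have [_ [K0 [cK0 _ bK0]]] := tp; exact: integrable_cpt cK0 (test_fun_continuous tp) bK0.
Qed.

Let i_chi phi : test_fun setT phi -> leb.-integrable setT (EFin \o (fun x => chi x * phi x)).
Proof.
move=> tp; under eq_fun do rewrite mulrC.
by apply: (integrable_EFinM (M := 1) measurableT (leb_test_integrable tp)).
Qed.

Definition weighted_mass z : R := \int[leb]_x (chi x * shifted_test z x).

Hypothesis flux0 : forall i (z : 'rV[rat]_d),
  \int[leb]_x (chi x * partial i (shifted_test (map_mx ratr z)) x) = 0.

(** Absence of flux removes the first-order term in the Taylor expansion of the shifted bump, so
    moving it by h changes the mass by O(h^2). Shifts are rational because for almost every time
    only countably many flux identities hold simultaneously. *)
Lemma weighted_mass_step i (r : R) : exists c, forall (z : 'rV[rat]_d) (h : R),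
  (forall j, `|ratr (z ord0 j)| <= r) -> `|h| <= 1 ->
  `|weighted_mass (map_mx ratr z + h *: delta_mx ord0 i) - weighted_mass (map_mx ratr z)| <= c * h ^+ 2.
Proof.
have [B _ hB] := test_fun_bounded (test_fun_partial i (test_fun_partial i tm)).
have [sm [K [cK _ mK]]] := tm.
have [_ [K' [cK' _ mK']]] := test_fun_partial i tm.
have [s s0 Ks] := compact_sub_obox (compactU cK cK').
(* A box containing the supports of the bump and of its derivative after any admissible shift: |z_j|
   <= r and |h| <= 1. *)
pose Q : set Rd := cbox (const_mx (- (r + 1 + s))) (const_mx (r + 1 + s)).
have cQ : compact Q by exact: compact_cbox.
exists (B * fine (leb Q)) => z h zr h1; set z' := map_mx _ z.
have p1 x : partial i (shifted_test z') x = partial i m (1 *: x - z').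
  by rewrite partial_affine ?mul1r//; exact: (sm 1%N).
have -> : weighted_mass (z' + h *: delta_mx ord0 i) - weighted_mass z' =
  \int[leb]_x (chi x * shifted_test (z' + h *: delta_mx ord0 i) x - chi x * shifted_test z' x +
    h * (chi x * partial i (shifted_test z') x)).
  have t1 := test_fun_shifted z'; have t2 := test_fun_shifted (z' + h *: delta_mx ord0 i).
  have i1 := i_chi t1; have i2 := i_chi t2; have i3 := i_chi (test_fun_partial i t1).
  rewrite RintegralD//; [|by apply: integrable_EFinB|by apply: integrable_EFinZ].
  by rewrite RintegralB// RintegralZl// flux0 mulr0 addr0.
have mQ : measurable Q by exact: compact_measurable_rV.
have iQ : leb.-integrable setT (EFin \o (fun x => B * h ^+ 2 * \1_Q x)).
  apply: integrable_EFinZ => //; apply: integrable_indic_lty => //.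
  exact: leb_compact_lty.
have t1 := test_fun_shifted z'; have t2 := test_fun_shifted (z' + h *: delta_mx ord0 i).
have i1 := i_chi t1; have i2 := i_chi t2; have i3 := i_chi (test_fun_partial i t1).
have iT : leb.-integrable setT (EFin \o (fun x => chi x * shifted_test (z' + h *: delta_mx ord0 i) x -
    chi x * shifted_test z' x + h * (chi x * partial i (shifted_test z') x))).
  by apply: integrable_EFinD => //; [exact: integrable_EFinB|exact: integrable_EFinZ].
apply: (le_trans (le_normr_Rintegral measurableT iT)).
have -> : B * fine (leb Q) * h ^+ 2 = \int[leb]_x (B * h ^+ 2 * \1_Q x).
  rewrite RintegralZl//; last by apply: integrable_indic_lty => //; exact: leb_compact_lty.
  by rewrite /Rintegral integral_indic// setIT mulrAC.
apply: le_Rintegral => //; first exact: integrable_norm.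
move=> x _; rewrite p1 /shifted_test.
set x' := 1 *: x - z'.
have -> : 1 *: x - (z' + h *: delta_mx ord0 i) = (- h) *: delta_mx ord0 i + x'.
  by rewrite opprD addrA scaleNr addrC.
have -> : chi x * m (- h *: delta_mx ord0 i + x') - chi x * m x' + h * (chi x * partial i m x') =
    chi x * (m (- h *: delta_mx ord0 i + x') - m x' - (- h) * partial i m x') by ring.
have B0 : 0 <= B * h ^+ 2 by rewrite mulr_ge0 ?sqr_ge0// (le_trans _ (hB 0)).
rewrite normrM; have [Qx|nQx] := pselect (Q x).
  rewrite indicE mem_set// mulr1 -[leRHS]mul1r ler_pM//.
  by have := partial_taylor x' (- h) (sm 2%N) hB; rewrite sqrrN.
have nK (y : Rd) : (forall j, `|y ord0 j - x' ord0 j| <= 1) -> ~ (K `|` K') y.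
  move=> yx /Ks Ky; apply: nQx => j; rewrite !mxE.
  have := Ky j; have := yx j; have := zr j; rewrite !mxE.
  by rewrite !ler_norml mul1r => /andP[a1 a2] /andP[a3 a4] /andP[a5 a6]; apply/andP; split; lra.
have nK1 : ~ (K `|` K') x' by apply: nK => j; rewrite subrr normr0.
have nK2 : ~ (K `|` K') (- h *: delta_mx ord0 i + x').
  apply: nK => j; rewrite mxE addrK !mxE normrM normrN.
  by rewrite (le_trans _ h1)// ler_piMr// normr_nat lern1 leq_b1.
rewrite (mK x') ?(mK (_ + _)) ?(mK' x'); last 3 first.
- by move=> ?; apply: nK1; right.
- by move=> ?; apply: nK2; left.
- by move=> ?; apply: nK1; left.
by rewrite mulr0 !subr0 normr0 mulr0 mulr_ge0.
Qed.

Lemma weighted_mass_line i (z : 'rV[rat]_d) (h : rat) :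
  weighted_mass (map_mx ratr (z + h *: delta_mx ord0 i)) = weighted_mass (map_mx ratr z).
Proof.
pose r : R := \sum_j `|ratr (z ord0 j)| + `|ratr h|.
have [c hc] := weighted_mass_step i r.
pose q (x : rat) : R := weighted_mass (map_mx ratr (z + x *: delta_mx ord0 i)).
have c0 : 0 <= c.
  have := hc 0 1; rewrite normr1 => /(_ _ (lexx _)) h0.
  have : forall j : 'I_d, `|ratr ((0 : 'rV[rat]_d) ord0 j)| <= r.
    by move=> j; rewrite mxE rmorph0 normr0 addr_ge0// sumr_ge0.
  by move=> /h0; rewrite expr1n mulr1; exact: le_trans.
have shift (a b : rat) : map_mx ratr (z + (a + b) *: delta_mx ord0 i) =
    map_mx ratr (z + a *: delta_mx ord0 i) + ratr b *: delta_mx ord0 i :> Rd.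
  by apply/rowP => j; rewrite !mxE !(rmorphD, rmorphM)/= rmorph_nat mulrDl addrA.
have step (n k : nat) (a : rat) : (0 < n)%N -> (k <= n)%N -> `|ratr h| <= n%:R :> R ->
    a = h * (k%:R / n%:R) -> `|q (a + h / n%:R) - q a| <= c * (ratr h / n%:R) ^+ 2.
  move=> n0 kn hn ->; have nR0 : 0 < n%:R :> R by rewrite ltr0n.
  have hb : ratr (h / n%:R) = ratr h / n%:R :> R by rewrite fmorph_div /= ratr_nat.
  rewrite /q shift hb; apply: hc; last by rewrite normrM normfV normr_nat ler_pdivrMr// mul1r.
  move=> j; rewrite !mxE rmorphD (le_trans (ler_normD _ _))// lerD//.
    by rewrite (bigD1 j)//= lerDl sumr_ge0.
  rewrite !rmorphM fmorphV /= !ratr_nat !normrM !normr_nat -mulrA ler_piMr//.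
  rewrite mulr_ile1 ?mulr_ge0//; last by rewrite lern1 leq_b1.
  by rewrite normfV normr_nat ler_pdivrMr// mul1r ler_nat.
have <- : q 0 = weighted_mass (map_mx ratr z) by rewrite /q scale0r addr0.
apply: (@quadratic_increment_const _ q h (ratr h) c c0).
by move=> n k n0 kn hn; apply: step kn hn _.
Qed.

Lemma weighted_mass_const (z z' : 'rV[rat]_d) :
  weighted_mass (map_mx ratr z) = weighted_mass (map_mx ratr z').
Proof.
suff h (s : seq 'I_d) (c : 'I_d -> rat) (y : 'rV[rat]_d) :
    weighted_mass (map_mx ratr (y + \sum_(i <- s) c i *: delta_mx ord0 i)) = weighted_mass (map_mx ratr y).
  rewrite -(h (index_enum 'I_d) (fun i => (z - z') ord0 i) z').
  by rewrite -row_sum_delta addrC subrK.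
elim: s y => [|i s IH] y; first by rewrite big_nil addr0.
by rewrite big_cons addrA IH weighted_mass_line.
Qed.

End flux_free.

Lemma ae_forall_count d (T : measurableType d) (R : realType) (mu : {measure set T -> \bar R})
    (I : countType) (Q : I -> T -> Prop) :
  (forall i, \forall x \ae mu, Q i x) -> \forall x \ae mu, forall i, Q i x.
Proof.
move=> hQ; have : \forall x \ae mu, forall n, if unpickle n is Some i then Q i x else True.
  by apply/ae_foralln => n; case: (unpickle n) => [i|]; [exact: hQ|exact: aeW].
by apply: filterS => x hx i; have := hx (pickle i); rewrite pickleK.
Qed.

Lemma rat_approx {R : realType} {d : nat} (x : 'rV[R]_d) (r : R) : 0 < r ->
  exists z : 'rV[rat]_d, forall j, `|ratr (z ord0 j) - x ord0 j| < r.
Proof.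
move=> r0; have hj (j : 'I_d) : exists q : rat, `|ratr q - x ord0 j| < r.
  have [|q] := @rat_in_itvoo R (x ord0 j - r) (x ord0 j + r).
    by rewrite ltrD2l gtrN.
  by rewrite in_itv/= => h; exists q; rewrite ltr_distl.
by exists (\row_j projT1 (cid (hj j))) => j; rewrite mxE; exact: projT2 (cid (hj j)).
Qed.

(** The mass of [K] seen by a shifted bump does not depend on the rational shift. A bump of
    half-width r/2 centred within r/2 of [x0] lies in the box missed by [K] and sees nothing, hence
    no shifted bump sees any mass of [K], and these bumps cover the space. *)
Lemma flux_free_null {R : realType} {d : nat} (K : set 'rV[R]_d) (x0 : 'rV[R]_d) (r : R) :
  measurable K -> 0 < r -> (forall x, obox (x0 - const_mx r) (x0 + const_mx r) x -> ~ K x) ->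
  (forall i (z : 'rV[rat]_d), \int[lebesgue_rV R d]_x (\1_K x *
     partial i (shifted_test (box_bump (const_mx (- (r / 2))) (const_mx (r / 2))) (map_mx ratr z)) x) = 0) ->
  lebesgue_rV R d K = 0%E.
Proof.
move=> mK r0 hK flux0.
set m := box_bump _ _ in flux0.
have tm : test_fun setT m by exact: test_fun_box_bump.
have chi1 x : `|\1_K x : R| <= 1 by rewrite ger0_norm ?indic_le1.
have r20 : 0 < r / 2 by rewrite divr_gt0.
have mchi : measurable_fun setT (\1_K : 'rV[R]_d -> R) by exact: measurable_indic.
have boxE (z : 'rV[rat]_d) x : obox (const_mx (- (r / 2))) (const_mx (r / 2)) (1 *: x - map_mx ratr z) <->
    forall j, `|ratr (z ord0 j) - x ord0 j| < r / 2.
  by split=> h j; have := h j; rewrite !mxE mul1r distrC ltr_norml.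
have q0 (z : 'rV[rat]_d) : weighted_mass \1_K m (map_mx ratr z) = 0.
  have [y hy] := rat_approx x0 r20.
  rewrite (weighted_mass_const mchi chi1 tm flux0 z y) /weighted_mass.
  rewrite (_ : (fun x => _) = cst 0) ?Rintegral_cst ?mul0r//.
  apply/funext => x /=; rewrite indicE; have [Kx|] := boolP (x \in K); last by rewrite mul0r.
  rewrite mul1r /shifted_test /m box_bump_eq0// => /boxE hx.
  move/set_mem : Kx; apply: hK => j; rewrite !mxE.
  have := hx j; have := hy j; rewrite !ltr_distl => /andP[h1 h2] /andP[h3 h4].
  by apply/andP; split; lra.
have hz (z : 'rV[rat]_d) : \forall x \ae lebesgue_rV R d, K x -> shifted_test m (map_mx ratr z) x = 0.
  have tz := test_fun_shifted tm (map_mx ratr z).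
  have iz : (lebesgue_rV R d).-integrable setT (EFin \o (fun x => \1_K x * shifted_test m (map_mx ratr z) x)).
    have [_ [K0 [cK0 _ bK0]]] := tz.
    have ib := integrable_cpt cK0 (test_fun_continuous tz) bK0.
    under eq_fun do rewrite mulrC.
    by apply: (integrable_EFinM (M := 1) measurableT ib).
  have := Rintegral_eq0_ae measurableT _ iz (q0 z).
  have h0 x : [set: 'rV[R]_d] x -> 0 <= \1_K x * shifted_test m (map_mx ratr z) x.
    by move=> _; rewrite mulr_ge0// box_bump_ge0.
  move=> /(_ h0); apply: filterS => x /(_ I) + Kx.
  by rewrite indicE mem_set// mul1r.
have hall := ae_forall_count hz.
have /negligibleP : (lebesgue_rV R d).-negligible K.
  apply: negligibleS hall => x Kx /= h.
  have [z xz] := rat_approx x r20.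
  have := h z Kx; apply/eqP; rewrite gt_eqF// /shifted_test /m box_bump_gt0//.
  exact/boxE.
by apply.
Qed.

(** * Conservativity and finiteness of mu *)

Section conservative.
Context {R : realType} {d : nat} (p : R).
Local Notation Rd := 'rV[R]_d.
Local Notation leb := (lebesgue_rV R d).
Variables (A C : Rd -> 'M[R]_d) (H : Rd -> Rd) (rho : Rd -> R).
Variable mu : {measure set Rd -> \bar R}.
Variables T P : R -> (Rd -> R) -> (Rd -> R).
Context {dO : measure_display} {Omega : measurableType dO}.
Variable M : @hunt_process R d dO Omega.
Variable nu : {measure set Rd -> \bar R}.
Hypothesis mu_rho : inf_invariant_density p A (drift A C H) rho mu.
Hypothesis T_mu : L1_semigroup_construction mu A (drift A C H) rho T.
Hypothesis P_T : continuous_versions mu T P.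
Hypothesis M_P : has_transition M P.
Hypotheses (nu_inv : invariant_measure M nu) (nu_fin : (nu setT < +oo)%E).

Let i1 (u : Rd -> R) : in_Lp mu setT 1 u <-> mu.-integrable setT (EFin \o u).
Proof. exact: in_Lp1P. Qed.

Lemma mu_sigma_finite : sigma_finite setT mu.
Proof.
exists (fun n => obox (const_mx (- n%:R)) (const_mx n%:R)); first by rewrite obox_cover.
move=> n; split; first exact: measurable_obox.
apply: (mu_lty mu_rho); first exact: open_obox.
have cQ := @compact_cbox R d (const_mx (- n%:R)) (const_mx n%:R).
apply: (subclosed_compact _ cQ); first exact: closed_closure.
have clQ : closed (cbox (const_mx (- n%:R)) (const_mx n%:R) : set Rd).
  by apply: compact_closed => //; exact: norm_hausdorff.
by rewrite [X in _ `<=` X]((closure_id _).1 clQ); apply: closure_subset; exact: obox_cbox.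
Qed.

Lemma integral_transition (m : {measure set Rd -> \bar R}) (t : R) (E : set Rd) : 0 <= t -> measurable E ->
  (\int[m]_x law M (Some x) (state_in M t E) = \int[m]_x (P t \1_E x)%:E)%E.
Proof. by move=> t0 mE; apply: eq_integral => x _; exact: has_transition_indic. Qed.

(** By invariance at time 1, nu(E) is the nu-integral of P_1 1_E, which is identically 0 when mu(E)
    = 0. *)
Lemma nu_mu_null : nu `<< mu.
Proof.
apply/null_content_dominatesP => E mE E0; have [_ _ /(_ 1 E ler01 mE) <-] := nu_inv.
rewrite integral_transition// (P_null mu_rho T_mu P_T ltr01 mE E0).
by rewrite integral0.
Qed.

Lemma transition_ge0_le1 (t : R) (E : set Rd) (x : Rd) : 0 <= t -> measurable E -> 0 <= P t \1_E x <= 1.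
Proof.
move=> t0 mE; have := has_transition_indic M_P x t0 mE => h.
rewrite -!lee_fin -h probability_le1 ?andbT//; exact: measurable_state_in.
Qed.

Lemma continuous_measurable_P (t : R) (f : Rd -> R) : 0 < t -> in_Lp mu setT 1 f ->
  measurable_fun setT (P t f).
Proof. by move=> t0 fL; apply: continuous_measurable_rV; have [] := P_T_ae T_mu P_T t0 fL. Qed.

(* A continuous function with values 0 and 1 is constant on the connected space R^d. *)
Lemma continuous01_cst (u : Rd -> R) : continuous u -> (forall x, u x * (1 - u x) = 0) ->
  u = cst 0 \/ u = cst 1.
Proof.
move=> cu u01.
have u01' x : u x = 0 \/ u x = 1.
  have /eqP := u01 x; rewrite mulf_eq0 => /orP[/eqP|/eqP/subr0_eq]; by [left|right].
have uc x y : u x = u y.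
  apply: contrapT => uxy.
  pose f (s : R) := u (s *: (y - x) + x).
  have cf : continuous f.
    move=> s; apply: (@continuous_comp _ _ _ (fun s : R => s *: (y - x) + x) u); last exact: cu.
    by apply: cvgD; [apply: cvgZ; [exact: cvg_id|exact: cvg_cst]|exact: cvg_cst].
  have f0 : f 0 = u x by rewrite /f scale0r add0r.
  have f1 : f 1 = u y by rewrite /f scale1r subrK.
  have [|s _ fs] := @IVT R f 0 1 (1 / 2) ler01 (continuous_subspaceT cf).
    rewrite f0 f1; have [] := (u01' x, u01' y) => -[] e1 [] e2; rewrite e1 e2 in uxy *; try by [].
      by rewrite /minr /maxr ltr01; apply/andP; split; lra.
    by rewrite /minr /maxr ltr10; apply/andP; split; lra.
  by have := u01' (s *: (y - x) + x); rewrite -/(f s) fs; case; lra.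
have [h|h] := u01' 0; [left|right]; by apply/funext => x; rewrite (uc x 0).
Qed.

(** Among functions with values in [0, 1] and integral at most mu(S), the indicator of a superlevel
    set S of h maximises the integral against h. P_t 1_S competes by contraction and attains the
    maximum by invariance of [nu], so it must coincide with 1_S. *)
Lemma superlevel_invariant (h : Rd -> R) (c t : R) : (forall x, 0 <= h x) ->
  mu.-integrable setT (EFin \o h) ->
  (forall E, measurable E -> nu E = (\int[mu]_(x in E) (h x)%:E)%E) ->
  0 < c -> 0 < t -> let S := [set x | c < h x] in
  (mu S < +oo)%E /\ ae_eq mu setT (P t \1_S) (\1_S).
Proof.
move=> h0 ih nuh c0 t0 S.
have mh : measurable_fun setT h by exact: integrable_measurable ih.
have mS : measurable S.
  have -> : S = setT `&` h @^-1` `]c, +oo[ by apply/seteqP; split=> x; rewrite /= in_itv/= andbT => // -[].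
  by apply: mh.
have Sfin : (mu S < +oo)%E.
  have ic : mu.-integrable setT (EFin \o (fun x => c^-1 * h x)) by exact: integrable_EFinZ.
  have /integrableP[_] : mu.-integrable setT (EFin \o (\1_S : Rd -> R)).
    apply: (integrable_dominated measurableT _ _ ic); first exact: measurable_indic.
    move=> x _; rewrite ger0_norm ?indic_ge0// indicE; have [/set_mem xS|_] := boolP (x \in S).
      by rewrite mulrC ler_pdivlMr// mul1r ltW.
    by rewrite mulr_ge0// invr_ge0 ltW.
  under eq_integral do rewrite /= ger0_norm ?indic_ge0//.
  by rewrite integral_indic// setIT.
split=> //.
have SL : in_Lp mu setT 1 (\1_S : Rd -> R) by apply/i1; exact: integrable_indic_lty.
have [cu uL _] := P_T_ae T_mu P_T t0 SL.
set u := P t \1_S in cu uL *.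
have u01 x : 0 <= u x <= 1 by exact: transition_ge0_le1 (ltW t0) mS.
have iu := (i1 _).1 uL; have iS := (i1 _).1 SL.
have ihu : mu.-integrable setT (EFin \o (fun x => h x * u x)).
  apply: (integrable_EFinM (M := 1) measurableT ih); first exact: continuous_measurable_rV.
  by move=> x _; have /andP[a b] := u01 x; rewrite ger0_norm.
have ihS : mu.-integrable setT (EFin \o (fun x => h x * \1_S x)).
  apply: (integrable_EFinM (M := 1) measurableT ih); first exact: measurable_indic.
  by move=> x _; rewrite ger0_norm ?indic_le1.
have e1 : \int[mu]_x (h x * u x) = \int[mu]_x (h x * \1_S x).
  have mu_ : measurable_fun setT (fun x => (u x)%:E) by apply/measurable_EFinP; exact: continuous_measurable_rV.
  have u0 x : [set: Rd] x -> (0 <= (u x)%:E)%E by have /andP[] := u01 x.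
  have [_ _ /(_ t S (ltW t0) mS)] := nu_inv; rewrite integral_transition ?(ltW t0)// -/u.
  rewrite (ge0_integral_density mh h0 nuh measurableT mu_ u0) nuh// => hE.
  rewrite /Rintegral; congr fine.
  transitivity (\int[mu]_(x in S) (h x)%:E)%E.
    by rewrite -hE; apply: eq_integral => x _; rewrite -EFinM mulrC.
  rewrite [LHS]integral_mkcond; apply: eq_integral => x _; rewrite /patch indicE.
  by case: ifPn => _; rewrite ?mulr1 ?mulr0.
have e2 : \int[mu]_x u x <= \int[mu]_x \1_S x.
  have := P_L1_contraction T_mu P_T t0 SL; rewrite -/u.
  under eq_Rintegral do rewrite ger0_norm ?(andP (u01 _)).1//.
  by under [X in _ <= X -> _]eq_Rintegral do rewrite ger0_norm//.
(* Both factors are nonnegative on S and nonpositive off S. The integral of [D] is at most 0: the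
   h-parts cancel by invariance and the c-part has the sign given by contraction. *)
pose D x := (\1_S x - u x) * (h x - c).
have D0 x : 0 <= D x.
  rewrite /D indicE; have /andP[a b] := u01 x.
  have [/set_mem xS|/negP xS] := boolP (x \in S).
    by rewrite mulr_ge0// subr_ge0//; exact: ltW.
  rewrite sub0r mulNr -mulrN opprB mulr_ge0// subr_ge0 leNgt; apply/negP => ch.
  by apply: xS; rewrite inE.
have DE : D = fun x => (h x * \1_S x - h x * u x) - (c * \1_S x - c * u x).
  by apply/funext => x; rewrite /D; ring.
have iD : mu.-integrable setT (EFin \o D).
  rewrite DE; apply: integrable_EFinB => //; apply: integrable_EFinB => //; exact: integrable_EFinZ.
have D_0 : \int[mu]_x D x = 0.
  apply/eqP; rewrite eq_le Rintegral_ge0// andbT DE.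
  rewrite !RintegralB//; [|exact: integrable_EFinZ..|by apply: integrable_EFinB|
    by apply: integrable_EFinB => //; exact: integrable_EFinZ].
  rewrite e1 subrr sub0r oppr_le0 !RintegralZl// -mulrBr mulr_ge0 ?subr_ge0//.
  exact: ltW.
have uS := Rintegral_eq0_ae measurableT (fun x _ => D0 x) iD D_0.
(* Vanishing of [D] says nothing off S where h = c; the mass of u outside S is excluded by
   contraction instead. *)
pose N x := u x - \1_S x * u x.
have iSu : mu.-integrable setT (EFin \o (fun x => \1_S x * u x)).
  apply: (integrable_EFinM (M := 1) measurableT iS); first exact: continuous_measurable_rV.
  by move=> x _; have /andP[a b] := u01 x; rewrite ger0_norm.
have N0 x : 0 <= N x.
  by rewrite /N -[X in X - _]mul1r -mulrBl mulr_ge0 ?subr_ge0 ?indic_le1//; have /andP[] := u01 x.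
have iN : mu.-integrable setT (EFin \o N) by exact: integrable_EFinB.
have uS1 : \forall x \ae mu, \1_S x * u x = \1_S x.
  apply: filterS uS => x /(_ I) /eqP; rewrite mulf_eq0 subr_eq0 => /orP[/eqP <-|].
    by rewrite indicE; case: (x \in S); rewrite ?mul1r ?mul0r.
  rewrite subr_eq0 => /eqP hc; rewrite indicE memNset ?mul0r// /S /= hc ltxx.
  by [].
have N_0 : \int[mu]_x N x = 0.
  apply/eqP; rewrite eq_le Rintegral_ge0// andbT RintegralB// subr_le0 (le_trans e2)//.
  rewrite le_eqVlt; apply/orP; left; apply/eqP; apply: ae_eq_Rintegral => //.
  - exact: integrable_measurable iSu.
  - by apply: filterS uS1 => x -> _.
have uN := Rintegral_eq0_ae measurableT (fun x _ => N0 x) iN N_0.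
by apply: filterS2 uS1 uN => x h1 /(_ I) /subr0_eq; rewrite h1.
Qed.

(** P_t 1_S is continuous with values 0 and 1, hence constant, and not 0 since S is not null. As 1_S
    = P_t 1_S almost everywhere, S has full measure. *)
Lemma full_invariant_set : exists S, [/\ measurable S, (mu S < +oo)%E, mu (~` S) = 0%E &
  forall t, 0 < t -> P t \1_S = cst 1].
Proof.
have nuf : fin_num_fun nu.
  move=> E mE; rewrite ge0_fin_numE//; apply: le_lt_trans nu_fin.
  by apply: le_measure; rewrite ?inE.
have [h [h0 ih nuh]] := radon_nikodym_density mu_sigma_finite nuf nu_mu_null.
have mh : measurable_fun setT h by exact: integrable_measurable ih.
pose S (n : nat) := [set x | n.+1%:R^-1 < h x].
have n0 n : 0 < n.+1%:R^-1 :> R by rewrite invr_gt0.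
have mS n : measurable (S n).
  have -> : S n = setT `&` h @^-1` `]n.+1%:R^-1, +oo[ by apply/seteqP; split=> x; rewrite /= in_itv/= andbT => // -[].
  by apply: mh.
(* If all superlevel sets were null, h would vanish almost everywhere and [nu] would be 0. *)
have [n Sn] : exists n, mu (S n) != 0%E.
  apply: contrapT => /forallNP hn; have [/negP nu0 _ _] := nu_inv; apply: nu0; apply/eqP.
  rewrite nuh// (ae_eq_integral (cst 0%E)) ?integral0//.
    by apply/measurable_EFinP.
  have : \forall x \ae mu, forall n, ~ S n x.
    apply/ae_foralln => n; exists (S n); split=> //; last by move=> x /= /contrapT.
    by have /negP/negPn/eqP := hn n.
  apply: filterS => x hx _ /=; congr EFin; apply/eqP; rewrite eq_le h0 andbT leNgt; apply/negP => hx0.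
  have [k hk] : exists k : nat, k.+1%:R^-1 < h x.
    near \oo => k; exists k; near: k; exact: (near_infty_natSinv_lt (PosNum hx0)).
  exact: (hx k hk).
have [Sfin _] := superlevel_invariant h0 ih nuh (n0 n) ltr01.
have S1 t : 0 < t -> P t \1_(S n) = cst 1.
  move=> t0; have [_ e] := superlevel_invariant h0 ih nuh (n0 n) t0.
  have SL : in_Lp mu setT 1 (\1_(S n) : Rd -> R) by apply/i1; exact: integrable_indic_lty.
  have [cu _ _] := P_T_ae T_mu P_T t0 SL.
  set u := P t _ in e cu *.
  have cu1 : continuous (fun x => 1 - u x).
    by move=> x; apply: continuousB; [exact: cst_continuous|exact: cu].
  have uE : (fun x => u x * (1 - u x)) = cst 0.
    apply: (continuous_ae_eq mu_rho); [exact: continuous_mul_rV|exact: cst_continuous|].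
    by apply: filterS e => x -> //; rewrite indicE; case: (_ \in _); rewrite ?subrr ?mulr0 ?mul0r.
  have [u0|//] := continuous01_cst cu (fun x => congr1 (fun g : Rd -> R => g x) uE).
  case/negP: Sn; apply/eqP/negligibleP => //; apply: negligibleS e => x Sx /= /(_ I).
  by rewrite u0 indicE mem_set//=; apply/eqP; rewrite eq_sym oner_eq0.
exists (S n); split=> //; have [_ e] := superlevel_invariant h0 ih nuh (n0 n) ltr01.
apply/negligibleP; first exact: measurableC.
apply: negligibleS e => x Sx /= /(_ I).
by rewrite S1// indicE memNset//=; apply/eqP; rewrite oner_eq0.
Unshelve. all: by end_near.
Qed.

Lemma mu_fin : (mu setT < +oo)%E.
Proof.
have [S [mS Sfin S0 _]] := full_invariant_set.
have h : (mu (S `|` ~` S) <= mu S + mu (~` S))%E by apply: measureU2 => //; exact: measurableC.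
rewrite S0 adde0 setUv in h.
exact: le_lt_trans h Sfin.
Qed.

Lemma bounded_L1 (f : Rd -> R) (B : R) : measurable_fun setT f -> (forall x, `|f x| <= B) ->
  in_Lp mu setT 1 f.
Proof.
move=> mf fB; apply/i1.
apply: measurable_bounded_integrable => //; first exact: mu_fin.
exists B; split; first exact: num_real.
by move=> r Br x _ /=; rewrite (le_trans (fB x))// ltW.
Qed.

Lemma state_alive (t : R) (x : Rd) : 0 <= t -> law M (Some x) (state_in M t setT) = 1%E.
Proof.
rewrite le_eqVlt => /predU1P[<-|t0].
  by rewrite (has_transition_indic M_P)// (proj1 P_T) indicT.
have [S [mS _ _ S1]] := full_invariant_set.
apply/eqP; rewrite eq_le probability_le1 /=; last by apply: measurable_state_in => //; exact: ltW.
have <- : law M (Some x) (state_in M t S) = 1%E by rewrite (has_transition_indic M_P)// ?ltW// S1.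
apply: le_measure; rewrite ?inE; try by apply: measurable_state_in => //; exact: ltW.
by move=> w [y _ e]; exists y.
Qed.

Lemma transition_setC (t : R) (E : set Rd) (x : Rd) : 0 <= t -> measurable E ->
  P t \1_(~` E) x = 1 - P t \1_E x.
Proof.
move=> t0 mE; have := state_alive x t0.
have -> : state_in M t setT = state_in M t E `|` state_in M t (~` E).
  by rewrite /state_in -preimage_setU -image_setU setUv.
rewrite measureU; last first.
- apply/seteqP; split=> // w [[y Ey e] [z Ez e']]; apply: Ez.
  by move: e'; rewrite -e => -[->].
- by apply: measurable_state_in => //; exact: measurableC.
- exact: measurable_state_in.
move=> h; have : (law M (Some x) (state_in M t E) + law M (Some x) (state_in M t (~` E)) = 1)%E := h.
rewrite (has_transition_indic M_P x t0 mE) (has_transition_indic M_P x t0 (measurableC mE)).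
move=> [] {}h; by rewrite -h addrAC subrr add0r.
Qed.

Lemma transition_mass_le (t : R) (E : set Rd) : 0 < t -> measurable E ->
  \int[mu]_x P t \1_E x <= fine (mu E).
Proof.
move=> t0 mE; have EL : in_Lp mu setT 1 (\1_E : Rd -> R).
  apply: (@bounded_L1 _ 1); first exact: measurable_indic.
  by move=> x; rewrite ger0_norm ?indic_le1.
have -> : fine (mu E) = \int[mu]_x \1_E x by rewrite /Rintegral integral_indic// setIT.
have := P_L1_contraction T_mu P_T t0 EL.
under eq_Rintegral do rewrite ger0_norm ?(andP (transition_ge0_le1 _ (ltW t0) mE)).1//.
by under [X in _ <= X -> _]eq_Rintegral do rewrite ger0_norm//.
Qed.

Lemma transition_L1 (t : R) (E : set Rd) : 0 <= t -> measurable E -> in_Lp mu setT 1 (P t \1_E).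
Proof.
have EL (F : set Rd) : measurable F -> in_Lp mu setT 1 (\1_F : Rd -> R).
  move=> mF; apply: (@bounded_L1 _ 1); first exact: measurable_indic.
  by move=> x; rewrite ger0_norm ?indic_le1.
rewrite le_eqVlt => /predU1P[<- mE|t0 mE]; first by rewrite (proj1 P_T); exact: EL.
by have [] := P_T_ae T_mu P_T t0 (EL _ mE).
Qed.

(** Contraction gives one inequality for E and the opposite one through the complement, P_t of the
    two indicators adding up to 1 by conservativity. *)
Lemma Rintegral_transition (t : R) (E : set Rd) : 0 <= t -> measurable E ->
  \int[mu]_x P t \1_E x = fine (mu E).
Proof.
rewrite le_eqVlt => /predU1P[<- mE|t0 mE].
  by rewrite (proj1 P_T) /Rintegral integral_indic// setIT.
apply/eqP; rewrite eq_le transition_mass_le//=.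
have := transition_mass_le t0 (measurableC mE).
have iu := (i1 _).1 (transition_L1 (ltW t0) mE).
have fE F : measurable F -> mu F \is a fin_num.
  by move=> mF; rewrite ge0_fin_numE// (le_lt_trans _ mu_fin)//; apply: le_measure; rewrite ?inE.
have i_1 : mu.-integrable setT (EFin \o (cst 1 : Rd -> R)).
  by apply/i1; apply: (@bounded_L1 _ 1) => // x; rewrite normr1.
have -> : \int[mu]_x P t \1_(~` E) x = fine (mu setT) - \int[mu]_x P t \1_E x.
  under eq_Rintegral do rewrite transition_setC ?(ltW t0)//.
  by rewrite (RintegralB measurableT i_1 iu) Rintegral_cst// mul1r.
have -> : fine (mu (~` E)) = fine (mu setT) - fine (mu E).
  rewrite -(setUv E) measureU ?setICr//; last exact: measurableC.
  by rewrite fineD ?fE//; [rewrite addrAC subrr add0r|exact: measurableC].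
by rewrite lerD2l lerN2.
Qed.

Lemma mu_invariant : invariant_measure M mu.
Proof.
split; [|exact: mu_sigma_finite|].
  have [n0 _ _] := nu_inv; apply: contra n0 => /eqP m0; apply/eqP.
  by have /null_content_dominatesP := nu_mu_null; apply.
move=> t E t0 mE; have iu := (i1 _).1 (transition_L1 t0 mE).
rewrite integral_transition// -EFin_Rintegral// Rintegral_transition// fineK//.
by rewrite ge0_fin_numE// (le_lt_trans _ mu_fin)//; apply: le_measure; rewrite ?inE.
Qed.

End conservative.

(** * Irreducibility *)

Section irreducible.
Context {R : realType} {d : nat} (p : R).
Local Notation Rd := 'rV[R]_d.
Local Notation leb := (lebesgue_rV R d).
Variables (A C : Rd -> 'M[R]_d) (H : Rd -> Rd) (rho : Rd -> R).
Variable mu : {measure set Rd -> \bar R}.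
Variables T P : R -> (Rd -> R) -> (Rd -> R).
Context {dO : measure_display} {Omega : measurableType dO}.
Variable M : @hunt_process R d dO Omega.
Variable nu : {measure set Rd -> \bar R}.
Hypotheses (d_ge2 : (2 <= d)%N) (p_gtd : d%:R < p).
Hypothesis ass_a : assumption_a p A C H.
Hypothesis mu_rho : inf_invariant_density p A (drift A C H) rho mu.
Hypothesis T_mu : L1_semigroup_construction mu A (drift A C H) rho T.
Hypothesis P_T : continuous_versions mu T P.
Hypothesis M_P : has_transition M P.
Hypotheses (nu_inv : invariant_measure M nu) (nu_fin : (nu setT < +oo)%E).

Let setC_P := transition_setC mu_rho T_mu P_T M_P nu_inv nu_fin.

Lemma mu_leb_null (E : set Rd) : measurable E -> mu E = 0%E <-> leb E = 0%E.
Proof.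
have tr (m1 m2 : {measure set Rd -> \bar R}) : measurable E ->
    (forall Q : Rd -> Prop, (\forall x \ae m1, Q x) -> \forall x \ae m2, Q x) -> m1 E = 0%E -> m2 E = 0%E.
  move=> mE h E0; have [|N [mN N0 NE]] := h (fun x => ~ E x).
    by exists E; split=> // x /= /contrapT.
  by apply/negligibleP => //; exists N; split=> // x Ex; apply: NE => /=; apply.
by move=> mE; split; apply: tr => // Q; [exact: (mu_leb_ae mu_rho)|exact: (mu_ae mu_rho)].
Qed.

(** P_s(x, .) does not charge mu-null sets, so if P_s g(x) were 0, g and therefore [b] would vanish
    almost surely at time s. *)
Lemma P_gt0_mono (s : R) (b g : Rd -> R) (x : Rd) (B : R) : 0 <= s -> measurable_fun setT b ->
  measurable_fun setT g -> (forall y, 0 <= b y <= B) -> (forall y, 0 <= g y <= B) ->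
  (\forall y \ae mu, 0 < b y -> 0 < g y) -> 0 < s -> 0 < P s b x -> 0 < P s g x.
Proof.
move=> s0 mb mg bB gB bg s1 Pb.
have bB' : exists K : R, forall y, `|b y| <= K by exists B => y; have /andP[a ?] := bB y; rewrite ger0_norm.
have gB' : exists K : R, forall y, `|g y| <= K by exists B => y; have /andP[a ?] := gB y; rewrite ger0_norm.
have [ib eb] := has_transition_Rintegral M_P x s0 mb bB'.
have [ig eg] := has_transition_Rintegral M_P x s0 mg gB'.
have g0 w : 0 <= oapp g 0 (state M s w) by case: (state M s w) => [y|] //=; have /andP[] := gB y.
rewrite lt_neqAle eq_sym eg Rintegral_ge0// andbT -eg; apply/eqP => Pg0.
rewrite eg in Pg0; have hg := Rintegral_eq0_ae measurableT (fun w _ => g0 w) ig Pg0.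
move: bg => [N [mN N0 NP]].
have hN : \forall w \ae law M (Some x), ~ state_in M s N w.
  exists (state_in M s N); split=> //; first exact: measurable_state_in.
    by rewrite (has_transition_indic M_P)// (P_null mu_rho T_mu P_T s1 mN N0).
  by move=> w /= /contrapT.
suff : P s b x = 0 by move=> e; rewrite e ltxx in Pb.
rewrite eb (@ae_eq_Rintegral _ _ _ _ setT measurableT _ (cst 0)) ?Rintegral_cst ?mul0r//.
  exact: measurable_state_oapp.
apply: filterS2 hg hN => w /(_ I) + nw _ /=; rewrite /state_in in nw.
case E : (state M s w) => [y|] //= gy0; apply/eqP; rewrite eq_le; have /andP[-> _] := bB y.
rewrite andbT leNgt; apply/negP => b0; apply: nw; exists y => //; apply: NP => /= h.
by have := h b0; rewrite gy0 ltxx.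
Qed.

Lemma P_gt0_ae (s : R) (g : Rd -> R) (x : Rd) (B : R) : 0 < s ->
  measurable_fun setT g -> (forall y, 0 <= g y <= B) ->
  (\forall y \ae mu, 0 < g y) -> 0 < P s g x.
Proof.
move=> s0 mg gB g0.
have B1 : forall y, 0 <= g y <= maxr B 1.
  by move=> y; have /andP[-> h] := gB y; rewrite le_max h.
apply: (@P_gt0_mono s (\1_setT) g x (maxr B 1) (ltW s0)) => //.
- by move=> y; rewrite indicT ler01 le_max lexx orbT.
- by apply: filterS g0.
have := has_transition_indic M_P x (ltW s0) measurableT.
rewrite (state_alive mu_rho T_mu P_T M_P nu_inv nu_fin x (ltW s0)) => -[<-].
exact: ltr01.
Qed.

(** For almost every small t the zero set of P_t f has no flux, and it misses a neighbourhood of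
    [x0] by continuity in time and space; so it is null. Positivity almost everywhere at time t
    becomes positivity everywhere after the remaining time t0 - t. *)
Lemma P_test_gt0 (f : Rd -> R) (x0 x : Rd) (t0 : R) : test_fun setT f -> (forall y, 0 <= f y) ->
  0 < f x0 -> 0 < t0 -> 0 < P t0 f x.
Proof.
move=> tf f0 fx0 t00.
pose U := evolution P f.
have cU0 : {for (0 : R), continuous (fun t => U t x0)} by exact: (evolution_continuous_time M_P tf).
have U0 : 0 < U 0 x0 by rewrite /U /evolution normr0 (proj1 P_T).
have /nbhs_ballP[del /= del0 hdel] : \forall t \near (0 : R), 0 < U t x0 by exact: (cvgr_gt _ cU0 _ U0).
(* The window ]a'/2, a'] lies below [t0] and inside the interval where P_t f(x0) stays positive. *)
pose a' := minr del t0 / 2; have a'0 : 0 < a' by rewrite divr_gt0// lt_min del0.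
have a'm : a' < minr del t0 by rewrite /a' ltr_pdivrMr// ltr_pMr ?ltr1n// lt_min del0.
have a0 : 0 < a' / 2 by rewrite divr_gt0.
have aa' : a' / 2 < a' by rewrite ltr_pdivrMr// ltr_pMr ?ltr1n.
have rn (n : nat) : 0 < n.+1%:R^-1 :> R by rewrite invr_gt0.
pose b (n : nat) : Rd -> R := box_bump (const_mx (- (n.+1%:R^-1 / 2))) (const_mx (n.+1%:R^-1 / 2)).
have tb n : test_fun setT (b n) by exact: test_fun_box_bump.
(* All radii, rational shifts and directions form a countable family, so a single time in the window
   serves them all. *)
have hflux (q : nat * 'rV[rat]_d * 'I_d) : \forall t \ae lebesgue_measure, t \in `]a' / 2, a'] ->
    \int[leb]_x ((U t x == 0)%:R * partial q.2 (shifted_test (b q.1.1) (map_mx ratr q.1.2)) x) = 0.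
  apply: (evolution_zero_set_flux d_ge2 p_gtd ass_a mu_rho T_mu P_T M_P tf f0) => //.
  exact: test_fun_shifted.
have [N [mN N0 NP]] := ae_forall_count hflux.
have [t tI tN] : exists2 t : R, t \in `]a' / 2, a'] & ~ N t.
  apply: contrapT => hN.
  have sub : (`]a' / 2, a'] : set (measurableTypeR R)) `<=` N.
    by move=> t tI; apply: contrapT => tN; apply: hN; exists t.
  pose I : set (measurableTypeR R) := [set` `]a' / 2, a']].
  have mI : measurable I by exact: measurable_itv.
  have : (lebesgue_measure I <= lebesgue_measure N)%E.
    by apply: le_measure => //; apply/mem_set.
  by rewrite /I N0 lebesgue_measure_itv /= lte_fin aa' -EFinB lee_fin leNgt subr_gt0 aa'.
have flux0 q := (contrapT (fun h => tN (NP t h))) q tI.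
have [ta ta'] : a' / 2 < t /\ t <= a' by move: tI; rewrite in_itv/= => /andP[].
have t_gt0 : 0 < t by exact: lt_trans ta.
have Utx0 : 0 < U t x0.
  apply: hdel; rewrite /ball/= sub0r normrN gtr0_norm// (le_lt_trans ta')// (lt_le_trans a'm)//.
  by rewrite ge_min lexx.
have cU : continuous (U t) by exact: (evolution_continuous T_mu P_T tf).
have [S US] := evolution_bound M_P tf f0.
have /nbhs_ballP[e /= e0 he] : \forall y \near x0, 0 < U t y by exact: (cvgr_gt _ (cU x0) _ Utx0).
have [n ne] : exists n : nat, n.+1%:R^-1 < e.
  near \oo => k; exists k; near: k; exact: (near_infty_natSinv_lt (PosNum e0)).
pose K := [set y | U t y = 0].
have mK : measurable K.
  have -> : K = setT `&` U t @^-1` [set 0] by rewrite setTI.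
  exact: (continuous_measurable_rV cU).
have K0 : leb K = 0%E.
  apply: (@flux_free_null _ _ K x0 n.+1%:R^-1 mK (rn n)).
    move=> y; rewrite -ball_obox// => /(le_ball (ltW ne)) /he Uy Ky.
    by rewrite Ky ltxx in Uy.
  move=> i z; rewrite -[RHS](flux0 (n, z, i)); apply: eq_Rintegral => y _.
  rewrite indicE; congr (_%:R * _); congr nat_of_bool.
  by apply/idP/eqP => [/set_mem|h]; [|apply/mem_set].
have tt0 : t < t0 by rewrite (le_lt_trans ta')// (lt_le_trans a'm)// ge_min lexx orbT.
have fL : in_Lp mu setT 1 f by have [] := glob_extends T_mu tf.
have -> : P t0 f = P (t0 - t) (U t).
  by rewrite /U /evolution gtr0_norm// -(P_semigroup mu_rho T_mu P_T) ?subr_gt0// subrK.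
apply: (@P_gt0_ae _ _ _ S); rewrite ?subr_gt0//.
  exact: continuous_measurable_rV.
exists K; split=> //; first by apply/mu_leb_null.
move=> y /= /negP; rewrite -leNgt => h; apply/eqP; rewrite eq_le h.
by have /andP[-> _] := US t y.
Unshelve. all: by end_near.
Qed.

(** Half of the time makes P_(t/2) 1_E continuous with integral mu(E) > 0, so it is positive on a
    ball. A bump supported there is transported by the other half. *)
Lemma transition_gt0 (t : R) (E : set Rd) (x : Rd) : 0 < t -> measurable E -> (0 < mu E)%E ->
  0 < P t \1_E x.
Proof.
move=> t0 mE E0; have s0 : 0 < t / 2 by rewrite divr_gt0.
set g := P (t / 2) \1_E.
have g01 y : 0 <= g y <= 1 by exact: (transition_ge0_le1 M_P y (ltW s0) mE).
have EL : in_Lp mu setT 1 (\1_E : Rd -> R).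
  apply: (bounded_L1 mu_rho T_mu P_T M_P nu_inv nu_fin (B := 1)).
    exact: measurable_indic.
  by move=> y; rewrite ger0_norm ?indic_le1.
have [cg _ _] := P_T_ae T_mu P_T s0 EL.
have [x0 gx0] : exists x0, 0 < g x0.
  apply: contrapT => /forallNP h.
  have : \int[mu]_y g y = 0.
    rewrite (_ : g = cst 0) ?Rintegral_cst ?mul0r//; apply/funext => y /=.
    by apply/eqP; rewrite eq_le; have /andP[-> _] := g01 y; rewrite andbT leNgt; apply/negP/h.
  rewrite (Rintegral_transition mu_rho T_mu P_T M_P nu_inv nu_fin (ltW s0) mE).
  have Ef : mu E \is a fin_num.
    rewrite ge0_fin_numE// (le_lt_trans _ (mu_fin mu_rho T_mu P_T M_P nu_inv nu_fin))//.
    by apply: le_measure; rewrite ?inE.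
  by move=> h0; rewrite -(fineK Ef) h0 ltxx in E0.
have /nbhs_ballP[e /= e0 he] : \forall y \near x0, 0 < g y by exact: (cvgr_gt _ (cg x0) _ gx0).
pose b : Rd -> R := box_bump (x0 - const_mx e) (x0 + const_mx e).
have tb : test_fun setT b by exact: test_fun_box_bump.
have [B B0 hB] := test_fun_bounded tb.
have -> : P t \1_E = P (t / 2) g.
  by rewrite /g -(P_semigroup mu_rho T_mu P_T s0 s0 EL) -splitr.
apply: (@P_gt0_mono _ b g x (maxr B 1) (ltW s0)) => //.
- exact: continuous_measurable_rV (test_fun_continuous tb).
- exact: continuous_measurable_rV.
- by move=> y; rewrite box_bump_ge0 le_max (le_trans (ler_norm _) (hB y)).
- by move=> y; have /andP[-> h] := g01 y; rewrite le_max h orbT.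
- apply: aeW => y b0; apply: he; rewrite ball_obox//.
  by apply: contrapT => h; rewrite /b box_bump_eq0// ltxx in b0.
- apply: (@P_test_gt0 _ x0) => //; first by move=> y; exact: box_bump_ge0.
  apply: box_bump_gt0 => i; rewrite !mxE; apply/andP; split; lra.
Qed.

End irreducible.

(** * Convergence to equilibrium in L^1 *)

Section ergodic.
Context {R : realType} {d : nat} (p : R).
Local Notation Rd := 'rV[R]_d.
Local Notation leb := (lebesgue_rV R d).
Variables (A C : Rd -> 'M[R]_d) (H : Rd -> Rd) (rho : Rd -> R).
Variable mu : {measure set Rd -> \bar R}.
Variables T P : R -> (Rd -> R) -> (Rd -> R).
Context {dO : measure_display} {Omega : measurableType dO}.
Variable M : @hunt_process R d dO Omega.
Variable nu : {measure set Rd -> \bar R}.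
Hypotheses (d_ge2 : (2 <= d)%N) (p_gtd : d%:R < p).
Hypothesis ass_a : assumption_a p A C H.
Hypothesis mu_rho : inf_invariant_density p A (drift A C H) rho mu.
Hypothesis T_mu : L1_semigroup_construction mu A (drift A C H) rho T.
Hypothesis P_T : continuous_versions mu T P.
Hypothesis M_P : has_transition M P.
Hypotheses (nu_inv : invariant_measure M nu) (nu_fin : (nu setT < +oo)%E).

Let i1 (u : Rd -> R) : in_Lp mu setT 1 u <-> mu.-integrable setT (EFin \o u).
Proof. exact: in_Lp1P. Qed.

Let muT_fin := mu_fin mu_rho T_mu P_T M_P nu_inv nu_fin.

Let alive t x : 0 <= t -> law M (Some x) (state_in M t setT) = 1%E.
Proof. exact: (state_alive mu_rho T_mu P_T M_P nu_inv nu_fin). Qed.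

Let bdd_L1 (f : Rd -> R) (B : R) : measurable_fun setT f -> (forall x, `|f x| <= B) ->
  in_Lp mu setT 1 f.
Proof. exact: (bounded_L1 mu_rho T_mu P_T M_P nu_inv nu_fin). Qed.

Lemma state_alive_ae (t : R) (x : Rd) : 0 <= t ->
  \forall w \ae law M (Some x), state_in M t setT w.
Proof.
move=> t0; exists (~` state_in M t setT); split=> //.
  by apply: measurableC; exact: measurable_state_in.
have := probability_setC (law M (Some x)) (measurable_state_in M t0 measurableT).
by rewrite alive// subee.
Qed.

Lemma transition_probability (t : R) (x : Rd) : 0 <= t -> exists Q : probability Rd R,
  (forall E, measurable E -> Q E = (P t \1_E x)%:E) /\
  forall (f : Rd -> R) (B : R), measurable_fun setT f -> (forall y, `|f y| <= B) -> P t f x = \int[Q]_y f y.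
Proof.
(* The cemetery is sent to 0, an arbitrary point: at a fixed time the process is almost surely
   alive. *)
move=> t0; pose phi (w : Omega) : Rd := oapp id 0 (state M t w).
have mphi : measurable_fun setT phi.
  apply: measurable_fun_rV => i.
  rewrite (_ : (fun w => _) = fun w => oapp (fun y : Rd => y ord0 i) 0 (state M t w)).
    by apply: measurable_state_oapp => //; exact: measurable_coord.
  by apply/funext => w; rewrite /phi; case: (state M t w) => //=; rewrite mxE.
pose X : {mfun Omega >-> Rd} := mfun_Sub (mem_set mphi).
pose Q : probability Rd R := distribution (law M (Some x)) X.
have QP (f : Rd -> R) (B : R) : measurable_fun setT f -> (forall y, `|f y| <= B) -> P t f x = \int[Q]_y f y.
  move=> mf fB; have [i_f ->] := has_transition_Rintegral M_P x t0 mf (ex_intro _ B fB).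
  have mfphi : measurable_fun setT (f \o phi) by exact: measurableT_comp.
  have i_fphi : (law M (Some x)).-integrable setT (EFin \o (f \o phi)).
    apply: (integrable_dominated measurableT (g := cst B)) => //; first by move=> w _; exact: fB.
    exact: finite_measure_integrable_cst.
  rewrite /Rintegral /Q /distribution (integral_pushforward mphi)//; last exact/measurable_EFinP.
  rewrite preimage_setT; congr fine; apply: ae_eq_integral => //.
  - by apply/measurable_EFinP; exact: measurable_state_oapp.
  - exact/measurable_EFinP.
  - apply: filterS (state_alive_ae x t0) => w [y _ e] _ /=.
    by rewrite /phi -e.
exists Q; split=> // E mE.
have E1 (y : Rd) : `|\1_E y : R| <= 1 by rewrite ger0_norm ?indic_le1.
have iE : Q.-integrable setT (EFin \o (\1_E : Rd -> R)).
  apply: (integrable_dominated measurableT (g := cst 1)) => //.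
  exact: finite_measure_integrable_cst.
by rewrite (QP _ 1 (measurable_indic mE) E1) EFin_Rintegral// integral_indic// setIT.
Qed.

(** Radon-Nikodym applies by [P_null]. The set where the density vanishes has P_t(x, .)-measure 0,
    hence is mu-null by irreducibility. *)
Lemma transition_density (t : R) (x : Rd) : 0 < t -> exists h : Rd -> R,
  [/\ forall y, 0 <= h y, mu.-integrable setT (EFin \o h), \forall y \ae mu, 0 < h y &
  forall (f : Rd -> R) (B : R), measurable_fun setT f -> (forall y, `|f y| <= B) -> P t f x = \int[mu]_y (f y * h y)].
Proof.
move=> t0; have [Q [QE QP]] := transition_probability x (ltW t0).
have Qmu : Q `<< mu.
  apply/null_content_dominatesP => E mE E0.
  by rewrite QE// (P_null mu_rho T_mu P_T t0 mE E0).
have Qfin : fin_num_fun Q by move=> E mE; exact: fin_num_measure.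
have [h [h0 ih Qh]] := radon_nikodym_density (mu_sigma_finite mu_rho) Qfin Qmu.
have mh : measurable_fun setT h by exact: integrable_measurable ih.
exists h; split=> //.
  pose E := [set y | h y = 0].
  have mE : measurable E.
    have -> : E = setT `&` h @^-1` [set 0] by rewrite setTI.
    exact: mh.
  exists E; split=> //; last by move=> y /= /negP; rewrite lt_neqAle h0 andbT negbK => /eqP.
  apply/eqP/negPn/negP => E0; have Epos : (0 < mu E)%E by rewrite lt0e E0 measure_ge0.
  have := transition_gt0 d_ge2 p_gtd ass_a mu_rho T_mu P_T M_P nu_inv nu_fin x t0 mE Epos.
  rewrite -lte_fin -QE// Qh//.
  rewrite (eq_integral (cst 0%E)) ?integral0 ?ltxx// => y; rewrite inE /E /= => ->; by [].
move=> f B mf fB; rewrite (QP f B)//.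
by rewrite (Rintegral_density mh h0 Qh).
Qed.

Lemma P_norm_le (t : R) (f : Rd -> R) (B : R) (x : Rd) : 0 <= t -> measurable_fun setT f ->
  (forall y, `|f y| <= B) -> `|P t f x| <= B.
Proof.
move=> t0 mf fB; have [Q [_ QP]] := transition_probability x t0.
have iQ : Q.-integrable setT (EFin \o f).
  by apply: (integrable_dominated measurableT (g := cst B)) => //; exact: finite_measure_integrable_cst.
rewrite (QP f B)//; apply: (le_trans (le_normr_Rintegral measurableT iQ)).
have -> : B = \int[Q]_y cst B y by rewrite Rintegral_cst// [X in fine X]probability_setT mulr1.
by apply: le_Rintegral => //; [exact: integrable_norm|exact: finite_measure_integrable_cst].
Qed.

Lemma P_cst (t b : R) : 0 <= t -> P t (cst b) = cst b.
Proof.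
move=> t0; apply/funext => x; have [Q [_ QP]] := transition_probability x t0.
by rewrite (QP _ `|b|)// Rintegral_cst// [X in fine X]probability_setT mulr1.
Qed.

(** Adding the constant [B] to f or to -f gives nonnegative functions, for which contraction bounds
    the integral; the two signs give both inequalities. *)
Lemma Rintegral_P (t : R) (f : Rd -> R) (B : R) : 0 < t -> measurable_fun setT f ->
  (forall y, `|f y| <= B) -> \int[mu]_x P t f x = \int[mu]_x f x.
Proof.
move=> t0 mf fB; have fL := bdd_L1 mf fB.
have cL b : in_Lp mu setT 1 (cst b : Rd -> R) by apply: (@bdd_L1 _ `|b|).
have [_ PfL _] := P_T_ae T_mu P_T t0 fL.
have half (a : R) : `|a| = 1 -> \int[mu]_x (a * P t f x + B) <= \int[mu]_x (a * f x + B).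
  move=> a1; have aB (g : Rd -> R) : (forall y, `|g y| <= B) -> forall y, `|a * g y + B| = a * g y + B.
    move=> gB y; rewrite ger0_norm// -lerBlDr sub0r; apply: le_trans (_ : - `|a * g y| <= _).
      by rewrite lerN2 normrM a1 mul1r.
    by rewrite lerNl -normrN ler_norm.
  have hL : in_Lp mu setT 1 (fun x => a * f x + cst B x).
    by apply/i1; apply: integrable_EFinD; [|apply: integrable_EFinZ|] => //; exact/i1.
  have := P_L1_contraction T_mu P_T t0 hL.
  rewrite (P_linear mu_rho T_mu P_T a t0 fL (cL B)) P_cst ?(ltW t0)//.
  have PB y : `|P t f y| <= B by exact: P_norm_le (ltW t0) mf fB.
  have -> : (fun x => `|a * P t f x + cst B x|) = (fun x => a * P t f x + B) by apply/funext => y; exact: aB.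
  by have -> : (fun x => `|a * f x + cst B x|) = (fun x => a * f x + B) by apply/funext => y; exact: aB.
have := half 1 (normr1 _); have := half (-1) (normrN1 _).
have iB := (i1 _).1 (cL B); have iP := (i1 _).1 PfL; have i_f := (i1 _).1 fL.
rewrite !(RintegralD measurableT) ?RintegralZl//; try exact: integrable_EFinZ; try exact: iB.
by rewrite !mulN1r !mul1r => h1 h2; apply/eqP; rewrite eq_le; apply/andP; split; lra.
Qed.

Lemma P_L1_noninc (f : Rd -> R) (s t : R) : in_Lp mu setT 1 f -> 0 < s -> s <= t ->
  \int[mu]_x `|P t f x| <= \int[mu]_x `|P s f x|.
Proof.
move=> fL s0; rewrite le_eqVlt => /predU1P[<-//|st].
rewrite -(subrK s t) (P_semigroup mu_rho T_mu P_T) ?subr_gt0//.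
by apply: (P_L1_contraction T_mu P_T); rewrite ?subr_gt0//; have [] := P_T_ae T_mu P_T s0 fL.
Qed.

Let mu_gt0 : (0 < mu setT)%E.
Proof.
by have [m0 _ _] := mu_invariant mu_rho T_mu P_T M_P nu_inv nu_fin; rewrite lt0e m0 measure_ge0.
Qed.

Let ae_ex (Q : Rd -> Prop) : (\forall x \ae mu, Q x) -> exists x, Q x.
Proof.
move=> [N [mN N0 NQ]]; apply: contrapT => /forallNP nQ.
have : (mu setT <= mu N)%E by apply: le_measure; rewrite ?inE// => x _; apply: NQ; exact: nQ.
by rewrite N0 leNgt mu_gt0.
Qed.

(* The masses of [P_s f^+] and [P_s f^-] that cancel in [P_s f] are at least
   [min (P_1 g^+) (P_1 g^-)], which cannot tend to 0 since the density of
   [P_1(x, dy)] is positive. *)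
Lemma ergodic_L1 (f : Rd -> R) (B e : R) : measurable_fun setT f -> (forall x, `|f x| <= B) ->
  \int[mu]_x f x = 0 -> 0 < e ->
  exists2 s : R, 0 < s & forall t : R, s <= t -> \int[mu]_x `|P t f x| <= e.
Proof.
move=> mf fB f0 e0; have fL := bdd_L1 mf fB.
suff [s s0 hs] : exists2 s : R, 0 < s & \int[mu]_x `|P s f x| <= e.
  by exists s => // t st; apply: le_trans hs; exact: P_L1_noninc.
apply: contrapT => hne.
have {}hne s : 0 < s -> e < \int[mu]_x `|P s f x|.
  by move=> s0; rewrite ltNge; apply/negP => h; apply: hne; exists s.
have n0 (n : nat) : 0 < n.+1%:R :> R by rewrite ltr0n.
pose g n : Rd -> R := P n.+1%:R f.
have cg n : continuous (g n) by have [] := P_T_ae T_mu P_T (n0 n) fL.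
have mg n : measurable_fun setT (g n) := continuous_measurable_rV (@cg n).
have gB n x : `|g n x| <= B by exact: P_norm_le (ltW (n0 n)) mf fB.
have B0 : 0 <= B by rewrite (le_trans _ (fB 0)).
pose G (b : bool) n x : R := maxr (if b then g n x else - g n x) 0.
have mG b n : measurable_fun setT (G b n).
  apply: measurable_maxr => //; case: b => //; exact: measurableT_comp.
have G0 b n x : 0 <= G b n x by rewrite le_max lexx orbT.
have GB b n x : `|G b n x| <= B.
  rewrite ger0_norm// ge_max B0 andbT; have := gB n x; rewrite ler_norml.
  by case: b => /andP[h1 h2] //; rewrite lerNl.
have iG b n := (i1 _).1 (bdd_L1 (mG b n) (GB b n)).
have gE n x : g n x = G true n x - G false n x.
  by rewrite /G /maxr; case: ltP => h1; case: ltP => h2; lra.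
have gN n x : `|g n x| = G true n x + G false n x.
  rewrite /G /maxr; case: (ltP (g n x) 0) => h1; case: (ltP (- g n x) 0) => h2.
  - by lra.
  - by rewrite ltr0_norm// add0r.
  - by rewrite ger0_norm// addr0.
  - by rewrite ger0_norm//; lra.
pose a n := \int[mu]_x `|g n x|.
have aE n : a n = \int[mu]_x G true n x + \int[mu]_x G false n x.
  by rewrite /a -RintegralD//; apply: eq_Rintegral => x _; exact: gN.
have GG n : \int[mu]_x G true n x = \int[mu]_x G false n x.
  apply/eqP; rewrite -subr_eq0 -RintegralB//.
  rewrite -[X in X == _]/(\int[mu]_x (fun x => G true n x - G false n x) x).
  rewrite -(_ : g n = fun x => G true n x - G false n x); last by apply/funext => x; exact: gE.
  by rewrite /g (Rintegral_P (n0 n) mf fB) f0.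
have Ge b n : e / 2 <= \int[mu]_x G b n x.
  have := hne _ (n0 n); rewrite -/(g n) -/(a n) aE; case: b; rewrite GG => h; lra.
pose PG b n : Rd -> R := P 1 (G b n).
have PG0 b n x : 0 <= PG b n x.
  have Gb y : 0 <= G b n y <= G b n y by rewrite G0 lexx.
  have Gb' : exists K : R, forall y, G b n y <= K by exists B => y; rewrite (le_trans (ler_norm _)).
  by have /andP[] := P_ge0_le M_P x ler01 (mG b n) (mG b n) Gb Gb'.
have PGL b n : in_Lp mu setT 1 (PG b n).
  by have [] := P_T_ae T_mu P_T ltr01 (bdd_L1 (mG b n) (GB b n)).
have iPG b n := (i1 _).1 (PGL b n).
have gS n x : g n.+1 x = PG true n x - PG false n x.
  rewrite /g -[n.+2]add1n natrD (P_semigroup mu_rho T_mu P_T ltr01 (n0 n) fL) -/(g n).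
  have -> : g n = fun x => (-1) * G false n x + G true n x.
    by apply/funext => y; rewrite gE mulN1r addrC.
  have GL b := bdd_L1 (mG b n) (GB b n).
  by rewrite (P_linear mu_rho T_mu P_T (-1) ltr01 (GL false) (GL true)) mulN1r addrC.
(* The overlap of the two transported parts. A minimum is half of the sum minus half of the
   distance, so by invariance its integral is half the decrease of the L^1 norm from n to n + 1. *)
pose mn n x := minr (PG true n x) (PG false n x).
have mn0 n x : 0 <= mn n x by rewrite le_min !PG0.
have mnE n x : mn n x = 2^-1 * (PG true n x + PG false n x) - 2^-1 * `|g n.+1 x|.
  rewrite gS /mn /minr; case: ltP => h; first by rewrite distrC ger0_norm ?subr_ge0 ?ltW//; lra.
  by rewrite ger0_norm ?subr_ge0//; lra.
have mmn n : measurable_fun setT (mn n).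
  by apply: measurable_minr; exact: in_Lp_measurable (PGL _ n).
have mn_int n : \int[mu]_x mn n x = 2^-1 * (a n - a n.+1).
  have ig : mu.-integrable setT (EFin \o (fun x => `|g n.+1 x|)).
    apply: integrable_norm; apply/i1; exact: bdd_L1 (mg n.+1) (gB n.+1).
  under eq_Rintegral do rewrite mnE.
  rewrite RintegralB//; [|by apply: integrable_EFinZ => //; exact: integrable_EFinD|exact: integrable_EFinZ].
  rewrite !RintegralZl//; last exact: integrable_EFinD.
  rewrite RintegralD// -/(a n.+1) -mulrBr (aE n).
  by rewrite !(Rintegral_P ltr01 (mG _ n) (GB _ n)).
have an : forall n m, (n <= m)%N -> a m <= a n.
  by move=> n m nm; apply: P_L1_noninc; rewrite // ler_nat ltnS.
have acv : a n @[n --> \oo] --> inf (range a).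
  apply: nonincreasing_cvgn => //; exists 0 => _ [n _ <-]; exact: Rintegral_ge0.
have l0 : (\int[mu]_x (mn n x)%:E)%E @[n --> \oo] --> 0%E.
  have imn n : mu.-integrable setT (EFin \o mn n).
    have -> : mn n = fun x => 2^-1 * (PG true n x + PG false n x) - 2^-1 * `|g n.+1 x|.
      by apply/funext => x; exact: mnE.
    apply: integrable_EFinB => //; apply: integrable_EFinZ => //; first exact: integrable_EFinD.
    apply: integrable_norm; apply/i1; exact: bdd_L1 (mg n.+1) (gB n.+1).
  rewrite (_ : (fun n => _) = EFin \o (fun n => 2^-1 * (a n - a n.+1))); last first.
    by apply/funext => n /=; rewrite -EFin_Rintegral// mn_int.
  apply: cvg_EFin; first exact: nearW.
  have acv1 : a n.+1 @[n --> \oo] --> inf (range a) by rewrite (cvg_shiftS a).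
  have l : 2^-1 * (a n - a n.+1) @[n --> \oo] --> 2^-1 * (inf (range a) - inf (range a)).
    by apply: cvgMr; apply: cvgB.
  by rewrite subrr mulr0 in l.
have [k [_ hk]] := L1_cvg_subseq mmn mn0 l0.
have [x hx] := ae_ex hk.
have [h [h0 ih hpos hP]] := transition_density x ltr01.
(* At the chosen x, select the part whose image under P_1 is the smaller one. Its integral against
   the positive density of P_1(x, .) tends to 0, although its mass stays at least e/2. *)
pose b n := PG true (k n) x <= PG false (k n) x.
pose gam n := G (b n) (k n).
have gamE n : \int[mu]_y (gam n y * h y) = mn (k n) x.
  rewrite -(hP (gam n) B)//; [|exact: mG|by move=> y; exact: GB].
  rewrite /mn /gam /b; case: (leP (PG true (k n) x) (PG false (k n) x)) => hb //.
have mh := integrable_measurable ih.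
have igam n : mu.-integrable setT (EFin \o (fun y => gam n y * h y)).
  under eq_fun do rewrite mulrC.
  by apply: (integrable_EFinM (M := B) measurableT ih) => //; [exact: mG|move=> y _; exact: GB].
have l1 : (\int[mu]_y (gam n y * h y)%:E)%E @[n --> \oo] --> 0%E.
  rewrite (_ : (fun n => _) = EFin \o (fun n => mn (k n) x)); last first.
    by apply/funext => n /=; rewrite -EFin_Rintegral// gamE.
  by apply: cvg_EFin => //; exact: nearW.
have [j [_ hj]] := L1_cvg_subseq (fun n => measurable_funM (mG (b n) (k n)) mh)
  (fun n y => mulr_ge0 (G0 (b n) (k n) y) (h0 y)) l1.
have [|||||_ _ l2] := @Rdominated_cvg _ _ _ mu setT measurableT (fun n => gam (j n)) (cst 0) (cst B).
- by move=> n; exact: mG.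
- by [].
- apply: filterS2 hj hpos => y hy hy0 _.
  have l : gam (j n) y * h y * (h y)^-1 @[n --> \oo] --> 0 * (h y)^-1 by apply: cvgMl.
  by move: l; rewrite mul0r; under eq_fun do rewrite mulfK ?gt_eqF//.
- by apply/i1; apply: (@bdd_L1 _ B) => // y; rewrite ger0_norm.
- by apply: aeW => y n _; exact: GB.
have : e / 2 <= \int[mu]_x (cst 0 : Rd -> R) x.
  rewrite -(cvg_lim (@Rhausdorff R) l2); apply: limr_ge; first by apply/cvg_ex; eexists; exact: l2.
  by apply: nearW => n; exact: Ge.
by rewrite Rintegral_cst// mul0r; lra.
Qed.

End ergodic.

(** * Convergence in L^s and at every point *)

Lemma ae_fatou dT (X : measurableType dT) {R : realType} (m : {measure set X -> \bar R})
    (f_ : nat -> X -> R) (f : X -> R) (c : \bar R) :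
  (forall n, measurable_fun setT (f_ n)) -> measurable_fun setT f -> (forall n x, 0 <= f_ n x) ->
  (\forall x \ae m, f_ n x @[n --> \oo] --> f x) ->
  (forall n, (\int[m]_x (f_ n x)%:E <= c)%E) -> (\int[m]_x (f x)%:E <= c)%E.
Proof.
move=> mf_ mf f0 ff fc.
have mE n : measurable_fun setT (fun x => (f_ n x)%:E) by exact/measurable_EFinP.
have := fatou m measurableT mE (fun n x _ => f0 n x : (0 <= (f_ n x)%:E)%E).
have -> : (\int[m]_x limn_einf (fun n => (f_ n x)%:E) = \int[m]_x (f x)%:E)%E.
  apply: ae_eq_integral => //.
  - have -> : (fun x => limn_einf (fun n => (f_ n x)%:E)) =
        (fun x => - limn_esup (-%E \o (fun n => (f_ n x)%:E)))%E.
      by apply/funext => x; rewrite limn_esupN oppeK.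
    apply: measurableT_comp => //; apply: measurable_fun_limn_esup => n.
    exact: measurableT_comp.
  - exact/measurable_EFinP.
  - apply: filterS ff => x hx _.
    have l : (f_ n x)%:E @[n --> \oo] --> (f x)%:E by apply: cvg_EFin => //; exact: nearW.
    rewrite is_cvg_limn_einfE; first exact/cvg_lim.
    by apply/cvg_ex; exists (f x)%:E.
move=> h; apply: (le_trans h); rewrite limn_einf_lim; apply: lime_le; first exact: is_cvg_einfs.
apply: nearW => n; apply: le_trans (fc n); apply: ereal_inf_lbound.
by exists n => /=.
Qed.

Lemma powR_triple {R : realType} (a b c s : R) : 0 <= s ->
  `|a + b + c| `^ s <= 3 `^ s * (`|a| `^ s + `|b| `^ s + `|c| `^ s).
Proof.
move=> s0; pose m := maxr `|a| (maxr `|b| `|c|).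
have m0 : 0 <= m by rewrite le_max normr_ge0.
have h : `|a + b + c| <= 3 * m.
  have h1 : `|a + b + c| <= `|a| + `|b| + `|c|.
    by rewrite (le_trans (ler_normD _ _))// lerD2r ler_normD.
  have h2 : `|a| <= m by rewrite le_max lexx.
  have h3 : `|b| <= m by rewrite !le_max lexx orbT.
  have h4 : `|c| <= m by rewrite !le_max lexx !orbT.
  lra.
apply: (@le_trans _ _ ((3 * m) `^ s)); first by rewrite ge0_ler_powR ?nnegrE// mulr_ge0.
rewrite powRM// ler_wpM2l ?powR_ge0// /m.
have := powR_ge0 `|a| s; have := powR_ge0 `|b| s; have := powR_ge0 `|c| s.
rewrite /maxr; case: ifP => _; [case: ifP => _|]; lra.
Qed.

Lemma powR_cvg {R : realType} (u : R^nat) (y s : R) : 0 < s -> (forall n, 0 <= u n) -> 0 <= y ->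
  u n @[n --> \oo] --> y -> u n `^ s @[n --> \oo] --> y `^ s.
Proof.
move=> s0 u0; rewrite le_eqVlt => /predU1P[<-|y0] uy.
  rewrite powR0 ?gt_eqF//; apply/cvgrPdist_le => e e0.
  have d0 : 0 < e `^ s^-1 by exact: powR_gt0.
  have /cvgrPdist_le/(_ _ d0) := uy; apply: filterS => n; rewrite !sub0r !normrN.
  rewrite !ger0_norm ?powR_ge0// => h.
  have := ge0_ler_powR (ltW s0) _ _ h; rewrite !nnegrE u0 powR_ge0 => /(_ isT isT).
  by rewrite -powRrM mulVf ?gt_eqF// powRr1// ltW.
have e : \forall n \near \oo, expR (s * ln (u n)) = u n `^ s.
  by near=> n; rewrite /powR gt_eqF//; near: n; exact: (cvgr_gt _ uy).
have -> : y `^ s = expR (s * ln y) by rewrite /powR gt_eqF.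
apply: cvg_trans (near_eq_cvg e) _; apply: continuous_cvg; first exact: continuous_expR.
by apply: cvgMr; apply: continuous_cvg => //; exact: continuous_ln.
Unshelve. all: by end_near.
Qed.

Lemma powR_le_bounded {R : realType} (y D s : R) : 0 <= y <= D -> 1 <= s -> y `^ s <= D `^ (s - 1) * y.
Proof.
move=> /andP[y0 yD] s1; have [->|yn0] := eqVneq y 0.
  by rewrite mulr0 powR0// gt_eqF// (lt_le_trans ltr01).
have -> : y `^ s = y `^ (s - 1) * y.
  by rewrite -[X in _ * X](powRr1 y0) -powRD ?yn0 ?implybT// subrK.
by rewrite ler_wpM2r// ge0_ler_powR ?nnegrE ?subr_ge0// (le_trans y0).
Qed.

Lemma le_Rintegral_sum3 dT (X : measurableType dT) {R : realType} (m : {measure set X -> \bar R})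
    (l u v w : X -> R) (W : R) : m.-integrable setT (EFin \o l) -> m.-integrable setT (EFin \o u) ->
  m.-integrable setT (EFin \o v) -> m.-integrable setT (EFin \o w) ->
  (forall x, l x <= W * (u x + v x + w x)) ->
  \int[m]_x l x <= W * (\int[m]_x u x + \int[m]_x v x + \int[m]_x w x).
Proof.
move=> il iu iv iw h; have iuv : m.-integrable setT (EFin \o (fun x => u x + v x)) by exact: integrable_EFinD.
have iuvw : m.-integrable setT (EFin \o (fun x => u x + v x + w x)) by exact: integrable_EFinD.
rewrite -(RintegralD measurableT iu iv) -(RintegralD measurableT iuv iw) -RintegralZl//.
by apply: le_Rintegral => //; exact: integrable_EFinZ.
Qed.

(* Young's inequality in place of Jensen's *)
Lemma powR_Rintegral_le dT (X : measurableType dT) {R : realType} (Q : probability X R) (f : X -> R) (s : R) :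
  1 <= s -> Q.-integrable setT (EFin \o f) -> Q.-integrable setT (EFin \o (fun x => `|f x| `^ s)) ->
  `|\int[Q]_x f x| `^ s <= \int[Q]_x (`|f x| `^ s).
Proof.
move=> s1 i_f ifs; have s0 : 0 < s by exact: lt_le_trans s1.
have iaf : Q.-integrable setT (EFin \o (fun x => `|f x|)) by exact: integrable_norm.
set a := \int[Q]_x `|f x|; have a0 : 0 <= a by exact: Rintegral_ge0.
apply: (@le_trans _ _ (a `^ s)).
  apply: ge0_ler_powR; [exact: ltW|by rewrite nnegrE|by rewrite nnegrE|].
  exact: (le_normr_Rintegral measurableT i_f).
move: s1; rewrite le_eqVlt => /predU1P[s1|s1].
  rewrite -s1 powRr1//; under [leRHS]eq_Rintegral do rewrite powRr1//.
  exact: lexx.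
have s10 : 0 < s - 1 by rewrite subr_gt0.
pose q := s / (s - 1); have q0 : 0 < q by rewrite divr_gt0.
have sq : q^-1 + s^-1 = 1 by rewrite /q; field; rewrite !gt_eqF.
have [->|an0] := eqVneq a 0; first by rewrite powR0 ?gt_eqF// Rintegral_ge0// => x _; exact: powR_ge0.
have h : a `^ (s - 1) * a <= a `^ s / q + (\int[Q]_x (`|f x| `^ s)) / s.
  have -> : a `^ s / q = \int[Q]_x cst (a `^ s / q) x.
    by rewrite Rintegral_cst// [X in fine X]probability_setT mulr1.
  rewrite {2}/a -RintegralZl// [_ / s]mulrC -RintegralZl// -RintegralD//; last 2 first.
  - exact: finite_measure_integrable_cst.
  - exact: integrable_EFinZ.
  apply: le_Rintegral => //; first exact: integrable_EFinZ.
    by apply: integrable_EFinD => //; [exact: finite_measure_integrable_cst|exact: integrable_EFinZ].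
  move=> x _ /=; have := conjugate_powR (powR_ge0 a (s - 1)) (normr_ge0 (f x)) q0 s0 sq.
  by rewrite -powRrM /q mulrCA divff ?gt_eqF// mulr1 [s^-1 * _]mulrC.
have e : a `^ (s - 1) * a = a `^ s by rewrite -[X in _ * X](powRr1 a0) -powRD ?an0 ?implybT// subrK.
rewrite e in h.
have : a `^ s * (1 - q^-1) <= (\int[Q]_x (`|f x| `^ s)) / s by rewrite mulrBr mulr1 lerBlDl.
by rewrite -sq addrAC subrr add0r ler_pM2r ?invr_gt0.
Qed.

Section truncation.
Context {dT : measure_display} {X : measurableType dT} {R : realType}.
Implicit Types f : X -> R.

Definition truncation f (k : nat) (x : X) : R := maxr (- k%:R) (minr (f x) k%:R).

Lemma measurable_truncation f k : measurable_fun setT f -> measurable_fun setT (truncation f k).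
Proof. by move=> mf; apply: measurable_maxr => //; exact: measurable_minr. Qed.

Lemma truncation_bounds f k x :
  [/\ `|truncation f k x| <= k%:R, `|truncation f k x| <= `|f x| & `|f x - truncation f k x| <= `|f x|].
Proof.
have k0 : 0 <= k%:R :> R by [].
rewrite /truncation; move: (f x) (k%:R) k0 => y a a0.
have [h1|/ltW h1] := leP y a.
  have [h2|/ltW h2] := leP (- a) y.
    by rewrite subrr normr0 normr_ge0 lexx ler_norml h1 h2.
  have y0 : y <= 0 by lra.
  have s0 : y - - a <= 0 by lra.
  by rewrite normrN (ger0_norm a0) (ler0_norm y0) (ler0_norm s0); split; lra.
have h3 : - a <= a by lra.
have y0 : 0 <= y by lra.
have s0 : 0 <= y - a by lra.
by rewrite (max_idPr h3) (ger0_norm a0) (ger0_norm y0) (ger0_norm s0); split; lra.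
Qed.

Lemma truncation_eq f k x : `|f x| <= k%:R -> truncation f k x = f x.
Proof.
rewrite ler_norml => /andP[h1 h2]; rewrite /truncation (min_idPl h2).
exact/max_idPr.
Qed.

Lemma truncation_near f x : \forall k \near \oo, truncation f k x = f x.
Proof.
by near=> k; apply: truncation_eq; apply: ltW; near: k; exact: nbhs_infty_gtr.
Unshelve. all: by end_near.
Qed.

End truncation.

Section ergodic_limits.
Context {R : realType} {d : nat} (p : R).
Local Notation Rd := 'rV[R]_d.
Local Notation leb := (lebesgue_rV R d).
Variables (A C : Rd -> 'M[R]_d) (H : Rd -> Rd) (rho : Rd -> R).
Variable mu : {measure set Rd -> \bar R}.
Variables T P : R -> (Rd -> R) -> (Rd -> R).
Context {dO : measure_display} {Omega : measurableType dO}.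
Variable M : @hunt_process R d dO Omega.
Variable nu : {measure set Rd -> \bar R}.
Hypotheses (d_ge2 : (2 <= d)%N) (p_gtd : d%:R < p).
Hypothesis ass_a : assumption_a p A C H.
Hypothesis mu_rho : inf_invariant_density p A (drift A C H) rho mu.
Hypothesis T_mu : L1_semigroup_construction mu A (drift A C H) rho T.
Hypothesis P_T : continuous_versions mu T P.
Hypothesis M_P : has_transition M P.
Hypotheses (nu_inv : invariant_measure M nu) (nu_fin : (nu setT < +oo)%E).

Let i1 (u : Rd -> R) : in_Lp mu setT 1 u <-> mu.-integrable setT (EFin \o u).
Proof. exact: in_Lp1P. Qed.

Let bdd_L1 (f : Rd -> R) (B : R) : measurable_fun setT f -> (forall x, `|f x| <= B) ->
  in_Lp mu setT 1 f.
Proof. exact: (bounded_L1 mu_rho T_mu P_T M_P nu_inv nu_fin). Qed.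

Let m := fine (mu setT).

Let m_gt0 : 0 < m.
Proof.
have muT := mu_fin mu_rho T_mu P_T M_P nu_inv nu_fin.
have [m0 _ _] := mu_invariant mu_rho T_mu P_T M_P nu_inv nu_fin.
by rewrite /m fine_gt0// lt0e m0 measure_ge0.
Qed.

Let Pn t f B x := P_norm_le mu_rho T_mu P_T M_P nu_inv nu_fin (t := t) (f := f) (B := B) x.

Let mean (f : Rd -> R) := m^-1 * \int[mu]_x f x.

Let centered (f : Rd -> R) (B : R) : measurable_fun setT f -> (forall x, `|f x| <= B) ->
  [/\ measurable_fun setT (fun x => f x - mean f), forall x, `|f x - mean f| <= B + `|mean f|,
     \int[mu]_x (f x - mean f) = 0 &
     forall t x, 0 < t -> P t (fun x => f x - mean f) x = P t f x - mean f].
Proof.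
move=> mf fB; have fL := bdd_L1 mf fB.
have cL : in_Lp mu setT 1 (cst (mean f) : Rd -> R) by apply: (@bdd_L1 _ `|mean f|).
split=> [||| t x t0].
- exact: measurable_funB.
- by move=> x; rewrite (le_trans (ler_normB _ _))// lerD2r.
- rewrite RintegralB//; [|exact/i1..].
  by rewrite Rintegral_cst// -/m /mean mulrAC mulVf ?mul1r ?subrr ?gt_eqF.
have -> : (fun x => f x - mean f) = (fun x => (-1) * cst (mean f) x + f x).
  by apply/funext => y; rewrite mulN1r addrC.
rewrite (P_linear mu_rho T_mu P_T (-1) t0 cL fL).
by rewrite (P_cst mu_rho T_mu P_T M_P nu_inv nu_fin _ (ltW t0)) mulN1r addrC.
Qed.

Lemma ergodic_mean (f : Rd -> R) (B e : R) : measurable_fun setT f -> (forall x, `|f x| <= B) -> 0 < e ->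
  \forall t \near +oo, \int[mu]_x `|P t f x - mean f| <= e.
Proof.
move=> mf fB e0; have [mc cB c0 Pc] := centered mf fB.
have [s s0 hs] := ergodic_L1 d_ge2 p_gtd ass_a mu_rho T_mu P_T M_P nu_inv nu_fin mc cB c0 e0.
near=> t; have st : s <= t by near: t; exact: nbhs_pinfty_ge (num_real _).
apply: le_trans (hs t st); under [leRHS]eq_Rintegral do rewrite Pc ?(lt_le_trans s0)//.
exact: lexx.
Unshelve. all: by end_near.
Qed.

(** Write P_t = P_1 P_(t-1) and split the density h of P_1(x, .) into min(h, n), which only sees the
    L^1 norm of the centred P_(t-1) f, and a remainder of small integral, which is paired with the
    uniform bound. *)
Lemma ergodic_pointwise (f : Rd -> R) (B : R) (x : Rd) : measurable_fun setT f -> (forall x, `|f x| <= B) ->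
  P t f x @[t --> +oo] --> mean f.
Proof.
move=> mf fB; apply/cvgrPdist_le => e e0; have [mc cB c0 Pc] := centered mf fB.
set g := fun x => f x - mean f in mc cB c0 Pc; set B' := B + `|mean f| in cB.
have B'0 : 0 <= B' by rewrite (le_trans _ (cB 0)).
have [h [h0 ih _ hP]] := transition_density d_ge2 p_gtd ass_a mu_rho T_mu P_T M_P nu_inv nu_fin x ltr01.
have mh := integrable_measurable ih.
have mt n : measurable_fun setT (fun y => h y - minr (h y) n%:R).
  by apply: measurable_funB => //; exact: measurable_minr.
have t0 n y : 0 <= h y - minr (h y) n%:R by rewrite subr_ge0 ge_min lexx.
have th n y : h y - minr (h y) n%:R <= h y by rewrite gerBl le_min h0 ler0n.
have [|||||_ _ l] := @Rdominated_cvg _ _ _ mu setT measurableT (fun n y => h y - minr (h y) n%:R) (cst 0) h.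
- by [].
- by [].
- apply: aeW => y _; apply/cvgrPdist_le => r r0; near=> n.
  rewrite /= min_l ?subrr ?subr0 ?normr0 ?ltW//.
  by near: n; exact: nbhs_infty_gtr.
- exact: ih.
- by apply: aeW => y n _; rewrite ger0_norm.
have [n hn] : exists n : nat, B' * \int[mu]_y (h y - minr (h y) n%:R) <= e / 2.
  rewrite Rintegral_cst// mul0r in l.
  have e1 : 0 < e / 2 / (B' + 1) by rewrite !divr_gt0// ltr_wpDl.
  have /cvgrPdist_le/(_ _ e1)[n _ /(_ n (leqnn n))] := l.
  rewrite /= sub0r normrN ger0_norm; last by apply: Rintegral_ge0 => y _; exact: t0.
  rewrite ler_pdivlMr ?ltr_wpDl// => hn; exists n; apply: le_trans hn; rewrite mulrC ler_wpM2l ?lerDl//.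
  by apply: Rintegral_ge0 => y _; exact: t0.
have e2 : 0 < e / 2 / (n%:R + 1) by rewrite !divr_gt0// ltr_wpDl.
have [s s0 hs] := ergodic_L1 d_ge2 p_gtd ass_a mu_rho T_mu P_T M_P nu_inv nu_fin mc cB c0 e2.
near=> t; have st : s + 1 <= t by near: t; exact: nbhs_pinfty_ge (num_real _).
have t10 : 0 < t - 1 by rewrite subr_gt0 (lt_le_trans _ st)// ltrDr.
have tt0 : 0 < t by rewrite (lt_trans t10)// gtrBl.
rewrite distrC -Pc// -/g.
have gL := bdd_L1 mc cB.
rewrite -[t](subrKC 1) (P_semigroup mu_rho T_mu P_T ltr01 t10 gL).
set u := P (t - 1) g.
have uL : in_Lp mu setT 1 u by have [] := P_T_ae T_mu P_T t10 gL.
have mu_ : measurable_fun setT u by exact: in_Lp_measurable uL.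
have uB y : `|u y| <= B' by exact: Pn (ltW t10) mc cB.
have iu := (i1 _).1 uL.
rewrite (hP u B')//.
have iuh : mu.-integrable setT (EFin \o (fun y => u y * h y)).
  under eq_fun do rewrite mulrC.
  exact: (integrable_EFinM (M := B') measurableT ih).
have it : mu.-integrable setT (EFin \o (fun y => h y - minr (h y) n%:R)).
  by apply: (integrable_dominated measurableT (g := h)) => // y _; rewrite ger0_norm.
have inu : mu.-integrable setT (EFin \o (fun y => n%:R * `|u y|)) by apply: integrable_EFinZ => //; exact: integrable_norm.
have iBt : mu.-integrable setT (EFin \o (fun y => B' * (h y - minr (h y) n%:R))) by exact: integrable_EFinZ.
apply: (le_trans (le_normr_Rintegral measurableT iuh)).
apply: (@le_trans _ _ (\int[mu]_y (n%:R * `|u y| + B' * (h y - minr (h y) n%:R)))).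
  apply: le_Rintegral => //; [exact: integrable_norm|exact: integrable_EFinD|].
  move=> y _; rewrite normrM [`|h y|]ger0_norm// -{1}[h y](subrKC (minr (h y) n%:R)) mulrDr.
  rewrite lerD//; last by rewrite ler_wpM2r.
  by rewrite mulrC ler_wpM2r// ge_min lexx orbT.
rewrite RintegralD// !RintegralZl//; last exact: integrable_norm.
rewrite [leRHS](splitr e) lerD//.
have : \int[mu]_y `|u y| <= e / 2 / (n%:R + 1) by apply: hs; rewrite lerBrDr.
rewrite ler_pdivlMr ?ltr_wpDl//; apply: le_trans; rewrite mulrC ler_wpM2l ?lerDl//.
exact: Rintegral_ge0.
Unshelve. all: by end_near.
Qed.

Let mpow (f : Rd -> R) (s : R) : measurable_fun setT f -> measurable_fun setT (fun y => `|f y| `^ s).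
Proof. by move=> mf; apply: measurableT_comp (measurable_powR s) _; exact: measurableT_comp. Qed.

(** Convexity of the s-th power under the probability P_t(x, .), followed by invariance of [mu]. *)
Let P_Ls_bounded (f : Rd -> R) (B s t : R) : measurable_fun setT f -> (forall x, `|f x| <= B) ->
  1 <= s -> 0 < t ->
  mu.-integrable setT (EFin \o (fun x => `|P t f x| `^ s)) /\
  \int[mu]_x (`|P t f x| `^ s) <= \int[mu]_x (`|f x| `^ s).
Proof.
move=> mf fB s1 t0; have s0 : 0 <= s by exact: le_trans s1.
have B0 : 0 <= B by rewrite (le_trans _ (fB 0)).
have pB (g : Rd -> R) x : (forall x, `|g x| <= B) -> `| `|g x| `^ s| <= B `^ s.
  by move=> gB; rewrite ger0_norm ?powR_ge0// ge0_ler_powR ?nnegrE.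
have [_ PfL _] := P_T_ae T_mu P_T t0 (bdd_L1 mf fB).
have mPf : measurable_fun setT (P t f) by exact: in_Lp_measurable PfL.
have PB x : `|P t f x| <= B by exact: Pn (ltW t0) mf fB.
have iP : mu.-integrable setT (EFin \o (fun x => `|P t f x| `^ s)).
  by apply/i1; apply: (bdd_L1 (mpow s mPf)) => x; exact: pB.
split=> //.
have fs := fun x => pB f x fB.
have [_ PsL _] := P_T_ae T_mu P_T t0 (bdd_L1 (mpow s mf) fs).
rewrite -(Rintegral_P mu_rho T_mu P_T M_P nu_inv nu_fin t0 (mpow s mf) fs).
apply: le_Rintegral => //; first exact/i1.
move=> x _.
have [Q [_ QP]] := transition_probability mu_rho T_mu P_T M_P nu_inv nu_fin x (ltW t0).
rewrite (QP _ _ mf fB) (QP _ _ (mpow s mf) fs); apply: powR_Rintegral_le => //.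
  by apply: (integrable_dominated measurableT (g := cst B)) => //; exact: finite_measure_integrable_cst.
apply: (integrable_dominated measurableT (g := cst (B `^ s))) => //; first exact: mpow.
exact: finite_measure_integrable_cst.
Qed.

Let Ls_L1 (f : Rd -> R) (s : R) : 1 <= s -> in_Lp mu setT s%:E f -> in_Lp mu setT 1 f.
Proof.
move=> s1; apply: Lfun_subset; rewrite ?lee_fin// ge0_fin_numE//.
exact: (mu_fin mu_rho T_mu P_T M_P nu_inv nu_fin).
Qed.

Let trunc_L1 (f : Rd -> R) (k : nat) : measurable_fun setT f -> in_Lp mu setT 1 (truncation f k).
Proof.
move=> mf; apply: (@bdd_L1 _ k%:R); first exact: measurable_truncation.
by move=> x; have [] := truncation_bounds f k x.
Qed.

Let trunc_cvg (f : Rd -> R) : in_Lp mu setT 1 f ->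
  \int[mu]_x `|truncation f k x - f x| @[k --> \oo] --> 0 /\
  \int[mu]_x truncation f k x @[k --> \oo] --> \int[mu]_x f x.
Proof.
move=> fL; have mf : measurable_fun setT f by exact: in_Lp_measurable fL.
have [|||||_ l1 l2] := @Rdominated_cvg _ _ _ mu setT measurableT (truncation f) f (fun x => `|f x|).
- by move=> k; exact: measurable_truncation.
- by [].
- by apply: aeW => x _; apply: cvg_near_cst; exact: truncation_near.
- by apply: integrable_norm; exact/i1.
- by apply: aeW => x k _; have [] := truncation_bounds f k x.
- by [].
Qed.

(** Truncations reduce to bounded functions. Their images converge to P_t f in L^1, hence almost
    everywhere along a subsequence, and Fatou preserves the bound. *)
Lemma P_Ls_contraction (f : Rd -> R) (s t : R) : 1 <= s -> 0 < t -> in_Lp mu setT s%:E f ->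
  \int[mu]_x (`|P t f x| `^ s) <= \int[mu]_x (`|f x| `^ s).
Proof.
move=> s1 t0 fs; have fL := Ls_L1 s1 fs.
have s0 : 0 < s by exact: lt_le_trans s1.
have [mf ifs] := (in_LpP mu f measurableT s1).1 fs.
have [_ [_ Pfs _]] := (P_T.2 s%:E t f s1 t0 fs).
have [mPf iPfs] := (in_LpP mu (P t f) measurableT s1).1 Pfs.
pose D k x := `|P t (truncation f k) x - P t f x|.
have PkL k : in_Lp mu setT 1 (P t (truncation f k)) by have [] := P_T_ae T_mu P_T t0 (trunc_L1 k mf).
have PfL : in_Lp mu setT 1 (P t f) by have [] := P_T_ae T_mu P_T t0 fL.
have iD k : mu.-integrable setT (EFin \o D k).
  by apply: integrable_norm; apply: integrable_EFinB => //; exact/i1.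
have l : (\int[mu]_x (D k x)%:E)%E @[k --> \oo] --> 0%E.
  rewrite (_ : (fun k => _) = EFin \o (fun k => \int[mu]_x D k x)); last first.
    by apply/funext => k /=; rewrite EFin_Rintegral.
  apply: cvg_EFin; first exact: nearW.
  apply: (@squeeze_cvgr _ _ _ _ (cst 0) (fun k => \int[mu]_x `|truncation f k x - f x|)).
  - apply: nearW => k; apply/andP; split.
      by rewrite /=; apply: Rintegral_ge0 => x _; exact: normr_ge0.
    rewrite /=.
    have hL : in_Lp mu setT 1 (fun x => (-1) * f x + truncation f k x).
      by apply/i1; apply: integrable_EFinD => //; [apply: integrable_EFinZ => //|]; apply/i1 => //; exact: trunc_L1.
    have := P_L1_contraction T_mu P_T t0 hL.
    rewrite (P_linear mu_rho T_mu P_T (-1) t0 fL (trunc_L1 k mf)).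
    under eq_Rintegral do rewrite mulN1r addrC.
    by under [X in _ <= X -> _]eq_Rintegral do rewrite mulN1r addrC.
  - exact: cvg_cst.
  - by have [] := trunc_cvg fL.
have [j [_ hj]] := L1_cvg_subseq (fun k => integrable_measurable (iD k)) (fun k x => normr_ge0 _) l.
rewrite -lee_fin EFin_Rintegral//.
apply: (@ae_fatou _ _ _ mu (fun n x => `|P t (truncation f (j n)) x| `^ s)).
- by move=> n; apply: mpow; exact: in_Lp_measurable (PkL _).
- exact: mpow.
- by move=> n x; exact: powR_ge0.
- apply: filterS hj => x hx.
  have l1 : P t (truncation f (j n)) x @[n --> \oo] --> P t f x.
    by apply/cvgrPdist_le => e e0; have /cvgrPdist_le/(_ e e0) := hx;
      apply: filterS => n; rewrite sub0r normrN normr_id distrC.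
  have l2 : `|P t (truncation f (j n)) x| @[n --> \oo] --> `|P t f x| by exact: cvg_norm.
  exact: powR_cvg.
- move=> n; have tB x : `|truncation f (j n) x| <= (j n)%:R by have [] := truncation_bounds f (j n) x.
  have [i_ h] := P_Ls_bounded (measurable_truncation (j n) mf) tB s1 t0.
  have e := EFin_Rintegral measurableT i_; rewrite -e lee_fin; apply: (le_trans h).
  apply: (le_Rintegral measurableT _ ifs).
    apply/i1; apply: (@bdd_L1 _ ((j n)%:R `^ s)); first by apply: mpow; exact: measurable_truncation.
    by move=> x; rewrite ger0_norm ?powR_ge0// ge0_ler_powR ?nnegrE//; exact: ltW.
  by move=> x _; rewrite ge0_ler_powR ?nnegrE//; [exact: ltW|have [] := truncation_bounds f (j n) x].
Qed.

(** The error is split into P_t of the truncation error, controlled by [P_Ls_contraction], the L^s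
    error of the bounded truncation, and the difference of the means. The factor 3^s comes from
    splitting the s-th power of a sum of three terms. *)
Lemma ergodic_Ls (f : Rd -> R) (s : R) : 1 <= s -> in_Lp mu setT s%:E f ->
  Lp_dist mu setT s%:E (P t f) (cst (mean f)) @[t --> +oo] --> 0%E.
Proof.
move=> s1 fs; have fL := Ls_L1 s1 fs; have s0 : 0 < s by exact: lt_le_trans s1.
have [mf ifs] := (in_LpP mu f measurableT s1).1 fs.
apply/Lp_dist_cvg => //; apply/ge0_cvge0P.
  by move=> t; apply: integral_ge0 => x _; rewrite lee_fin powR_ge0.
move=> e e0; pose W : R := 3 `^ s; have W0 : 0 < W by exact: powR_gt0.
have d0 : 0 < e / 3 / W by rewrite !divr_gt0.
have cL b : in_Lp mu setT s%:E (cst b : Rd -> R).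
  apply/in_LpP => //; split=> //; apply/i1; apply: (@bdd_L1 _ (`|b| `^ s)); first exact: mpow.
  by move=> x; rewrite ger0_norm ?powR_ge0.
have [k [hk1 hk2]] : exists k, \int[mu]_x (`|f x - truncation f k x| `^ s) <= e / 3 / W /\
    m * `|mean (truncation f k) - mean f| `^ s <= e / 3 / W.
  have [|||||_ _ l1] := @Rdominated_cvg _ _ _ mu setT measurableT
      (fun k x => `|f x - truncation f k x| `^ s) (cst 0) (fun x => `|f x| `^ s).
  - by move=> k; apply: mpow; apply: measurable_funB => //; exact: measurable_truncation.
  - by [].
  - apply: aeW => x _; apply: cvg_near_cst; apply: filterS (truncation_near f x) => k ->.
    by rewrite subrr normr0 powR0// gt_eqF.
  - exact: ifs.
  - apply: aeW => x k _; rewrite ger0_norm ?powR_ge0// ge0_ler_powR ?nnegrE//; first exact: ltW.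
    by have [] := truncation_bounds f k x.
  rewrite Rintegral_cst// mul0r in l1.
  have l2 : mean (truncation f k) @[k --> \oo] --> mean f.
    by have [_ h] := trunc_cvg fL; apply: cvgMr.
  have c0 : 0 < minr 1 (e / 3 / W / m) by rewrite lt_min ltr01 divr_gt0.
  have /cvgrPdist_le/(_ _ d0) n1 := l1; have /cvgrPdist_le/(_ _ c0) n2 := l2.
  have [k [h1 h2]] := @filter_ex _ \oo _ _ (filterI n1 n2); exists k; split.
    by apply: le_trans h1; rewrite sub0r normrN ler_norm.
  rewrite mulrC -ler_pdivlMr//; move: h2; rewrite distrC le_min => /andP[a1 a2].
  apply: le_trans a2; set y := `|_|; have [->|y0] := eqVneq y 0; first by rewrite powR0// gt_eqF.
  by rewrite ge1r_powR// lt0r y0 normr_ge0.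
have mk := measurable_truncation k mf.
have tk x : `|truncation f k x| <= k%:R by have [] := truncation_bounds f k x.
(* A uniform bound for the centred evolution of the truncation: the s-th power is then at most
   D^(s-1) times the absolute value, and L^1 convergence suffices. *)
pose D := k%:R + `|mean (truncation f k)|.
have D0 : 0 <= D by rewrite addr_ge0.
have DD : 0 < D `^ (s - 1) + 1 by rewrite ltr_wpDl// powR_ge0.
have e1 : 0 < e / 3 / W / (D `^ (s - 1) + 1) by rewrite divr_gt0.
have hmean := ergodic_mean mk tk e1.
near=> t; have t0 : 0 < t by near: t; exact: nbhs_pinfty_gt (num_real _).
have ht : \int[mu]_x `|P t (truncation f k) x - mean (truncation f k)| <= e / 3 / W / (D `^ (s - 1) + 1).
  by near: t.
have ts : in_Lp mu setT s%:E (truncation f k).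
  apply/in_LpP => //; split=> //; apply/i1; apply: (@bdd_L1 _ (k%:R `^ s)); first exact: mpow.
  by move=> x; rewrite ger0_norm ?powR_ge0// ge0_ler_powR ?nnegrE//; exact: ltW.
have phs : in_Lp mu setT s%:E (fun x => f x - truncation f k x) by exact: in_LpB.
have Ps (g : Rd -> R) : in_Lp mu setT s%:E g -> in_Lp mu setT s%:E (P t g).
  by move=> gs; have [_ []] := P_T.2 s%:E t g s1 t0 gs.
have pw (g : Rd -> R) : in_Lp mu setT s%:E g -> mu.-integrable setT (EFin \o (fun x => `|g x| `^ s)).
  by move=> gs; have [] := (in_LpP mu g measurableT s1).1 gs.
pose a x := P t (fun x => f x - truncation f k x) x.
pose b x := P t (truncation f k) x - mean (truncation f k).
pose c := mean (truncation f k) - mean f.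
have split3 x : P t f x - mean f = a x + b x + c.
  have phL := Ls_L1 s1 phs; have tL := Ls_L1 s1 ts.
  have fE : (fun x => 1 * (f x - truncation f k x) + truncation f k x) = f.
    by apply/funext => y; rewrite mul1r subrK.
  have PE := P_linear mu_rho T_mu P_T 1 t0 phL tL; rewrite fE in PE.
  by rewrite PE /a /b /c; ring.
have ia : mu.-integrable setT (EFin \o (fun x => `|a x| `^ s)) by apply: pw; exact: Ps.
have bs : in_Lp mu setT s%:E b by apply: in_LpB; [by rewrite lee_fin|exact: Ps|exact: cL].
have ib := pw _ bs.
have ic : mu.-integrable setT (EFin \o (fun x : Rd => `|c| `^ s)) by have := pw _ (cL c).
have il : mu.-integrable setT (EFin \o (fun x => `|P t f x - cst (mean f) x| `^ s)).
  by apply: pw; apply: in_LpB => //; exact: Ps.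
rewrite -EFin_Rintegral// lee_fin.
have tri x : `|P t f x - cst (mean f) x| `^ s <= W * (`|a x| `^ s + `|b x| `^ s + `|c| `^ s).
  by rewrite [cst _ _]/(mean f) split3; apply: powR_triple; exact: ltW.
apply: (le_trans (le_Rintegral_sum3 il ia ib ic tri)).
have ha : \int[mu]_x (`|a x| `^ s) <= e / 3 / W by apply: le_trans hk1; exact: P_Ls_contraction.
have hb : \int[mu]_x (`|b x| `^ s) <= e / 3 / W.
  have bL : mu.-integrable setT (EFin \o (fun x => `|b x|)).
    apply: integrable_norm; apply/i1; apply: Ls_L1 s1 _.
    exact: bs.
  apply: (@le_trans _ _ (\int[mu]_x (D `^ (s - 1) * `|b x|))).
    have ibD : mu.-integrable setT (EFin \o (fun x => D `^ (s - 1) * `|b x|)) by exact: integrable_EFinZ.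
    apply: (le_Rintegral measurableT ib ibD).
    move=> x _; apply: powR_le_bounded => //; rewrite normr_ge0 (le_trans (ler_normB _ _))// lerD2r.
    exact: Pn (ltW t0) mk tk.
  rewrite RintegralZl//; move: ht; rewrite ler_pdivlMr// => ht; apply: le_trans ht.
  rewrite mulrC ler_wpM2l ?lerDl//; exact: Rintegral_ge0.
have hc : \int[mu]_x (`|c| `^ s) <= e / 3 / W by rewrite Rintegral_cst// mulrC.
have -> : e = W * (e / 3 / W + e / 3 / W + e / 3 / W).
  by field; rewrite gt_eqF.
by rewrite ler_wpM2l ?(ltW W0)// !lerD.
Unshelve. all: by end_near.
Qed.

End ergodic_limits.

(** * Invariant measures, recurrence and non-explosion *)

Lemma probability_ae_eq1 dT (X : measurableType dT) {R : realType} (Q : probability X R) (A : set X) :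
  measurable A -> (\forall x \ae Q, A x) -> Q A = 1%E.
Proof.
move=> mA [N [mN N0 NA]]; have mC := measurableC mA.
have z : Q (~` A) = 0%E.
  apply/eqP; rewrite eq_le measure_ge0 andbT -N0; apply: le_measure; rewrite ?inE//.
have := probability_setC Q mC.
by rewrite setCK z sube0.
Qed.

Section consequences.
Context {R : realType} {d : nat} (p : R).
Local Notation Rd := 'rV[R]_d.
Local Notation leb := (lebesgue_rV R d).
Variables (A C : Rd -> 'M[R]_d) (H : Rd -> Rd) (rho : Rd -> R).
Variable mu : {measure set Rd -> \bar R}.
Variables T P : R -> (Rd -> R) -> (Rd -> R).
Context {dO : measure_display} {Omega : measurableType dO}.
Variable M : @hunt_process R d dO Omega.
Variable nu : {measure set Rd -> \bar R}.
Hypotheses (d_ge2 : (2 <= d)%N) (p_gtd : d%:R < p).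
Hypothesis ass_a : assumption_a p A C H.
Hypothesis mu_rho : inf_invariant_density p A (drift A C H) rho mu.
Hypothesis T_mu : L1_semigroup_construction mu A (drift A C H) rho T.
Hypothesis P_T : continuous_versions mu T P.
Hypothesis M_P : has_transition M P.
Hypotheses (nu_inv : invariant_measure M nu) (nu_fin : (nu setT < +oo)%E).

Let m := fine (mu setT).

Let muT := mu_fin mu_rho T_mu P_T M_P nu_inv nu_fin.

Let alive t x : 0 <= t -> law M (Some x) (state_in M t setT) = 1%E.
Proof. exact: (state_alive mu_rho T_mu P_T M_P nu_inv nu_fin). Qed.

Let mu_gt0 : (0 < mu setT)%E.
Proof.
by have [m0 _ _] := mu_invariant mu_rho T_mu P_T M_P nu_inv nu_fin; rewrite lt0e m0 measure_ge0.
Qed.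

Let m_gt0 : 0 < m. Proof. by rewrite /m fine_gt0// mu_gt0. Qed.

Let mu_fin_num E : measurable E -> mu E \is a fin_num.
Proof.
by move=> mE; rewrite ge0_fin_numE// (le_lt_trans _ muT)//; apply: le_measure; rewrite ?inE.
Qed.

Lemma transition_cvg (x : Rd) (E : set Rd) : measurable E ->
  P t \1_E x @[t --> +oo] --> fine (mu E) / m.
Proof.
move=> mE; have mi : measurable_fun setT (\1_E : Rd -> R) by exact: measurable_indic.
have E1 (y : Rd) : `|\1_E y : R| <= 1 by rewrite ger0_norm ?indic_le1.
have := ergodic_pointwise d_ge2 p_gtd ass_a mu_rho T_mu P_T M_P nu_inv nu_fin x mi E1.
by rewrite /Rintegral integral_indic// setIT mulrC.
Qed.

Lemma transition_cvg_seq (x : Rd) (E : set Rd) (u : R^nat) : measurable E -> u n @[n --> \oo] --> +oo ->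
  P (u n) \1_E x @[n --> \oo] --> fine (mu E) / m.
Proof. by move=> mE uoo; exact: (cvg_comp _ _ uoo (transition_cvg x mE)). Qed.

(** Since the cemetery is absorbing, an infinite lifetime means being alive at every integer time, a
    countable intersection of almost sure events. *)
Lemma hunt_nonexplosive : nonexplosive M.
Proof.
move=> x.
have lifeE : [set w | lifetime M w = +oo%E] = \bigcap_n state_in M n%:R setT.
  apply/seteqP; split=> w /=.
    move=> lw n _; rewrite /state_in /=; case E : (state M n%:R w) => [y|]; first by exists y.
    have : (lifetime M w <= n%:R%:E)%E by apply: ereal_inf_lbound; exists n%:R.
    by rewrite lw leye_eq.
  move=> hw; apply/eqP; rewrite -leye_eq; apply: le_ereal_inf_tmp => _ [t [t0 st] <-].
  have [y _] := hw (Num.truncn t).+1 I.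
  by rewrite (state_absorbed t0 _ st)// ltW// truncnS_gt.
rewrite lifeE; set A_ := fun n : nat => state_in M n%:R setT.
have mA n : measurable (A_ n) by exact: measurable_state_in.
apply: probability_ae_eq1; first by apply: bigcap_measurableType => n _; exact: mA.
have : \forall w \ae law M (Some x), forall n, A_ n w.
  apply/ae_foralln => n.
  exact: (state_alive_ae mu_rho T_mu P_T M_P nu_inv nu_fin x (ler0n R n)).
by apply: filterS => w hw n _; exact: hw.
Qed.

(** Take F with mu(F) > 0 and finite m0-measure. P_k 1_F tends to the positive constant
    mu(F)/mu(R^d), so Fatou and sub-invariance bound that constant times m0(R^d) by m0(F). *)
Lemma subinvariant_finite (m0 : {measure set Rd -> \bar R}) : subinvariant_measure M m0 -> (m0 setT < +oo)%E.
Proof.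
move=> [_ [F_ FT Ffin] sub].
have mF n : measurable (F_ n) by have [] := Ffin n.
have [n Fn] : exists n, mu (F_ n) != 0%E.
  apply: contrapT => /forallNP h.
  have : mu.-negligible setT.
    rewrite FT; apply: negligible_bigcup => n; apply/negligibleP => //.
    by have /negP/negPn/eqP := h n.
  move=> neg; have z : mu setT = 0%E by apply/negligibleP.
  by have := mu_gt0; rewrite z ltxx.
have q0 : 0 < fine (mu (F_ n)) / m.
  rewrite divr_gt0// fine_gt0// lt0e Fn measure_ge0/=.
  by move: (mu_fin_num (mF n)); rewrite ge0_fin_numE.
have E1 (k : nat) x : 0 <= P k%:R \1_(F_ n) x <= 1 by exact: (transition_ge0_le1 M_P x (ler0n R k) (mF n)).
have mPF (k : nat) : measurable_fun setT (P k%:R \1_(F_ n)).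
  by apply: (in_Lp_measurable (mu := mu) (s := 1%E)) => //; exact: (transition_L1 mu_rho T_mu P_T M_P nu_inv nu_fin (ler0n R k) (mF n)).
have h : (\int[m0]_x (fine (mu (F_ n)) / m)%:E <= m0 (F_ n))%E.
  apply: (@ae_fatou _ _ _ m0 (fun k => P k%:R \1_(F_ n)) (cst _)) => //.
  - by move=> k x; have /andP[] := E1 k x.
  - by apply: aeW => x; apply: transition_cvg_seq => //; exact: cvgr_idn.
  - by move=> k; rewrite -(integral_transition M_P m0 (ler0n R k) (mF n)); exact: sub.
rewrite integral_cst// in h; rewrite ltNge leye_eq; apply/negP => /eqP moo.
by have [_] := Ffin n; rewrite ltNge => /negP; apply; apply: le_trans h; rewrite moo gt0_muley ?lte_fin.
Qed.

(** Invariance makes the integral of P_k 1_E constant in k, while dominated convergence gives its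
    limit; every finite invariant measure is thus a multiple of [mu]. *)
Lemma invariant_eq (m0 : {measure set Rd -> \bar R}) (E : set Rd) : invariant_measure M m0 -> measurable E ->
  (m0 setT < +oo)%E -> m0 E = ((fine (m0 setT) * (fine (mu E) / m))%:E)%E.
Proof.
move=> [_ _ inv] mE m0T.
have E1 (k : nat) x : 0 <= P k%:R \1_E x <= 1 by exact: (transition_ge0_le1 M_P x (ler0n R k) mE).
have mPE (k : nat) : measurable_fun setT (P k%:R \1_E).
  by apply: (in_Lp_measurable (mu := mu) (s := 1%E)) => //; exact: (transition_L1 mu_rho T_mu P_T M_P nu_inv nu_fin (ler0n R k) mE).
have i1 : m0.-integrable setT (EFin \o (cst 1 : Rd -> R)).
  by apply: measurable_bounded_integrable => //; exact: bounded_cst.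
have n1 k x : `|P k%:R \1_E x| <= 1 by have /andP[a b] := E1 k x; rewrite ger0_norm.
have ik k : m0.-integrable setT (EFin \o P k%:R \1_E).
  exact: (integrable_dominated measurableT (mPE k) (fun x _ => n1 k x) i1).
have [|||||_ _ l] := @Rdominated_cvg _ _ _ m0 setT measurableT (fun k : nat => P k%:R \1_E)
    (cst (fine (mu E) / m)) (cst 1) => //.
- by apply: aeW => x _; apply: transition_cvg_seq => //; exact: cvgr_idn.
- by apply: aeW => x k _; exact: n1.
have c k : \int[m0]_x P k%:R \1_E x = fine (m0 E).
  by rewrite /Rintegral -(integral_transition M_P m0 (ler0n R k) mE) inv.
have l2 : fine (m0 E) @[k --> \oo] --> \int[m0]_x cst (fine (mu E) / m) x.
  by move: l; under eq_fun do rewrite c.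
have e : fine (m0 E) = \int[m0]_x cst (fine (mu E) / m) x.
  by apply: (cvg_unique (@Rhausdorff R) _ l2); exact: cvg_cst.
rewrite Rintegral_cst// in e; rewrite [X in X%:E]mulrC -e fineK//.
by rewrite ge0_fin_numE// (le_lt_trans _ m0T)//; apply: le_measure; rewrite ?inE.
Qed.

(** The strong Markov property at a constant stopping time, rewritten with the transition function
    P_r. *)
Lemma markov_fixed_time (x : Rd) (S r : R) (Gam : set Omega) (E : set Rd) : 0 <= S -> 0 <= r ->
  filtration M S Gam -> measurable E ->
  (law M (Some x) (Gam `&` state_in M (S + r) E) =
   \int[law M (Some x)]_(w in Gam) (oapp (P r \1_E) 0 (state M S w))%:E)%E.
Proof.
move=> S0 r0 FG mE; have [sS subS] := filtration_sigma_algebra M S0.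
have mG : measurable Gam := subS _ FG.
have st : stopping_time (filtration M) (cst S%:E).
  split=> [w|t t0]; first by rewrite lee_fin.
  have [[s0 sC _] _] := filtration_sigma_algebra M t0.
  have [h|h] := boolP (S <= t).
    rewrite (_ : [set _ | _] = setT `\` set0); first exact: sC.
    by rewrite setD0; apply/seteqP; split=> // w _ /=; rewrite lee_fin.
  rewrite (_ : [set _ | _] = set0)//; apply/seteqP; split=> // w /=.
  by rewrite lee_fin (negbTE h).
have FGt t : 0 <= t -> filtration M t (Gam `&` [set w | (cst S%:E w <= t%:E)%E]).
  move=> t0; have [h|h] := boolP (S <= t).
    rewrite (_ : _ `&` _ = Gam); first exact: (filtration_nondecreasing S0 h).
    by apply/seteqP; split=> w /=; [case|rewrite lee_fin].
  rewrite (_ : _ `&` _ = set0); first by have [[s0 _ _] _] := filtration_sigma_algebra M t0.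
  by apply/seteqP; split=> // w /= []; rewrite lee_fin (negbTE h).
have := law_strong_markov (Some x) st mG FGt r0 (sigma_Some mE).
have -> : Gam `&` [set w | (cst S%:E w < +oo)%E] = Gam.
  by apply/seteqP; split=> w /=; [case|rewrite ltry].
move=> /= hM; rewrite -[LHS]/(law M (Some x) (Gam `&` [set w | (Some @` E) (state M (S + r) w)])) hM.
have mP : measurable_fun setT (P r \1_E).
  by apply: (in_Lp_measurable (mu := mu) (s := 1%E)) => //; exact: (transition_L1 mu_rho T_mu P_T M_P nu_inv nu_fin r0 mE).
(* The value of the kernel at the cemetery. Separating it as a constant makes the integrand
   measurable; the cemetery itself has probability 0 at time S. *)
pose k := fine (law M None (state_in M r E)).
have lE w : law M (state M S w) (state_in M r E) = (oapp (fun y => P r \1_E y - k) 0 (state M S w) + k)%:E.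
  case: (state M S w) => [y|] /=; first by rewrite subrK (has_transition_indic M_P).
  by rewrite add0r /k fineK// fin_num_measure//; exact: measurable_state_in.
apply: ae_eq_integral => //.
- apply: measurable_funTS; rewrite (_ : (fun w => _) =
    (fun w => (oapp (fun y => P r \1_E y - k) 0 (state M S w) + k)%:E)); last by apply/funext.
  apply/measurable_EFinP; apply: measurable_funD => //; apply: measurable_state_oapp => //.
  exact: measurable_funB.
- by apply: measurable_funTS; apply/measurable_EFinP; exact: measurable_state_oapp.
- apply: filterS (state_alive_ae mu_rho T_mu P_T M_P nu_inv nu_fin x S0) => w [y _ e] _.
  by rewrite /= -/(state_in M r E) lE -e /= subrK.
Qed.

(** Let q = mu(E)/mu(R^d) > 0. Conditionally on avoiding E at the times N, ..., N+j-1, the Markov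
    property and convergence to equilibrium make the probability of being in E at a much later t_n
    tend to q. Avoiding E at all times from N on thus has probability at most 1 - q times that of
    the finite avoidance; letting j tend to infinity, it is at most 1 - q times itself, hence 0. *)
Lemma hit_infinitely_often (x : Rd) (E : set Rd) (t_ : R^nat) : measurable E -> (0 < mu E)%E ->
  (forall n, 0 < t_ n) -> t_ n @[n --> \oo] --> +oo ->
  law M (Some x) (lim_sup_set (fun n => state_in M (t_ n) E)) = 1%E.
Proof.
move=> mE E0 t0 too; pose A_ n := state_in M (t_ n) E.
have mA n : measurable (A_ n) by apply: measurable_state_in => //; exact: ltW.
have q0 : 0 < fine (mu E) / m.
  by rewrite divr_gt0// fine_gt0// E0/=; move: (mu_fin_num mE); rewrite ge0_fin_numE.
set q := fine (mu E) / m in q0.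
pose pr (B : set Omega) : R := fine (law M (Some x) B).
have prE B : measurable B -> law M (Some x) B = (pr B)%:E.
  by move=> mB; rewrite /pr fineK// fin_num_measure.
pose B_ N := [set w | forall i, ~ A_ (N + i)%N w].
pose Gam N j := [set w | forall i, (i < j)%N -> ~ A_ (N + i)%N w].
(* The times need not be ordered; their sum bounds all of them, so the finite avoidance event is
   known at time S. *)
pose S N j := \sum_(i < j) t_ (N + i)%N.
have S0 N j : 0 <= S N j by apply: sumr_ge0 => i _; exact: ltW.
have GamS N j : Gam N j.+1 = Gam N j `&` ~` A_ (N + j)%N.
  apply/seteqP; split=> w; first by move=> h; split=> [i ij|]; apply: h => //; exact: ltnW.
  by move=> [h1 h2] i; rewrite ltnS leq_eqVlt => /predU1P[->//|]; exact: h1.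
have FGam N j : filtration M (S N j) (Gam N j).
  elim: j => [|j IH].
    rewrite (_ : Gam N 0%N = setT `\` set0); last by rewrite setD0; apply/seteqP; split.
    by have [[s0 sC _] _] := filtration_sigma_algebra M (S0 N 0%N); exact: sC.
  have SS : S N j.+1 = S N j + t_ (N + j)%N by rewrite /S big_ord_recr.
  have [sS _] := filtration_sigma_algebra M (S0 N j.+1).
  rewrite GamS -(sigma_algebra_id sS).
  apply: (@measurableI _ (g_sigma_algebraType (filtration M (S N j.+1)))).
    apply: sub_sigma_algebra; apply: (filtration_nondecreasing (S0 N j)) IH.
    by rewrite SS lerDl ltW.
  apply: measurableC; apply: sub_sigma_algebra.
  have tS : t_ (N + j)%N <= S N j.+1 by rewrite SS lerDr.
  apply: (filtration_nondecreasing (ltW (t0 _)) tS).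
  by apply: state_adapted; [exact: ltW|exact: sigma_Some].
have mGam N j : measurable (Gam N j).
  by have [_ sub] := filtration_sigma_algebra M (S0 N j); apply: sub.
have hit N j : pr (Gam N j `&` A_ n) @[n --> \oo] --> pr (Gam N j) * q.
  (* The absolute value keeps the lag nonnegative for every n; it equals t_n - S for all large n. *)
  pose r n := `|t_ n - S N j|.
  have r0 n : 0 <= r n by exact: normr_ge0.
  have roo : r n @[n --> \oo] --> +oo.
    apply/cvgryPge => a; have /cvgryPge/(_ (a + S N j)) := too.
    by apply: filterS => n h; rewrite (le_trans _ (ler_norm _))// lerBrDr.
  have mP n : measurable_fun setT (P (r n) \1_E).
    by apply: (in_Lp_measurable (mu := mu) (s := 1%E)) => //; exact: (transition_L1 mu_rho T_mu P_T M_P nu_inv nu_fin (r0 n) mE).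
  have f1 n w : 0 <= oapp (P (r n) \1_E) 0 (state M (S N j) w) <= 1.
    by case: (state M (S N j) w) => [y|] /=; [exact: (transition_ge0_le1 M_P y (r0 n) mE)|rewrite lexx ler01].
  have mf n : measurable_fun (Gam N j) (fun w => oapp (P (r n) \1_E) 0 (state M (S N j) w)).
    by apply: measurable_funTS; exact: measurable_state_oapp.
  have i1 : (law M (Some x)).-integrable (Gam N j) (EFin \o (cst (1 : R))).
    by apply: (integrableS measurableT) => //; exact: finite_measure_integrable_cst.
  have [|||||_ _ l] := @Rdominated_cvg _ _ _ (law M (Some x)) (Gam N j) (mGam N j)
    (fun n w => oapp (P (r n) \1_E) 0 (state M (S N j) w)) (cst q) (cst 1) => //.
  - apply: filterS (state_alive_ae mu_rho T_mu P_T M_P nu_inv nu_fin x (S0 N j)) => w [y _ <-] _ /=.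
    exact: transition_cvg_seq.
  - by apply: aeW => w n _; have /andP[a b] := f1 n w; rewrite ger0_norm.
  rewrite Rintegral_cst// mulrC in l; apply: cvg_trans l; apply: near_eq_cvg.
  have /cvgryPge/(_ (S N j)) := too; apply: filterS => n hn.
  have e := markov_fixed_time x (S0 N j) (r0 n) (FGam N j) mE.
  have rE : S N j + r n = t_ n by rewrite /r ger0_norm ?subr_ge0// addrC subrK.
  by rewrite rE in e; rewrite /pr /A_ e.
have mB N : measurable (B_ N).
  rewrite (_ : B_ N = \bigcap_i ~` A_ (N + i)%N); last first.
    by apply/seteqP; split=> w h i; [move=> _; exact: h|exact: h].
  by apply: bigcap_measurableType => i _; exact: measurableC.
(* For n >= N, permanent avoidance from N on is contained in the finite avoidance event minus the
   visit at t_n. *)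
have le N j : pr (B_ N) <= pr (Gam N j) * (1 - q).
  have l : pr (Gam N j) - pr (Gam N j `&` A_ n) @[n --> \oo] --> pr (Gam N j) - pr (Gam N j) * q.
    by apply: cvgB; [exact: cvg_cst|exact: hit].
  rewrite mulrBr mulr1 -(cvg_lim (@Rhausdorff R) l); apply: limr_ge.
    by apply/cvg_ex; eexists; exact: l.
  near=> n; have nN : (N <= n)%N by near: n; exact: nbhs_infty_ge.
  have mD : measurable (Gam N j `\` A_ n) by exact: measurableD.
  have mI : measurable (Gam N j `&` A_ n) by exact: measurableI.
  have -> : pr (Gam N j) = pr (Gam N j `\` A_ n) + pr (Gam N j `&` A_ n).
    have h : (law M (Some x) ((Gam N j `\` A_ n) `|` (Gam N j `&` A_ n)) =
        law M (Some x) (Gam N j `\` A_ n) + law M (Some x) (Gam N j `&` A_ n))%E.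
      by apply: measureU => //; apply/seteqP; split=> // w [[_ h1] [_ h2]].
    by move: h; rewrite setUC setUIDK !prE// => -[].
  rewrite addrK -lee_fin -!prE//; apply: le_measure; rewrite ?inE//.
  move=> w h; split; first by move=> i _; exact: h.
  by have := h (n - N)%N; rewrite subnKC.
have B0 N : pr (B_ N) = 0.
  have GB : law M (Some x) (Gam N j) @[j --> \oo] --> law M (Some x) (\bigcap_j Gam N j).
    apply: nonincreasing_cvg_mu => //.
    - by apply: (le_lt_trans (probability_le1 _ (mGam N 0%N))); exact: ltry.
    - by apply: bigcap_measurableType => j _; exact: mGam.
    - by move=> a b ab; apply/subsetPset => w h i ia; apply: h; exact: leq_trans ab.
  have GBE : \bigcap_j Gam N j = B_ N.
    apply/seteqP; split=> w h; first by move=> i; exact: (h i.+1 I i (ltnSn i)).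
    by move=> j _ i _; exact: h.
  rewrite GBE in GB.
  have l : pr (Gam N j) * (1 - q) @[j --> \oo] --> pr (B_ N) * (1 - q).
    by apply: cvgMl; apply: fine_cvg; rewrite -[X in _ --> X]/((pr (B_ N))%:E) -prE.
  have : pr (B_ N) <= pr (B_ N) * (1 - q).
    rewrite -[leRHS](cvg_lim (@Rhausdorff R) l); apply: limr_ge; first by apply/cvg_ex; eexists; exact: l.
    exact: nearW.
  have pB : 0 <= pr (B_ N) by exact: fine_ge0.
  rewrite mulrBr mulr1 lerBrDr gerDl => h; apply/eqP; rewrite eq_le pB andbT.
  by rewrite -(pmulr_lle0 _ q0).
apply: probability_ae_eq1.
  apply: bigcap_measurableType => n _; apply: bigcup_measurable => k _; exact: mA.
have : \forall w \ae law M (Some x), forall N, ~ B_ N w.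
  apply/ae_foralln => N; exists (B_ N); split=> //; last by move=> w /= /contrapT.
  exact: etrans (prE _ (mB N)) (congr1 EFin (B0 N)).
apply: filterS => w h N _; apply: contrapT => hN; apply: (h N) => i hi; apply: hN.
by exists (N + i)%N => //=; rewrite leq_addr.
Unshelve. all: by end_near.
Qed.

Lemma last_exit_infty (E : set Rd) (w : Omega) :
  (forall N : nat, exists2 t : R, N%:R <= t & state_in M t E w) -> last_exit M E w = +oo%E.
Proof.
move=> h; have hN (N : nat) : (N%:R%:E <= last_exit M E w)%E.
  have [t Nt tw] := h N; rewrite /last_exit le_max; apply/orP; right.
  apply: (@le_trans _ _ t%:E); first by rewrite lee_fin.
  by apply: ereal_sup_ubound; exists t => //; split=> //; exact: le_trans Nt.
case E0 : (last_exit M E w) => [r||] //; last by have := hN 0%N; rewrite E0.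
have := hN (Num.truncn r).+1; rewrite E0 lee_fin leNgt.
by rewrite truncnS_gt.
Qed.

Let natS_oo : n.+1%:R @[n --> \oo] --> (+oo : set_system R).
Proof. by rewrite (cvg_shiftS (fun n => n%:R : R)); exact: cvgr_idn. Qed.

(** Stated almost surely because, for a Borel set E, the event involves uncountably many times; its
    complement lies in the null event of only finitely many visits at integer times. *)
Lemma last_exit_ae (x : Rd) (E : set Rd) : measurable E -> (0 < mu E)%E ->
  \forall w \ae law M (Some x), last_exit M E w = +oo%E.
Proof.
move=> mE E0; have n0 (n : nat) : 0 < n.+1%:R :> R by rewrite ltr0n.
have h := hit_infinitely_often x mE E0 n0 natS_oo.
set Z := lim_sup_set _ in h.
have mZ : measurable Z.
  apply: bigcap_measurableType => n _; apply: bigcup_measurable => k _.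
  by apply: measurable_state_in => //; exact: ltW.
exists (~` Z); split; first exact: measurableC.
  by have := probability_setC (law M (Some x)) mZ; rewrite h subee.
move=> w /= hw Zw; apply: hw; apply: last_exit_infty => N.
have [k /= Nk kw] := Zw N I; exists k.+1%:R => //.
by rewrite ler_nat (leq_trans Nk).
Qed.

(** Paths are right continuous, so a visit to an open set persists until some later rational time.
    The event becomes a countable combination of measurable ones. *)
Lemma last_exit_open_rat (U : set Rd) : open U -> [set w | last_exit M U w = +oo%E] =
  \bigcap_(N : nat) \bigcup_(q in [set q : rat | N%:R <= ratr q :> R]) state_in M (ratr q) U.
Proof.
move=> oU; apply/seteqP; split=> w /=; last first.
  by move=> h; apply: last_exit_infty => N; have [q /= Nq qw] := h N I; exists (ratr q).
move=> lw N _.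
have [t [Nt [t0 tw]]] : exists t : R, N%:R < t /\ 0 <= t /\ state_in M t U w.
  have : (N%:R%:E < maxe 0 (ereal_sup [set t%:E | t in [set t | (0 <= t)%R /\ state_in M t U w]]))%E.
    by rewrite -/(last_exit M U w) lw ltry.
  rewrite lt_max => /orP[|/ereal_sup_gt[_ [t [t0 tw] <-]]]; first by rewrite lte_fin ltNge ler0n.
  by rewrite lte_fin => Nt; exists t.
have /subspace_continuousP/(_ t) := @state_continuous _ _ _ _ M w.
rewrite /= in_itv/= andbT => /(_ t0) ct.
have oSU : open_nbhs (state M t w) (Some @` U).
  by split; [exact: one_point_compactification_open_some|exact: tw].
have /ct := open_nbhs_nbhs oSU; move=> /nbhs_ballP[e /= e0 he].
have [|q] := @rat_in_itvoo R t (t + e); first by rewrite ltrDl.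
rewrite in_itv/= => /andP[tq qe]; exists q; first by rewrite /= ltW// (lt_trans Nt).
apply: he; last by rewrite /= in_itv/= andbT (le_trans t0)// ltW.
by rewrite /ball/= ltr_distlC; apply/andP; split; lra.
Qed.

(** Nonempty open sets have positive mu-measure, and for them the event of infinite last exit is
    measurable, so an almost sure statement becomes probability one. *)
Lemma hunt_recurrent : recurrent M.
Proof.
move=> x U oU U0; have mU : measurable U by exact: open_measurable_rV.
have muU : (0 < mu U)%E.
  rewrite lt0e measure_ge0 andbT; apply/eqP => /(mu_leb_null mu_rho mU) z.
  by have := leb_open_gt0 oU U0; rewrite z ltxx.
apply: probability_ae_eq1; last exact: last_exit_ae.
rewrite last_exit_open_rat//; apply: bigcap_measurableType => N _.
rewrite bigcup_mkcond; apply: bigcupT_measurable_rat => q.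
case: ifPn => // /set_mem /= Nq; apply: measurable_state_in => //.
exact: le_trans Nq.
Qed.

End consequences.

Theorem theorem3p46 (R : realType) (d : nat) (p : R)
  (A C : 'rV[R]_d -> 'M[R]_d) (H : 'rV[R]_d -> 'rV[R]_d)
  (rho : 'rV[R]_d -> R) (mu : {measure set 'rV[R]_d -> \bar R})
  (T P : R -> ('rV[R]_d -> R) -> ('rV[R]_d -> R))
  (dO : measure_display) (Omega : measurableType dO)
  (M : @hunt_process R d dO Omega)
  (nu : {measure set 'rV[R]_d -> \bar R})
  (d_ge2 : (2 <= d)%N) (p_gtd : d%:R < p)
  (ass_a : assumption_a p A C H) (ass_b : assumption_b p A C H)
  (mu_rho : inf_invariant_density p A (drift A C H) rho mu)
  (T_mu : L1_semigroup_construction mu A (drift A C H) rho T)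
  (P_T : continuous_versions mu T P)
  (M_P : has_transition M P)
  (nu_inv : invariant_measure M nu) (nu_fin : (nu setT < +oo)%E) :
  [/\
    (* (i) *)
    nonexplosive M /\
    (forall (x : 'rV[R]_d) (t : R), 0 < t ->
      exists Ptx : probability 'rV[R]_d R,
        [/\ forall E, measurable E -> Ptx E = (P t \1_E x)%:E,
            Ptx `<< lebesgue_rV R d & lebesgue_rV R d `<< Ptx]),
    (* (ii) *)
    (forall m : {measure set 'rV[R]_d -> \bar R},
      subinvariant_measure M m -> (m setT < +oo)%E) /\
    (mu setT < +oo)%E /\ invariant_measure M mu,
    (* (iii) *)
    (forall pi_ : {measure set 'rV[R]_d -> \bar R},
      invariant_measure M pi_ ->
      (pi_ setT < +oo)%E /\
      forall E, measurable E ->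
        nu E = ((fine (nu setT) / fine (pi_ setT))%:E * pi_ E)%E),
    (* (iv) *)
    (forall (s : R) (f : 'rV[R]_d -> R), 1 <= s -> in_Lp mu setT s%:E f ->
      Lp_dist mu setT s%:E (P t f)
        (cst ((fine (mu setT))^-1 * \int[mu]_x f x)) @[t --> +oo] --> 0%E) /\
    (forall (x : 'rV[R]_d) (E : set 'rV[R]_d), measurable E ->
      (P t \1_E x @[t --> +oo] --> fine (mu E) / fine (mu setT)) /\
      (law M (Some x) (state_in M t E) @[t --> +oo] -->
        (fine (mu E) / fine (mu setT))%:E)) &
    (* (v) *)
    (forall (E : set 'rV[R]_d) (t_ : nat -> R), measurable E ->
      (0 < mu E)%E -> (forall n, 0 < t_ n) -> t_ n @[n --> \oo] --> +oo ->
      forall x : 'rV[R]_d,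
        law M (Some x) (lim_sup_set (fun n => state_in M (t_ n) E)) = 1%E) /\
    (forall E : set 'rV[R]_d, measurable E -> (0 < mu E)%E ->
      forall x : 'rV[R]_d,
        \forall w \ae law M (Some x), last_exit M E w = +oo%E) /\
    recurrent M].
Proof.
have muT := mu_fin mu_rho T_mu P_T M_P nu_inv nu_fin.
have mu_inv := mu_invariant mu_rho T_mu P_T M_P nu_inv nu_fin.
have tr_cvg x E := transition_cvg d_ge2 p_gtd ass_a mu_rho T_mu P_T M_P nu_inv nu_fin x (E := E).
have inv_eq m E := invariant_eq d_ge2 p_gtd ass_a mu_rho T_mu P_T M_P nu_inv nu_fin (m0 := m) (E := E).
have sub_fin m := subinvariant_finite d_ge2 p_gtd ass_a mu_rho T_mu P_T M_P nu_inv nu_fin (m0 := m).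
have inv_sub (m : {measure set 'rV[R]_d -> \bar R}) : invariant_measure M m -> subinvariant_measure M m.
  by move=> [m0 ms me]; split=> // t E t0 mE; rewrite me.
split.
- split; first exact: hunt_nonexplosive mu_rho T_mu P_T M_P nu_inv nu_fin.
  move=> x t t0.
  have [Q [QE _]] := transition_probability mu_rho T_mu P_T M_P nu_inv nu_fin x (ltW t0).
  exists Q; split=> //; apply/null_content_dominatesP => E mE E0.
    by rewrite QE// (P_null mu_rho T_mu P_T t0 mE)//; apply/(mu_leb_null mu_rho mE).
  apply/(mu_leb_null mu_rho mE); apply/eqP/negPn/negP => mE0.
  have Epos : (0 < mu E)%E by rewrite lt0e mE0 measure_ge0.
  have := transition_gt0 d_ge2 p_gtd ass_a mu_rho T_mu P_T M_P nu_inv nu_fin x t0 mE Epos.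
  by rewrite -lte_fin -QE// E0 ltxx.
- by [].
- move=> pi_ pi_inv; have piT := sub_fin _ (inv_sub _ pi_inv); split=> // E mE.
  have [pi0 _ _] := pi_inv.
  have pi_gt0 : 0 < fine (pi_ setT) by rewrite fine_gt0// piT lt0e pi0 measure_ge0.
  (* Both measures are their total mass times the normalised [mu], so the ratio of the masses is the
     factor. *)
  rewrite (inv_eq nu E)// (inv_eq pi_ E)// -EFinM; congr EFin.
  by rewrite [RHS]mulrA divfK// gt_eqF.
- split=> [s f s1 fs|x E mE].
    exact: (ergodic_Ls d_ge2 p_gtd ass_a mu_rho T_mu P_T M_P nu_inv nu_fin s1 fs).
  split; first exact: tr_cvg.
  have e : \forall t \near +oo, (P t \1_E x)%:E = law M (Some x) (state_in M t E).
    by near=> t; rewrite (has_transition_indic M_P)//; near: t; exact: nbhs_pinfty_ge (num_real _).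
  apply: cvg_trans (near_eq_cvg e) _.
  by apply: cvg_EFin; [exact: nearW|exact: tr_cvg].
- split; first by move=> E t_ mE E0 t0 too x; exact: (hit_infinitely_often d_ge2 p_gtd ass_a mu_rho T_mu P_T M_P nu_inv nu_fin).
  split; last exact: (hunt_recurrent d_ge2 p_gtd ass_a mu_rho T_mu P_T M_P nu_inv nu_fin).
  by move=> E mE E0 x; exact: (last_exit_ae d_ge2 p_gtd ass_a mu_rho T_mu P_T M_P nu_inv nu_fin).
Unshelve. all: by end_near.
Qed.
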